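(* If $5\le n\le 12$, then there is no solution $u\in C^4(\mathbb{R}^n)$ of $\Delta^2u=e^u$ in $\mathbb{R}^n$ which is stable outside a compact set and such that $\Delta u$ vanishes at infinity (that is, $\Delta u(x)\to0$ as $|x|\to\infty$).
   Context: A solution $u$ of $\Delta^2u=e^u$ in $\mathbb{R}^n$ is stable outside a compact set if there exists $R>0$ such that $\int_{\mathbb{R}^n}e^u\phi^2dx\le\int_{\mathbb{R}^n}|\Delta\phi|^2dx$ for all $\phi\in C_c^\infty(\mathbb{R}^n\setminus\overline{B_R})$, where $B_R$ is the ball of radius $R$ centered at $0$. *)

(* Defs.v *)
From HB Require Import structures.
From mathcomp Require Import all_boot all_order all_algebra.
From mathcomp Require Import all_classical all_reals all_analysis.

Set Implicit Arguments.
Unset Strict Implicit.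
Unset Printing Implicit Defensive.

Import Order.TTheory GRing.Theory Num.Theory.
Import numFieldNormedType.Exports.

Local Open Scope classical_set_scope.
Local Open Scope ring_scope.

(* Vectors of R^n are rows 'rV[R]_n for the differential calculus; MathComp-
   Analysis puts the product sigma-algebra on n.-tuple R, so Lebesgue measure
   lives there and integrands are read through [row_of_tuple]. The library norm
   of 'rV[R]_n is the sup norm, hence the separate Euclidean norm [enorm]. *)

Section euclidean.
Context {R : realType} {n : nat}.
Implicit Types (x : 'rV[R]_n) (f : 'rV[R]_n -> R).

Definition enorm x : R := Num.sqrt (\sum_(i < n) x 0 i ^+ 2).

Definition eball (r : R) : set 'rV[R]_n := [set x | enorm x < r].

Definition vanishes_at_infinity f : Prop :=
  forall e : R, 0 < e -> exists M : R, forall x, M < enorm x -> `|f x| < e.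

Definition partial (i : 'I_n) f : 'rV[R]_n -> R :=
  fun x => 'D_(delta_mx 0 i) f x.

(* All partial derivatives of order at most k exist and are continuous. The
   derivability clause is needed because ['D_v f x] is a total function. *)
Fixpoint Ck (k : nat) f : Prop :=
  continuous f /\
  if k is k'.+1 then
    forall i : 'I_n,
      (forall x, derivable f x (delta_mx 0 i)) /\ Ck k' (partial i f)
  else True.

Definition laplacian f : 'rV[R]_n -> R :=
  fun x => \sum_(i < n) partial i (partial i f) x.

Definition bilaplacian f : 'rV[R]_n -> R := laplacian (laplacian f).

(* Elements of C_c^oo(U), identified with their extension by 0 to R^n. *)
Definition test_function (U : set 'rV[R]_n) f : Prop :=
  [/\ forall k, Ck k f,
      compact (closure [set x | f x != 0]) &
      closure [set x | f x != 0] `<=` U].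

End euclidean.

Section pushforward_product_sigma_finite.
Context {R : realType} {d1 d2 d3 : measure_display}.
Context {T1 : measurableType d1} {T2 : measurableType d2}.
Context {T3 : measurableType d3}.
Variable m1 : {sigma_finite_measure set T1 -> \bar R}.
Variable m2 : {sigma_finite_measure set T2 -> \bar R}.
Variables (f : T1 * T2 -> T3) (g : T3 -> T1 * T2).
Hypotheses (mf : measurable_fun setT f) (mg : measurable_fun setT g).
Hypothesis fK : cancel f g.

Let map := pushforward (product_measure1 m1 m2) f.

Let map0 : (map set0 = 0)%E. Proof. exact: measure0. Qed.

Let map_ge0 A : (0 <= map A)%E. Proof. exact: measure_ge0. Qed.

Let map_sigma_additive : semi_sigma_additive map.
Proof. exact: measure_semi_sigma_additive. Qed.

HB.instance Definition _ := isMeasure.Build _ _ _ map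
  map0 map_ge0 map_sigma_additive.

Let map_sigma_finite : sigma_finite setT map.
Proof.
have /sigma_finiteP[F [TF ndF Foo]] := sigma_finiteT m1.
have /sigma_finiteP[G [TG ndG Goo]] := sigma_finiteT m2.
exists (fun k => g @^-1` (F k `*` G k)).
  apply/seteqP; split => // t _.
  have [k _ Fk] : (\bigcup_k F k) (g t).1 by rewrite -TF.
  have [l _ Gl] : (\bigcup_k G k) (g t).2 by rewrite -TG.
  exists (maxn k l) => //; split.
    by move: Fk; exact/subsetPset/ndF/leq_maxl.
  by move: Gl; exact/subsetPset/ndG/leq_maxr.
move=> k; have [mFk Fkoo] := Foo k; have [mGk Gkoo] := Goo k; split.
  by rewrite -[X in measurable X]setTI; apply: mg => //; exact: measurableX.
rewrite /map /pushforward -comp_preimage.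
rewrite (_ : g \o f = id); last by apply: funext => z /=; rewrite fK.
by rewrite preimage_id product_measure1E// lte_mul_pinfty// ge0_fin_numE.
Qed.

HB.instance Definition _ := Measure_isSigmaFinite.Build _ _ _ map
  map_sigma_finite.

Lemma pushforward_product_sigma_finite :
  exists m : {sigma_finite_measure set T3 -> \bar R},
    (m : set T3 -> \bar R) = pushforward (product_measure1 m1 m2) f.
Proof. by exists map. Qed.

End pushforward_product_sigma_finite.

Section tcons.
Context {d} {T : measurableType d} {n : nat}.

Definition tcons (z : T * n.-tuple T) : n.+1.-tuple T := [tuple of z.1 :: z.2].

Definition tuncons (t : n.+1.-tuple T) : T * n.-tuple T :=
  (thead t, [tuple of behead t]).

Lemma tconsK : cancel tcons tuncons.
Proof.
by move=> [x t]; rewrite /tcons /tuncons /=; congr pair; exact: val_inj.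
Qed.

Lemma measurable_tcons : measurable_fun setT tcons.
Proof. exact: measurable_cons measurable_fst measurable_snd. Qed.

Lemma measurable_tuncons : measurable_fun setT tuncons.
Proof.
apply/measurable_fun_pairP; split; first exact: measurable_tnth.
exact: measurable_behead.
Qed.

End tcons.

Section lebesgue_tuple.
Context {R : realType}.
Local Notation RT := (measurableTypeR R).

Local Open Scope ereal_scope.

(* n-dimensional Lebesgue measure: the n-fold product of [lebesgue_measure]. *)
Fixpoint lebesgue_tuple (n : nat) : set (n.-tuple RT) -> \bar R :=
  match n with
  | 0 => dirac ([tuple] : 0.-tuple RT)
  | m.+1 => pushforward ((lebesgue_measure : set RT -> \bar R) \x
                          @lebesgue_tuple m) (@tcons _ RT m)
  end.

Let sigma_finite_measureP n :
  exists m : {sigma_finite_measure set (n.-tuple RT) -> \bar R},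
    (m : set _ -> \bar R) = @lebesgue_tuple n.
Proof.
elim: n => [|n [m mE]].
  by exists (dirac ([tuple] : 0.-tuple RT)).
have [Q QE] := pushforward_product_sigma_finite
  [the {sigma_finite_measure set RT -> \bar R} of lebesgue_measure] m
  measurable_tcons measurable_tuncons tconsK.
by exists Q; rewrite QE /= -mE.
Qed.

Let lebesgue_tuple0 n : @lebesgue_tuple n set0 = 0.
Proof. by have [m <-] := sigma_finite_measureP n; exact: measure0. Qed.

Let lebesgue_tuple_ge0 n A : 0 <= @lebesgue_tuple n A.
Proof. by have [m <-] := sigma_finite_measureP n; exact: measure_ge0. Qed.

Let lebesgue_tuple_sigma_additive n : semi_sigma_additive (@lebesgue_tuple n).
Proof.
by have [m <-] := sigma_finite_measureP n; exact: measure_semi_sigma_additive.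
Qed.

Let lebesgue_tuple_sigma_finite n : sigma_finite setT (@lebesgue_tuple n).
Proof. by have [m <-] := sigma_finite_measureP n; exact: sigma_finiteT. Qed.

HB.instance Definition _ n := isMeasure.Build _ _ _ (@lebesgue_tuple n)
  (@lebesgue_tuple0 n) (@lebesgue_tuple_ge0 n)
  (@lebesgue_tuple_sigma_additive n).

HB.instance Definition _ n := Measure_isSigmaFinite.Build _ _ _
  (@lebesgue_tuple n) (@lebesgue_tuple_sigma_finite n).

Lemma lebesgue_tuple_box n (A : 'I_n -> set RT) :
  (forall i, measurable (A i)) ->
  @lebesgue_tuple n [set t | forall i, A i (tnth t i)] =
    \prod_(i < n) (lebesgue_measure : set RT -> \bar R) (A i).
Proof.
elim: n A => [|n IH] A mA.
  rewrite big_ord0 /= diracE mem_set//= => -[]//.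
rewrite big_ord_recl /= /pushforward -IH//.
rewrite (_ : _ @^-1` _ =
  A ord0 `*` [set t | forall i, A (lift ord0 i) (tnth t i)]).
  rewrite product_measure1E//.
  rewrite (_ : [set t | _] =
    \bigcap_(i in [set: 'I_n])
      ((fun t : n.-tuple RT => tnth t i) @^-1` A (lift ord0 i))).
    apply: fin_bigcap_measurable => // i _.
    by rewrite -[X in measurable X]setTI; exact: measurable_tnth.
  by apply/seteqP; split => t /=; [move=> h i _; exact: h|move=> h i; exact: h].
apply/seteqP; split => -[x t] /=.
  move=> h; split; first by have := h ord0; rewrite tnth0.
  by move=> i; have := h (lift ord0 i); rewrite tnthS.
by move=> [h0 h] i; case: (unliftP ord0 i) => [j|] ->; rewrite ?tnthS ?tnth0.
Qed.

End lebesgue_tuple.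

Section stability.
Context {R : realType} {n : nat}.

Definition row_of_tuple (t : n.-tuple (measurableTypeR R)) : 'rV[R]_n :=
  \row_i tnth t i.

Definition integral_Rn (f : 'rV[R]_n -> R) : \bar R :=
  (\int[@lebesgue_tuple R n]_t (f (row_of_tuple t))%:E)%E.

Definition stable_outside_compact (u : 'rV[R]_n -> R) : Prop :=
  exists2 r : R, 0 < r &
    forall phi : 'rV[R]_n -> R, test_function (~` closure (eball r)) phi ->
      (integral_Rn (fun x => expR (u x) * phi x ^+ 2)%R <=
       integral_Rn (fun x => `|laplacian phi x| ^+ 2)%R)%E.

End stability.

(* Main.v *)
(* Let v = - Delta u, so that - Delta v = e^u. Since v tends to 0, the maximum
   principle gives v > 0, and a Keller-Osserman comparison gives 2 e^u <= v^2.

   Testing stability with (M^2 + |x|^2)^((2 - n)/4), which the Rellich inequality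
   allows, bounds the integrals of e^u and v against the rescaled Newtonian
   kernels. Interpolating, by solving Poisson equations approximately and
   applying Picone's inequality, stability implies that for every L > 1
     int e^(u/2) phi^2 <= L int |grad phi|^2 + C int_box phi^2.
   Take phi to be e^(al u/2) Z and v^al Z, with al = (n - 2)/4 and Z a decaying
   weight of scale M. The error terms are absorbed with Nash's inequality, and
   the two resulting estimates close up uniformly in M exactly when
   (n - 2)^3 < 128 (n - 4), which holds for 5 <= n <= 12. So e^(nu/4) is
   integrable.

   A weighted mean U(M) of u over the ball of radius M then satisfies
   U(M) <= C - 4 c ln M by Jensen's inequality, where c > 0. But its derivative
   in M is a negative multiple of a mean of v, which is o(1/M). This is a
   contradiction. *)

From HB Require Import structures.
Require Import Defs.
From mathcomp Require Import all_boot all_order all_algebra.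
From mathcomp Require Import all_classical all_reals all_analysis.
From mathcomp Require Import measurable_realfun ring lra.

Set Implicit Arguments.
Unset Strict Implicit.
Unset Printing Implicit Defensive.

Import Order.TTheory GRing.Theory Num.Theory.
Import numFieldNormedType.Exports.

Local Open Scope classical_set_scope.
Local Open Scope ring_scope.

(** * Lebesgue integration on R^n *)

(** Read as an operator inequality, stability says that e^u is at most Delta^2 outside a compact
    set, and the interpolated inequality is its square root. No spectral calculus enters: with s a
    cut-off e^(u/2), stability makes f -> th s (1 + (-Delta)^-1 f) a contraction of L^2 when th (1 +
    eta) = 1. Its approximate fixed points give positive approximate solutions w of -Delta w = th s
    w, to which Picone's inequality applies. The exponent al is forced by scaling: 2 al + 1 = n/2,
    so the cutoff error at scale M, of size (M^-2)^(n/2) times a volume M^n, stays bounded. The test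
    with e^(al u/2) absorbs this error in its own left side. The test with v^al cannot, because its
    left side is e^(u/2) v^(2 al) and v is not controlled by e^(u/2); hence Nash's inequality. The
    two energies carry the constants al/4 and al^2/(2 al - 1). The pointwise inequality (t^p -
    w^p)(t - w) >= 0 with t = e^(u/2) and w = v/k couples the two estimates, so that only the
    product of the constants, (n - 2)^3/(128 (n - 4)), has to be below 1. *)

Section measurability.
Context {R : realType}.
Local Notation RT := (measurableTypeR R).

Let grid n k (z : {ffun 'I_n -> int}) : 'rV[R]_n := \row_i ((z i)%:~R / k.+1%:R).
Let cell n k (t : n.-tuple RT) : {ffun 'I_n -> int} :=
  [ffun i => Num.floor (k.+1%:R * (tnth t i : R))].

Lemma rV_cvgP n (u : nat -> 'rV[R]_n) (x : 'rV[R]_n) :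
  (forall i, u k 0 i @[k --> \oo] --> x 0 i) -> u @ \oo --> x.
Proof.
move=> ux; apply/cvgrPdist_lt => e e0.
have H : \forall k \near \oo, forall i : 'I_n, `|x 0 i - u k 0 i| < e.
  apply: filter_forall => i.
  by move/cvgrPdist_lt : (ux i) => /(_ e e0).
near=> k.
have Hk : forall i : 'I_n, `|x 0 i - u k 0 i| < e by near: k.
rewrite [ltLHS]/Num.norm/= mx_normrE.
apply/bigmax_ltP; split => // -[a i] _ /=; rewrite !mxE ord1.
exact: Hk.
Unshelve. all: by end_near. Qed.

(** Continuity refers to the topology of rows, measurability to the product sigma-algebra of tuples.
    They are linked by sampling f at the lower corners of cubes of side 1/(k + 1): each sampled
    function takes countably many values on measurable cells, and the samples converge pointwise to
    f. *)
Lemma continuous_measurable_Rn n (f : 'rV[R]_n -> R) : continuous f ->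
  measurable_fun [set: n.-tuple RT] (f \o row_of_tuple).
Proof.
move=> cf.
apply: (@measurable_fun_cvg _ _ R setT (fun k t => f (grid k (cell k t)))).
- move=> k _ B mB; rewrite setTI.
  rewrite (_ : _ @^-1` B = \bigcup_(z : {ffun 'I_n -> int})
     (if `[< B (f (grid k z)) >] then [set t | cell k t = z] else set0)); last first.
    apply/seteqP; split => [t /= Bt|t [z _]].
      by exists (cell k t) => //; rewrite ifT//; exact/asboolP.
    by case: asboolP => //= Bz tz; rewrite tz.
  apply: countable_bigcupT_measurable => [|z]; first exact: countableP.
  case: asboolP => // _.
  rewrite (_ : [set t | _] = \bigcap_(i in [set: 'I_n])
    ((fun t : n.-tuple RT => tnth t i) @^-1`
       `[(z i)%:~R / k.+1%:R, ((z i + 1)%:~R / k.+1%:R)[%classic)).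
    apply: fin_bigcap_measurable => // i _.
    rewrite -[X in measurable X]setTI; apply: measurable_tnth => //.
  have k0 : (0 : R) < k.+1%:R by rewrite ltr0n.
  apply/seteqP; split => [t /= <- i _ /=|t /= tz].
    rewrite in_itv/= ffunE ler_pdivrMr// ltr_pdivlMr// mulrC.
    by rewrite floor_le /= mulrC floorD1_gt.
  apply/ffunP => i; rewrite ffunE; have := tz i I.
  rewrite /= in_itv/= ler_pdivrMr// ltr_pdivlMr// mulrC => zt.
  exact: floor_def.
- move=> t _; apply: continuous_cvg; first exact: cf.
  apply: rV_cvgP => i.
  apply/cvgrPdist_lt => e e0; near=> k.
  rewrite !mxE ffunE.
  have k0 : (0 : R) < k.+1%:R by rewrite ltr0n.
  set a : R := tnth t i.
  have h1 : (Num.floor (k.+1%:R * a))%:~R <= k.+1%:R * a by exact: floor_le.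
  have h2 : k.+1%:R * a < (Num.floor (k.+1%:R * a))%:~R + 1.
    by have := floorD1_gt (k.+1%:R * a); rewrite intrD.
  have -> : a = (k.+1%:R * a) / k.+1%:R by rewrite mulrAC divff ?gt_eqF// mul1r.
  rewrite [in X in _ - X](_ : (k.+1%:R * a) / k.+1%:R = a); last first.
    by rewrite mulrAC divff ?gt_eqF// mul1r.
  rewrite -mulrBl normrM (@ger0_norm _ k.+1%:R^-1) ?invr_ge0// ?ltW//.
  rewrite ltr_pdivrMr// ger0_norm ?subr_ge0//.
  rewrite (@lt_le_trans _ _ 1)//; first by rewrite ltrBlDl.
  rewrite -ler_pdivrMl// mulr1.
  near: k.
  exists (Num.truncn e^-1) => // m /= em.
  apply: ltW; apply: lt_le_trans (_ : (Num.truncn e^-1).+1%:R <= _).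
    exact: truncnS_gt.
  by rewrite ler_nat.
Unshelve. all: by end_near. Qed.
End measurability.

Section integral.
Context {R : realType} {n : nat}.
Local Notation RT := (measurableTypeR R).
Local Notation mu := (@lebesgue_tuple R n).
Implicit Types f g : 'rV[R]_n -> R.

Definition Mf f := measurable_fun [set: n.-tuple RT] (f \o row_of_tuple).
Definition Itg f := mu.-integrable setT (EFin \o (f \o row_of_tuple)).
(** [fine] sends an infinite integral to 0, so an upper bound on [Int] carries information only
    together with [Itg]; this is why the two are often proved together below. *)
Definition Int f : R := fine (integral_Rn f).

Lemma continuous_Mf f : continuous f -> Mf f.
Proof. exact: continuous_measurable_Rn. Qed.

Lemma Itg_Mf f : Itg f -> Mf f.
Proof. by move=> /measurable_int/measurable_EFinP. Qed.

Lemma Itg_dom f g : Mf f -> Itg g -> (forall x, `|f x| <= g x) -> Itg f.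
Proof.
move=> mf ig fg; apply: (le_integrable _ _ _ ig) => //.
  exact/measurable_EFinP.
move=> x _ /=; rewrite lee_fin (le_trans (fg _))//; exact: ler_norm.
Qed.

Lemma ItgD f g : Itg f -> Itg g -> Itg (fun x => f x + g x).
Proof. by move=> If Ig; exact: (integrableD _ If Ig). Qed.

Lemma ItgB f g : Itg f -> Itg g -> Itg (fun x => f x - g x).
Proof. by move=> If Ig; exact: (integrableB _ If Ig). Qed.

Lemma ItgZ (c : R) f : Itg f -> Itg (fun x => c * f x).
Proof. by move=> If; exact: (integrableZl _ c If). Qed.

Lemma ItgN f : Itg f -> Itg (fun x => - f x).
Proof. by move=> /(ItgZ (-1)); under eq_fun do rewrite mulN1r. Qed.

Lemma Itg0 : Itg (fun=> 0).
Proof. exact: integrable0. Qed.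

Lemma Itg_sum (I : Type) (r : seq I) (F : I -> 'rV[R]_n -> R) :
  (forall i, Itg (F i)) -> Itg (fun x => \sum_(i <- r) F i x).
Proof.
move=> IF; elim: r => [|a r IH].
  by under eq_fun do rewrite big_nil; exact: Itg0.
by under eq_fun do rewrite big_cons; exact: ItgD.
Qed.

Lemma IntE f : Itg f -> (Int f)%:E = integral_Rn f.
Proof. by move=> If; rewrite /Int fineK//; exact: integrable_fin_num. Qed.

Lemma IntD f g : Itg f -> Itg g -> Int (fun x => f x + g x) = Int f + Int g.
Proof. by move=> If Ig; exact: (RintegralD _ If Ig). Qed.

Lemma IntB f g : Itg f -> Itg g -> Int (fun x => f x - g x) = Int f - Int g.
Proof. by move=> If Ig; exact: (RintegralB _ If Ig). Qed.

Lemma IntZ (c : R) f : Itg f -> Int (fun x => c * f x) = c * Int f.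
Proof. by move=> If; exact: (RintegralZl _ _ If). Qed.

Lemma IntN f : Itg f -> Int (fun x => - f x) = - Int f.
Proof. by move=> If; rewrite -mulN1r -IntZ//; congr Int; apply/funext => x; rewrite mulN1r. Qed.

Lemma Int0 : Int (fun=> 0) = 0.
Proof. by rewrite /Int /integral_Rn integral0. Qed.

Lemma Int_sum (I : Type) (r : seq I) (F : I -> 'rV[R]_n -> R) :
  (forall i, Itg (F i)) ->
  Int (fun x => \sum_(i <- r) F i x) = \sum_(i <- r) Int (F i).
Proof.
move=> IF; elim: r => [|a r IH].
  by rewrite big_nil; under eq_fun do rewrite big_nil; exact: Int0.
rewrite big_cons; under eq_fun do rewrite big_cons.
by rewrite IntD ?IH//; exact: Itg_sum.
Qed.

Lemma Int_le f g : Itg f -> Itg g -> (forall x, f x <= g x) -> Int f <= Int g.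
Proof. by move=> If Ig fg; apply: (le_Rintegral _ If Ig) => // x _; exact: fg. Qed.

Lemma Int_ge0 f : (forall x, 0 <= f x) -> 0 <= Int f.
Proof. by move=> f0; apply: Rintegral_ge0 => x _; exact: f0. Qed.

Lemma Int_norm_le f g : Itg f -> Itg g -> (forall x, `|f x| <= g x) ->
  `|Int f| <= Int g.
Proof.
move=> If Ig fg; rewrite ler_norml -IntN//; apply/andP; split.
  by apply: Int_le => //; [exact: ItgN|move=> x; have := fg x; rewrite ler_norml => /andP[]].
by apply: Int_le => // x; have := fg x; rewrite ler_norml => /andP[].
Qed.

Lemma Int_dct (f_ : nat -> 'rV[R]_n -> R) f g :
  (forall k, Mf (f_ k)) -> Mf f -> Itg g ->
  (forall k x, `|f_ k x| <= g x) -> (forall x, f_ k x @[k --> \oo] --> f x) ->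
  Itg f /\ Int (f_ k) @[k --> \oo] --> Int f.
Proof.
move=> mf_ mf Ig fg ff.
have If_ k : Itg (f_ k) by apply: Itg_dom Ig (fg k).
have [] := @dominated_convergence _ _ _ mu setT measurableT
  (fun k => EFin \o (f_ k \o row_of_tuple)) (EFin \o (f \o row_of_tuple))
  (EFin \o (g \o row_of_tuple)).
- by move=> k; apply/measurable_EFinP; exact: mf_.
- exact/measurable_EFinP.
- by apply: aeW => t _ /=; apply: cvg_EFin; [exact: nearW|exact: ff].
- exact: Ig.
- by apply: aeW => t /= k _; rewrite lee_fin.
move=> If _ cv; split => //.
apply: fine_cvg; rewrite -/(Int f) IntE//.
Qed.

(** This is how bounds for compactly supported or truncated integrands pass to their limits:
    integrability of the limit comes out of the uniform bound, no dominating function being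
    available. *)
Lemma Int_fatou (f_ : nat -> 'rV[R]_n -> R) f (C : R) :
  (forall k, Itg (f_ k)) -> (forall k x, 0 <= f_ k x) ->
  (forall x, f_ k x @[k --> \oo] --> f x) -> (forall k, Int (f_ k) <= C) ->
  Itg f /\ Int f <= C.
Proof.
move=> If_ f0 ff fC.
have mf : Mf f.
  apply: (@measurable_fun_cvg _ _ R setT (fun k => f_ k \o row_of_tuple)).
    by move=> k; exact: Itg_Mf.
  by move=> t _; exact: ff.
have F0 x : 0 <= f x.
  rewrite -(cvg_lim _ (ff x))//; apply: limr_ge; first exact: cvgP (ff x).
  by apply: nearW => k; exact: f0.
have le : (integral_Rn f <= C%:E)%E.
  apply: le_trans (_ : (limn_einf (fun k => integral_Rn (f_ k)) <= _)%E).
    apply: le_trans (_ : (\int[mu]_(x in setT) limn_einf (fun k => (f_ k (row_of_tuple x))%:E) <= _)%E).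
      rewrite le_eqVlt; apply/orP; left; apply/eqP; apply: eq_integral => t _.
      have cv : (f_ k (row_of_tuple t))%:E @[k --> \oo] --> (f (row_of_tuple t))%:E.
        by apply: cvg_EFin; [exact: nearW|exact: ff].
      by rewrite is_cvg_limn_einfE ?(cvg_lim _ cv)//; apply: cvgP cv.
    apply: fatou => //.
      by move=> k; apply/measurable_EFinP; exact: Itg_Mf.
      by move=> k t _; rewrite lee_fin.
  apply: le_trans (_ : (limn_esup (fun k => integral_Rn (f_ k)) <= _)%E).
    exact: limn_einf_sup.
  rewrite limn_esup_lim; apply: lime_le.
    exact: is_cvg_esups.
  apply: nearW => k; apply: ge_ereal_sup => _ [m /= _ <-].
  by rewrite -IntE// lee_fin.
have Iff : Itg f.
  apply/integrableP; split; first exact/measurable_EFinP.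
  under eq_integral do rewrite /= ger0_norm//.
  exact: le_lt_trans le (ltry _).
by split => //; rewrite -lee_fin IntE.
Qed.

(** Cubes replace balls throughout: their volume is read off the product measure, and they are the
    balls of the sup norm of rows. *)
Definition box (B : R) : set 'rV[R]_n := [set x | forall i, `|x 0 i| <= B].

Definition ibox (B : R) (x : 'rV[R]_n) : R := (`[< box B x >])%:R.

Lemma iboxP B x : ibox B x = if `[< box B x >] then 1 else 0.
Proof. by rewrite /ibox; case: asboolP. Qed.

Lemma Int_ibox (B : R) : 0 <= B -> Itg (ibox B) /\ Int (ibox B) = (2 * B) ^+ n.
Proof.
move=> B0.
pose A (i : 'I_n) : set RT := `[- B, B]%classic.
have mA i : measurable (A i) by exact: measurable_itv.
pose S := [set t : n.-tuple RT | forall i, A i (tnth t i)].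
have mS : measurable S.
  rewrite (_ : S = \bigcap_(i in [set: 'I_n])
      ((fun t : n.-tuple RT => tnth t i) @^-1` A i)).
    apply: fin_bigcap_measurable => // i _.
    by rewrite -[X in measurable X]setTI; exact: measurable_tnth.
  by apply/seteqP; split => t /=; [move=> h i _; exact: h|move=> h i; exact: h].
have muS : mu S = ((2 * B) ^+ n)%:E.
  rewrite lebesgue_tuple_box// (eq_bigr (fun=> (2 * B)%:E)).
    rewrite -[in RHS](card_ord n) -prodr_const.
    by apply: (big_rec2 (fun x y => x = y%:E)) => // i x y _ ->; rewrite EFinM.
  move=> i _; rewrite lebesgue_measure_itv/= lte_fin.
  have [->|B0'] := eqVneq B 0; first by rewrite oppr0 ltxx mulr0.
  rewrite ifT; last by rewrite gtrN// lt_neqAle eq_sym B0' B0.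
  by rewrite opprK -EFinD mulrDl mul1r.
have iE : ibox B \o row_of_tuple = \1_S.
  apply/funext => t /=; rewrite /ibox indicE; congr ((_ : bool)%:R).
  apply/asboolP/idP; rewrite inE /S /A /box /=.
    by move=> h i; have := h i; rewrite mxE ler_norml in_itv.
  by move=> h i; have := h i; rewrite mxE ler_norml in_itv.
have II : Itg (ibox B).
  rewrite /Itg; apply/integrableP; split.
    by apply/measurable_EFinP; rewrite iE; exact: measurable_indic.
  rewrite (eq_integral (fun x => (\1_S x)%:E)); last first.
    by move=> x _ /=; rewrite -iE /= ger0_norm// ler0n.
  by rewrite integral_indic// setIT [ltLHS]muS ltry.
split => //; apply: EFin_inj; rewrite IntE// /integral_Rn.
rewrite (eq_integral (fun x => (\1_S x)%:E)); last by move=> x _ /=; rewrite -iE.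
by rewrite integral_indic// setIT.
Qed.

Lemma compact_box (B : R) : compact (box B).
Proof.
apply: bounded_closed_compact.
  exists `|B|; split; first by rewrite num_real.
  move=> M BM x xA /=; rewrite [leLHS]/Num.norm/= mx_normrE.
  apply/bigmax_leP; split; first by rewrite (le_trans _ (ltW BM)).
  by move=> [a i] _ /=; rewrite ord1 (le_trans (xA i))// (le_trans (ler_norm _))// ltW.
rewrite (_ : box _ = \bigcap_(i in [set: 'I_n]) [set x | `|x 0 i| <= B]).
  apply: closed_bigI => i _.
  apply: (@closed_comp _ _ (fun x : 'rV[R]_n => `|x 0 i|) [set x | x <= B]).
    by move=> x _; apply: continuous_comp; [exact: coord_continuous|exact: norm_continuous].
  exact: closed_le.
by apply/seteqP; split => [x h i _|x h i]; exact: h.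
Qed.

Lemma Itg_box f (B : R) : continuous f -> (forall x, ~ box B x -> f x = 0) -> Itg f.
Proof.
move=> cf f0.
have B0' : 0 <= Num.max B 0 by rewrite le_max lexx orbT.
have [Ii _] := Int_ibox B0'.
have cA : compact (box (Num.max B 0)) by exact: compact_box.
have cf' : {within box (Num.max B 0), continuous (fun x => `|f x|)}.
  by apply: continuous_subspaceT => x; apply: continuous_comp; [exact: cf|exact: norm_continuous].
have [c _ hc] : exists2 c, c \in box (Num.max B 0) & forall t, t \in box (Num.max B 0) -> `|f t| <= `|f c|.
  apply: EVT_max_rV cA cf'.
  by exists 0 => i; rewrite mxE normr0.
apply: (@Itg_dom _ (fun x => `|f c| * ibox (Num.max B 0) x)).
- exact: continuous_Mf.
- exact: ItgZ.
- move=> x; rewrite iboxP; case: asboolP => bx.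
    by rewrite mulr1; apply: hc; rewrite inE.
  rewrite f0 ?normr0 ?mulr0//.
  by apply: contra_not bx => h i; rewrite (le_trans (h i))// le_max lexx.
Qed.

End integral.

(** * Slicing R^(n+1) along its first coordinate *)

Section rowS.
Context {R : realType}.
Local Notation RT := (measurableTypeR R).

Definition rowS n (x : R) (y : 'rV[R]_n) : 'rV[R]_n.+1 :=
  \row_i if unlift ord0 i is Some j then y 0 j else x.

Lemma rowS0 n (x : R) (y : 'rV[R]_n) : rowS x y 0 ord0 = x.
Proof. by rewrite mxE unlift_none. Qed.

Lemma rowSS n (x : R) (y : 'rV[R]_n) j : rowS x y 0 (lift ord0 j) = y 0 j.
Proof. by rewrite mxE liftK. Qed.

Lemma row_of_tcons n (z : RT * n.-tuple RT) :
  row_of_tuple (tcons z) = rowS z.1 (row_of_tuple z.2).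
Proof.
apply/rowP => i; case: (unliftP ord0 i) => [j|] ->.
  by rewrite rowSS !mxE tnthS.
by rewrite rowS0 mxE tnth0.
Qed.

Lemma rowS_line0 n (x t : R) (y : 'rV[R]_n) :
  rowS (x + t) y = rowS x y + t *: delta_mx 0 ord0.
Proof.
apply/rowP => i; case: (unliftP ord0 i) => [j|] ->.
  by rewrite !mxE liftK !eqxx mulr0 addr0.
by rewrite !mxE unlift_none !eqxx mulr1.
Qed.

Lemma rowS_lineS n (x t : R) (y : 'rV[R]_n) j :
  rowS x (y + t *: delta_mx 0 j) = rowS x y + t *: delta_mx 0 (lift ord0 j).
Proof.
apply/rowP => i; case: (unliftP ord0 i) => [k|] ->.
  by rewrite !mxE !liftK !mxE (inj_eq (@lift_inj _ _)).
by rewrite !mxE !unlift_none /= mulr0 addr0.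
Qed.

Lemma is_derive_line (V : normedModType R) (f : V -> R) x v d :
  is_derive x v f d <-> is_derive (0:R) 1 (fun t : R => f (x + t *: v)) d.
Proof.
have E : (fun h : R => h^-1 *: (((fun t : R => f (x + t *: v)) \o shift 0) (h *: 1) -
    (fun t : R => f (x + t *: v)) 0)) = (fun h => h^-1 *: ((f \o shift x) (h *: v) - f x)).
  apply/funext => h /=; rewrite scale0r !addr0; congr (_ *: (f _ - _)).
  by rewrite addrC; congr (_ *: _ + _); rewrite /GRing.scale/= mulr1.
split=> -[D1 D2]; split.
- by rewrite /derivable E.
- by rewrite /derive E.
- by move: D1; rewrite /derivable E.
- by move: D2; rewrite /derive E.
Qed.

Lemma ltr_norm_rowS n (x x' : R) (y y' : 'rV[R]_n) e : 0 < e ->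
  `|x - x'| < e -> `|y - y'| < e -> `|rowS x y - rowS x' y'| < e.
Proof.
move=> e0 h1 h2; rewrite [ltLHS]/Num.norm/= mx_normrE.
apply/bigmax_ltP; split => // -[a i] _ /=; rewrite !mxE.
case: unlift => [j|//].
apply: le_lt_trans h2; rewrite [leRHS]/Num.norm/= mx_normrE.
by apply/bigmax_geP; right; exists (0, j) => //=; rewrite !mxE.
Qed.

Lemma continuous_rowSl n (x : R) : continuous (fun y : 'rV[R]_n => rowS x y).
Proof.
suff H : forall y : 'rV[R]_n, rowS x w @[w --> y] --> rowS x y by exact: H.
move=> y; apply: (iffRL (@cvgrPdist_lt _ 'rV[R]_n.+1 'rV[R]_n (nbhs (y : 'rV[R]_n)) (nbhs_filter (y : 'rV[R]_n)) (rowS x) (rowS x y))) => e e0.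
apply: (@filterS _ (nbhs (y : 'rV[R]_n)) _ _ _ _ (nbhs_ball_norm (y : 'rV[R]_n) (PosNum e0))) => w hw.
by apply: ltr_norm_rowS => //; rewrite subrr normr0.
Qed.

Lemma continuous_rowSr n (y : 'rV[R]_n) : continuous (fun x : R => rowS x y).
Proof.
move=> x; apply/(@cvgrPdist_lt _ 'rV[R]_n.+1) => e e0.
apply: (@filterS _ (nbhs (x : R)) _ _ _ _ (nbhs_ball_norm (x : R) (PosNum e0))) => w hw.
by apply: ltr_norm_rowS => //; rewrite subrr normr0.
Qed.

(** Both orders of integration are kept, because [Int_partial0] needs the first coordinate innermost
    in one case and outermost in the other. *)
Lemma integral_RnS n (f : 'rV[R]_n.+1 -> R) : Itg f ->
  (integral_Rn f = \int[lebesgue_measure]_x integral_Rn (fun y : 'rV[R]_n => f (rowS x y))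
  /\ integral_Rn f = \int[@lebesgue_tuple R n]_t
        \int[lebesgue_measure]_x (f (rowS x (row_of_tuple t)))%:E)%E.
Proof.
move=> If.
have mf := measurable_int _ If.
have /= IF : ((lebesgue_measure : set RT -> \bar R) \x @lebesgue_tuple R n)%E.-integrable
    ((@tcons _ RT n) @^-1` setT) ((EFin \o (f \o row_of_tuple)) \o @tcons _ RT n).
  rewrite preimage_setT; apply/integrableP; split.
    apply: (measurableT_comp mf); exact: measurable_tcons.
  have /integrableP[_] := If.
  rewrite (@ge0_integral_pushforward _ _ _ _ _ _ measurable_tcons
   ((lebesgue_measure : set RT -> \bar R) \x @lebesgue_tuple R n)%E)//.
  exact: measurableT_comp.
have E : integral_Rn f = (\int[((lebesgue_measure : set RT -> \bar R) \x @lebesgue_tuple R n)%E]_z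
   (f (rowS z.1 (row_of_tuple z.2)))%:E)%E.
  rewrite /integral_Rn /= (@integral_pushforward _ _ _ _ _ _ measurable_tcons
    ((lebesgue_measure : set RT -> \bar R) \x @lebesgue_tuple R n)%E)//.
  rewrite preimage_setT; apply: eq_integral => z _ /=.
  by rewrite row_of_tcons.
rewrite preimage_setT in IF.
have EF : ((EFin \o (f \o row_of_tuple)) \o @tcons _ RT n) =
   (fun z : RT * n.-tuple RT => (f (rowS z.1 (row_of_tuple z.2)))%:E).
  by apply/funext => z /=; rewrite row_of_tcons.
rewrite EF in IF.
split; rewrite E.
  by rewrite -integral12_prod_meas1.
by rewrite -integral21_prod_meas1.
Qed.
End rowS.

(** * Translation invariance of Lebesgue measure *)

Section translation.
Context {R : realType}.
Local Notation RT := (measurableTypeR R).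

Lemma lebesgue_measure_shift (a : R) (A : set RT) : measurable A ->
  lebesgue_measure ((fun x : RT => x + a : RT) @^-1` A) = lebesgue_measure A.
Proof.
move=> mA.
have mf : measurable_fun setT (fun x : RT => x + a : RT).
  apply: continuous_measurable_fun => x.
  by apply: cvgD; [exact: cvg_id|exact: cvg_cst].
pose m := @measure_function_pushforward__canonical__measure_function_Measure
  _ _ RT RT R lebesgue_measure (fun x : RT => x + a : RT) mf.
apply/esym; apply: (lebesgue_measure_unique (mu := m)) => //.
move=> _ [[c d]] _ <-; rewrite /m/= /pushforward.
rewrite (_ : _ @^-1` _ = `]c - a, d - a]%classic).
  rewrite !lebesgue_measure_itv/= !lte_fin ltrD2r.
  by case: ifP => // _; rewrite -!EFinB opprB addrA subrK.
apply/seteqP; split => x /=; rewrite !in_itv/= ltrBlDr lerBrDr//.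
Qed.

Definition tshift n (a : n.-tuple R) (t : n.-tuple RT) : n.-tuple RT :=
  [tuple (tnth t i + tnth a i : RT) | i < n].

Lemma measurable_tshift n (a : n.-tuple R) : measurable_fun setT (tshift a).
Proof.
apply/measurable_fun_tnthP => i.
rewrite (_ : _ \o _ = (fun t : n.-tuple RT => (tnth t i : R) + tnth a i)); last first.
  by apply/funext => t; rewrite /= tnth_mktuple.
apply: measurable_funD => //; exact: measurable_tnth.
Qed.

(** Through [tcons] a shift becomes a product of shifts. The image of the product measure under it
    agrees with that measure on rectangles, by the one-dimensional case and induction, and
    uniqueness of the product measure extends this to all measurable sets. *)
Lemma lebesgue_tuple_shift n (a : n.-tuple R) (A : set (n.-tuple RT)) :
  measurable A -> @lebesgue_tuple R n (tshift a @^-1` A) = @lebesgue_tuple R n A.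
Proof.
elim: n a A => [|n IH] a A mA.
  rewrite (_ : tshift a = id) ?preimage_id//.
  by apply/funext => t; rewrite (tuple0 (tshift a t)) (tuple0 t).
pose a' := [tuple of behead a]; pose a0 := thead a.
pose s (z : RT * n.-tuple RT) : RT * n.-tuple RT := (z.1 + a0, tshift a' z.2).
have ms : measurable_fun setT s.
  apply/measurable_fun_pairP; split; rewrite /comp/=.
    by apply: measurable_funD => //; exact: measurable_fst.
  apply: measurableT_comp; first exact: measurable_tshift.
  exact: measurable_snd.
pose L := ((lebesgue_measure : set RT -> \bar R) \x @lebesgue_tuple R n)%E.
pose m := @measure_function_pushforward__canonical__measure_function_Measure
  _ _ _ _ R L s ms.
rewrite /= /pushforward -/L.
have mtA : measurable ((@tcons _ RT n) @^-1` A).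
  by rewrite -[X in measurable X]setTI; apply: measurable_tcons.
rewrite (_ : _ @^-1` (_ @^-1` A) = s @^-1` ((@tcons _ RT n) @^-1` A)); last first.
  suff E z : tshift a (tcons z) = tcons (s z).
    by apply/seteqP; split => z; rewrite /preimage/= E.
  apply: eq_from_tnth => i; rewrite /= tnth_mktuple.
  case: (unliftP ord0 i) => [j|] ->; last by rewrite !tnth0 /a0 /thead.
  by rewrite !tnthS tnth_mktuple tnth_behead; congr (_ + tnth a _); apply/val_inj; rewrite /= inordK// ltnS ltn_ord.
apply/esym/(@product_measure_unique _ _ _ _ _ _ _ m) => // B C mB mC.
rewrite /m/= /pushforward (_ : s @^-1` _ =
  ((fun x : RT => x + a0 : RT) @^-1` B) `*` (tshift a' @^-1` C)); last first.
  by apply/seteqP; split => -[x t].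
have mB' : measurable ((fun x : RT => x + a0 : RT) @^-1` B).
  have mf : measurable_fun setT (fun x : RT => x + a0 : RT).
    apply: continuous_measurable_fun => x.
    by apply: cvgD; [exact: cvg_id|exact: cvg_cst].
  by rewrite -[X in measurable X]setTI; apply: mf.
have mC' : measurable (tshift a' @^-1` C).
  by rewrite -[X in measurable X]setTI; apply: measurable_tshift.
rewrite /L product_measure1E//; congr (_ * _)%E.
  exact: lebesgue_measure_shift.
exact: IH.
Qed.

Lemma Int_shift n (a : 'rV[R]_n) (f : 'rV[R]_n -> R) : Itg f ->
  Itg (fun x => f (x + a)) /\ Int (fun x => f (x + a)) = Int f.
Proof.
move=> If.
pose b := [tuple a 0 i | i < n].
have rE t : row_of_tuple (tshift b t) = row_of_tuple t + a.
  by apply/rowP => i; rewrite !mxE !tnth_mktuple.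
have mf := measurable_int _ If.
pose m := @measure_function_pushforward__canonical__measure_function_Measure
  _ _ _ _ R (@lebesgue_tuple R n) (tshift b) (measurable_tshift b).
have mE (g : n.-tuple RT -> \bar R) :
    (\int[@lebesgue_tuple R n]_x g x = \int[pushforward (@lebesgue_tuple R n) (tshift b)]_x g x)%E.
  apply: (@eq_measure_integral _ _ _ setT m) => A mA _.
  exact: (esym (lebesgue_tuple_shift b mA)).
have E : (EFin \o ((fun x => f (x + a)) \o row_of_tuple)) =
    ((EFin \o (f \o row_of_tuple)) \o tshift b).
  by apply/funext => t /=; rewrite rE.
have IF : (@lebesgue_tuple R n).-integrable (tshift b @^-1` setT)
    ((EFin \o (f \o row_of_tuple)) \o tshift b).
  rewrite preimage_setT; apply/integrableP; split.
    apply: (measurableT_comp mf); exact: measurable_tshift.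
  have /integrableP[_] := If; apply: le_lt_trans.
  rewrite [leRHS]mE (ge0_integral_pushforward (measurable_tshift b))//.
  exact: measurableT_comp.
split; first by rewrite /Itg E -(preimage_setT (tshift b)).
congr fine; rewrite /integral_Rn.
transitivity (\int[@lebesgue_tuple R n]_x ((EFin \o (f \o row_of_tuple)) \o tshift b) x)%E.
  by apply: eq_integral => t _; rewrite -E.
rewrite [RHS]mE [RHS](integral_pushforward (measurable_tshift b) _ IF)//.
Qed.
End translation.

(** * Integrals of derivatives of compactly supported functions *)

Section divergence.
Context {R : realType}.
Local Notation RT := (measurableTypeR R).

Lemma is_derive_cont (h : R -> R) (x d : R) : is_derive x (1 : R) h d ->
  {for x, continuous h}.
Proof. by move=> [D _]; apply/differentiable_continuous/derivable1_diffP. Qed.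

Lemma integral_derive0 (h h' : R -> R) (B : R) :
  (forall x : R, is_derive x (1 : R) h (h' x)) -> continuous h' ->
  (forall x, B < `|x| -> h x = 0 /\ h' x = 0) ->
  (\int[lebesgue_measure]_x (h' x)%:E = 0)%E.
Proof.
(* C is positive and strictly beyond B, so h vanishes at both endpoints of [-C, C]. *)
move=> dh ch h0; pose C := `|B| + 1.
have C0 : 0 < C by rewrite ltr_wpDl.
have BC : B < C by rewrite (le_lt_trans (ler_norm _))// ltrDl.
pose D : set RT := `[- C, C]%classic.
rewrite (_ : (\int[_]_x _)%E = (\int[lebesgue_measure]_(x in D) (h' x)%:E)%E).
  rewrite (@continuous_FTC2 _ h' h)//.
  - have [-> _] : h C = 0 /\ h' C = 0 by apply: h0; rewrite gtr0_norm.
    have [-> _] : h (- C) = 0 /\ h' (- C) = 0 by apply: h0; rewrite normrN gtr0_norm.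
    by rewrite subee.
  - by rewrite gtrN.
  - exact: continuous_subspaceT.
  - split.
    + by move=> x _; have [] := dh x.
    + by apply: cvg_at_right_filter; exact: (is_derive_cont (dh _)).
    + by apply: cvg_at_left_filter; exact: (is_derive_cont (dh _)).
  - by move=> x _; rewrite derive1E; have [] := dh x.
rewrite [RHS]integral_mkcond; apply: eq_integral => x _.
rewrite /patch; case: ifPn => //.
rewrite notin_setE /D /= in_itv/= => /negP; rewrite -ler_norml -ltNge => Cx.
by have [_ ->] := h0 x (lt_trans BC Cx).
Qed.

Lemma continuous_line n (x v : 'rV[R]_n) : continuous (fun t : R => x + t *: v).
Proof.
move=> t; apply: cvgD; first exact: cvg_cst.
by apply: cvgZr_tmp; exact: cvg_id.
Qed.

(** The root of every integration by parts below. Induction on the dimension: for the first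
    coordinate the inner one-variable integral vanishes by the fundamental theorem of calculus; for
    another coordinate the slices with the first coordinate fixed vanish by induction. *)
Lemma Int_partial0 n (i : 'I_n) (f g : 'rV[R]_n -> R) (B : R) :
  (forall x, is_derive x (delta_mx 0 i) f (g x)) -> continuous g ->
  (forall x, ~ box B x -> f x = 0 /\ g x = 0) -> Int g = 0.
Proof.
elim: n i f g => [[]//|n IH] i f g df cg fg0.
have Ig : Itg g by apply: (Itg_box (B := B)) => // x /fg0[].
suff H : integral_Rn g = 0%E by rewrite /Int H.
have [E1 E2] := integral_RnS Ig.
case: (unliftP ord0 i) => [j|] ij; rewrite ij in df.
  rewrite E1 integral0_eq// => x _.
  have cgx : continuous (fun y : 'rV[R]_n => g (rowS x y)).
    move=> y; apply: continuous_comp; last exact: cg.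
    exact: continuous_rowSl.
  have bx y : ~ box B y -> ~ box B (rowS x y).
    by apply: contra_not => h k; have := h (lift ord0 k); rewrite rowSS.
  have Igx : Itg (fun y : 'rV[R]_n => g (rowS x y)).
    by apply: (Itg_box (B := B)) => // y /bx/fg0[].
  rewrite -IntE//; congr EFin.
  apply: (IH j (fun y => f (rowS x y))) => // [y|y /bx/fg0//].
  apply/is_derive_line; under eq_fun do rewrite rowS_lineS.
  by move: (df (rowS x y)) => /is_derive_line.
rewrite E2 integral0_eq// => t _.
apply: (@integral_derive0 (fun x => f (rowS x (row_of_tuple t))) _ B).
- move=> x; apply/is_derive_line.
  rewrite (_ : (fun _ => _) = (fun h : R => f (rowS x (row_of_tuple t) + h *: delta_mx 0 ord0))).
    by move: (df (rowS x (row_of_tuple t))) => /is_derive_line.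
  by apply/funext => h; rewrite -rowS_line0 /GRing.scale/= mulr1.
- move=> x; apply: continuous_comp; last exact: cg.
  exact: continuous_rowSr.
- move=> x Bx; apply: fg0 => /(_ ord0); rewrite rowS0.
  by apply/negP; rewrite -ltNge.
Qed.
End divergence.

(** * Differential calculus and Green's formula *)

Section derivation.
Context {R : realType} {V : normedModType R}.
Implicit Types (f g : V -> R) (x v : V).

Lemma isd_cst (c : R) x v : is_derive x v (fun=> c) 0.
Proof. exact: is_derive_cst. Qed.

Lemma isdD f g x v a b : is_derive x v f a -> is_derive x v g b ->
  is_derive x v (fun y => f y + g y) (a + b).
Proof. by move=> df dg; exact: is_deriveD. Qed.

Lemma isdN f x v a : is_derive x v f a -> is_derive x v (fun y => - f y) (- a).
Proof. by move=> df; exact: is_deriveN. Qed.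

Lemma isdB f g x v a b : is_derive x v f a -> is_derive x v g b ->
  is_derive x v (fun y => f y - g y) (a - b).
Proof. by move=> df dg; exact: is_deriveB. Qed.

Lemma isdM f g x v a b : is_derive x v f a -> is_derive x v g b ->
  is_derive x v (fun y => f y * g y) (a * g x + f x * b).
Proof.
move=> df dg; apply: is_derive_eq.
by rewrite /GRing.scale/= addrC mulrC.
Qed.

Lemma isdZ (c : R) f x v a : is_derive x v f a ->
  is_derive x v (fun y => c * f y) (c * a).
Proof.
by move=> df; have := isdM (isd_cst c x v) df; rewrite mul0r add0r.
Qed.

Lemma isd_sum (I : Type) (r : seq I) (F : I -> V -> R) (G : I -> R) x v :
  (forall i, is_derive x v (F i) (G i)) ->
  is_derive x v (fun y => \sum_(i <- r) F i y) (\sum_(i <- r) G i).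
Proof.
move=> FG; elim: r => [|a r IH].
  by rewrite big_nil; under eq_fun do rewrite big_nil; exact: isd_cst.
by rewrite big_cons; under eq_fun do rewrite big_cons; exact: isdD.
Qed.

Lemma isd_comp (h : R -> R) f x v a b :
  is_derive (f x) (1 : R) h a -> is_derive x v f b ->
  is_derive x v (fun y => h (f y)) (a * b).
Proof.
move=> dh /is_derive_line df; apply/is_derive_line.
have fx : f (x + (0:R) *: v) = f x by rewrite scale0r addr0.
rewrite -fx in dh.
pose l := fun t : R => f (x + t *: v).
have dl : derivable l 0 1 by case: df.
have dh' : derivable h (l 0) 1 by case: dh.
split.
  apply/derivable1_diffP; apply: (@differentiable_comp _ _ _ _ l h).
    exact/derivable1_diffP.
  exact/derivable1_diffP.
rewrite -derive1E; etransitivity; first exact: (derive1_comp dl dh').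
rewrite !derive1E.
by congr (_ * _); [case: dh|case: df].
Qed.

Lemma isd_line f x v (t d : R) : is_derive (x + t *: v) v f d ->
  is_derive t (1 : R) (fun s : R => f (x + s *: v)) d.
Proof.
move=> /is_derive_line D; apply/is_derive_line.
rewrite (_ : (fun _ => _) = (fun s : R => f (x + t *: v + s *: v)))//.
apply/funext => s; rewrite -addrA -scalerDl; congr (f (_ + _ *: _)).
by congr (_ + _); rewrite /GRing.scale/= mulr1.
Qed.

Lemma isd_uniq f x v a b : is_derive x v f a -> is_derive x v f b -> a = b.
Proof. by move=> [_ <-] [_ <-]. Qed.

End derivation.

Section derivation1.
Context {R : realType}.

Lemma isd_inv (y : R) : y != 0 -> is_derive y (1 : R) (fun z : R => z^-1) (- (y ^- 2)).
Proof.
move=> y0; split.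
  by apply: (@derivableV _ _ id) => //; exact: derivable_id.
rewrite (@deriveV _ _ id)//.
by rewrite derive_id /GRing.scale/= mulr1.
Qed.

Lemma isd_expR (y : R) : is_derive y (1 : R) (fun z : R => expR z) (expR y).
Proof. exact: is_derive_expR. Qed.

Lemma isd_ln (y : R) : 0 < y -> is_derive y (1 : R) (fun z : R => ln z) y^-1.
Proof. exact: is_derive1_ln. Qed.

Lemma isd_powR (a y : R) : 0 < y ->
  is_derive y (1 : R) (fun z : R => z `^ a) (a * y `^ (a - 1)).
Proof.
exact: is_derive1_powR.
Qed.

Lemma isd_exprn k (y : R) : is_derive y (1 : R) (fun z : R => z ^+ k) (k%:R * y ^+ k.-1).
Proof.
split; first exact: exprn_derivable.
by rewrite exp_derive /GRing.scale/= mulr1.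
Qed.

End derivation1.

Section cont.
Context {R : realType} {T : topologicalType}.
Implicit Types f g : T -> R.

Lemma cont_cst (c : R) : continuous (fun _ : T => c).
Proof. by move=> x; exact: cvg_cst. Qed.

Lemma cont_add f g : continuous f -> continuous g -> continuous (fun x => f x + g x).
Proof. by move=> cf cg x; apply: cvgD; [exact: cf|exact: cg]. Qed.

Lemma cont_mul f g : continuous f -> continuous g -> continuous (fun x => f x * g x).
Proof. by move=> cf cg x; apply: cvgM; [exact: cf|exact: cg]. Qed.

Lemma cont_comp (h : R -> R) f : continuous f ->
  (forall x, {for f x, continuous h}) -> continuous (fun x => h (f x)).
Proof. by move=> cf ch x; apply: continuous_comp; [exact: cf|exact: ch]. Qed.

End cont.

Fact diff_key : unit. Proof. exact: tt. Qed.

(* Locked copies: unfolding the limits inside [partial] makes conversion tests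
   between unrelated derivatives very slow. *)
Definition pd {R : realType} {n : nat} : 'I_n -> ('rV[R]_n -> R) -> 'rV[R]_n -> R :=
  locked_with diff_key (@partial R n).
Definition CK {R : realType} {n : nat} : nat -> ('rV[R]_n -> R) -> Prop :=
  locked_with diff_key (@Ck R n).
Definition lap {R : realType} {n : nat} : ('rV[R]_n -> R) -> 'rV[R]_n -> R :=
  locked_with diff_key (@laplacian R n).

Section Ck.
Context {R : realType} {n : nat}.
Implicit Types (f g : 'rV[R]_n -> R) (x : 'rV[R]_n) (i : 'I_n).
Local Notation e_ i := (delta_mx 0 i : 'rV[R]_n).

Lemma pdE : pd = @partial R n. Proof. exact: unlock. Qed.

Lemma CKE : CK = @Ck R n. Proof. exact: unlock. Qed.

Lemma lapE f x : lap f x = \sum_(i < n) pd i (pd i f) x.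
Proof. by rewrite /lap unlock pdE. Qed.

Lemma laplacianE : lap = @laplacian R n. Proof. exact: unlock. Qed.

Lemma isd_coord x (i j : 'I_n) : is_derive x (e_ i) (fun y => y 0 j) ((j == i)%:R).
Proof.
apply/is_derive_line; under eq_fun do rewrite !mxE eqxx/=.
have := isdD (isd_cst (x 0 j) (0:R) (1:R)) (isdM (is_derive_id (0:R) (1:R)) (isd_cst ((j == i)%:R : R) _ _)).
by rewrite mulr0 addr0 mul1r add0r.
Qed.

Lemma partial_eq i f x d : is_derive x (e_ i) f d -> pd i f x = d.
Proof. by rewrite pdE => -[_ <-]. Qed.

Lemma Ck_continuous k f : CK k f -> continuous f.
Proof. by rewrite CKE; case: k => [|k] []. Qed.

Lemma Ck0I f : continuous f -> CK 0 f.
Proof. by rewrite CKE. Qed.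

Lemma Ck_isd k f i x : CK k.+1 f -> is_derive x (e_ i) f (pd i f x).
Proof. by rewrite CKE pdE => -[_ /(_ i)[df _]]; exact/derivableP. Qed.

Lemma Ck_partial k f i : CK k.+1 f -> CK k (pd i f).
Proof. by rewrite CKE pdE => -[_ /(_ i)[]]. Qed.

Lemma CkI k f : continuous f ->
  (forall i, exists2 g, (forall x, is_derive x (e_ i) f (g x)) & CK k g) -> CK k.+1 f.
Proof.
rewrite CKE => cf H; split => // i; have [g dg cg] := H i; split.
  by move=> x; have [] := dg x.
by rewrite -pdE (_ : pd i f = g)//; apply/funext => x; exact: partial_eq.
Qed.

Lemma CkW k f : CK k.+1 f -> CK k f.
Proof.
elim: k f => [|k IH] f cf; first exact/Ck0I/(Ck_continuous cf).
apply: CkI; first exact: Ck_continuous cf.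
move=> i; exists (pd i f); first by move=> x; exact: Ck_isd cf.
exact/IH/Ck_partial.
Qed.

Lemma Ck_le j k f : (j <= k)%N -> CK k f -> CK j f.
Proof.
move=> /subnK <-; elim: (k - j)%N => // m IH; rewrite addSn => /CkW; exact: IH.
Qed.

Lemma Ck_cst k (c : R) : CK k (fun _ : 'rV[R]_n => c).
Proof.
elim: k c => [|k IH] c; first exact/Ck0I/cont_cst.
apply: CkI; first exact: cont_cst.
by move=> i; exists (fun=> 0) => // x; exact: isd_cst.
Qed.

Lemma Ck_coord k j : CK k (fun x => x 0 j).
Proof.
have c : continuous (fun x : 'rV[R]_n => x 0 j) by exact: coord_continuous.
case: k => [|k]; first exact: Ck0I.
apply: CkI => // i; exists (fun=> (j == i)%:R); first by move=> x; exact: isd_coord.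
exact: Ck_cst.
Qed.

Lemma CkD k f g : CK k f -> CK k g -> CK k (fun x => f x + g x).
Proof.
elim: k f g => [|k IH] f g cf cg.
  by apply: Ck0I; apply: cont_add; [exact: Ck_continuous cf|exact: Ck_continuous cg].
apply: CkI.
  by apply: cont_add; [exact: Ck_continuous cf|exact: Ck_continuous cg].
move=> i; exists (fun x => pd i f x + pd i g x).
  by move=> x; apply: isdD; apply: Ck_isd; eassumption.
by apply: IH; exact: Ck_partial.
Qed.

Lemma CkM k f g : CK k f -> CK k g -> CK k (fun x => f x * g x).
Proof.
elim: k f g => [|k IH] f g cf cg.
  by apply: Ck0I; apply: cont_mul; [exact: Ck_continuous cf|exact: Ck_continuous cg].
apply: CkI.
  by apply: cont_mul; [exact: Ck_continuous cf|exact: Ck_continuous cg].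
move=> i; exists (fun x => pd i f x * g x + f x * pd i g x).
  by move=> x; apply: isdM; apply: Ck_isd; eassumption.
by apply: CkD; apply: IH; try exact: Ck_partial; exact: CkW.
Qed.

Lemma CkZ k (c : R) f : CK k f -> CK k (fun x => c * f x).
Proof. by move=> cf; apply: CkM => //; exact: Ck_cst. Qed.

Lemma CkN k f : CK k f -> CK k (fun x => - f x).
Proof. by move=> /(CkZ (-1)); under eq_fun do rewrite mulN1r. Qed.

Lemma CkB k f g : CK k f -> CK k g -> CK k (fun x => f x - g x).
Proof. by move=> cf cg; apply: CkD => //; exact: CkN. Qed.

Lemma Ck_sum k (I : Type) (r : seq I) (F : I -> 'rV[R]_n -> R) :
  (forall a, CK k (F a)) -> CK k (fun x => \sum_(a <- r) F a x).
Proof.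
move=> FG; elim: r => [|a r IH].
  by under eq_fun do rewrite big_nil; exact: Ck_cst.
by under eq_fun do rewrite big_cons; exact: CkD.
Qed.

Lemma CkX k m f : CK k f -> CK k (fun x => f x ^+ m).
Proof.
move=> cf; elim: m => [|m IH]; first by under eq_fun do rewrite expr0; exact: Ck_cst.
by under eq_fun do rewrite exprS; exact: CkM.
Qed.

(** A family S of outer functions that is stable under derivation makes the induction on k work once
    and for all. It is used with S = {exp} and with S = {c y^b}. *)
Lemma Ck_comp k (I : set R) (S : set (R -> R)) f : CK k f -> (forall x, I (f x)) ->
  (forall h, S h -> forall y, I y -> {for y, continuous h}) ->
  (forall h, S h -> exists2 h', S h' & forall y, I y -> is_derive y (1 : R) h (h' y)) ->
  forall h, S h -> CK k (fun x => h (f x)).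
Proof.
move=> + If cS dS; elim: k => [|k IH] cf h Sh.
  apply: Ck0I; apply: cont_comp; first exact: Ck_continuous cf.
  by move=> x; exact: cS.
apply: CkI.
  apply: cont_comp; first exact: Ck_continuous cf.
  by move=> x; exact: cS.
move=> i; have [h' Sh' dh] := dS _ Sh.
exists (fun x => h' (f x) * pd i f x).
  by move=> x; apply: isd_comp; [exact: dh|exact: Ck_isd cf].
by apply: CkM; [apply: IH => //; exact: CkW|exact: Ck_partial].
Qed.

Lemma Ck_expR k f : CK k f -> CK k (fun x => expR (f x)).
Proof.
move=> cf; apply: (@Ck_comp k setT [set @expR R] f) => //.
  by move=> _ -> y _; exact: continuous_expR.
by move=> _ ->; exists (@expR R) => // y _; exact: isd_expR.
Qed.

Lemma Ck_powR k (a : R) f : CK k f -> (forall x, 0 < f x) ->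
  CK k (fun x => f x `^ a).
Proof.
move=> cf f0.
apply: (@Ck_comp k [set y | 0 < y] [set h | exists c b : R, h = fun y => c * y `^ b] f cf f0 _ _ (fun y => y `^ a)).
- move=> _ [c [b ->]] y y0.
  exact: (is_derive_cont (isdZ c (isd_powR b y0))).
- move=> _ [c [b ->]]; exists (fun y => (c * b) * y `^ (b - 1)).
    by exists (c * b), (b - 1).
  by move=> y y0; rewrite -mulrA; exact: (isdZ c (isd_powR b y0)).
- by exists 1, a; apply/funext => y; rewrite mul1r.
Qed.

Lemma Ck_inv k f : CK k f -> (forall x, 0 < f x) -> CK k (fun x => (f x)^-1).
Proof.
move=> cf f0; have := Ck_powR (-1) cf f0.
by under eq_fun do rewrite powR_inv1 ?ltW//.
Qed.

End Ck.

Section csupp.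
Context {R : realType} {n : nat}.
Implicit Types (f g : 'rV[R]_n -> R) (x : 'rV[R]_n) (i : 'I_n).

Definition csupp f := exists B : R, forall x, ~ box B x -> f x = 0.

Lemma csuppM f g : csupp f -> csupp (fun x => f x * g x).
Proof. by move=> [B h]; exists B => x /h ->; rewrite mul0r. Qed.

Lemma csuppMr f g : csupp f -> csupp (fun x => g x * f x).
Proof. by move=> [B h]; exists B => x /h ->; rewrite mulr0. Qed.

Lemma csupp_comp (h : R -> R) f : h 0 = 0 -> csupp f -> csupp (fun x => h (f x)).
Proof. by move=> h0 [B hB]; exists B => x /hB ->. Qed.

Lemma csuppD f g : csupp f -> csupp g -> csupp (fun x => f x + g x).
Proof.
move=> [B hB] [C hC]; exists (Num.max B C) => x bx.
rewrite hB ?hC ?addr0//; apply: contra_not bx => h i.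
  by rewrite (le_trans (h i))// le_max lexx orbT.
by rewrite (le_trans (h i))// le_max lexx.
Qed.

Lemma not_box_near (B : R) x : ~ box B x -> \forall y \near x, ~ box B y.
Proof.
move=> /existsNP[i /negP]; rewrite -ltNge => Bi.
have c : {for x, continuous (fun y : 'rV[R]_n => `|y 0 i|)}.
  by apply: continuous_comp; [exact: coord_continuous|exact: norm_continuous].
have := @cvgr_gt _ _ (nbhs x) (nbhs_filter x) _ _ c _ Bi.
apply: (@filterS _ (nbhs x) (nbhs_filter x)) => y /= By /(_ i).
by apply/negP; rewrite -ltNge.
Qed.

Lemma box_partial f i (B : R) x : (forall y, ~ box B y -> f y = 0) ->
  ~ box B x -> pd i f x = 0.
Proof.
move=> f0 /not_box_near nx; rewrite pdE /partial.
rewrite (@near_eq_derive _ _ _ f (fun=> 0))//; first by rewrite derive_cst.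
by apply: (@filterS _ (nbhs x) (nbhs_filter x)) nx => y /f0.
Qed.

Lemma csupp_partial f i : csupp f -> csupp (pd i f).
Proof. by move=> [B hB]; exists B => x; exact: box_partial. Qed.

Lemma Itg_csupp f : continuous f -> csupp f -> Itg f.
Proof. by move=> cf [B hB]; exact: (Itg_box (B := B)). Qed.

Lemma Int_div_csupp f i : CK 1 f -> csupp f -> Int (pd i f) = 0.
Proof.
move=> cf [B hB]; apply: (@Int_partial0 _ _ i f _ B).
- by move=> x; exact: Ck_isd cf.
- exact: Ck_continuous (Ck_partial i cf).
- by move=> x bx; rewrite hB//; split => //; exact: box_partial bx.
Qed.

Definition gdot f g x := \sum_(i < n) pd i f x * pd i g x.

Lemma gdotC f g x : gdot f g x = gdot g f x.
Proof. by apply: eq_bigr => i _; rewrite mulrC. Qed.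

Lemma gdot_ge0 f x : 0 <= gdot f f x.
Proof. by apply: sumr_ge0 => i _; rewrite -expr2 sqr_ge0. Qed.

Lemma continuous_gdot f g : CK 1 f -> CK 1 g -> continuous (gdot f g).
Proof.
move=> cf cg; apply: (@Ck_continuous _ _ 0).
by apply: Ck_sum => i; apply: CkM; exact: Ck_partial.
Qed.

Lemma csupp_gdot f g : csupp f -> csupp (gdot f g).
Proof.
move=> [B hB]; exists B => x bx; rewrite /gdot big1// => i _.
by rewrite (box_partial _ hB)// mul0r.
Qed.

Lemma Ck_laplacian k f : CK k.+2 f -> CK k (lap f).
Proof.
move=> cf; rewrite (_ : lap f = fun x => \sum_(i < n) pd i (pd i f) x).
  by apply: Ck_sum => i; do 2 apply: Ck_partial.
by apply/funext => x; rewrite lapE.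
Qed.

Lemma continuous_laplacian f : CK 2 f -> continuous (lap f).
Proof.
move=> cf; apply: (@Ck_continuous _ _ 0); exact: Ck_laplacian.
Qed.

Lemma csupp_laplacian f : csupp f -> csupp (lap f).
Proof.
move=> [B hB]; exists B => x bx; rewrite !lapE big1// => i _.
by rewrite (@box_partial _ _ B)// => y; exact: box_partial.
Qed.

Lemma partialM f g i x : CK 1 f -> CK 1 g ->
  pd i (fun y => f y * g y) x = pd i f x * g x + f x * pd i g x.
Proof. by move=> cf cg; apply: partial_eq; apply: isdM; apply: Ck_isd; eassumption. Qed.

Lemma partialD f g i x : CK 1 f -> CK 1 g ->
  pd i (fun y => f y + g y) x = pd i f x + pd i g x.
Proof. by move=> cf cg; apply: partial_eq; apply: isdD; apply: Ck_isd; eassumption. Qed.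

Lemma partialZ (c : R) f i x : CK 1 f ->
  pd i (fun y => c * f y) x = c * pd i f x.
Proof. by move=> cf; apply: partial_eq; apply: isdZ; apply: Ck_isd; eassumption. Qed.

Lemma partialN f i x : CK 1 f -> pd i (fun y => - f y) x = - pd i f x.
Proof. by move=> cf; apply: partial_eq; apply: isdN; apply: Ck_isd; eassumption. Qed.

Lemma partial_comp (h h' : R -> R) f i x : CK 1 f ->
  is_derive (f x) (1 : R) h (h' (f x)) ->
  pd i (fun y => h (f y)) x = h' (f x) * pd i f x.
Proof. by move=> cf dh; apply: partial_eq; apply: isd_comp => //; apply: Ck_isd; eassumption. Qed.

Lemma laplacianD f g x : CK 2 f -> CK 2 g ->
  lap (fun y => f y + g y) x = lap f x + lap g x.
Proof.
move=> cf cg; rewrite !lapE -big_split/=; apply: eq_bigr => i _.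
rewrite (_ : pd i (fun y => f y + g y) = fun y => pd i f y + pd i g y); last first.
  by apply/funext => y; rewrite partialD//; exact: CkW.
by rewrite partialD//; exact: Ck_partial.
Qed.

Lemma laplacianZ (c : R) f x : CK 2 f ->
  lap (fun y => c * f y) x = c * lap f x.
Proof.
move=> cf; rewrite !lapE mulr_sumr; apply: eq_bigr => i _.
rewrite (_ : pd i (fun y => c * f y) = fun y => c * pd i f y); last first.
  by apply/funext => y; rewrite partialZ//; exact: CkW.
by rewrite partialZ//; exact: Ck_partial.
Qed.

Lemma laplacianN f x : CK 2 f -> lap (fun y => - f y) x = - lap f x.
Proof.
by move=> cf; under [X in lap X]eq_fun do rewrite -mulN1r; rewrite laplacianZ// mulN1r.
Qed.

Lemma laplacianB f g x : CK 2 f -> CK 2 g ->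
  lap (fun y => f y - g y) x = lap f x - lap g x.
Proof. move=> cf cg; etransitivity; first exact: (laplacianD x cf (CkN cg)).
by congr (_ + _); exact: laplacianN. Qed.

Lemma laplacianM f g x : CK 2 f -> CK 2 g ->
  lap (fun y => f y * g y) x =
  lap f x * g x + 2 * gdot f g x + f x * lap g x.
Proof.
move=> cf cg; have cf1 := CkW cf; have cg1 := CkW cg.
rewrite !lapE /gdot mulr_suml !mulr_sumr -!big_split/=; apply: eq_bigr => i _.
rewrite (_ : pd i (fun y => f y * g y) = fun y => pd i f y * g y + f y * pd i g y); last first.
  by apply/funext => y; rewrite partialM.
have cfi := Ck_partial i cf; have cgi := Ck_partial i cg.
etransitivity; first exact: partial_eq (isdD (isdM (Ck_isd i x cfi) (Ck_isd i x cg1))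
  (isdM (Ck_isd i x cf1) (Ck_isd i x cgi))).
move: (pd i (pd i f) x) (pd i (pd i g) x) => a b.
by move: (pd i f x) (pd i g x) (f x) (g x) => c d p q; ring.
Qed.

Lemma gdotMl f g h x : CK 1 f -> CK 1 g ->
  gdot (fun y => f y * g y) h x = f x * gdot g h x + g x * gdot f h x.
Proof.
move=> cf cg; rewrite /gdot !mulr_sumr -big_split/=; apply: eq_bigr => i _.
rewrite partialM//.
move: (pd i f x) (pd i g x) (pd i h x) => a b c; ring.
Qed.

Lemma gdot_compl (p p' : R -> R) f g x : CK 1 f ->
  is_derive (f x) (1 : R) p (p' (f x)) ->
  gdot (fun y => p (f y)) g x = p' (f x) * gdot f g x.
Proof.
move=> cf dp; rewrite /gdot mulr_sumr; apply: eq_bigr => i _.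
by rewrite (@partial_comp p p')// mulrA.
Qed.

Lemma laplacian_comp (p p' p'' : R -> R) f x : CK 2 f ->
  (forall y, is_derive (f y) (1 : R) p (p' (f y))) ->
  is_derive (f x) (1 : R) p' (p'' (f x)) ->
  lap (fun y => p (f y)) x = p'' (f x) * gdot f f x + p' (f x) * lap f x.
Proof.
move=> cf dp dp'; have cf1 := CkW cf.
rewrite !lapE /gdot !mulr_sumr -big_split/=; apply: eq_bigr => i _.
rewrite (_ : pd i (fun y => p (f y)) = fun y => p' (f y) * pd i f y); last first.
  by apply/funext => y; rewrite (@partial_comp p p').
have cfi := Ck_partial i cf.
have d1 := isd_comp dp' (Ck_isd i x cf1).
have d2 := Ck_isd i x cfi.
rewrite (partial_eq (isdM d1 d2)).
move: (pd i (pd i f) x) (pd i f x) => a b; ring.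
Qed.

Lemma Int_gdot f g : CK 2 f -> CK 1 g -> csupp g ->
  Int (gdot g f) = - Int (fun x => g x * lap f x).
Proof.
move=> cf cg sg.
have cfi i := Ck_partial i cf.
have I1 i : Itg (fun x => pd i g x * pd i f x).
  apply: Itg_csupp; last by apply: csuppM; exact: csupp_partial.
  by apply: (@Ck_continuous _ _ 0); apply: CkM; [exact: Ck_partial|exact: CkW].
have I2 i : Itg (fun x => g x * pd i (pd i f) x).
  apply: Itg_csupp; last exact: csuppM.
  by apply: (@Ck_continuous _ _ 0); apply: CkM; [exact: CkW|exact: Ck_partial].
rewrite /gdot Int_sum//.
under [in RHS]eq_fun do rewrite !lapE mulr_sumr.
rewrite Int_sum// -sumrN; apply: eq_bigr => i _.
apply/eqP; rewrite -addr_eq0 -IntD//; apply/eqP.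
rewrite -[RHS](@Int_div_csupp (fun x => g x * pd i f x) i).
- by congr Int; apply/funext => x; rewrite partialM.
- by apply: CkM.
- exact: csuppM.
Qed.

Lemma Green f g : CK 2 f -> CK 2 g -> csupp g ->
  Int (fun x => g x * lap f x) = Int (fun x => lap g x * f x).
Proof.
move=> cf cg sg; have cf1 := CkW cf; have cg1 := CkW cg.
apply/eqP; rewrite -subr_eq0; apply/eqP.
have cl (h : 'rV[R]_n -> R) : CK 2 h -> CK 0 (lap h) by exact: (@Ck_laplacian 0 h).
have I1 : Itg (fun x => g x * lap f x).
  apply: Itg_csupp; last exact: csuppM.
  by apply: (@Ck_continuous _ _ 0); apply: CkM; [exact: CkW|exact: cl].
have I2 : Itg (fun x => lap g x * f x).
  apply: Itg_csupp; last by apply: csuppM; exact: csupp_laplacian.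
  by apply: (@Ck_continuous _ _ 0); apply: CkM; [exact: cl|exact: CkW].
rewrite -[X in X - _]opprK -Int_gdot//.
suff -> : Int (fun x => lap g x * f x) = - Int (gdot g f) by rewrite subrr.
have I3 i : Itg (fun x => pd i (pd i g) x * f x).
  apply: Itg_csupp; last by apply: csuppM; do 2 apply: csupp_partial.
  by apply: (@Ck_continuous _ _ 0); apply: CkM; [do 2 apply: Ck_partial|exact: CkW].
have I4 i : Itg (fun x => pd i g x * pd i f x).
  apply: Itg_csupp; last by apply: csuppM; exact: csupp_partial.
  by apply: (@Ck_continuous _ _ 0); apply: CkM; exact: Ck_partial.
under eq_fun do rewrite !lapE mulr_suml.
rewrite /gdot !Int_sum// -sumrN; apply: eq_bigr => i _.
apply/eqP; rewrite -addr_eq0 -IntD//; apply/eqP.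
have cgi := Ck_partial i cg.
rewrite -[RHS](@Int_div_csupp (fun x => pd i g x * f x) i).
- by congr Int; apply/funext => x; rewrite partialM.
- exact: CkM.
- by apply: csuppM; exact: csupp_partial.
Qed.
End csupp.

(** * Maximum principles *)

Section nsq.
Context {R : realType} {n : nat}.
Implicit Types (x : 'rV[R]_n) (f : 'rV[R]_n -> R).

Definition nsq x : R := \sum_(i < n) x 0 i ^+ 2.

Lemma nsq_ge0 x : 0 <= nsq x.
Proof. by apply: sumr_ge0 => i _; exact: sqr_ge0. Qed.

Lemma enormE x : enorm x = Num.sqrt (nsq x).
Proof. by []. Qed.

Lemma sqr_coord_nsq x i : x 0 i ^+ 2 <= nsq x.
Proof. by rewrite /nsq (bigD1 i)//= lerDl; apply: sumr_ge0 => j _; exact: sqr_ge0. Qed.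

Lemma coord_enorm x i : `|x 0 i| <= enorm x.
Proof. by rewrite -sqrtr_sqr ler_wsqrtr// sqr_coord_nsq. Qed.

Lemma Ck_nsq k : CK k nsq.
Proof. by apply: Ck_sum => i; apply: CkX; exact: Ck_coord. Qed.

Lemma partial_nsq i x : pd i nsq x = 2 * x 0 i.
Proof.
have h (j : 'I_n) : is_derive x (delta_mx 0 i) (fun y : 'rV[R]_n => y 0 j ^+ 2) (2 * x 0 j * (j == i)%:R).
  have := isd_comp (isd_exprn 2 (x 0 j)) (isd_coord x i j).
  by rewrite expr1.
rewrite (partial_eq (isd_sum _ h)) (bigD1 i)//= eqxx mulr1 big1 ?addr0// => j ji.
by rewrite (negbTE ji) mulr0.
Qed.

Lemma laplacian_nsq x : lap nsq x = 2 * n%:R.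
Proof.
rewrite lapE (eq_bigr (fun=> 2)).
  by rewrite sumr_const card_ord mulr_natr.
move=> i _; rewrite (_ : pd i nsq = fun y => 2 * y 0 i); last first.
  by apply/funext => y; exact: partial_nsq.
by rewrite (partial_eq (isdZ 2 (isd_coord x i i))) eqxx mulr1.
Qed.

Lemma laplacian_cst (c : R) x : lap (fun _ : 'rV[R]_n => c) x = 0.
Proof.
have h (d : R) i : pd i (fun _ : 'rV[R]_n => d) = fun=> 0.
  by apply/funext => y; exact: partial_eq (isd_cst _ _ _).
by rewrite lapE big1// => i _; rewrite !h.
Qed.

Lemma gdot_nsq f x : gdot nsq f x = 2 * \sum_(i < n) x 0 i * pd i f x.
Proof. by rewrite /gdot mulr_sumr; apply: eq_bigr => i _; rewrite partial_nsq mulrA. Qed.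

Lemma gdot_nsq2 x : gdot nsq nsq x = 4 * nsq x.
Proof.
rewrite gdot_nsq /nsq !mulr_sumr; apply: eq_bigr => i _.
by rewrite partial_nsq; ring.
Qed.

End nsq.

Section maximum.
Context {R : realType} {n : nat}.
Implicit Types (x : 'rV[R]_n) (f : 'rV[R]_n -> R).

Let line_near f x (i : 'I_n) (P : set 'rV[R]_n) : (\forall y \near x, P y) ->
  exists2 d : R, 0 < d & forall t, `|t| < d -> P (x + t *: delta_mx 0 i).
Proof.
move=> nP.
have cl := @continuous_line R n x (delta_mx 0 i) 0.
have : \forall t \near (0 : R), P (x + t *: delta_mx 0 i).
  by apply: cl; rewrite scale0r addr0.
move=> /nbhs_ballP[d d0 dP]; exists d => // t td; apply: dP.
by rewrite /ball/= sub0r normrN.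
Qed.

Lemma near_lt f x (a : R) : continuous f -> f x < a -> \forall y \near x, f y < a.
Proof.
move=> cf fa; have cx : {for x, continuous f} by exact: cf.
exact: (@cvgr_lt _ _ (nbhs x) (nbhs_filter x) _ _ cx _ fa).
Qed.

Lemma max_partial f x i : CK 1 f -> (\forall y \near x, f y <= f x) ->
  pd i f x = 0.
Proof.
move=> cf /(line_near f i)[d d0 df].
pose h := fun t : R => f (x + t *: delta_mx 0 i).
have dh t : is_derive t (1:R) h (pd i f (x + t *: delta_mx 0 i)).
  exact: isd_line (Ck_isd i _ cf).
have h0 : is_derive (0:R) (1:R) h 0.
  apply: (@derive1_at_max _ h (- d) d).
  - by rewrite lerNl (le_trans _ (ltW d0))// oppr_le0 ltW.
  - by move=> t _; have [] := dh t.
  - by rewrite in_itv/= oppr_lt0 d0.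
  - move=> t; rewrite in_itv/= -ltr_norml => td.
    by rewrite /h scale0r addr0; exact: df.
have := dh 0; rewrite scale0r addr0 => dh0.
exact: isd_uniq dh0 h0.
Qed.

(** If the second derivative were positive, the first one, which vanishes at x, would be positive
    just beyond x, and the mean value theorem would yield a larger value nearby. *)
Lemma max_partial2 f x i : CK 2 f -> (\forall y \near x, f y <= f x) ->
  pd i (pd i f) x <= 0.
Proof.
move=> cf mx; have cf1 := CkW cf.
have p0 := max_partial i cf1 mx.
have [d d0 df] := line_near f i mx.
pose h := fun t : R => f (x + t *: delta_mx 0 i).
pose h' := fun t : R => pd i f (x + t *: delta_mx 0 i).
have isl (g : 'rV[R]_n -> R) t : CK 1 g ->
    is_derive t (1:R) (fun t => g (x + t *: delta_mx 0 i)) (pd i g (x + t *: delta_mx 0 i)).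
  by move=> cg; exact: isd_line (Ck_isd i _ cg).
rewrite leNgt; apply/negP => L0.
have dh' := isl _ 0 (Ck_partial i cf); rewrite scale0r addr0 in dh'.
have [D1 D2] := dh'.
have : (t^-1 *: (h' (t *: 1 + 0) - h' 0)) @[t --> 0^'] --> pd i (pd i f) x.
  by rewrite -[in X in _ --> X]D2; exact: D1.
move=> /cvgr_gt => /(_ _ L0) /nbhs_ballP[e /= e0 he].
have pos t : 0 < t -> t < e -> 0 < h' t.
  move=> t0 te; have := he t; rewrite /ball/= sub0r normrN gtr0_norm// => /(_ te).
  rewrite gt_eqF// => /(_ isT).
  have h00 : h' 0 = 0 by rewrite /h' scale0r addr0.
  rewrite h00 subr0 (_ : t%:A + 0 = t); last by rewrite addr0 /GRing.scale/= mulr1.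
  rewrite /GRing.scale/=.
  by rewrite pmulr_rgt0// invr_gt0.
pose m := Num.min d e / 2.
have m0 : 0 < m by rewrite divr_gt0// lt_min d0 e0.
have mmin : m < Num.min d e by rewrite ltr_pdivrMr// ltr_pMr ?ltr1n// lt_min d0 e0.
have [c cm] := @MVT R h h' 0 m m0 (fun t _ => isl f t cf1)
  (@continuous_subspaceT _ _ _ _ (fun t => is_derive_cont (isl f t cf1))).
move: cm; rewrite in_itv/= => /andP[c0 cm] E.
have md : m < d by rewrite (lt_le_trans mmin)// ge_min lexx.
have ce : c < e by rewrite (lt_trans cm)// (lt_le_trans mmin)// ge_min lexx orbT.
have : 0 < h m - h 0 by rewrite E pmulr_rgt0 ?subr0// pos.
apply/negP; rewrite -leNgt subr_le0 /h scale0r addr0.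
by apply: df; rewrite gtr0_norm.
Qed.

Lemma max_laplacian f x : CK 2 f -> (\forall y \near x, f y <= f x) ->
  lap f x <= 0.
Proof.
by move=> cf mx; rewrite lapE; apply: sumr_le0 => i _; exact: max_partial2.
Qed.

(** A strictly superharmonic function has no global minimum, but a nonpositive value would force
    one: either it is itself the minimum, or f takes a negative value, and then decay at infinity
    confines the infimum to a compact cube. *)
Lemma superharmonic_gt0 f : CK 2 f -> (forall x, lap f x < 0) ->
  vanishes_at_infinity f -> forall x, 0 < f x.
Proof.
move=> cf lf f0.
have nomin c : ~ (forall y, f c <= f y).
  move=> mc; have : lap (fun y => - f y) c <= 0.
    apply: max_laplacian; first exact: CkN.
    by apply: (@filterE _ (nbhs c) (nbhs_filter c)) => y; rewrite lerN2.
  by rewrite laplacianN// oppr_le0 leNgt lf.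
move=> x0; rewrite ltNge; apply/negP => fx0.
have [x1 fx1] : exists x1, f x1 < 0.
  apply: contrapT => /forallNP h; apply: (nomin x0) => y.
  by rewrite (le_trans fx0)// leNgt; apply/negP/h.
have [|M hM] := f0 (- f x1); first by rewrite oppr_gt0.
pose B := Num.max M (enorm x1).
have bx1 : box B x1 by move=> i; rewrite (le_trans (coord_enorm _ _))// le_max lexx orbT.
have [c cB cm] : exists2 c, c \in box B & forall t, t \in box B -> f c <= f t.
  apply: EVT_min_rV; [by exists x1|exact: compact_box|].
  by apply: continuous_subspaceT; exact: Ck_continuous cf.
apply: (nomin c) => y.
have [yB|yB] := pselect (box B y); first by apply: cm; rewrite inE.
have : M < enorm y.
  move/existsNP : yB => [i /negP]; rewrite -ltNge => Bi.
  rewrite (le_lt_trans _ (lt_le_trans Bi (coord_enorm _ _)))//.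
  by rewrite le_max lexx.
move=> /hM; rewrite ltr_norml opprK => /andP[fy _].
by rewrite (le_trans _ (ltW fy))// cm// inE.
Qed.

End maximum.

(** * Pointwise comparison of e^u with v^2 *)

Section comparison.
Context {R : realType} {n : nat}.
Variables (u v : 'rV[R]_n -> R).
Hypotheses (cu : CK 2 u) (cv : CK 2 v).
Hypothesis (lu : forall x, lap u x = - v x).
Hypothesis (lv : forall x, lap v x = - expR (u x)).
Hypothesis (v0 : forall x, 0 < v x).

Let s2 : R := Num.sqrt 2.
Let t x := expR (u x / 2).
Let w x := s2 * t x - v x.

Lemma expR_half2 (y : R) : expR (y / 2) ^+ 2 = expR y.
Proof. by rewrite -expRM_natl; congr expR; field. Qed.

Lemma laplacian_expR (f : 'rV[R]_n -> R) (a : R) x : CK 2 f ->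
  lap (fun y => expR (a * f y)) x =
  expR (a * f x) * (a ^+ 2 * gdot f f x + a * lap f x).
Proof.
move=> cf.
have d (c y : R) : is_derive y (1 : R) (fun z => c * expR (a * z)) (a * c * expR (a * y)).
  have := isdZ c (isd_comp (isd_expR (a * y)) (isdZ a (is_derive_id y (1 : R)))).
  by rewrite mulr1 (mulrC _ a) !mulrA (mulrC c a).
have d1 y : is_derive y (1 : R) (fun z => expR (a * z)) (a * expR (a * y)).
  by have := d 1 y; rewrite mulr1; under eq_fun do rewrite mul1r.
rewrite (laplacian_comp (p := fun z => expR (a * z)) (p' := fun z => a * expR (a * z))
  (p'' := fun z => a * a * expR (a * z)) cf (fun y => d1 (f y)) (d a (f x))).
move: (gdot f f x) (lap f x) (expR (a * f x)) => p q r; ring.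
Qed.

(** The constant sqrt 2 in w is the one for which the right side factors: without the nonnegative
    gradient term, lap w is t^2 - t v / sqrt 2 = t w / sqrt 2. Since v > 0, t is at least w / sqrt
    2. *)
Let lw x : 0 < w x -> w x ^+ 2 / 2 <= lap w x.
Proof.
move=> w0.
have s20 : 0 < s2 by rewrite sqrtr_gt0.
have s22 : s2 ^+ 2 = 2 by rewrite sqr_sqrtr.
have t0 : 0 < t x by exact: expR_gt0.
have ct : CK 2 t by apply: Ck_expR; under eq_fun do rewrite mulrC; exact: CkZ.
rewrite [lap w x](laplacianB x (CkZ s2 ct) cv) (laplacianZ s2 x ct).
have -> : lap t x = lap (fun y => expR (2^-1 * u y)) x.
  by congr (lap _ x); apply/funext => y; rewrite /t mulrC.
rewrite laplacian_expR// lu lv opprK (mulrC _ (u x)) -/(t x) -(expR_half2 (u x)) -/(t x).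
move: w0; rewrite /w -/(t x).
have := gdot_ge0 u x; have := v0 x.
move: (gdot u u x) (v x) (t x) t0 => g y r r0 y0 g0 w0.
have e : (s2 * r - y) ^+ 2 / 2 <= r * s2^-1 * (s2 * r - y).
  rewrite expr2 mulrAC ler_wpM2r ?(ltW w0)//.
  have -> : r / s2 = s2 * r / 2 by rewrite -s22; field; rewrite gt_eqF.
  by rewrite ler_pM2r ?invr_gt0// gerBl ltW.
apply: le_trans e _.
have -> : r * s2^-1 * (s2 * r - y) = r ^+ 2 - r * y / s2.
  by field; rewrite gt_eqF.
have -> : r * y / s2 = s2 * r * y / 2.
  by rewrite -s22; field; rewrite gt_eqF.
have := mulr_ge0 (mulr_ge0 (ltW s20) (ltW r0)) g0.
lra.
Qed.

Let Phi (r : R) x := w x * (r - nsq x) ^+ 2.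

(** Osserman's device: the factor (r - |x|^2)^2 vanishes on the sphere, so [Phi] has an interior
    maximum whenever w is positive somewhere, and the superlinear inequality [lw] bounds [Phi]
    there. *)
Lemma Keller_Osserman (x : 'rV[R]_n) (r : R) : nsq x < r ->
  w x * (r - nsq x) ^+ 2 <= (48 + 8 * n%:R) * r.
Proof.
move=> xr; have r0 : 0 < r := le_lt_trans (nsq_ge0 x) xr.
have [wx|wx] := leP (w x) 0.
  rewrite (@le_trans _ _ 0)//; first by rewrite mulr_le0_ge0// sqr_ge0.
  by rewrite mulr_ge0 ?ltW// addr_ge0// mulr_ge0.
have ct : CK 2 t by apply: Ck_expR; under eq_fun do rewrite mulrC; exact: CkZ.
have cw : CK 2 w by exact: CkB (CkZ s2 ct) cv.
have cd : CK 2 (fun y : 'rV[R]_n => r - nsq y) by apply: CkB; [exact: Ck_cst|exact: Ck_nsq].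
have cd2 : CK 2 (fun y : 'rV[R]_n => (r - nsq y) ^+ 2) by exact: CkX.
have cP : CK 2 (Phi r) by apply: CkM.
have cK : compact [set y : 'rV[R]_n | nsq y <= r].
  apply: (@subclosed_compact _ _ (box (r + 1))).
  - apply: (@closed_comp _ _ nsq [set z | z <= r]); last exact: closed_le.
    by move=> y _; exact: (Ck_continuous (@Ck_nsq R n 0)).
  - exact: compact_box.
  - move=> y /= yr i; rewrite -(ger0_norm (_ : 0 <= r + 1)); last by rewrite addr_ge0// ltW.
    rewrite -(@ler_pXn2r _ 2) ?nnegrE// -!normrX !ger0_norm ?sqr_ge0//.
    rewrite (le_trans (sqr_coord_nsq _ _))// (le_trans yr)//.
    by nra.
have [c cK' cm] : exists2 c, c \in [set y : 'rV[R]_n | nsq y <= r] &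
    forall y, y \in [set y : 'rV[R]_n | nsq y <= r] -> Phi r y <= Phi r c.
  apply: EVT_max_rV => //; first by exists x; exact: ltW.
  by apply: continuous_subspaceT; exact: Ck_continuous cP.
have Px : 0 < Phi r x by rewrite mulr_gt0// exprn_gt0// subr_gt0.
have xc : Phi r x <= Phi r c by apply: cm; rewrite inE/= ltW.
apply: le_trans xc _.
have Pc : 0 < Phi r c by rewrite (lt_le_trans Px)// cm// inE/= ltW.
have cr : nsq c < r.
  rewrite lt_neqAle; move: cK'; rewrite inE/= => ->; rewrite andbT.
  by apply/eqP => E; move: Pc; rewrite /Phi E subrr expr0n/= mulr0 ltxx.
have d0 : 0 < r - nsq c by rewrite subr_gt0.
have wc : 0 < w c by move: Pc; rewrite /Phi pmulr_lgt0// exprn_gt0.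
have mx : \forall y \near c, Phi r y <= Phi r c.
  have := near_lt (Ck_continuous (@Ck_nsq R n 0)) cr.
  apply: (@filterS _ (nbhs c) (nbhs_filter c)) => y /= yr.
  by apply: cm; rewrite inE/= ltW.
have lP := max_laplacian cP mx.
have gP i := max_partial i (CkW cP) mx.
pose g := fun y : 'rV[R]_n => (r - nsq y) ^+ 2.
have pg i : pd i g c = - 4 * (r - nsq c) * c 0 i.
  have D1 : is_derive c (delta_mx 0 i) (fun y : 'rV[R]_n => r - nsq y) (0 - 2 * c 0 i).
    rewrite -partial_nsq; exact: isdB (isd_cst _ _ _) (Ck_isd i c (Ck_nsq 1)).
  rewrite (partial_eq (isd_comp (isd_exprn 2 _) D1)) expr1; ring.
have gw i : pd i w c * (r - nsq c) = 4 * w c * c 0 i.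
  have := gP i; rewrite partialM; [|exact: CkW|exact: CkW].
  rewrite pg -/(g c) => E.
  apply: (mulIf (lt0r_neq0 d0)).
  move: E; rewrite /g; move: (pd i w c) (w c) (c 0 i) (r - nsq c) => p q z d E.
  have -> : p * d * d = p * d ^+ 2 by ring.
  by move: E => /eqP; rewrite addr_eq0 => /eqP ->; ring.
have lg : lap g c = 8 * nsq c - 4 * n%:R * (r - nsq c).
  have dd (k y : R) : is_derive y (1 : R) (fun z : R => k * z) k.
    by have := isdZ k (is_derive_id y (1 : R)); rewrite mulr1.
  have d2 (y : R) : is_derive y (1 : R) (fun z : R => z ^+ 2) (2 * y).
    by have := isd_exprn 2 y; rewrite expr1.
  rewrite [lap g c](laplacian_comp (p := fun z : R => z ^+ 2) (p' := fun z : R => 2 * z)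
    (p'' := fun=> 2) cd (fun y => d2 _) (dd 2 _)).
  rewrite (laplacianB c (Ck_cst 2 r) (Ck_nsq 2)) laplacian_nsq.
  rewrite laplacian_cst.
  have -> : gdot (fun y => r - nsq y) (fun y => r - nsq y) c = 4 * nsq c.
    rewrite -gdot_nsq2; apply: eq_bigr => i _.
    have D1 : is_derive c (delta_mx 0 i) (fun y : 'rV[R]_n => r - nsq y) (0 - pd i nsq c).
      exact: isdB (isd_cst _ _ _) (Ck_isd i c (Ck_nsq 1)).
    by rewrite (partial_eq D1); ring.
  by ring.
have gwg : gdot w g c * (r - nsq c) = - 16 * w c * (r - nsq c) * nsq c.
  rewrite /gdot mulr_suml /nsq mulr_sumr; apply: eq_bigr => i _.
  rewrite mulrAC gw pg -/(nsq c).
  move: (w c) (c 0 i) (r - nsq c) => q z d; ring.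
(* With d = r - |c|^2, criticality gives grad w = 4 w c / d, so lap Phi <= 0 reads d^2 lap w <= w
   (24 |c|^2 + 4 n d). Inserting lap w >= w^2/2 yields w d^2 <= 48 |c|^2 + 8 n d, whence the
   constant 48 + 8 n. *)
move: lP; rewrite /Phi laplacianM// -/g lg.
have E2 : gdot w g c = - 16 * w c * nsq c.
  apply: (mulIf (lt0r_neq0 d0)); rewrite gwg.
  move: (w c) (nsq c) (r - nsq c) => q z d; ring.
rewrite E2 => lP.
have l1 := lw wc.
have l2 : w c ^+ 2 / 2 * g c <= lap w c * g c by rewrite ler_wpM2r// sqr_ge0.
have cr' : nsq c <= r by exact: ltW.
have n0 : 0 <= n%:R :> R by [].
have c0 := nsq_ge0 c.
rewrite -(ler_pM2l wc).
move: l2 lP; rewrite /g.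
move: (lap w c * (r - nsq c) ^+ 2) => L.
move: (w c) (nsq c) (n%:R : R) wc cr' n0 c0 => q z m q0 zr m0 z0 h1 h2.
have h3 : q * (q * (r - z) ^+ 2) <= 2 * q * (32 * z - 8 * z + 4 * m * (r - z)).
  have -> : q * (q * (r - z) ^+ 2) = 2 * (q ^+ 2 / 2 * (r - z) ^+ 2) by field.
  have -> : 2 * q * (32 * z - 8 * z + 4 * m * (r - z)) = 2 * (q * (32 * z - 8 * z + 4 * m * (r - z))) by ring.
  rewrite ler_pM2l//; lra.
apply: le_trans h3 _.
rewrite -mulrA mulrCA ler_pM2l//.
have : m * z >= 0 by rewrite mulr_ge0.
nra.
Qed.

Lemma comparison x : 2 * expR (u x) <= v x ^+ 2.
Proof.
have w0 : w x <= 0.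
  rewrite leNgt; apply/negP => w0.
  pose C : R := (48 + 8 * n%:R) / w x.
  have C0 : 0 <= C by rewrite divr_ge0 ?ltW// addr_gt0// ltr_wpDr// mulr_ge0.
  have N0 := nsq_ge0 x.
  (* In [Keller_Osserman] the left side grows like r^2 and the right side like r; this r is already
     past the crossing point. *)
  pose r := 2 * nsq x + 4 * C + 1.
  have := @Keller_Osserman x r; rewrite /r.
  have -> : 48 + 8 * n%:R = C * w x by rewrite /C divfK// gt_eqF.
  clear r; move: C (nsq x) (w x) w0 C0 N0 => C z q q0 C0 z0 H.
  have {H} := H ltac:(lra).
  have p : 0 < (2 * z + 4 * C + 1 - z) ^+ 2 - C * (2 * z + 4 * C + 1) by nra.
  move=> h2; have := mulr_gt0 q0 p.
  by rewrite mulrBr (mulrA q C) (mulrC q C) subr_gt0 ltNge h2.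
have s20 : 0 <= s2 by rewrite sqrtr_ge0.
have : (s2 * t x) ^+ 2 <= v x ^+ 2.
  rewrite ler_sqr ?nnegrE ?mulr_ge0 ?expR_ge0 ?(ltW (v0 x))//.
  by move: w0; rewrite /w subr_le0.
by rewrite exprMn sqr_sqrtr// /t expR_half2.
Qed.

End comparison.

(** * Radial weights and flat cutoffs *)

Lemma cvg_eventually {R : realType} (f : nat -> R) (l : R) N :
  (forall k, (N <= k)%N -> f k = l) -> f k @[k --> \oo] --> l.
Proof.
move=> H; apply/cvgrPdist_lt => e e0; exists N => // k /= Nk.
by rewrite H// subrr normr0.
Qed.

Section weight.
Context {R : realType} {n : nat}.
Implicit Types (x : 'rV[R]_n) (c a b : R).

(** Powers of this function stand in for powers of |x|: they are smooth at the origin and have the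
    length scale sqrt c. *)
Definition rho c x : R := c + nsq x.
Definition rw c a x : R := rho c x `^ a.

Lemma rho_gt0 c x : 0 < c -> 0 < rho c x.
Proof. by move=> c0; rewrite ltr_pwDl// nsq_ge0. Qed.

Lemma nsq_le_rho c x : 0 <= c -> nsq x <= rho c x.
Proof. by move=> c0; rewrite lerDr. Qed.

Lemma rw_gt0 c a x : 0 < c -> 0 < rw c a x.
Proof. by move=> c0; rewrite powR_gt0// rho_gt0. Qed.

Lemma rwD c a b x : 0 < c -> rw c (a + b) x = rw c a x * rw c b x.
Proof. by move=> c0; rewrite /rw powRD// (gt_eqF (rho_gt0 x c0)) implybT. Qed.

Lemma rw1 c x : 0 < c -> rw c 1 x = rho c x.
Proof. by move=> c0; rewrite /rw powRr1// ltW// rho_gt0. Qed.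

Lemma rw0 c x : rw c 0 x = 1.
Proof. by rewrite /rw powRr0. Qed.

Lemma rwN c a x : rw c (- a) x = (rw c a x)^-1.
Proof. by rewrite /rw powRN. Qed.

Lemma rw_le c a b x : 1 <= c -> a <= b -> rw c a x <= rw c b x.
Proof. by move=> c1 ab; rewrite ler_powR// (le_trans c1)// lerDl nsq_ge0. Qed.

Lemma rw_powR c a b x : rw c a x `^ b = rw c (a * b) x.
Proof. by rewrite /rw powRrM. Qed.

Lemma Ck_rho k c : CK k (rho c).
Proof. by apply: CkD; [exact: Ck_cst|exact: Ck_nsq]. Qed.

Lemma Ck_rw k c a : 0 < c -> CK k (rw c a).
Proof. by move=> c0; apply: Ck_powR; [exact: Ck_rho|move=> x; exact: rho_gt0]. Qed.

Lemma partial_rho c i x : pd i (rho c) x = 2 * x 0 i.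
Proof.
have := isdD (isd_cst c _ _) (Ck_isd i x (Ck_nsq 1)).
by move/partial_eq; rewrite add0r partial_nsq.
Qed.

Lemma laplacian_rho c x : lap (rho c) x = 2 * n%:R.
Proof. by rewrite (laplacianD x (Ck_cst 2 c) (Ck_nsq 2)) laplacian_nsq laplacian_cst add0r. Qed.

Lemma gdot_rho c x : gdot (rho c) (rho c) x = 4 * nsq x.
Proof. by rewrite -gdot_nsq2; apply: eq_bigr => i _; rewrite !partial_rho !partial_nsq. Qed.

Lemma partial_rw c a i x : 0 < c -> pd i (rw c a) x = 2 * a * x 0 i * rw c (a - 1) x.
Proof.
move=> c0; rewrite (partial_eq (isd_comp (isd_powR a (rho_gt0 x c0)) (Ck_isd i x (Ck_rho 1 c)))).
by rewrite partial_rho -/(rw c (a - 1) x); move: (rw c (a - 1) x) => r; ring.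
Qed.

Lemma gdot_rw c a b x : 0 < c ->
  gdot (rw c a) (rw c b) x = 4 * a * b * nsq x * (rw c (a - 1) x * rw c (b - 1) x).
Proof.
move=> c0; rewrite /gdot /nsq.
rewrite (eq_bigr (fun i => x 0 i ^+ 2 * (4 * a * b * (rw c (a - 1) x * rw c (b - 1) x)))).
  rewrite -mulr_suml; move: (\sum_(i < n) _) (rw c (a - 1) x) (rw c (b - 1) x) => q r s; ring.
move=> i _; rewrite !partial_rw//.
move: (rw c (a - 1) x) (rw c (b - 1) x) => r s; ring.
Qed.

Lemma laplacian_rw c a x : 0 < c ->
  lap (rw c a) x = 2 * a * n%:R * rw c (a - 1) x + 4 * a * (a - 1) * nsq x * rw c (a - 2) x.
Proof.
move=> c0.
have d1 (y : 'rV[R]_n) : is_derive (rho c y) (1 : R) (fun z : R => z `^ a) (a * (rho c y) `^ (a - 1)).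
  exact: isd_powR (rho_gt0 y c0).
have d2 := isdZ a (isd_powR (a - 1) (rho_gt0 x c0)).
rewrite [LHS](laplacian_comp (p := fun z : R => z `^ a) (p' := fun z : R => a * z `^ (a - 1))
  (p'' := fun z => a * ((a - 1) * z `^ (a - 1 - 1))) (Ck_rho 2 c) d1 d2).
rewrite laplacian_rho gdot_rho.
have -> : a - 1 - 1 = a - 2 by ring.
rewrite -/(rw c (a - 1) x) -/(rw c (a - 2) x).
move: (rw c (a - 1) x) (rw c (a - 2) x) (nsq x) => r s q; ring.
Qed.

(* The exponent of the Newtonian mass kernel [-lap ((c + |x|^2)^(1 - n/2))]. *)
Definition cexp : R := - (n%:R + 2) / 2.

Lemma not_box_nsq (B : R) x : 0 <= B -> ~ box B x -> B ^+ 2 < nsq x.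
Proof.
move=> B0 /existsNP[i /negP]; rewrite -ltNge => Bi.
apply: lt_le_trans (sqr_coord_nsq x i).
by rewrite -(ger0_norm (sqr_ge0 (x 0 i))) normrX ltrXn2r.
Qed.

Lemma nsq_box (B : R) x : box B x -> nsq x <= n%:R * B ^+ 2.
Proof.
move=> bx; have -> : n%:R * B ^+ 2 = \sum_(i < n) B ^+ 2.
  by rewrite sumr_const card_ord mulr_natl.
apply: ler_sum => i _; rewrite -(ger0_norm (sqr_ge0 (x 0 i))) normrX.
by rewrite lerXn2r ?nnegrE// (le_trans _ (bx i)).
Qed.

Lemma cexp_lt0 : cexp < 0.
Proof. by rewrite /cexp mulNr oppr_lt0 divr_gt0// ltr_wpDl. Qed.

Lemma powR_cexp (B : R) : 0 < B -> (B ^+ 2) `^ cexp = B ^- (n + 2).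
Proof.
move=> B0; rewrite -powR_mulrn ?ltW// -powRrM /cexp.
have -> : 2 * (- (n%:R + 2) / 2) = - ((n + 2)%:R : R) by rewrite natrD; field.
by rewrite powR_invn// ltW.
Qed.

(** Dyadic cubes of half-side 2^k M: outside the k-th cube the weight is below (2^k M)^-(n + 2),
    while the next cube has volume (4 2^k M)^n. The shells thus sum like a geometric series of ratio
    1/4. *)
Lemma Int_rw_cexp (M : R) : 0 < M ->
  Itg (rw (M ^+ 2) cexp) /\ Int (rw (M ^+ 2) cexp) <= 3 * 4 ^+ n * M ^- 2.
Proof.
move=> M0; have M20 : 0 < M ^+ 2 by rewrite exprn_gt0.
pose f k x := rw (M ^+ 2) cexp x * ibox (2 ^+ k * M) x.
have B0 k : 0 < 2 ^+ k * M by rewrite mulr_gt0// exprn_gt0.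
have mrw : Mf (rw (M ^+ 2) cexp).
  by apply: continuous_Mf; exact: Ck_continuous (Ck_rw 0 _ M20).
have rwle (B : R) x : 0 < B -> B ^+ 2 <= rho (M ^+ 2) x -> rw (M ^+ 2) cexp x <= B ^- (n + 2).
  move=> B0' Bx; rewrite -powR_cexp// /rw.
  have e0 : 0 <= (n%:R + 2) / 2 :> R by rewrite divr_ge0// addr_ge0.
  have -> : cexp = - ((n%:R + 2) / 2) by rewrite /cexp mulNr.
  rewrite !powRN lef_pV2 ?posrE ?powR_gt0 ?rho_gt0 ?exprn_gt0//.
  by rewrite ge0_ler_powR ?nnegrE// ?(ltW (rho_gt0 _ _)) ?sqr_ge0//.
have Ib k : Itg (ibox (2 ^+ k * M) : 'rV[R]_n -> R) by have [] := @Int_ibox R n _ (ltW (B0 k)).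
have Vb k : Int (ibox (2 ^+ k * M) : 'rV[R]_n -> R) = (2 * (2 ^+ k * M)) ^+ n.
  by have [] := @Int_ibox R n _ (ltW (B0 k)).
have fI k : Itg (f k).
  apply: (@Itg_dom _ _ _ (fun x => M ^- (n + 2) * ibox (2 ^+ k * M) x)).
  - by apply: measurable_funM => //; exact: Itg_Mf.
  - exact: ItgZ.
  - move=> x; rewrite /f ger0_norm ?mulr_ge0 ?ler0n// ?(ltW (rw_gt0 _ _ _))//.
    by rewrite ler_wpM2r ?ler0n// rwle// lerDl nsq_ge0.
have cancel (L c : R) : 0 < L -> L ^- (n + 2) * (c * L) ^+ n = c ^+ n * L ^- 2.
  move=> L0; rewrite addnC exprD invfM exprMn -mulrA (mulrCA _ (c ^+ n)) mulVf ?expf_neq0 ?gt_eqF//.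
  by rewrite mulr1 mulrC.
(* A shell adds 4^n M^-2 4^-k; the factor 3 - 2 4^-k equals 1 at k = 0 and grows fast enough to
   absorb it. *)
have fB k : Int (f k) <= 4 ^+ n * M ^- 2 * (3 - 2 * 4 ^- k).
  elim: k => [|k IH].
    apply: (@le_trans _ _ (Int (fun x => M ^- (n + 2) * ibox (2 ^+ 0 * M) x))).
      apply: Int_le => //; first exact: ItgZ.
      by move=> x; rewrite /f ler_wpM2r ?ler0n// rwle// lerDl nsq_ge0.
    rewrite IntZ// Vb expr0 mul1r cancel// invr1 mulr1.
    rewrite (_ : 3 - 2 = 1 :> R) ?mulr1; last by ring.
    by rewrite ler_pM2r ?invr_gt0// lerXn2r ?nnegrE// ler_nat.
  apply: (@le_trans _ _ (Int (fun x => f k x + (2 ^+ k * M) ^- (n + 2) * ibox (2 ^+ k.+1 * M) x))).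
    apply: Int_le => //; first by apply: ItgD => //; exact: ItgZ.
    move=> x; rewrite /f !iboxP.
    have r0 := ltW (rw_gt0 cexp x M20).
    have l0 : 0 <= (2 ^+ k * M) ^- (n + 2) by rewrite invr_ge0 exprn_ge0// ltW.
    case: asboolP => bS; last first.
      rewrite mulr0 mulr0 addr0 mulr_ge0//; by case: asboolP.
    case: asboolP => bk; first by rewrite !mulr1 lerDl.
    rewrite !mulr1 mulr0 add0r rwle//.
    apply: le_trans (nsq_le_rho _ (ltW M20)).
    exact: ltW (not_box_nsq (ltW (B0 k)) bk).
  rewrite IntD//; last exact: ItgZ.
  rewrite IntZ// Vb exprS -mulrA mulrA (_ : 2 * 2 = 4 :> R); last by ring.
  rewrite cancel// exprMn -exprM mulnC exprM (_ : 2 ^+ 2 = 4 :> R); last by ring.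
  rewrite invfM; apply: le_trans (lerD IH (lexx _)) _.
  set y := M ^- 2; rewrite [4 ^+ k.+1]exprS invfM; set z := 4 ^- k.
  have z0 : 0 <= z by rewrite invr_ge0 exprn_ge0.
  have y0 : 0 <= y by rewrite invr_ge0 sqr_ge0.
  have p0 : 0 <= 4 ^+ n :> R by rewrite exprn_ge0.
  have := mulr_ge0 (mulr_ge0 p0 y0) z0.
  move=> h; rewrite -subr_ge0.
  have -> : 4 ^+ n * y * (3 - 2 * (4^-1 * z)) - (4 ^+ n * y * (3 - 2 * z) + 4 ^+ n * (z * y)) =
    2^-1 * (4 ^+ n * y * z) by field.
  by rewrite mulr_ge0.
apply: (@Int_fatou _ _ f (rw (M ^+ 2) cexp) (3 * 4 ^+ n * M ^- 2) fI) => [k x|x|k].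
- by rewrite mulr_ge0 ?ler0n// ltW// rw_gt0.
- apply: (@cvg_eventually _ _ _ (Num.truncn (enorm x / M)).+1) => k kN.
  rewrite /f iboxP ifT ?mulr1//; apply/asboolP => i.
  apply: le_trans (coord_enorm x i) _.
  rewrite -ler_pdivrMr// (le_trans (ltW (truncnS_gt _)))//.
  by rewrite -natrX ler_nat (leq_trans kN)// ltnW// ltn_expl.
- apply: le_trans (fB k) _.
  rewrite mulrC mulrA ler_pM2r ?invr_gt0// ler_pM2r ?exprn_gt0//.
  by rewrite gerBl mulr_ge0// invr_ge0 exprn_ge0.
Qed.

End weight.

(** * Flat functions for smooth cutoffs *)

Section bump.
Context {R : realType}.

(* Derivatives of the flat function [exp (-1/t)] are combinations of these. *)
Definition flat (k : nat) (t : R) : R := if 0 < t then t ^- k * expR (- t^-1) else 0.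

Lemma flat_le0 k t : t <= 0 -> flat k t = 0.
Proof. by move=> t0; rewrite /flat ltNge t0. Qed.

Lemma flat_ge0 k t : 0 <= flat k t.
Proof. by rewrite /flat; case: ifPn => // t0; rewrite mulr_ge0 ?expR_ge0// invr_ge0 exprn_ge0// ltW. Qed.

Lemma flatS k t : flat k t = t * flat k.+1 t.
Proof.
rewrite /flat; case: ifPn => t0; last by rewrite mulr0.
by rewrite exprS invfM !mulrA divff ?gt_eqF// mul1r.
Qed.

(** Here e^(1/t) is the k-th power of e^(1/(k t)), which is at least 1/(k t). For k = 0 the bound
    reads 0^0 = 1. *)
Lemma flat_le k t : flat k t <= k%:R ^+ k.
Proof.
rewrite /flat; case: ifPn => [t0|_]; last by rewrite exprn_ge0.
case: k => [|k]; first by rewrite !expr0 invr1 mul1r -expR0 ler_expR oppr_le0 invr_ge0 ltW.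
rewrite expRN ler_pdivrMr ?expR_gt0//.
have k0 : (0 : R) < k.+1%:R by rewrite ltr0n.
rewrite -exprVn.
have -> : t^-1 = k.+1%:R * (t^-1 / k.+1%:R) by rewrite mulrCA divff ?mulr1// gt_eqF.
rewrite expRM_natl -exprMn lerXn2r ?nnegrE ?mulr_ge0 ?expR_ge0 ?invr_ge0 ?(ltW t0)//.
rewrite ler_pM2l// (le_trans _ (expR_ge1Dx _))// lerDr//.
Qed.

Lemma isd_flat k (t : R) : is_derive t (1 : R) (flat k) (flat k.+2 t - k%:R * flat k.+1 t).
Proof.
have [t0|t0|->] := ltgtP t 0.
- rewrite !flat_le0 ?(ltW t0)// mulr0 subr0.
  have D0 : is_derive t (1 : R) (fun _ : R => 0 : R) 0 by exact: is_derive_cst.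
  apply: near_eq_is_derive D0.
  near=> s; rewrite flat_le0//; apply: ltW; near: s; exact: lt_nbhsl.
- have d1 := isd_comp (f := fun s : R => s ^+ k) (h := fun z : R => z^-1)
    (isd_inv (lt0r_neq0 (exprn_gt0 k t0))) (isd_exprn k t).
  have d2 := isd_comp (f := fun s : R => - s^-1) (isd_expR _) (isdN (isd_inv (lt0r_neq0 t0))).
  have D0 := isdM d1 d2.
  suff E : flat k.+2 t - k%:R * flat k.+1 t =
      - (t ^+ k) ^- 2 * (k%:R * t ^+ k.-1) * expR (- t^-1) +
      (t ^+ k)^-1 * (expR (- t^-1) * - - t ^- 2).
    rewrite E; apply: near_eq_is_derive D0.
    near=> s; rewrite /flat ifT//; near: s; exact: lt_nbhsr.
  rewrite /flat t0 opprK.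
  set e := expR _.
  have tk : t ^+ k != 0 by rewrite expf_neq0// gt_eqF.
  have tn : t != 0 by rewrite gt_eqF.
  clear D0; case: k tk {d1 d2} => [|k] tk; rewrite /=; last rewrite !exprS in tk *.
    by rewrite !mul0r mulr0 mul0r subr0 add0r expr0; field.
  by move: (t ^+ k) tk => z; rewrite mulf_eq0 negb_or => /andP[_ z0]; field; rewrite tn z0.
- rewrite !flat_le0// mulr0 subr0.
  have H : (h^-1 *: ((flat k \o shift 0) (h *: (1:R)) - flat k 0)) @[h --> 0^'] --> (0:R).
    apply/cvgrPdist_lt => e e0; near=> h.
    rewrite sub0r normrN /= (flat_le0 _ (lexx 0)) subr0 addr0 [h *: 1]mulr1 [h^-1 *: _]mulrC.
    (* At the origin the difference quotient is [flat k.+1 h], that is h times the bounded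
       [flat k.+2 h]. *)
    rewrite flatS mulrAC divff ?mul1r; last by near: h; exact: nbhs_dnbhs_neq.
    rewrite ger0_norm ?flat_ge0// flatS.
    apply: le_lt_trans (_ : `|h| * (k.+2%:R ^+ k.+2) < _).
      rewrite (le_trans (ler_norm _))// normrM (ger0_norm (flat_ge0 _ _)).
      by rewrite ler_wpM2l// flat_le.
    have p0 : (0 : R) < k.+2%:R ^+ k.+2 by rewrite exprn_gt0.
    rewrite -ltr_pdivlMr//; near: h.
    apply: dnbhs0_lt; exact: divr_gt0.
  by split; [apply/cvg_ex; exists 0|apply/cvg_lim].
Unshelve. all: by end_near. Qed.

Lemma continuous_flat k : continuous (flat k).
Proof. by move=> t; exact: is_derive_cont (isd_flat k t). Qed.

Lemma Ck_flat n m k (f : 'rV[R]_n -> R) : CK m f -> CK m (fun x => flat k (f x)).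
Proof.
elim: m k f => [|m IH] k f cf.
  apply: Ck0I; apply: cont_comp; first exact: Ck_continuous cf.
  by move=> x; exact: continuous_flat.
apply: CkI.
  apply: cont_comp; first exact: Ck_continuous cf.
  by move=> x; exact: continuous_flat.
move=> i; exists (fun x => (flat k.+2 (f x) - k%:R * flat k.+1 (f x)) * pd i f x).
  by move=> x; exact: isd_comp (isd_flat k (f x)) (Ck_isd i x cf).
apply: CkM; last exact: Ck_partial.
by apply: CkB; [|apply: CkZ]; apply: IH; exact: CkW.
Qed.

Lemma flat_le1 t : flat 0 t <= 1.
Proof. by have := flat_le 0 t; rewrite expr0. Qed.

Lemma flat_lim (e : R) : e < 1 -> exists T, forall t, T <= t -> e <= flat 0 t.
Proof.
move=> e1.
have c0 : (0 : R) < 1 - e by rewrite subr_gt0.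
exists ((1 - e)^-1) => t tT.
have t0 : 0 < t by rewrite (lt_le_trans _ tT)// invr_gt0.
rewrite /flat t0 expr0 invr1 mul1r (le_trans _ (expR_ge1Dx _))//.
rewrite lerBrDr -lerBrDl -[leRHS]invrK lef_pV2 ?posrE// invr_gt0//.
Qed.

End bump.

(** * The Rellich inequality and stability for compactly supported functions *)

Section gdot_algebra.
Context {R : realType} {n : nat}.
Implicit Types (f g h : 'rV[R]_n -> R) (x : 'rV[R]_n).

Lemma CauchySchwarz_sum (I : finType) (a b : I -> R) :
  (\sum_i a i * b i) ^+ 2 <= (\sum_i a i * a i) * (\sum_i b i * b i).
Proof.
set p := \sum_i a i * a i; set q := \sum_i b i * b i; set m := \sum_i a i * b i.
have q0 : 0 <= q by apply: sumr_ge0 => i _; rewrite -expr2 sqr_ge0.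
have H (s t : R) : 0 <= s ^+ 2 * p - 2 * s * t * m + t ^+ 2 * q.
  have -> : s ^+ 2 * p - 2 * s * t * m + t ^+ 2 * q = \sum_i (s * a i - t * b i) ^+ 2.
    rewrite /p /q /m !mulr_sumr -sumrB -big_split/=; apply: eq_bigr => i _; ring.
  by apply: sumr_ge0 => i _; exact: sqr_ge0.
have := H q m.
have [q1|q1] := eqVneq q 0.
  have m0 : m = 0.
    apply/eqP; rewrite -[_ == 0]negbK; apply/negP => m0.
    have := H 1 ((p + 1) / (2 * m)); rewrite q1 mulr0 addr0 expr1n mul1r mulr1.
    have -> : 2 * ((p + 1) / (2 * m)) * m = p + 1 by field.
    lra.
  by move=> _; rewrite m0 q1 expr0n/= mulr0.
move=> h; rewrite -subr_ge0.
have q2 : 0 < q by rewrite lt_neqAle eq_sym q1.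
rewrite -(pmulr_rge0 _ q2); apply: le_trans h _.
by rewrite le_eqVlt; apply/orP; left; apply/eqP; ring.
Qed.

Lemma gdot_CS f g x : gdot f g x ^+ 2 <= gdot f f x * gdot g g x.
Proof. exact: CauchySchwarz_sum. Qed.

Lemma gdotZl (c : R) f g x : CK 1 f -> gdot (fun y => c * f y) g x = c * gdot f g x.
Proof.
by move=> cf; rewrite /gdot mulr_sumr; apply: eq_bigr => i _; rewrite partialZ// mulrA.
Qed.

End gdot_algebra.

Section logarithm.
Context {R : realType} {n : nat}.

Lemma Ck_ln k (f : 'rV[R]_n -> R) : CK k f -> (forall x, 0 < f x) -> CK k (fun x => ln (f x)).
Proof.
move=> cf f0.
have c : continuous (fun x => ln (f x)).
  apply: cont_comp; first exact: Ck_continuous cf.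
  by move=> x; exact: is_derive_cont (isd_ln (f0 x)).
case: k cf => [|k] cf; first exact: Ck0I.
apply: CkI => // i; exists (fun x => (f x)^-1 * pd i f x).
  by move=> x; exact: isd_comp (isd_ln (f0 x)) (Ck_isd i x cf).
by apply: CkM; [apply: Ck_inv => //; exact: CkW|exact: Ck_partial].
Qed.

Lemma ler_sqr_norm (a b : R) : `|a| <= b -> a ^+ 2 <= b ^+ 2.
Proof.
move=> ab; rewrite -(ger0_norm (sqr_ge0 a)) normrX lerXn2r ?nnegrE//.
exact: le_trans ab.
Qed.

End logarithm.

(** * Logarithmic cutoffs *)

Section cutoff.
Context {R : realType} {n : nat}.
Implicit Types (psi : 'rV[R]_n -> R) (x : 'rV[R]_n) (t c : R).

Definition lnr t c x : R := t * ln (rho 1 x) + c.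
(** A cutoff that varies in log |x| at speed t. For t > 0 it vanishes near the origin, if c is
    negative enough, and tends to 1 at infinity; for t < 0 it has compact support. Its derivatives
    are O(t) times the scale-invariant weights of the Rellich inequality, so cutting off costs as
    little as desired when t is small. *)
Definition lcut t c x : R := flat 0 (lnr t c x).

Lemma rho1_gt0 x : 0 < rho 1 x. Proof. exact: rho_gt0. Qed.

Lemma rw1_V x : rw 1 (-1) x = (rho 1 x)^-1.
Proof. by rewrite rwN rw1. Qed.

Lemma rw1_V2 x : rw 1 (-2) x = (rho 1 x) ^- 2.
Proof. by rewrite (_ : -2 = -1 + -1 :> R) ?rwD ?rw1_V//; [rewrite expr2 invfM|ring]. Qed.

Lemma isd_lnr t c i x : is_derive x (delta_mx 0 i) (lnr t c) (t * (2 * x 0 i) / rho 1 x).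
Proof.
have D := isd_comp (isd_ln (rho1_gt0 x)) (Ck_isd i x (Ck_rho 1 1)).
suff <- : t * ((rho 1 x)^-1 * pd i (rho 1) x) + 0 = t * (2 * x 0 i) / rho 1 x.
  exact: isdD (isdZ t D) (isd_cst c _ _).
by rewrite addr0 partial_rho; move: (rho 1 x)^-1 => r; ring.
Qed.

Lemma Ck_lnr k t c : CK k (lnr t c).
Proof. by apply: CkD; [apply: CkZ; apply: Ck_ln; [exact: Ck_rho|exact: rho1_gt0]|exact: Ck_cst]. Qed.

Lemma partial_lnr t c i x : pd i (lnr t c) x = t * (2 * x 0 i) / rho 1 x.
Proof. exact: partial_eq (isd_lnr t c i x). Qed.

Lemma gdot_lnr t c x : gdot (lnr t c) (lnr t c) x = 4 * t ^+ 2 * nsq x / rho 1 x ^+ 2.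
Proof.
rewrite /gdot /nsq (eq_bigr (fun i => x 0 i ^+ 2 * (4 * t ^+ 2 / rho 1 x ^+ 2))).
  by rewrite -mulr_suml mulrC mulrAC.
move=> i _; rewrite !partial_lnr; have := rho1_gt0 x; move: (rho 1 x) => r r0.
by field; rewrite gt_eqF.
Qed.

Lemma laplacian_lnr t c x : lap (lnr t c) x =
  t * (2 * n%:R / rho 1 x - 4 * nsq x / rho 1 x ^+ 2).
Proof.
rewrite lapE.
rewrite (eq_bigr (fun i => t * (2 / rho 1 x - 4 * x 0 i ^+ 2 / rho 1 x ^+ 2))).
  rewrite -mulr_sumr sumrB sumr_const card_ord; congr (_ * (_ - _)).
    by rewrite -[_ *+ n]mulr_natl mulrCA mulrA.
  by rewrite /nsq mulr_sumr mulr_suml.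
move=> i _; rewrite (_ : pd i (lnr t c) = fun y => t * (2 * (y 0 i * (rho 1 y)^-1))); last first.
  by apply/funext => y; rewrite partial_lnr !mulrA.
have D1 := isd_comp (isd_inv (lt0r_neq0 (rho1_gt0 x))) (Ck_isd i x (Ck_rho 1 1)).
rewrite (partial_eq (isdZ t (isdZ 2 (isdM (isd_coord x i i) D1)))) eqxx partial_rho (_ : true%:R = 1 :> R)//.
by have := rho1_gt0 x; move: (rho 1 x) => r r0; field; rewrite gt_eqF.
Qed.

Lemma Ck_cut k t c : CK k (lcut t c).
Proof. by apply: Ck_flat; exact: Ck_lnr. Qed.

Lemma cut_ge0 t c x : 0 <= lcut t c x. Proof. exact: flat_ge0. Qed.

Lemma cut_le1 t c x : lcut t c x <= 1. Proof. exact: flat_le1. Qed.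

Lemma isd_flat0 (s : R) : is_derive s (1 : R) (flat 0) (flat 2 s).
Proof. by have := isd_flat 0 s; rewrite mul0r subr0. Qed.

(** From [flat 2] <= 4, [flat 3] <= 27 and [flat 4] <= 256: in [lap_cut_le] the first-order square
    contributes at most 310 * 4 and the Laplacian of the logarithm at most 4 (2 n + 4). *)
Definition cutC : R := 1300 + 8 * n%:R.

Lemma cutC_gt0 : 0 < cutC.
Proof. by rewrite /cutC; have : 0 <= n%:R :> R by []; lra. Qed.

Lemma nsq_rho2 x : nsq x / rho 1 x ^+ 2 <= (rho 1 x)^-1.
Proof.
rewrite ler_pdivrMr ?exprn_gt0 ?rho1_gt0// expr2 mulrA mulVf ?mul1r ?gt_eqF ?rho1_gt0//.
exact: nsq_le_rho.
Qed.

Lemma gdot_cut t c x : gdot (lcut t c) (lcut t c) x <= (cutC * t) ^+ 2 * rw 1 (-1) x.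
Proof.
have cl := Ck_lnr 1 t c.
rewrite /lcut (gdot_compl (p := flat 0) (p' := flat 2) _ cl (isd_flat0 _)) gdotC.
rewrite (gdot_compl (p := flat 0) (p' := flat 2) _ cl (isd_flat0 _)) gdot_lnr rw1_V.
have h0 := flat_ge0 2 (lnr t c x).
have h4 : flat 2 (lnr t c x) <= 4 by have := flat_le 2 (lnr t c x); rewrite -natrX.
have hr := nsq_rho2 x; have n0 := nsq_ge0 x.
have hr0 : 0 <= nsq x / rho 1 x ^+ 2 by rewrite divr_ge0// sqr_ge0.
have r0 : 0 <= (rho 1 x)^-1 by rewrite invr_ge0 ltW// rho1_gt0.
rewrite mulrA -expr2 -[4 * _ * _ * _]mulrA mulrA [X in _ <= X * _]exprMn.
set f2 := flat _ _; have -> : f2 ^+ 2 * (4 * t ^+ 2) * (nsq x / rho 1 x ^+ 2) =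
  t ^+ 2 * (4 * f2 ^+ 2 * (nsq x / rho 1 x ^+ 2)) by ring.
have -> : cutC ^+ 2 * t ^+ 2 / rho 1 x = t ^+ 2 * (cutC ^+ 2 * (rho 1 x)^-1) by ring.
rewrite ler_wpM2l ?sqr_ge0//.
rewrite -/f2 in h0 h4.
have C1 : 64 <= cutC ^+ 2 by have : 0 <= n%:R :> R by []; rewrite /cutC; nra.
apply: (@le_trans _ _ (64 * (rho 1 x)^-1)); last by rewrite ler_wpM2r.
move: f2 (nsq x / _) (rho 1 x)^-1 h0 h4 hr hr0 r0 => p q r p0 p4 qr q0 r0.
have : p ^+ 2 <= 16 by nra.
nra.
Qed.

Lemma lap_cut_le t c x : `|t| <= 1 -> lap (lcut t c) x ^+ 2 <= (cutC * t) ^+ 2 * rw 1 (-2) x.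
Proof.
move=> t1; have cl := Ck_lnr 2 t c.
rewrite /lcut [X in X ^+ 2](laplacian_comp (p := flat 0) (p' := flat 2) (p'' := fun s => flat 4 s - 2 * flat 3 s) cl
  (fun y => isd_flat0 _) (isd_flat 2 _)) gdot_lnr laplacian_lnr rw1_V2.
set s := lnr t c x.
have h2 : 0 <= flat 2 s <= 4 by rewrite flat_ge0/=; have := flat_le 2 s; rewrite -natrX.
have h3 : 0 <= flat 3 s <= 27 by rewrite flat_ge0/=; have := flat_le 3 s; rewrite -natrX.
have h4 : 0 <= flat 4 s <= 256 by rewrite flat_ge0/=; have := flat_le 4 s; rewrite -natrX.
have hr := nsq_rho2 x; have n0 := nsq_ge0 x.
have hr0 : 0 <= nsq x / rho 1 x ^+ 2 by rewrite divr_ge0// sqr_ge0.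
have r0 : 0 <= (rho 1 x)^-1 by rewrite invr_ge0 ltW// rho1_gt0.
have N0 : 0 <= n%:R :> R by [].
have -> : (cutC * t) ^+ 2 / rho 1 x ^+ 2 = (cutC * `|t| * (rho 1 x)^-1) ^+ 2.
  by rewrite [RHS]exprMn exprVn !exprMn real_normK// num_real.
apply: ler_sqr_norm.
have -> : 4 * t ^+ 2 * nsq x / rho 1 x ^+ 2 = t * t * (4 * (nsq x / rho 1 x ^+ 2)).
  by move: (rho 1 x ^+ 2)^-1 => y; ring.
have -> : 4 * nsq x / rho 1 x ^+ 2 = 4 * (nsq x / rho 1 x ^+ 2) by rewrite mulrA.
move: (flat 2 s) (flat 3 s) (flat 4 s) (nsq x / _) (rho 1 x)^-1 h2 h3 h4 hr hr0 r0.
move=> f2 f3 f4 q r /andP[? ?] /andP[? ?] /andP[? ?] qr q0 r0.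
apply: le_trans (ler_normD _ _) _.
rewrite !normrM (ger0_norm q0) (@ger0_norm _ 4)//.
have N3 : `|2 * n%:R * r - 4 * q| <= (2 * n%:R + 4) * r.
  rewrite ler_norml; apply/andP; split.
    have := mulr_ge0 N0 r0; lra.
  have := mulr_ge0 N0 r0; lra.
have N1 : `|f4 - 2 * f3| <= 310 by rewrite ler_norml; apply/andP; split; lra.
have N2 : `|f2| <= 4 by rewrite ler_norml; apply/andP; split; lra.
have T0 := normr_ge0 t; move: `|t| T0 t1 => T T0 T1.
have M1 : `|f4 - 2 * f3| * (T * T * (4 * q)) <= 310 * (T * (4 * r)).
  apply: ler_pM => //; first by rewrite !mulr_ge0.
  rewrite -mulrA ler_wpM2l//; apply: le_trans (_ : 1 * (4 * q) <= _).
    by rewrite ler_wpM2r// mulr_ge0.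
  by rewrite mul1r ler_pM2l.
have M2 : `|f2| * (T * `|2 * n%:R * r - 4 * q|) <= 4 * (T * ((2 * n%:R + 4) * r)).
  by apply: ler_pM => //; [rewrite mulr_ge0|rewrite ler_wpM2l].
apply: le_trans (lerD M1 M2) _.
have := mulr_ge0 T0 r0; have := mulr_ge0 N0 (mulr_ge0 T0 r0).
rewrite /cutC; move: (n%:R) => m h1 h2; lra.
Qed.

End cutoff.

Section Rellich.
Context {R : realType} {n : nat}.
Hypothesis n5 : (5 <= n)%N.
Implicit Types (psi : 'rV[R]_n -> R) (x : 'rV[R]_n) (t c : R).

(** The left-hand weight is multiplied by 2 n - 8 |x|^2/(1 + |x|^2), which exceeds 2 (n - 4); this
    is at least 2 because n >= 5. *)
Lemma laplacian_rw1 x : 2 * rw 1 (-2) x <= - lap (rw (1 : R) (-1)) x.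
Proof.
rewrite laplacian_rw// (_ : -1 - 1 = -2 :> R); last by ring.
have -> : -1 - 2 = -2 + -1 :> R by ring.
rewrite rwD// rw1_V; have r0 := ltW (rw_gt0 (-2) x (ltr01 : 0 < (1 : R))).
have h : nsq x * (rho 1 x)^-1 <= 1 by rewrite ler_pdivrMr ?rho1_gt0// mul1r nsq_le_rho.
have h0 : 0 <= nsq x * (rho 1 x)^-1 by rewrite divr_ge0 ?nsq_ge0// ltW// rho1_gt0.
have n5' : 5 <= n%:R :> R by rewrite ler_nat.
move: (rw 1 (-2) x) r0 (nsq x) (rho 1 x)^-1 h h0 => r r0 q z h h0.
rewrite -subr_ge0.
have -> : - (2 * -1 * n%:R * r + 4 * -1 * -2 * q * (r * z)) - 2 * r =
   2 * r * (n%:R - 1 - 4 * (q * z)) by ring.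
by rewrite mulr_ge0 ?mulr_ge0//; lra.
Qed.

Lemma laplacian_sqr psi x : CK 2 psi ->
  lap (fun y => psi y ^+ 2) x = 2 * gdot psi psi x + 2 * psi x * lap psi x.
Proof.
move=> cp; under [X in lap X]eq_fun do rewrite expr2.
by rewrite laplacianM//; move: (lap psi x) (gdot _ _ _) => a b; ring.
Qed.

Lemma cont_rw (c a : R) : 0 < c -> continuous (rw c a : 'rV[R]_n -> R).
Proof. by move=> c0; exact: Ck_continuous (Ck_rw 0 a c0). Qed.

(** Integrate psi^2 against [laplacian_rw1], move the Laplacian onto psi^2 by Green's formula, and
    expand it as 2 |grad psi|^2 + 2 psi lap psi. Completing a square in the last term uses up half
    of the weighted L^2 norm and leaves the rest on the left. *)
Lemma Rellich psi : CK 2 psi -> csupp psi ->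
  Int (fun x => psi x ^+ 2 * rw 1 (-2) x) + 2 * Int (fun x => gdot psi psi x * rw 1 (-1) x)
  <= Int (fun x => lap psi x ^+ 2).
Proof.
move=> cp sp; have cp1 := CkW cp; have cp0 := Ck_continuous cp.
have cl := continuous_laplacian cp; have sl := csupp_laplacian sp.
have cg := continuous_gdot cp1 cp1; have sg := csupp_gdot psi sp.
have cw a : continuous (rw (1 : R) a : 'rV[R]_n -> R) by exact: cont_rw.
have sp2 : csupp (fun x => psi x ^+ 2) by apply: (csupp_comp (h := fun z => z ^+ 2)) => //; rewrite expr0n.
have cp2 : continuous (fun x => psi x ^+ 2) by exact: Ck_continuous (CkX 2 cp).
have I1 : Itg (fun x => psi x ^+ 2 * rw 1 (-2) x).
  by apply: Itg_csupp; [exact: cont_mul|exact: csuppM].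
have I2 : Itg (fun x => gdot psi psi x * rw 1 (-1) x).
  by apply: Itg_csupp; [exact: cont_mul|exact: csuppM].
have I3 : Itg (fun x => lap psi x ^+ 2).
  apply: Itg_csupp; first by under eq_fun do rewrite expr2; exact: cont_mul.
  by apply: (csupp_comp (h := fun z => z ^+ 2)) => //; rewrite expr0n.
have Crw : CK 2 (rw (1 : R) (-1) : 'rV[R]_n -> R) by exact: Ck_rw.
have G := Green Crw (CkX 2 cp) sp2.
have I4 : Itg (fun x => psi x ^+ 2 * lap (rw 1 (-1)) x).
  by apply: Itg_csupp; [apply: cont_mul => //; exact: continuous_laplacian|exact: csuppM].
have I5 : Itg (fun x => lap (fun y => psi y ^+ 2) x * rw 1 (-1) x).
  apply: Itg_csupp; last by apply: csuppM; exact: csupp_laplacian.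
  by apply: cont_mul => //; apply: continuous_laplacian; exact: CkX.
have L : 2 * Int (fun x => psi x ^+ 2 * rw 1 (-2) x) <= - Int (fun x => psi x ^+ 2 * lap (rw 1 (-1)) x).
  rewrite -IntZ// -IntN//; apply: Int_le; [exact: ItgZ|exact: ItgN|].
  by move=> x; rewrite mulrCA -mulrN ler_wpM2l ?sqr_ge0// laplacian_rw1.
rewrite G in L.
have U : - Int (fun x => lap (fun y => psi y ^+ 2) x * rw 1 (-1) x) <=
    - (2 * Int (fun x => gdot psi psi x * rw 1 (-1) x)) +
    (Int (fun x => psi x ^+ 2 * rw 1 (-2) x) + Int (fun x => lap psi x ^+ 2)).
  rewrite -IntN// -IntZ// -IntD// -IntN; last exact: ItgZ.
  rewrite -IntD; [|by apply: ItgN; exact: ItgZ|exact: ItgD].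
  apply: Int_le; [exact: ItgN|by apply: ItgD; [apply: ItgN; exact: ItgZ|exact: ItgD]|].
  move=> x; rewrite laplacian_sqr// (_ : -2 = -1 + -1 :> R) ?rwD//; last by ring.
  move: (rw 1 (-1) x) (gdot _ _ _) (lap psi x) (psi x) => w g l p.
  have := sqr_ge0 (p * w + l); nra.
lra.
Qed.

End Rellich.

Section stability.
Context {R : realType} {n : nat}.
Hypothesis n5 : (5 <= n)%N.
Implicit Types (psi : 'rV[R]_n -> R) (x : 'rV[R]_n) (t c : R).

Definition cutD : R := 16 * @cutC R n ^+ 2.

Lemma cutD_ge0 : 0 <= cutD. Proof. by rewrite mulr_ge0// sqr_ge0. Qed.

(** The commutator terms have squares of order t^2, so Young's inequality with parameter |t| keeps
    the main term up to a factor 1 + |t| and leaves O(|t|) times exactly the quantities controlled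
    by [Rellich]. *)
Lemma laplacian_cutM t c psi x : 0 < `|t| -> `|t| <= 1 -> CK 2 psi ->
  lap (fun y => lcut t c y * psi y) x ^+ 2 <=
  (1 + `|t|) * lap psi x ^+ 2 +
  cutD * `|t| * (gdot psi psi x * rw 1 (-1) x + psi x ^+ 2 * rw 1 (-2) x).
Proof.
move=> t0 t1 cp; rewrite laplacianM//; last exact: Ck_cut.
have h1 := gdot_cut t c x; have h2 := lap_cut_le c x t1.
have h3 := gdot_CS (lcut t c) psi x.
have g0 := gdot_ge0 psi x.
have c0 := cut_ge0 t c x; have c1 := cut_le1 t c x.
have r1 := ltW (rw_gt0 (-1) x (ltr01 : 0 < (1 : R))).
have r2 := ltW (rw_gt0 (-2) x (ltr01 : 0 < (1 : R))).
have TT : t ^+ 2 = `|t| ^+ 2 by rewrite real_normK// num_real.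
rewrite !exprMn TT in h1 h2.
have h4 : gdot (lcut t c) psi x ^+ 2 <= @cutC R n ^+ 2 * `|t| ^+ 2 * rw 1 (-1) x * gdot psi psi x.
  by apply: le_trans h3 _; rewrite ler_wpM2r.
move: (lcut t c x) (lap (lcut t c) x) (gdot (lcut t c) psi x) (gdot psi psi x) (psi x) (lap psi x)
  (rw 1 (-1) x) (rw 1 (-2) x) `|t| h2 h4 g0 c0 c1 r1 r2 t0 t1 => ch lc gc g p l w1 w2 T.
rewrite /cutD; move: (cutC ^+ 2) => C h2 h4 g0 c0 c1 r1 r2 T0 T1 {h1 h3 TT}.
have T2 : T != 0 by rewrite gt_eqF.
(* (A + B)^2 <= (1 + T) A^2 + (1 + 1/T) B^2 *)
set B := lc * p + 2 * gc.
have -> : lc * p + 2 * gc + ch * l = ch * l + B by rewrite addrC.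
have e1 : (ch * l + B) ^+ 2 <= (1 + T) * (ch * l) ^+ 2 + (1 + T^-1) * B ^+ 2.
  rewrite -subr_ge0.
  have -> : (1 + T) * (ch * l) ^+ 2 + (1 + T^-1) * B ^+ 2 - (ch * l + B) ^+ 2 =
    T^-1 * (T * (ch * l) - B) ^+ 2 by field.
  by rewrite mulr_ge0 ?sqr_ge0// invr_ge0 ltW.
have e2 : (ch * l) ^+ 2 <= l ^+ 2.
  rewrite exprMn -[leRHS]mul1r ler_wpM2r ?sqr_ge0//.
  by rewrite expr_le1.
have e3 : B ^+ 2 <= 8 * (C * T ^+ 2 * (g * w1 + p ^+ 2 * w2)).
  apply: (@le_trans _ _ (2 * (lc ^+ 2 * p ^+ 2) + 8 * gc ^+ 2)).
    by rewrite /B; have := sqr_ge0 (lc * p - 2 * gc); nra.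
  have := ler_wpM2r (sqr_ge0 p) h2.
  have := mulr_ge0 (mulr_ge0 g0 r1) (sqr_ge0 T).
  have : 0 <= C * T ^+ 2 * w2 * p ^+ 2 by apply: le_trans (ler_wpM2r (sqr_ge0 p) h2); rewrite mulr_ge0// sqr_ge0.
  nra.
apply: le_trans e1 _; apply: lerD.
  by rewrite ler_pM2l// addr_gt0.
have i1 : 1 + T^-1 <= 2 * T^-1.
  have : 1 <= T^-1 by rewrite invf_ge1.
  lra.
apply: le_trans (ler_wpM2r (sqr_ge0 B) i1) _.
apply: le_trans (ler_wpM2l _ e3) _; first by rewrite mulr_ge0// invr_ge0 ltW.
rewrite le_eqVlt; apply/orP; left; apply/eqP; field.
exact: T2.
Qed.

Lemma csupp_cut t c : 0 < t -> csupp (lcut (- t) c : 'rV[R]_n -> R).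
Proof.
move=> t0; exists (expR (c / t)) => x bx; apply: flat_le0.
rewrite /lnr mulNr addrC subr_le0 -ler_pdivrMl// mulrC.
rewrite -[leLHS]expRK ler_ln ?posrE ?expR_gt0 ?rho1_gt0//.
have b0 := not_box_nsq (expR_ge0 _) bx.
have : expR (c / t) <= 1 + expR (c / t) ^+ 2.
  have := sqr_ge0 (expR (c / t) - 1); move: (expR _) (expR_gt0 (c / t)) => e e0; nra.
by move=> /le_trans; apply; rewrite /rho lerD2l ltW.
Qed.

Variable u : 'rV[R]_n -> R.
Hypothesis cu : continuous u.
Hypothesis su : stable_outside_compact u.

Let e0 : continuous (fun x => expR (u x)).
Proof. by apply: cont_comp => // x; exact: continuous_expR. Qed.

Lemma stability_csupp : exists2 S : R, 0 < S & forall psi, (forall k, CK k psi) -> csupp psi ->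
  (forall x, nsq x <= S -> psi x = 0) ->
  Int (fun x => expR (u x) * psi x ^+ 2) <= Int (fun x => lap psi x ^+ 2).
Proof.
(* The [+ 1] leaves a gap, so that the closed support of psi misses the closure of the ball. *)
have [r r0 st] := su; exists (r ^+ 2 + 1).
  by rewrite ltr_wpDl// sqr_ge0.
move=> psi cp sp p0.
have cp0 := Ck_continuous (cp 0).
have cn : continuous (@nsq R n) by exact: Ck_continuous (Ck_nsq 0).
have sub : closure [set x | psi x != 0] `<=` [set x | r ^+ 2 + 1 <= nsq x].
  have cl : closed [set x : 'rV[R]_n | r ^+ 2 + 1 <= nsq x].
    apply: (@closed_comp _ _ nsq [set z | r ^+ 2 + 1 <= z]); last exact: closed_ge.
    by move=> y _; exact: cn.
  rewrite [X in _ `<=` X](closure_id _).1//; apply: closure_subset => x /= px.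
  rewrite leNgt; apply/negP => /ltW/p0 px0; by rewrite px0 eqxx in px.
have tf : test_function (~` closure (eball r)) psi.
  split.
  - by move=> k; rewrite -CKE.
  - have [B hB] := sp; apply: (@subclosed_compact _ _ (box B)).
    + exact: closed_closure.
    + exact: compact_box.
    + rewrite [X in _ `<=` X](closure_id _).1; last first.
        by apply: compact_closed; [exact: norm_hausdorff|exact: compact_box].
      apply: closure_subset => x /= px; apply: contrapT => /hB px0; by rewrite px0 eqxx in px.
  - move=> x /sub/= rx xr.
    have : closure (eball r) `<=` [set y : 'rV[R]_n | nsq y <= r ^+ 2].
      have cl : closed [set y : 'rV[R]_n | nsq y <= r ^+ 2].
        apply: (@closed_comp _ _ nsq [set z | z <= r ^+ 2]); last exact: closed_le.
        by move=> y _; exact: cn.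
      rewrite [X in _ `<=` X](closure_id _).1//; apply: closure_subset => y /= yr.
      rewrite /eball/= in yr; rewrite -(sqr_sqrtr (nsq_ge0 y)) lerXn2r ?nnegrE ?sqrtr_ge0 ?(ltW r0)//.
      exact: ltW.
    by move=> /(_ _ xr)/= ; lra.
have EE : (fun x => `|laplacian psi x| ^+ 2) = (fun x => lap psi x ^+ 2).
  by apply/funext => x; rewrite real_normK ?num_real// laplacianE.
have := st psi tf; rewrite EE -!IntE ?lee_fin//.
-  apply: Itg_csupp.
    under eq_fun do rewrite expr2; apply: cont_mul; exact: continuous_laplacian (cp 2).
  by apply: (csupp_comp (h := fun z => z ^+ 2)); [rewrite expr0n|exact: csupp_laplacian].
- apply: Itg_csupp; first by apply: cont_mul => //; exact: Ck_continuous (CkX 2 (cp 0)).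
  by apply: csuppMr; apply: (csupp_comp (h := fun z => z ^+ 2)) => //; rewrite expr0n.
Qed.

End stability.

(** * Stability for decaying functions *)

Section decaying.
Context {R : realType} {n : nat}.
Hypothesis n5 : (5 <= n)%N.
Implicit Types (psi : 'rV[R]_n -> R) (x : 'rV[R]_n) (t c : R).

(** The pointwise bound makes the three integrals of [Rellich] finite, since [rw 1 cexp] is
    integrable. The class is there for the square root of the Newtonian kernel and for Newtonian
    potentials, which have no compact support. *)
Definition decaying psi := (forall k, CK k psi) /\
  exists C : R, forall x, psi x ^+ 2 * rw 1 (-2) x + gdot psi psi x * rw 1 (-1) x + lap psi x ^+ 2
    <= C * rw 1 (@cexp R n) x.

Lemma Itg_decaying psi : decaying psi ->
  [/\ Itg (fun x => psi x ^+ 2 * rw 1 (-2) x), Itg (fun x => gdot psi psi x * rw 1 (-1) x) &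
      Itg (fun x => lap psi x ^+ 2)].
Proof.
move=> [cp [C hC]].
have I1 : Itg (fun x : 'rV[R]_n => C * rw 1 (@cexp R n) x).
  by apply: ItgZ; have [] := @Int_rw_cexp R n 1 ltr01; rewrite expr1n.
have cp2 := CkX 2 (cp 0%N).
have cw a : CK 0 (rw (1 : R) a : 'rV[R]_n -> R) by exact: Ck_rw.
have h1 x : 0 <= psi x ^+ 2 * rw 1 (-2) x by rewrite mulr_ge0 ?sqr_ge0// ltW// rw_gt0.
have h2 x : 0 <= gdot psi psi x * rw 1 (-1) x by rewrite mulr_ge0 ?gdot_ge0// ltW// rw_gt0.
have h3 x := sqr_ge0 (lap psi x).
split; apply: (Itg_dom _ I1).
- by apply: continuous_Mf; apply: (@Ck_continuous _ _ 0); exact: CkM.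
- by move=> x; rewrite ger0_norm//; have := hC x; have := h2 x; have := h3 x; lra.
- apply: continuous_Mf; apply: cont_mul; last exact: Ck_continuous (cw _).
  exact: (continuous_gdot (cp 1%N) (cp 1%N)).
- by move=> x; rewrite ger0_norm//; have := hC x; have := h1 x; have := h3 x; lra.
- by apply: continuous_Mf; apply: (@Ck_continuous _ _ 0); apply: CkX; exact: Ck_laplacian (cp 2).
- by move=> x; rewrite ger0_norm//; have := hC x; have := h1 x; have := h2 x; lra.
Qed.

Lemma gdotB f g x : CK 1 f -> CK 1 g ->
  gdot (fun y => f y - g y) (fun y => f y - g y) x <= 2 * (gdot f f x + gdot g g x).
Proof.
move=> cf cg; rewrite /gdot -big_split/= mulr_sumr; apply: ler_sum => i _.
have -> : pd i (fun y => f y - g y) x = pd i f x - pd i g x.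
  rewrite -[in RHS]partialN// -partialD//; exact: CkN.
by move: (pd i f x) (pd i g x) => a b; have := sqr_ge0 (a + b); nra.
Qed.

Lemma decayingB f g : decaying f -> decaying g -> decaying (fun x => f x - g x).
Proof.
move=> [cf [C hC]] [cg [D hD]]; split; first by move=> k; exact: CkB.
exists (2 * (C + D)) => x; rewrite laplacianB//.
have hg := gdotB x (cf 1%N) (cg 1%N).
have {hC} := hC x; have {hD} := hD x.
have := rw_gt0 (-1) x (ltr01 : 0 < (1 : R)); have := rw_gt0 (-2) x (ltr01 : 0 < (1 : R)).
move: (lap f x) (lap g x) (gdot f f x) (gdot g g x) (gdot _ _ x) hg (f x) (g x)
  (rw _ _ x) (rw _ _ x) (rw _ _ x) => l1 l2 g1 g2 g3 hg a b w1 w2 w3 w10 w20 h1 h2.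
have := ler_wpM2r (ltW w20) hg.
have := sqr_ge0 (l1 + l2); have := mulr_ge0 (sqr_ge0 (a + b)) (ltW w10); nra.
Qed.

Lemma cut_lim t c (e : R) : 0 < t -> e < 1 ->
  exists2 B : R, 0 <= B & forall x : 'rV[R]_n, B <= nsq x -> e <= lcut t c x.
Proof.
move=> t0 /flat_lim[T hT]; exists (expR ((T - c) / t)); first exact: expR_ge0.
move=> x hx; apply: hT; rewrite /lnr -lerBlDr -ler_pdivrMl// mulrC.
by rewrite -[leLHS]expRK ler_ln ?posrE ?expR_gt0 ?rho1_gt0// (le_trans hx)// nsq_le_rho.
Qed.

(** The offset k + 1 pushes the argument of the flat function to infinity while the slope -1/(k + 1)
    tends to 0: compactly supported cutoffs that exhaust the space at vanishing cost. *)
Lemma cvg_cut_out x : lcut (- (k.+1%:R^-1 : R)) k.+1%:R x @[k --> \oo] --> (1 : R).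
Proof.
have L0 : 0 <= ln (rho 1 x) by rewrite ln_ge0// lerDl nsq_ge0.
apply/cvgrPdist_le => e e0.
have [T hT] := @flat_lim R (1 - e) ltac:(lra).
near=> k.
rewrite ger0_norm ?subr_ge0 ?cut_le1// lerBlDr -lerBlDl; apply: hT.
rewrite /lnr mulNr addrC.
have : k.+1%:R^-1 * ln (rho 1 x) <= ln (rho 1 x).
  by rewrite ler_piMl// invf_le1// ler1n.
have : T + ln (rho 1 x) <= k.+1%:R.
  have : T + ln (rho 1 x) <= k%:R by near: k; exact: nbhs_infty_ger.
  by move=> /le_trans; apply; rewrite ler_nat.
move: (k.+1%:R) (k.+1%:R^-1 * _) => a b; lra.
Unshelve. all: by end_near.
Qed.

Variable u : 'rV[R]_n -> R.
Hypothesis cu : continuous u.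
Hypothesis su : stable_outside_compact u.

Let e0 : continuous (fun x => expR (u x)).
Proof. by apply: cont_comp => // x; exact: continuous_expR. Qed.

(** Stability requires test functions that vanish near a ball. A slow inner cutoff removes this
    restriction at the price of a factor 1 + e. *)
Lemma stability_cut (e : R) : 0 < e -> exists t c, 0 < t /\
  forall psi, (forall k, CK k psi) -> csupp psi ->
  Int (fun x => expR (u x) * (lcut t c x * psi x) ^+ 2) <= (1 + e) * Int (fun x => lap psi x ^+ 2).
Proof.
move=> e_gt0; have [S S0 st] := stability_csupp cu su.
(* The loss is t from Young's inequality plus t [cutD] times terms that [Rellich] bounds by the main
   one, so t (1 + [cutD]) <= e is what is required. *)
pose t := Num.min 1 (e / (1 + @cutD R n)).
have D0 := @cutD_ge0 R n.
have t0 : 0 < t by rewrite lt_min ltr01/= divr_gt0//; lra.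
have t1 : t <= 1 by rewrite ge_min lexx.
have te : t * (1 + @cutD R n) <= e.
  by rewrite -ler_pdivlMr ?ge_min ?lexx ?orbT//; lra.
exists t, (- (t * ln (1 + S))); split => // psi cp sp.
have S1 : 0 < 1 + S by lra.
have cc k : CK k (fun x => lcut t (- (t * ln (1 + S))) x * psi x) by apply: CkM => //; exact: Ck_cut.
apply: le_trans (st _ cc _ _) _.
- exact: csuppMr.
- move=> x nx; rewrite /lcut flat_le0 ?mul0r// /lnr subr_le0 ler_pM2l//.
  by rewrite ler_ln ?posrE ?rho1_gt0// lerD2l.
have cp1 := cp 1%N; have cp2 := cp 2%N; have cp0 := Ck_continuous (cp 0%N).
have cw a : continuous (rw (1 : R) a : 'rV[R]_n -> R) by exact: cont_rw.
have sp2 : csupp (fun x => psi x ^+ 2) by apply: (csupp_comp (h := fun z => z ^+ 2)) => //; rewrite expr0n.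
have I1 : Itg (fun x => psi x ^+ 2 * rw 1 (-2) x).
  by apply: Itg_csupp; [apply: cont_mul => //; exact: Ck_continuous (CkX 2 cp2)|exact: csuppM].
have I2 : Itg (fun x => gdot psi psi x * rw 1 (-1) x).
  apply: Itg_csupp; [apply: cont_mul => //; exact: continuous_gdot|apply: csuppM; exact: csupp_gdot].
have IL f : CK 2 f -> csupp f -> Itg (fun x => lap f x ^+ 2).
  move=> cf sf; apply: Itg_csupp; first exact: Ck_continuous (CkX 2 (@Ck_laplacian _ _ 0 _ cf)).
  by apply: (csupp_comp (h := fun z => z ^+ 2)); [rewrite expr0n|exact: csupp_laplacian].
have I3 := IL _ cp2 sp.
have I4 : Itg (fun x => lap (fun y => lcut t (- (t * ln (1 + S))) y * psi y) x ^+ 2).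
  by apply: IL => //; exact: csuppMr.
have RE := Rellich n5 cp2 sp.
apply: (@le_trans _ _ (Int (fun x => (1 + t) * lap psi x ^+ 2 +
  @cutD R n * t * (gdot psi psi x * rw 1 (-1) x + psi x ^+ 2 * rw 1 (-2) x)))).
  apply: Int_le => //; first by apply: ItgD; apply: ItgZ => //; exact: ItgD.
  move=> x; have := @laplacian_cutM R n t (- (t * ln (1 + S))) psi x.
  by rewrite ger0_norm ?(ltW t0)//; apply.
rewrite IntD ?IntZ ?IntD//; [|exact: ItgD|exact: ItgZ|by apply: ItgZ; exact: ItgD].
have P1 : 0 <= Int (fun x => psi x ^+ 2 * rw 1 (-2) x).
  by apply: Int_ge0 => x; rewrite mulr_ge0 ?sqr_ge0// ltW// rw_gt0.
have P2 : 0 <= Int (fun x => gdot psi psi x * rw 1 (-1) x).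
  by apply: Int_ge0 => x; rewrite mulr_ge0 ?gdot_ge0// ltW// rw_gt0.
have P3 : 0 <= Int (fun x => lap psi x ^+ 2) by apply: Int_ge0 => x; exact: sqr_ge0.
move: (Int _) (Int _) (Int _) P1 P2 P3 RE => a b l a0 b0 l0 RE.
move: (cutD) D0 te => D D0 te.
have : D * t * (b + l) <= D * t * a by rewrite ler_wpM2l ?mulr_ge0 ?(ltW t0)//; lra.
have : (t * (1 + D)) * a <= e * a by rewrite ler_wpM2r.
lra.
Qed.

Lemma stability_decaying (e : R) : 0 < e -> exists t c, 0 < t /\
  forall psi, decaying psi -> Itg (fun x => expR (u x) * (lcut t c x * psi x) ^+ 2) /\
  Int (fun x => expR (u x) * (lcut t c x * psi x) ^+ 2) <= (1 + e) * Int (fun x => lap psi x ^+ 2).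
Proof.
move=> e_gt0; have [t [c [t0 st]]] := stability_cut e_gt0; exists t, c; split => // psi dpsi.
have e1 : 0 <= 1 + e by lra.
have [cp _] := dpsi; have [I1 I2 I3] := Itg_decaying dpsi.
pose A := Int (fun x => lap psi x ^+ 2).
pose B := Int (fun x => gdot psi psi x * rw 1 (-1) x + psi x ^+ 2 * rw 1 (-2) x).
have A0 : 0 <= A by apply: Int_ge0 => x; exact: sqr_ge0.
have B0 : 0 <= B.
  by apply: Int_ge0 => x; rewrite addr_ge0// mulr_ge0 ?gdot_ge0 ?sqr_ge0 ?(ltW (rw_gt0 _ _ ltr01)).
have D0 := @cutD_ge0 R n.
have cc (tau s : R) k : CK k (fun x => lcut tau s x * psi x) by apply: CkM => //; exact: Ck_cut.
have bd k : Int (fun x => expR (u x) * (lcut t c x * (lcut (- k.+1%:R^-1) k.+1%:R x * psi x)) ^+ 2) <=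
  (1 + e) * (A + k.+1%:R^-1 * (A + @cutD R n * B)).
  have k0 : 0 < k.+1%:R^-1 :> R by rewrite invr_gt0 ltr0n.
  have k1 : k.+1%:R^-1 <= 1 :> R by rewrite invf_le1 ?ltr0n// ler1n.
  have sc : csupp (fun x => lcut (- k.+1%:R^-1) k.+1%:R x * psi x) by apply: csuppM; exact: csupp_cut.
  apply: le_trans (st _ (cc _ _) sc) _; rewrite ler_wpM2l//.
  apply: (@le_trans _ _ (Int (fun x => (1 + k.+1%:R^-1) * lap psi x ^+ 2 +
    @cutD R n * k.+1%:R^-1 * (gdot psi psi x * rw 1 (-1) x + psi x ^+ 2 * rw 1 (-2) x)))).
    apply: Int_le.
    - apply: Itg_csupp; first exact: Ck_continuous (CkX 2 (@Ck_laplacian _ _ 0 _ (cc _ _ 2%N))).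
      by apply: (csupp_comp (h := fun z => z ^+ 2)); [rewrite expr0n|exact: csupp_laplacian].
    - by apply: ItgD; apply: ItgZ => //; exact: ItgD.
    - move=> x; have := @laplacian_cutM R n (- k.+1%:R^-1) k.+1%:R psi x.
      by rewrite normrN ger0_norm ?(ltW k0)//; apply.
  rewrite IntD ?IntZ -/A -/B//; [|exact: ItgD|exact: ItgZ|by apply: ItgZ; exact: ItgD].
  by rewrite le_eqVlt; apply/orP; left; apply/eqP; ring.
have cs (x : 'rV[R]_n) : expR (u x) * (lcut t c x * (lcut (- k.+1%:R^-1) k.+1%:R x * psi x)) ^+ 2
  @[k --> \oo] --> expR (u x) * (lcut t c x * psi x) ^+ 2.
  apply: cvgM; first exact: cvg_cst.
  have L : lcut t c x * (lcut (- k.+1%:R^-1) k.+1%:R x * psi x) @[k --> \oo] --> lcut t c x * psi x.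
    apply: cvgM; first exact: cvg_cst.
    by rewrite -[X in _ --> X]mul1r; apply: cvgM; [exact: cvg_cut_out|exact: cvg_cst].
  by rewrite expr2; under eq_fun do rewrite expr2; exact: cvgM.
have Ik k : Itg (fun x => expR (u x) * (lcut t c x * (lcut (- k.+1%:R^-1) k.+1%:R x * psi x)) ^+ 2).
  apply: Itg_csupp.
    apply: cont_mul => //; apply: (@Ck_continuous _ _ 0); apply: CkX; apply: CkM; last exact: cc.
    exact: Ck_cut.
  apply: csuppMr; apply: (csupp_comp (h := fun z => z ^+ 2)); first by rewrite expr0n.
  by apply: csuppMr; apply: csuppM; apply: csupp_cut; rewrite invr_gt0 ltr0n.
(* Fatou's lemma is applied to the tail starting at m, where the error is at most 1/(m + 1) times a
   constant; letting m tend to infinity afterwards recovers the sharp constant. *)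
have F m : Itg (fun x => expR (u x) * (lcut t c x * psi x) ^+ 2) /\
   Int (fun x => expR (u x) * (lcut t c x * psi x) ^+ 2) <= (1 + e) * (A + m.+1%:R^-1 * (A + @cutD R n * B)).
  apply: (@Int_fatou _ _ (fun k x => expR (u x) * (lcut t c x * (lcut (- (k + m).+1%:R^-1) (k + m).+1%:R x * psi x)) ^+ 2)).
  - by move=> k; exact: Ik.
  - by move=> k x; rewrite mulr_ge0 ?expR_ge0// sqr_ge0.
  - by move=> x; have := cs x; rewrite -(cvg_shiftn m).
  - move=> k; apply: le_trans (bd (k + m)%N) _.
    rewrite ler_wpM2l// lerD2l ler_wpM2r ?(addr_ge0 A0 (mulr_ge0 D0 B0))//.
    by rewrite lef_pV2 ?posrE ?ltr0n// ler_nat ltnS leq_addl.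
split; first by have [] := F 0%N.
have L : (1 + e) * (A + m.+1%:R^-1 * (A + @cutD R n * B)) @[m --> \oo] --> (1 + e) * A.
  apply: cvgM; first exact: cvg_cst.
  rewrite -[X in _ --> X]addr0; apply: cvgD; first exact: cvg_cst.
  rewrite -[X in _ --> X](mul0r (A + @cutD R n * B)); apply: cvgM; last exact: cvg_cst.
  exact: cvg_harmonic.
apply: (cvgr_to_ge L); near=> m; by have [] := F m.
Unshelve. all: by end_near.
Qed.

End decaying.

(** * Superharmonic kernels *)

Section bounded.
Context {R : realType} {n : nat}.
Implicit Types (f g : 'rV[R]_n -> R) (x : 'rV[R]_n).

Lemma box_bounded f (B : R) : continuous f -> 0 <= B ->
  exists2 C : R, 0 <= C & forall x, box B x -> `|f x| <= C.
Proof.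
move=> cf B0.
have cf' : {within box B, continuous (fun x => `|f x|)}.
  by apply: continuous_subspaceT => x; apply: continuous_comp; [exact: cf|exact: norm_continuous].
have [c _ hc] : exists2 c, c \in box B & forall t, t \in box B -> `|f t| <= `|f c|.
  apply: EVT_max_rV cf'; first by exists 0 => i; rewrite mxE normr0.
  exact: compact_box.
by exists `|f c| => // x bx; apply: hc; rewrite inE.
Qed.

Lemma not_box_enorm (M : R) x : ~ box (Num.max M 0) x -> M < enorm x.
Proof.
have M0 : 0 <= Num.max M 0 by rewrite le_max lexx orbT.
move=> /(not_box_nsq M0); rewrite enormE => h.
have h0 := sqrtr_ge0 (nsq x); rewrite -(sqr_sqrtr (nsq_ge0 x)) in h.
have : Num.max M 0 < Num.sqrt (nsq x) by rewrite -(ltr_pXn2r (isT : (0 < 2)%N)) ?nnegrE.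
by apply: le_lt_trans; rewrite le_max lexx.
Qed.

Lemma vanishes_bounded f : continuous f -> vanishes_at_infinity f ->
  exists2 C : R, 0 < C & forall x, `|f x| <= C.
Proof.
move=> cf /(_ 1 ltr01)[M hM].
have M0 : 0 <= Num.max M 0 by rewrite le_max lexx orbT.
have [C C0 hC] := box_bounded cf M0; exists (C + 1) => [|x]; first lra.
have [bx|bx] := pselect (box (Num.max M 0) x); first by have := hC _ bx; lra.
by have := hM x (not_box_enorm bx); lra.
Qed.

Lemma vanishes_csupp f (e : R) : 0 < e -> vanishes_at_infinity f ->
  exists B : R, forall x, ~ box B x -> f x <= e.
Proof.
move=> e0 /(_ e e0)[M hM].
exists (Num.max M 0) => x bx; apply: le_trans (ler_norm _) (ltW _).
exact: hM (not_box_enorm bx).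
Qed.

End bounded.

Section kernel.
Context {R : realType} {n : nat}.
Implicit Types (c a : R) (x : 'rV[R]_n).

(** With this exponent [rw c gexp] is the Newtonian kernel |x|^(2 - n) smoothed at scale sqrt c. *)
Definition gexp : R := - (n%:R - 2) / 2.

Lemma cexpE : @cexp R n = gexp - 2.
Proof. by rewrite /cexp /gexp; field. Qed.

Lemma nsq_rw c a x : 0 < c -> nsq x * rw c (a - 1) x <= rw c a x.
Proof.
move=> c0; have {2}-> : a = (a - 1) + 1 :> R by ring.
rewrite [rw c (a - 1 + 1) x]rwD// rw1// mulrC ler_wpM2l ?(ltW (rw_gt0 _ _ c0))//.
by rewrite /rho lerDr ltW.
Qed.

Lemma rw_antil c a x : 1 <= c -> a <= 0 -> rw c a x <= rw 1 a x.
Proof.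
move=> c1 a0; have c0 : 0 < c by lra.
rewrite -[a]opprK; have : 0 <= - a by rewrite oppr_ge0.
move: (- a) => b b0; rewrite !rwN lef_pV2 ?posrE ?rw_gt0//.
by apply: ge0_ler_powR; rewrite // ?nnegrE ?(ltW (rho_gt0 _ _))// lerD2r.
Qed.

Lemma rw_antiM (M : R) a x : 1 <= M -> a <= -1 -> rw (M ^+ 2) a x <= M ^- 2.
Proof.
move=> M1 a1; have M2 : 1 <= M ^+ 2 by rewrite expr_ge1//; lra.
apply: le_trans (rw_le _ M2 a1) _; rewrite rwN rw1; last by lra.
by rewrite lef_pV2 ?posrE ?rho_gt0 ?lerDl ?nsq_ge0//; lra.
Qed.

Lemma rw_mul c a b x : 0 < c -> rw c a x * rw c b x = rw c (a + b) x.
Proof. by move=> c0; rewrite rwD. Qed.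

(** For a = 1 - n/2 one has 4 a (a - 1) = - 2 a n, so the |x|^2 terms cancel in 2 a n (c + |x|^2) +
    4 a (a - 1) |x|^2, which leaves 2 a n c. *)
Lemma laplacian_G c x : 0 < c ->
  lap (rw c gexp) x = - (n%:R * (n%:R - 2) * c * rw c (@cexp R n) x).
Proof.
move=> c0; rewrite laplacian_rw// cexpE.
have -> : gexp - 1 = (gexp - 2) + 1 :> R by ring.
rewrite rwD// rw1// /rho /gexp.
by move: (rw _ _ _) (nsq x) => w q; field.
Qed.

End kernel.
Arguments gexp {R n}.

Section sqrtG.
Context {R : realType} {n : nat}.
Hypothesis n5 : (5 <= n)%N.
Implicit Types (x : 'rV[R]_n) (c : R).

Let a : R := @gexp R n / 2.

Lemma gexp_le1 : @gexp R n <= -1.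
Proof.
have : 5 <= n%:R :> R by rewrite ler_nat.
by rewrite /gexp; lra.
Qed.

Definition lapC : R := `|2 * a * n%:R| + `|4 * a * (a - 1)|.

Lemma lap_sqrtG c x : 0 < c -> lap (rw c a) x ^+ 2 <= lapC ^+ 2 * rw c (@cexp R n) x.
Proof.
move=> c0; rewrite laplacian_rw//.
have -> : rw c (@cexp R n) x = rw c (a - 1) x ^+ 2.
  by rewrite expr2 rw_mul// cexpE /a; congr rw; field.
rewrite -exprMn; apply: ler_sqr_norm.
have h1 := nsq_rw (a - 1) x c0.
have -> : a - 2 = a - 1 - 1 by ring.
have h2 : 0 <= nsq x * rw c (a - 1 - 1) x by rewrite mulr_ge0 ?nsq_ge0 ?(ltW (rw_gt0 _ _ c0)).
have h3 := rw_gt0 (a - 1) x c0.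
apply: le_trans (ler_normD _ _) _; rewrite /lapC [X in _ <= X]mulrDl.
rewrite normrM (gtr0_norm h3) -[_ * nsq x * _]mulrA [X in _ + X <= _]normrM (ger0_norm h2).
by rewrite lerD2l ler_wpM2l.
Qed.

Lemma decaying_sqrtG c : 1 <= c -> decaying (rw c a : 'rV[R]_n -> R).
Proof.
move=> c1; have c0 : 0 < c by lra.
have g1 := gexp_le1.
split; first by move=> k; exact: Ck_rw.
exists (1 + 4 * a ^+ 2 + lapC ^+ 2) => x.
have x1 : rw c a x ^+ 2 * rw 1 (-2) x <= rw 1 (@cexp R n) x.
  rewrite expr2 rw_mul// cexpE [rw 1 (gexp - 2) x]rwD//.
  apply: ler_wpM2r; first exact: ltW (rw_gt0 _ _ ltr01).
  have -> : a + a = @gexp R n by rewrite /a; field.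
  by apply: rw_antil => //; lra.
have x2 : gdot (rw c a) (rw c a) x * rw 1 (-1) x <= 4 * a ^+ 2 * rw 1 (@cexp R n) x.
  rewrite gdot_rw// rw_mul//.
  have -> : 4 * a * a * nsq x * rw c (a - 1 + (a - 1)) x = 4 * a ^+ 2 * (nsq x * rw c ((@gexp R n - 1) - 1) x).
    by rewrite (_ : a - 1 + (a - 1) = (@gexp R n - 1) - 1 :> R); [move: (rw _ _ _) => w; ring|rewrite /a; field].
  rewrite -mulrA; apply: ler_wpM2l; first exact: mulr_ge0 (sqr_ge0 a).
  have -> : @cexp R n = @gexp R n - 1 + -1 by rewrite cexpE; ring.
  rewrite [rw 1 (@gexp R n - 1 + -1) x]rwD//; apply: ler_wpM2r; first exact: ltW (rw_gt0 _ _ ltr01).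
  apply: le_trans (nsq_rw _ _ c0) _; apply: rw_antil => //; lra.
have x3 : lap (rw c a) x ^+ 2 <= lapC ^+ 2 * rw 1 (@cexp R n) x.
  apply: le_trans (lap_sqrtG _ c0) _; rewrite ler_wpM2l ?sqr_ge0//.
  by apply: rw_antil => //; rewrite ltW// cexp_lt0.
rewrite !mulrDl mul1r; lra.
Qed.

End sqrtG.

Section kernel_estimates.
Context {R : realType} {n : nat}.
Hypothesis n5 : (5 <= n)%N.
Implicit Types (x : 'rV[R]_n) (c M : R).
Variables (u v : 'rV[R]_n -> R).
Hypotheses (cu : CK 2 u) (cv : CK 2 v).
Hypothesis lv : forall x, lap v x = - expR (u x).
Hypothesis v0 : forall x, 0 < v x.
Hypothesis vi : vanishes_at_infinity v.
Hypothesis su : stable_outside_compact u.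

Let e0 : continuous (fun x => expR (u x)).
Proof. by apply: cont_comp; [exact: Ck_continuous cu|move=> x; exact: continuous_expR]. Qed.

(** Stability is tested with the square root of the smoothed Newtonian kernel: its squared Laplacian
    is at most a multiple of [rw (M^2) cexp], whose mass is O(M^-2). *)
Lemma G_expu_le : exists2 C : R, 0 <= C & forall M, 1 <= M ->
  Itg (fun x => rw (M ^+ 2) (@gexp R n) x * expR (u x)) /\
  Int (fun x => rw (M ^+ 2) (@gexp R n) x * expR (u x)) <= C * M ^- 2.
Proof.
have [t [c [t0 st]]] := stability_decaying n5 (Ck_continuous cu) su (ltr01 : 0 < (1 : R)).
have [B B0 hB] := @cut_lim R n t c (2^-1) t0 ltac:(lra).
have B1 : 0 <= B + 1 by lra.
have [E E0 hE] := box_bounded e0 B1.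
have [Ib Vb] := @Int_ibox R n _ B1.
pose L := @lapC R n ^+ 2.
exists (4 * (2 * (L * (3 * 4 ^+ n))) + E * (2 * (B + 1)) ^+ n).
  have L0 : 0 <= L by exact: sqr_ge0.
  have Z0 : 0 <= (2 * (B + 1)) ^+ n by rewrite exprn_ge0// mulr_ge0.
  have Y0 : 0 <= (4 : R) ^+ n by rewrite exprn_ge0.
  by apply: addr_ge0 (mulr_ge0 E0 Z0); do 2 apply: mulr_ge0 => //; apply: mulr_ge0 => //; exact: mulr_ge0.
move=> M M1; have M2 : 1 <= M ^+ 2 by rewrite expr_ge1//; lra.
have M0 : 0 < M by lra.
have M20 : 0 < M ^+ 2 by rewrite exprn_gt0.
have dG := decaying_sqrtG n5 M2.
have [I1 L1] := st _ dG; have [_ _ I2] := Itg_decaying dG.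
have [I3 L3] := @Int_rw_cexp R n M M0.
have L2 : Int (fun x => lap (rw (M ^+ 2) ((@gexp R n) / 2)) x ^+ 2) <= L * (3 * 4 ^+ n * M ^- 2).
  apply: le_trans (ler_wpM2l _ L3); last by rewrite sqr_ge0.
  rewrite -IntZ//; apply: Int_le => //; first exact: ItgZ.
  by move=> x; exact: lap_sqrtG.
have Gc : continuous (fun x => rw (M ^+ 2) (@gexp R n) x * expR (u x)) by apply: cont_mul => //; exact: cont_rw.
(* Off the box the inner cutoff is at least 1/2, whence the factor 4. In the box e^u <= E and the
   kernel is at most M^-2 because gexp <= -1, so the box contributes at the same order. *)
have pw x : rw (M ^+ 2) (@gexp R n) x * expR (u x) <=
   4 * (expR (u x) * (lcut t c x * rw (M ^+ 2) ((@gexp R n) / 2) x) ^+ 2) + E * M ^- 2 * ibox (B + 1) x.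
  have eu := expR_gt0 (u x); have rG := rw_gt0 (@gexp R n) x M20.
  have Gs : rw (M ^+ 2) ((@gexp R n) / 2) x ^+ 2 = rw (M ^+ 2) (@gexp R n) x.
    by rewrite expr2 rw_mul//; congr rw; field.
  rewrite exprMn Gs iboxP.
  have ch0 := sqr_ge0 (lcut t c x).
  case: asboolP => bx.
    rewrite mulr1; apply: (@le_trans _ _ (E * M ^- 2)).
      rewrite mulrC ler_pM ?(ltW eu) ?(ltW rG)//.
        by have := hE _ bx; rewrite gtr0_norm.
      by apply: rw_antiM => //; exact: gexp_le1.
    rewrite lerDr; apply: mulr_ge0 => //; apply: mulr_ge0 (ltW eu) _; exact: mulr_ge0 ch0 (ltW rG).
  rewrite mulr0 addr0.
  have nB : B <= nsq x.
    have := not_box_nsq B1 bx; move: (nsq x) => q; nra.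
  have := hB _ nB; move: (lcut t c x) => ch h.
  have h2 : 1 <= 4 * ch ^+ 2 by nra.
  rewrite [leLHS]mulrC [X in _ <= X]mulrCA -subr_ge0 -mulrBr mulr_ge0 ?(ltW eu)//.
  by rewrite mulrA -[X in _ - X]mul1r -mulrBl mulr_ge0 ?(ltW rG)//; lra.
have Id : Itg (fun x => 4 * (expR (u x) * (lcut t c x * rw (M ^+ 2) ((@gexp R n) / 2) x) ^+ 2) + E * M ^- 2 * ibox (B + 1) x).
  by apply: ItgD; apply: ItgZ.
have IG : Itg (fun x => rw (M ^+ 2) (@gexp R n) x * expR (u x)).
  apply: Itg_dom Id _; first exact: continuous_Mf.
  by move=> x; rewrite ger0_norm// mulr_ge0 ?expR_ge0 ?(ltW (rw_gt0 _ _ M20)).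
split=> //; apply: le_trans (Int_le IG Id pw) _.
rewrite IntD ?IntZ ?Vb//; [|exact: ItgZ|exact: ItgZ].
move: L1 L2; move: (Int _) (Int _) (M ^- 2) (4 ^+ n) ((2 * _) ^+ n) => p q m z y L1 L2.
have -> : (4 * (2 * (L * (3 * z))) + E * y) * m = 4 * ((1 + 1) * (L * (3 * z * m))) + E * m * y by ring.
rewrite lerD2r ler_pM2l//; apply: le_trans L1 _; rewrite ler_pM2l//.
Qed.

(** A smooth convex substitute for the positive part: it vanishes for w <= 0, its derivative h' lies
    in [0, 1], and its second derivative is [flat 3]. *)
Let h (w : R) := w * flat 0 w.
Let h' (w : R) := flat 0 w + flat 1 w.

Let isd_h w : is_derive w (1 : R) h (h' w).
Proof.
suff <- : 1 * flat 0 w + w * flat 2 w = h' w by exact: isdM (is_derive_id _ _) (isd_flat0 _).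
by rewrite /h' mul1r -flatS.
Qed.

Let isd_h' w : is_derive w (1 : R) h' (flat 3 w).
Proof.
suff <- : flat 2 w + (flat 3 w - 1%:R * flat 2 w) = flat 3 w by exact: isdD (isd_flat0 _) (isd_flat 1 _).
by rewrite mul1r addrC subrK.
Qed.

Let h'_le1 w : h' w <= 1.
Proof.
rewrite /h' /flat; case: ifPn => w0; last by rewrite addr0.
rewrite expr0 expr1 invr1 -mulrDl expRN ler_pdivrMr ?expR_gt0// mul1r.
by rewrite expR_ge1Dx.
Qed.

Let h_ge0 w : 0 <= h w.
Proof.
rewrite /h; have [w0|w0] := ltP 0 w; last by rewrite flat_le0// mulr0.
by rewrite mulr_ge0 ?flat_ge0// ltW.
Qed.

(** Formally this is Green's formula for v and the Newtonian kernel. To have compact support v is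
    replaced by d h((v - d)/d), which vanishes where v <= d, hence far away. Convexity of h and h'
    <= 1 keep its Laplacian above - e^u, and it converges to v as d tends to 0. *)
Lemma kernel_v_le c : 0 < c -> Itg (fun x => rw c (@gexp R n) x * expR (u x)) ->
  Itg (fun x => rw c (@cexp R n) x * v x) /\
  n%:R * (n%:R - 2) * c * Int (fun x => rw c (@cexp R n) x * v x) <=
    Int (fun x => rw c (@gexp R n) x * expR (u x)).
Proof.
move=> c0 IG.
pose d k : R := k.+1%:R^-1.
have d0 k : 0 < d k by rewrite invr_gt0 ltr0n.
pose w k x := (d k)^-1 * (v x - d k).
have cw k : CK 2 (w k) by apply: CkZ; apply: CkB => //; exact: Ck_cst.
have lw k x : lap (w k) x = - ((d k)^-1 * expR (u x)).
  rewrite laplacianZ; last by apply: CkB => //; exact: Ck_cst.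
  by rewrite laplacianB// ?laplacian_cst ?subr0 ?lv ?mulrN//; exact: Ck_cst.
have Ch k : CK 2 (fun x => h (w k x)) by apply: CkM => //; exact: Ck_flat.
have sh k : csupp (fun x => d k * h (w k x)).
  have [B hB] := vanishes_csupp (d0 k) vi; exists B => x /hB vx.
  rewrite /h flat_le0 ?mulr0// /w pmulr_rle0 ?invr_gt0// subr_le0//.
have lh k x : - expR (u x) <= lap (fun y => d k * h (w k y)) x.
  rewrite laplacianZ// (laplacian_comp (p := h) (p' := h') (p'' := flat 3) (cw k) (fun=> isd_h _) (isd_h' _)) lw.
  have H1 := h'_le1 (w k x).
  have H2 : 0 <= h' (w k x) by rewrite addr_ge0 ?flat_ge0.
  have H3 : 0 <= flat 3 (w k x) * gdot (w k) (w k) x by rewrite mulr_ge0 ?flat_ge0 ?gdot_ge0.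
  have := mulr_ge0 (ltW (d0 k)) H3; have := ler_wpM2r (expR_ge0 (u x)) H1.
  move: (flat _ _ * _) (h' _) (expR _) (d k) (d0 k) => A b e dk dk0.
  have -> : dk * (A + b * - (dk^-1 * e)) = dk * A - b * e by field; rewrite gt_eqF.
  lra.
pose N : R := n%:R * (n%:R - 2) * c.
have n5' : 5 <= n%:R :> R by rewrite ler_nat.
have N0 : 0 < N by rewrite !mulr_gt0//; lra.
have Ik k : Itg (fun x => rw c (@cexp R n) x * (d k * h (w k x))).
  apply: Itg_csupp; last exact: csuppMr.
  by apply: cont_mul; [exact: cont_rw|exact: Ck_continuous (CkZ _ (Ch k))].
have bd k : Int (fun x => rw c (@cexp R n) x * (d k * h (w k x))) <= N^-1 * Int (fun x => rw c (@gexp R n) x * expR (u x)).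
  rewrite mulrC ler_pdivlMr// mulrC -IntZ//.
  have GR := Green (Ck_rw 2 (@gexp R n) c0) (CkZ (d k) (Ch k)) (sh k).
  have -> : (fun x => N * (rw c (@cexp R n) x * (d k * h (w k x)))) =
    (fun x => - (d k * h (w k x) * lap (rw c (@gexp R n)) x)).
    by apply/funext => x; rewrite laplacian_G// -/N; ring.
  have IA : Itg (fun x => d k * h (w k x) * lap (rw c (@gexp R n)) x).
    by apply: Itg_csupp; [apply: cont_mul; [exact: Ck_continuous (CkZ _ (Ch k))|exact: continuous_laplacian (Ck_rw _ _ c0)]|exact: csuppM].
  have IB : Itg (fun x => lap (fun y => d k * h (w k y)) x * rw c (@gexp R n) x).
    by apply: Itg_csupp; [apply: cont_mul; [exact: continuous_laplacian (CkZ _ (Ch k))|exact: cont_rw]|apply: csuppM; exact: csupp_laplacian].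
  rewrite IntN// GR -IntN//; apply: Int_le => //; first exact: ItgN.
  move=> x; rewrite -mulNr mulrC ler_pM2l ?rw_gt0//.
  by rewrite lerNl.
have [|x|IK LK] := @Int_fatou _ _ (fun k x => rw c (@cexp R n) x * (d k * h (w k x)))
  (fun x => rw c (@cexp R n) x * v x) _ Ik _ _ bd.
- by move=> k x; exact: mulr_ge0 (ltW (rw_gt0 _ _ c0)) (mulr_ge0 (ltW (d0 k)) (h_ge0 _)).
- apply: cvgM; first exact: cvg_cst.
  have E k : d k * h (w k x) = (v x - d k) * flat 0 (w k x).
    by rewrite /h /w !mulrA divff ?gt_eqF// mul1r.
  under eq_fun do rewrite E.
  suff A : (v x - d k) @[k --> \oo] --> v x /\ flat 0 (w k x) @[k --> \oo] --> (1 : R).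
    have [A1 A2] := A; have := cvgM A1 A2; rewrite mulr1; exact.
  split.
    have := cvgB (cvg_cst (v x)) (@cvg_harmonic R); rewrite subr0; exact.
  apply/cvgrPdist_le => e e_gt0.
  have [T hT] := @flat_lim R (1 - e) ltac:(lra).
  near=> k.
  rewrite ger0_norm ?subr_ge0 ?flat_le1// lerBlDr -lerBlDl; apply: hT.
  rewrite /w /d invrK mulrBr divff ?pnatr_eq0//.
  rewrite lerBrDr -ler_pdivrMr//.
  have : (T + 1) / v x <= k%:R by near: k; exact: nbhs_infty_ger.
  by move=> /le_trans; apply; rewrite ler_nat.
split=> //; rewrite -/N mulrC -ler_pdivlMr// mulrC.
exact: LK.
Unshelve. all: by end_near.
Qed.

End kernel_estimates.

(** * Convolution *)

Section Int_parameter.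
Context {R : realType} {n : nat}.

Lemma isd_Int (f g : R -> 'rV[R]_n -> R) (G : 'rV[R]_n -> R) (a r : R) : 0 < r ->
  (forall s, a - r < s < a + r -> Itg (f s)) ->
  (forall s x, a - r < s < a + r -> is_derive s (1 : R) (f ^~ x) (g s x)) ->
  Itg G -> (forall s x, a - r < s < a + r -> `|g s x| <= G x) ->
  is_derive a (1 : R) (fun s => Int (f s)) (Int (g a)).
Proof.
move=> r0 If df IG gG.
have aI : a - r < a < a + r by apply/andP; split; lra.
have G0 x : 0 <= G x by apply: le_trans (gG a x aI).
have H s (y : n.-tuple (measurableTypeR R)) : a - r < s < a + r ->
    partial1of2 (fun s y => f s (row_of_tuple y)) s y = g s (row_of_tuple y).
  by move=> sI; rewrite partial1of2E; have [_ <-] := df s (row_of_tuple y) sI.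
have inI s : [set` `]a - r, a + r[%R] s -> a - r < s < a + r by rewrite /= in_itv.
have := @cvg_differentiation_under_integral R _ _ (@lebesgue_tuple R n)
  (fun s y => f s (row_of_tuple y)) setT measurableT a (a - r) (a + r).
move=> /(_ _ _ _ (G \o row_of_tuple)) D.
have {D} C : h^-1 *: (Int (f (h + a)) - Int (f a)) @[h --> 0^'] --> Int (g a).
  have -> : Int (g a) = (\int[@lebesgue_tuple R n]_(y in setT)
      partial1of2 (fun s y => f s (row_of_tuple y)) a y)%R.
    by rewrite /Int /integral_Rn /Rintegral; congr fine; apply: eq_integral => y _; rewrite H.
  apply: D => //.
  - by move=> s y /inI sI _; have [] := df s (row_of_tuple y) sI.
  - by move=> y; exact: G0.
  - by move=> s y /inI sI _; rewrite H//; exact: gG.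
split.
  apply/cvg_ex; exists (Int (g a)); under eq_fun do rewrite scaler1; exact: C.
by apply/cvg_lim => //; under eq_fun do rewrite scaler1; exact: C.
Qed.

End Int_parameter.

Section convolution.
Context {R : realType} {n : nat}.
Implicit Types (H f : 'rV[R]_n -> R) (x y : 'rV[R]_n).

Definition cvl H f x : R := Int (fun y => H (x - y) * f y).

Lemma boxB (B C : R) x y : box B x -> box C y -> box (B + C) (x - y).
Proof. by move=> bx cy i; rewrite !mxE; apply: le_trans (ler_normB _ _) (lerD (bx i) (cy i)). Qed.

Lemma box_norm x : box `|x| x.
Proof.
move=> i; rewrite [X in _ <= X]/Num.norm/= mx_normrE.
exact: (le_bigmax _ (fun ij : 'I_1 * 'I_n => `|x ij.1 ij.2|) (0, i)).
Qed.

(** Continuity is reduced to sequences because dominated convergence is available in that form. *)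
Lemma seq_continuous (h : 'rV[R]_n -> R) x :
  (forall w : nat -> 'rV[R]_n, w @ \oo --> x -> h (w k) @[k --> \oo] --> h x) ->
  {for x, continuous h}.
Proof.
move=> H; suff : h y @[y --> x] --> h x by [].
apply/(@cvgrPdist_le _ _ _ _ (nbhs_filter x)) => e e0.
have [//|N] := pselect (\forall y \near x, `|h x - h y| <= e).
have K (k : nat) : exists y : 'rV[R]_n, `|x - y| <= k.+1%:R^-1 /\ e < `|h x - h y|.
  apply: contrapT => /forallNP Hk; apply: N.
  have k0 : 0 < k.+1%:R^-1 :> R by rewrite invr_gt0 ltr0n.
  apply: (@filterS _ (nbhs x) (nbhs_filter x) (fun y : 'rV[R]_n => `|x - y| < k.+1%:R^-1)).
    by move=> y xy; rewrite leNgt; apply/negP => hy; apply: (Hk y); split => //; exact: ltW.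
  exact: (@cvgrPdist_lt _ _ _ _ (nbhs_filter x) id x).1 cvg_id _ k0.
have [w hw] := choice K.
have wx : w @ \oo --> x.
  apply/cvgrPdist_le => d d0; near=> k.
  have [k1 _] := hw k; apply: le_trans k1 _.
  by near: k; move/cvgrPdist_le : (@cvg_harmonic R) => /(_ d d0) [M _ hM]; exists M => // k /hM; rewrite /= sub0r normrN ger0_norm.
move/cvgrPdist_lt : (H w wx) => /(_ e e0)[M _ hM].
have := hM M (leqnn M); have [_] := hw M; rewrite /= => h1 h2.
by have := lt_trans h1 h2; rewrite ltxx.
Unshelve. all: by end_near.
Qed.

Lemma cont_subl H x : continuous H -> continuous (fun y => H (x - y)).
Proof.
move=> cH y; apply: seq_continuous => w wy.
exact: cvg_comp (cvgB (cvg_cst x) wy) (cH _).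
Qed.

Lemma cvl_Itg H f x : continuous H -> continuous f -> csupp f -> Itg (fun y => H (x - y) * f y).
Proof. by move=> cH cf sf; apply: Itg_csupp; [apply: cont_mul => //; exact: cont_subl|exact: csuppMr]. Qed.

Lemma cvl_continuous H f : continuous H -> continuous f -> csupp f -> continuous (cvl H f).
Proof.
move=> cH cf [B fB] x.
have B0 : 0 <= `|B| + (`|x| + 1) by rewrite !addr_ge0.
have [C C0 hC] := box_bounded cH B0.
have Bf y : ~ box `|B| y -> f y = 0.
  by move=> by0; apply: fB; apply: contra_not by0 => b i; exact: le_trans (b i) (ler_norm _).
apply: seq_continuous => w wx.
have [N _ hN] : \forall k \near \oo, `|x - w k| <= 1 by move/cvgrPdist_le : wx => /(_ 1 ltr01).
rewrite -(cvg_shiftn N).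
have [] := @Int_dct R n (fun k y => H (w (k + N)%N - y) * f y) (fun y => H (x - y) * f y) (fun y => C * `|f y|) => //.
- by move=> k; apply: continuous_Mf; apply: cont_mul => //; exact: cont_subl.
- by apply: continuous_Mf; apply: cont_mul => //; exact: cont_subl.
- apply: ItgZ; apply: Itg_csupp.
    by apply: cont_comp => // z; exact: norm_continuous.
  by apply: csupp_comp; [rewrite normr0|exists B].
- move=> k y; rewrite normrM; have [bb|bb] := pselect (box `|B| y); last first.
    by rewrite (Bf _ bb) normr0 !mulr0.
  rewrite ler_wpM2r//; apply: hC; rewrite addrC; apply: boxB => // i.
  have -> : w (k + N)%N = x - (x - w (k + N)%N) by rewrite opprB addrC subrK.
  apply: (boxB (box_norm _)) => j; apply: le_trans (box_norm _ j) _.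
  by apply: hN; rewrite /= leq_addl.
- move=> y; apply: cvgM; last exact: cvg_cst.
  have wN : w (k + N)%N @[k --> \oo] --> x by rewrite (cvg_shiftn N).
  exact: cvg_comp (cvgB wN (cvg_cst y)) (cH _).
Qed.

Lemma isd_cvl H f i x : CK 1 H -> continuous f -> csupp f ->
  is_derive x (delta_mx 0 i) (cvl H f) (cvl (pd i H) f x).
Proof.
move=> cH cf [B fB]; apply/is_derive_line.
have B0 : 0 <= `|B| + (`|x| + 1) by rewrite !addr_ge0.
have cH0 := Ck_continuous cH; have cpH := Ck_continuous (Ck_partial i cH).
have [C C0 hC] := box_bounded cpH B0.
have Bf y : ~ box `|B| y -> f y = 0.
  by move=> by0; apply: fB; apply: contra_not by0 => b j; exact: le_trans (b j) (ler_norm _).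
have sf : csupp f by exists B.
have := @isd_Int R n (fun s y => H (x + s *: delta_mx 0 i - y) * f y)
  (fun s y => pd i H (x + s *: delta_mx 0 i - y) * f y) (fun y => C * `|f y|) 0 1 ltr01.
rewrite scale0r addr0; apply.
- by move=> s _; exact: cvl_Itg.
- move=> s y _.
  suff -> : pd i H (x + s *: delta_mx 0 i - y) * f y = pd i H (x + s *: delta_mx 0 i - y) * f y + H (x + s *: delta_mx 0 i - y) * 0.
    apply: isdM (isd_cst _ _ _).
    have -> : (fun s : R => H (x + s *: delta_mx 0 i - y)) = (fun s => H ((x - y) + s *: delta_mx 0 i)).
      by apply/funext => t; rewrite addrAC.
    by apply: isd_line; rewrite (addrAC x (s *: _)); exact: (Ck_isd i _ cH).
  by rewrite mulr0 addr0.
- apply: ItgZ; apply: Itg_csupp.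
    by apply: cont_comp => // z; exact: norm_continuous.
  by apply: csupp_comp; [rewrite normr0|exists B].
- move=> s y /andP[s1 s2]; rewrite normrM; have [bb|bb] := pselect (box `|B| y); last first.
    by rewrite (Bf _ bb) normr0 !mulr0.
  rewrite ler_wpM2r//; apply: hC; rewrite addrC; apply: boxB => // j.
  rewrite !mxE; apply: le_trans (ler_normD _ _) _; apply: lerD; first exact: box_norm.
  rewrite normrM; have : `|(0 == 0 :> 'I_1) && (j == i)|%:R <= 1 :> R by case: (_ && _).
  have : `|s| <= 1 by rewrite ler_norml; apply/andP; split; lra.
  by case: (_ && _) => /=; rewrite ?normr0 ?mulr0 ?normr1 ?mulr1//.
Qed.

Lemma partial_cvl H f i x : CK 1 H -> continuous f -> csupp f ->
  pd i (cvl H f) x = cvl (pd i H) f x.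
Proof. by move=> cH cf sf; apply: partial_eq; exact: isd_cvl. Qed.

Lemma Ck_cvl k H f : CK k H -> continuous f -> csupp f -> CK k (cvl H f).
Proof.
move=> cH cf sf; elim: k H cH => [|k IH] H cH.
  by apply: Ck0I; exact: cvl_continuous (Ck_continuous cH) cf sf.
apply: CkI; first exact: cvl_continuous (Ck_continuous cH) cf sf.
move=> i; exists (cvl (pd i H) f); last by apply: IH; exact: Ck_partial.
by move=> x; apply: isd_cvl => //; exact: (@Ck_le _ _ 1 k.+1).
Qed.

Lemma laplacian_cvl H f x : CK 2 H -> continuous f -> csupp f ->
  lap (cvl H f) x = cvl (lap H) f x.
Proof.
move=> cH cf sf; rewrite lapE.
have cp i := Ck_partial i cH.
have cpp i := Ck_partial i (cp i).
rewrite (eq_bigr (fun i => cvl (pd i (pd i H)) f x)); last first.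
  move=> i _; have -> : pd i (cvl H f) = cvl (pd i H) f.
    by apply/funext => y; apply: partial_cvl => //; exact: CkW.
  exact: partial_cvl.
rewrite /cvl -Int_sum; last by move=> i; apply: cvl_Itg => //; exact: Ck_continuous (cpp i).
by congr Int; apply/funext => y; rewrite -mulr_suml -lapE.
Qed.

End convolution.

(** * Approximate solution of the Poisson equation *)

Section cvl_bounds.
Context {R : realType} {n : nat}.
Implicit Types (H f : 'rV[R]_n -> R) (x y : 'rV[R]_n) (a c : R).

Lemma powR_anti (a s t : R) : a <= 0 -> 0 < s -> s <= t -> t `^ a <= s `^ a.
Proof.
move=> a0 s0 st; have : 0 <= - a by rewrite oppr_ge0.
rewrite -[a]opprK; move: (- a) => b; rewrite opprK => b0.
rewrite !powRN lef_pV2 ?posrE ?powR_gt0//; last exact: lt_le_trans st.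
by apply: ge0_ler_powR; rewrite // ?nnegrE ?(ltW s0)// (le_trans (ltW s0)).
Qed.

Lemma nsqB x y : nsq x <= 2 * nsq (x - y) + 2 * nsq y.
Proof.
rewrite /nsq !mulr_sumr -big_split/=; apply: ler_sum => i _; rewrite !mxE.
move: (x 0 i) (y 0 i) => s t; have := sqr_ge0 (s - 2 * t); nra.
Qed.

Lemma nsqN x : nsq (- x) = nsq x.
Proof. by rewrite /nsq; apply: eq_bigr => i _; rewrite mxE sqrrN. Qed.

Lemma rw_shift c a (B : R) : 0 < c -> a <= 0 -> 0 <= B -> exists2 C : R, 0 <= C &
  forall x y, box B y -> rw c a (x - y) <= C * rw 1 a x.
Proof.
(* K is such that 1 + |x|^2 <= 1 + 2 |x - y|^2 + 2 |y|^2 <= K (c + |x - y|^2) for y in the cube; the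
   exponent a <= 0 reverses the inequality. *)
move=> c0 a0 B0; pose K := 2 + (1 + 2 * (n%:R * B ^+ 2)) / c.
have D0 : 0 <= n%:R * B ^+ 2 :> R by rewrite mulr_ge0// sqr_ge0.
have L0 : 0 <= (1 + 2 * (n%:R * B ^+ 2)) / c by rewrite divr_ge0 ?(ltW c0)//; lra.
have K0 : 0 < K by rewrite /K; lra.
exists (K `^ (- a)); first exact: powR_ge0.
move=> x y byB; have r0 := rho_gt0 (x - y) c0.
have -> : rw c a (x - y) = K `^ (- a) * (K * rho c (x - y)) `^ a.
  rewrite powRM ?(ltW K0) ?(ltW r0)// mulrA -powRD ?(gt_eqF K0) ?implybT//.
  by rewrite addNr powRr0 mul1r.
rewrite ler_wpM2l ?powR_ge0//; apply: powR_anti => //; first exact: rho_gt0.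
have := nsqB x y; have := nsq_box byB; have := nsq_ge0 (x - y).
rewrite /rho /K; set q := nsq (x - y) => q0 h1 h2.
rewrite mulrDl mulrDr -mulrA mulrDr mulVf ?gt_eqF//.
have : 0 <= (1 + 2 * (n%:R * B ^+ 2)) * (c^-1 * q) by rewrite mulr_ge0 ?mulr_ge0 ?invr_ge0 ?(ltW c0)//; lra.
lra.
Qed.

Lemma cvl_bound H f (B D : R) c a : continuous H -> continuous f -> 0 <= B ->
  (forall x, ~ box B x -> f x = 0) -> 0 < c -> a <= 0 -> 0 <= D ->
  (forall z, `|H z| <= D * rw c a z) ->
  exists2 C : R, 0 <= C & forall x, `|cvl H f x| <= C * rw 1 a x.
Proof.
move=> cH cf B0 fB c0 a0 D0 HD; have [C C0 hC] := rw_shift c0 a0 B0.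
have sf : csupp f by exists B.
have If : Itg (fun y => `|f y|).
  apply: Itg_csupp; first by apply: cont_comp => // z; exact: norm_continuous.
  by apply: csupp_comp => //; rewrite normr0.
have F0 : 0 <= Int (fun y => `|f y|) by exact: Int_ge0.
exists (D * C * Int (fun y => `|f y|)) => [|x]; first by apply: mulr_ge0 => //; exact: mulr_ge0.
rewrite mulrAC -IntZ//; apply: Int_norm_le => //; [exact: cvl_Itg|exact: ItgZ|].
move=> y; rewrite normrM; have [bb|bb] := pselect (box B y); last first.
  by rewrite (fB _ bb) normr0 !mulr0.
rewrite ler_wpM2r//; apply: le_trans (HD _) _.
by rewrite -mulrA ler_wpM2l// hC.
Qed.

End cvl_bounds.

Lemma harm_gt0 {R : realType} k : 0 < k.+1%:R^-1 :> R.
Proof. by rewrite invr_gt0 ltr0n. Qed.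

Lemma harm_le1 {R : realType} k : k.+1%:R^-1 <= 1 :> R.
Proof. by rewrite invf_le1 ?ltr0n// ler1n. Qed.

Section newton.
Context {R : realType} {n : nat}.
Hypothesis n5 : (5 <= n)%N.
Implicit Types (f : 'rV[R]_n -> R) (x y : 'rV[R]_n) (d : R).

Local Notation gx := (@gexp R n).
Local Notation cx := (@cexp R n).

Lemma partial_rw_bound (c a : R) i (z : 'rV[R]_n) : 0 < c -> a <= 0 ->
  `|pd i (rw c a) z| <= (2 * `|a|) * rw c (a - 2^-1) z.
Proof.
move=> c0 a0; rewrite partial_rw//.
have -> : a - 2^-1 = (a - 1) + 2^-1 :> R by field.
rewrite [rw c (a - 1 + 2^-1) z]rwD// !normrM (gtr0_norm (rw_gt0 _ _ c0)) (@ger0_norm _ 2)//.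
have h : `|z 0 i| <= rw c (2^-1) z.
  rewrite /rw powR12_sqrt ?(ltW (rho_gt0 _ c0))//.
  apply: le_trans (coord_enorm z i) _; rewrite enormE ler_wsqrtr//.
  by rewrite /rho lerDr ltW.
have := ler_wpM2l (mulr_ge0 (normr_ge0 a) (ltW (rw_gt0 (a - 1) z c0))) h.
by move: (rw _ _ _) (rw _ _ _) `|a| `|_| => p q r s; lra.
Qed.

Lemma decaying_cvl_G k (c B : R) f : 0 < c -> continuous f -> 0 <= B ->
  (forall x, ~ box B x -> f x = 0) ->
  decaying (cvl (fun z => k * rw c gx z) f).
Proof.
move=> c0 cf B0 fB; have sf : csupp f by exists B.
have g1 := @gexp_le1 R _ n5.
have CG m : CK m (fun z : 'rV[R]_n => k * rw c gx z) by apply: CkZ; exact: Ck_rw.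
have cG := Ck_continuous (CG 0%N).
split; first by move=> m; exact: Ck_cvl.
have [C1 C10 h1] : exists2 C : R, 0 <= C & forall x, `|cvl (fun z => k * rw c gx z) f x| <= C * rw 1 gx x.
  apply: (cvl_bound (D := `|k|) (B := B) (c := c)) => //; first lra.
  by move=> z; rewrite normrM (gtr0_norm (rw_gt0 _ _ c0)).
have h2 i : exists C : R, 0 <= C /\ forall x, `|pd i (cvl (fun z => k * rw c gx z) f) x| <= C * rw 1 (gx - 2^-1) x.
  suff [C C0 hC] : exists2 C : R, 0 <= C & forall x, `|cvl (pd i (fun z => k * rw c gx z)) f x| <= C * rw 1 (gx - 2^-1) x.
    by exists C; split => // x; rewrite partial_cvl.
  apply: (cvl_bound (D := `|k| * (2 * `|gx|)) (B := B) (c := c)) => //; [exact: Ck_continuous (Ck_partial _ (CG 1%N))| |].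
    by have := g1; move: gx => g; lra.
  move=> z; rewrite partialZ; last exact: Ck_rw.
  rewrite normrM -mulrA ler_wpM2l//; apply: partial_rw_bound => //; lra.
have [C2 hC2] := choice h2.
have [C3 C30 h3] : exists2 C : R, 0 <= C & forall x, `|lap (cvl (fun z => k * rw c gx z) f) x| <= C * rw 1 cx x.
  suff [C C0 hC] : exists2 C : R, 0 <= C & forall x, `|cvl (lap (fun z => k * rw c gx z)) f x| <= C * rw 1 cx x.
    by exists C => // x; rewrite laplacian_cvl.
  apply: (cvl_bound (D := `|k| * `|n%:R * (n%:R - 2) * c|) (B := B) (c := c)) => //; [exact: continuous_laplacian (CG 2)|exact: ltW (@cexp_lt0 R n)|].
  move=> z; rewrite laplacianZ; last exact: Ck_rw.
  by rewrite laplacian_G// normrM normrN [X in _ * X]normrM (gtr0_norm (rw_gt0 _ _ c0)) mulrA.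
exists (C1 ^+ 2 + \sum_i C2 i ^+ 2 + C3 ^+ 2) => x.
have P a := rw_gt0 a x (ltr01 : 0 < (1 : R)).
have e1 : cvl (fun z => k * rw c gx z) f x ^+ 2 * rw 1 (-2) x <= C1 ^+ 2 * rw 1 cx x.
  apply: le_trans (ler_wpM2r (ltW (P _)) (ler_sqr_norm (h1 x))) _.
  rewrite exprMn -mulrA ler_wpM2l ?sqr_ge0// expr2 !rw_mul//.
  by apply: rw_le => //; rewrite cexpE; have := g1; move: gx => g; lra.
have e2 : gdot (cvl (fun z => k * rw c gx z) f) (cvl (fun z => k * rw c gx z) f) x * rw 1 (-1) x <=
    (\sum_i C2 i ^+ 2) * rw 1 cx x.
  rewrite /gdot !mulr_suml; apply: ler_sum => i _.
  have [_ hi] := hC2 i.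
  rewrite -expr2; apply: le_trans (ler_wpM2r (ltW (P _)) (ler_sqr_norm (hi x))) _.
  rewrite exprMn -mulrA ler_wpM2l ?sqr_ge0// expr2 !rw_mul//.
  by apply: rw_le => //; rewrite cexpE; have := g1; move: gx => g; lra.
have e3 : lap (cvl (fun z => k * rw c gx z) f) x ^+ 2 <= C3 ^+ 2 * rw 1 cx x.
  apply: le_trans (ler_sqr_norm (h3 x)) _.
  rewrite exprMn ler_wpM2l ?sqr_ge0// expr2 !rw_mul//.
  by apply: rw_le => //; rewrite cexpE; have := g1; move: gx => g; lra.
by rewrite !mulrDl; apply: lerD => //; exact: lerD.
Qed.

(** On the cube of half-side d the weight is comparable with d^-(n + 2). With [Int_rw_cexp] this
    pins the integral down to the order d^-2, which replaces an exact scaling identity. *)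
Lemma Int_rw_ge : exists2 b : R, 0 < b & forall d, 0 < d -> b * d ^- 2 <= Int (rw (d ^+ 2) cx : 'rV[R]_n -> R).
Proof.
have n0 : 0 < 1 + n%:R :> R by rewrite ltr_wpDr.
exists ((1 + n%:R) `^ cx * 2 ^+ n); first by rewrite mulr_gt0 ?powR_gt0 ?exprn_gt0.
move=> d d0; have [Ii Vi] := @Int_ibox R n _ (ltW d0); have [Ir _] := @Int_rw_cexp R n d d0.
have d20 : 0 < d ^+ 2 by rewrite exprn_gt0.
have -> : (1 + n%:R) `^ cx * 2 ^+ n * d ^- 2 = (((1 + n%:R) * d ^+ 2) `^ cx) * (2 * d) ^+ n.
  rewrite powRM ?(ltW n0) ?(ltW d20)// powR_cexp// exprMn exprD.
  have := lt0r_neq0 d0; have : d ^+ n != 0 by rewrite expf_neq0// lt0r_neq0.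
  by move: ((_ + _) `^ _) (2 ^+ n) (d ^+ n) => p q dn h h'; field; apply/andP; split.
rewrite -Vi -IntZ//; apply: Int_le => //; first exact: ItgZ.
move=> x; rewrite iboxP; case: asboolP => bx; last by rewrite mulr0 ltW// rw_gt0.
rewrite mulr1; apply: powR_anti; [exact: ltW (@cexp_lt0 R n)|exact: rho_gt0|].
by rewrite /rho mulrDl mul1r lerD2l nsq_box.
Qed.

Let I d := Int (rw (d ^+ 2) cx : 'rV[R]_n -> R).
(** An approximate identity of width d. It is a multiple of minus the Laplacian of the Newtonian
    kernel smoothed at scale d, so convolving f with that kernel solves the Poisson equation with f
    replaced by its mollification. *)
Definition poisson d (z : 'rV[R]_n) : R := (I d)^-1 * rw (d ^+ 2) cx z.

Lemma poisson_ge0 d z : 0 < d -> 0 <= poisson d z.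
Proof.
move=> d0; apply: mulr_ge0; last by rewrite ltW// rw_gt0// exprn_gt0.
by rewrite invr_ge0; apply: Int_ge0 => x; rewrite ltW// rw_gt0// exprn_gt0.
Qed.

Lemma cont_poisson d : 0 < d -> continuous (poisson d).
Proof. by move=> d0; apply: cont_mul; [exact: cont_cst|apply: cont_rw; rewrite exprn_gt0]. Qed.

Lemma I_gt0 d : 0 < d -> 0 < I d.
Proof.
have [b b0 hb] := Int_rw_ge; move=> d0; apply: lt_le_trans (hb d d0).
by rewrite mulr_gt0// invr_gt0 exprn_gt0.
Qed.

Lemma Int_poisson d x : 0 < d ->
  Itg (fun y => poisson d (x - y)) /\ Int (fun y => poisson d (x - y)) = 1.
Proof.
move=> d0; have [I1 _] := @Int_rw_cexp R n d d0.
have [I2 V2] := Int_shift (- x) (ItgZ (I d)^-1 I1).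
have E : (fun y => poisson d (x - y)) = (fun y => (I d)^-1 * rw (d ^+ 2) cx (y - x)).
  by apply/funext => y; rewrite /poisson /rw /rho -[x - y]opprB nsqN.
rewrite E; split; first exact: I2.
etransitivity; first exact: V2.
etransitivity; first exact: (IntZ (I d)^-1 I1).
exact: mulVf (lt0r_neq0 (I_gt0 d0)).
Qed.

(** The factor d^2 comes from the lower bound on the normalising integral. Off the cube, d^2 + |z|^2
    is at least s (1 + |z|^2) with s = r^2/(1 + r^2), uniformly in d. *)
Lemma poisson_tail (r : R) : 0 < r -> exists2 C : R, 0 <= C & forall d z, 0 < d -> ~ box r z ->
  poisson d z <= C * d ^+ 2 * rw 1 cx z.
Proof.
move=> r0; have [b b0 hb] := Int_rw_ge.
pose s := r ^+ 2 / (1 + r ^+ 2).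
have r20 : 0 < r ^+ 2 by rewrite exprn_gt0.
have s0 : 0 < s by rewrite divr_gt0//; lra.
exists (b^-1 * s `^ cx); first by rewrite mulr_ge0 ?invr_ge0 ?powR_ge0 ?ltW.
move=> d z d0 /(not_box_nsq (ltW r0)) nz.
have -> : b^-1 * s `^ cx * d ^+ 2 * rw 1 cx z = (b^-1 * d ^+ 2) * (s `^ cx * rw 1 cx z) by ring.
apply: ler_pM.
- by rewrite invr_ge0 ltW// I_gt0.
- by rewrite ltW// rw_gt0// exprn_gt0.
- rewrite -[d ^+ 2]invrK -invfM lef_pV2 ?posrE ?I_gt0 ?mulr_gt0 ?invr_gt0 ?exprn_gt0//.
  exact: hb.
- rewrite /rw -powRM ?(ltW s0) ?(ltW (rho1_gt0 _))//.
  apply: powR_anti; [exact: ltW (@cexp_lt0 R n)|by rewrite mulr_gt0// rho1_gt0|].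
  rewrite /s /rho mulrAC ler_pdivrMr; last by lra.
  by have := sqr_ge0 d; move: (d ^+ 2) (r ^+ 2) (nsq z) r20 nz => e q m; nra.
Qed.

Lemma cvl_poisson_le d f (F : R) x : 0 < d -> continuous f -> csupp f -> (forall y, `|f y| <= F) ->
  `|cvl (poisson d) f x| <= F.
Proof.
move=> d0 cf sf fF; have [I1 V1] := Int_poisson x d0.
rewrite -[F]mulr1 -V1 -IntZ//; apply: Int_norm_le; [apply: cvl_Itg => //; exact: cont_poisson|exact: ItgZ|].
by move=> y; rewrite normrM (ger0_norm (poisson_ge0 _ d0)) mulrC ler_wpM2r ?poisson_ge0.
Qed.

Local Opaque poisson.
Let J := Int (rw (1 : R) cx : 'rV[R]_n -> R).

Lemma cvl_poisson_error f x (F C r e d : R) : continuous f -> csupp f -> 0 <= F ->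
  (forall y, `|f y| <= F) -> 0 <= e -> (forall y, box r (x - y) -> `|f x - f y| <= e) ->
  0 <= C -> 0 < d -> (forall z, ~ box r z -> poisson d z <= C * d ^+ 2 * rw 1 cx z) ->
  `|f x - cvl (poisson d) f x| <= e + d ^+ 2 * (2 * F * C * J).
Proof.
move=> cf sf F0 hF e0 hr C0 d0 hC.
have [I1 _] := @Int_rw_cexp R n 1 ltr01; rewrite expr1n in I1.
have [IJ0 VJ] := Int_shift (- x) I1.
have EJ : (fun y => rw 1 cx (x - y)) = (fun y => rw 1 cx (y - x)).
  by apply/funext => y; rewrite /rw /rho -[x - y]opprB nsqN.
rewrite -EJ in IJ0; rewrite -EJ -/J in VJ.
have [I2 V2] := Int_poisson x d0.
have IC := cvl_Itg x (cont_poisson d0) cf sf.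
have -> : f x = Int (fun y => f x * poisson d (x - y)) by rewrite (IntZ (f x) I2) V2 mulr1.
rewrite -(IntB (ItgZ (f x) I2) IC).
apply: (@le_trans _ _ (Int (fun y => e * poisson d (x - y) + 2 * F * C * d ^+ 2 * rw 1 cx (x - y)))).
  apply: (Int_norm_le (ItgB (ItgZ (f x) I2) IC) (ItgD (ItgZ _ I2) (ItgZ _ IJ0))).
  move=> y; rewrite mulrC -mulrBr normrM (ger0_norm (poisson_ge0 _ d0)).
  have P0 := poisson_ge0 (x - y) d0; have W0 := rw_gt0 cx (x - y) (ltr01 : 0 < (1 : R)).
  have Z0 : 0 <= 2 * F * C * d ^+ 2 * rw 1 cx (x - y).
    exact: mulr_ge0 (mulr_ge0 (mulr_ge0 (mulr_ge0 (ler0n _ 2) F0) C0) (sqr_ge0 d)) (ltW W0).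
  have [bxy|bxy] := pselect (box r (x - y)).
    rewrite mulrC; apply: le_trans (ler_wpM2r P0 (hr _ bxy)) _; by rewrite lerDl.
  have h1 := hC _ bxy.
  have h2 : `|f x - f y| <= 2 * F by apply: le_trans (ler_normB _ _) _; have := hF x; have := hF y; lra.
  apply: le_trans (ler_wpM2l P0 h2) _; rewrite mulrC.
  apply: le_trans (ler_wpM2l (mulr_ge0 (ler0n _ 2) F0) h1) _.
  by have := mulr_ge0 e0 P0; move: (poisson d _) (rw _ _ _) => p w; lra.
rewrite (IntD (ItgZ _ I2) (ItgZ _ IJ0)) (IntZ _ I2) (IntZ _ IJ0) V2 VJ mulr1 lerD2l.
by rewrite le_eqVlt; apply/orP; left; apply/eqP; ring.
Qed.

Lemma cvl_poisson_cvg f x : continuous f -> csupp f ->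
  cvl (poisson k.+1%:R^-1) f x @[k --> \oo] --> f x.
Proof.
move=> cf sf.
have [F F0 hF] : exists2 F : R, 0 <= F & forall y, `|f y| <= F.
  have [B fB] := sf; have [C C0 hC] := box_bounded cf (normr_ge0 B).
  exists C => // y; have [by0|by0] := pselect (box `|B| y); first exact: hC.
  rewrite fB ?normr0//; apply: contra_not by0 => b j; exact: le_trans (b j) (ler_norm _).
apply/cvgrPdist_le => e e0.
have e20 : 0 < e / 2 by rewrite divr_gt0.
have cfx : {for x, continuous f} by exact: cf.
have [r r0 hr] : exists2 r : R, 0 < r & forall y, box r (x - y) -> `|f x - f y| <= e / 2.
  have := (@cvgrPdist_le _ _ _ _ (nbhs_filter x) f (f x)).1 cfx _ e20.
  move=> /(@nbhs_ballP _ 'rV[R]_n)[r /= r0 hr]; exists (r / 2); first by rewrite divr_gt0.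
  move=> y bxy; apply: hr; rewrite -ball_normE/=.
  apply: le_lt_trans (_ : r / 2 < r); last by rewrite ltr_pdivrMr// ltr_pMr// ltr1n.
  rewrite [leLHS]/Num.norm/= mx_normrE; apply/bigmax_leP; split; first by rewrite divr_ge0 ?ltW.
  by move=> [i j] _ /=; rewrite ord1; exact: bxy.
have [C C0 hC] := poisson_tail r0.
have J0 : 0 <= J by apply: Int_ge0 => y; rewrite ltW// rw_gt0.
have A0 : 0 <= 2 * F * C * J by apply: mulr_ge0 J0; apply: mulr_ge0 => //; exact: mulr_ge0.
have T : \forall k \near \oo, k.+1%:R^-1 * (2 * F * C * J) <= e / 2.
  have [->|A1] := eqVneq (2 * F * C * J) 0; first by near=> k; rewrite mulr0 ltW.
  have A2 : 0 < 2 * F * C * J by rewrite lt_neqAle eq_sym A1.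
  move/cvgrPdist_le : (@cvg_harmonic R) => /(_ _ (divr_gt0 e20 A2))[N _ hN].
  by exists N => // k /hN; rewrite /= sub0r normrN ger0_norm// -ler_pdivlMr.
near=> k.
have d0 := @harm_gt0 R k; have d1 := @harm_le1 R k.
have Tk : k.+1%:R^-1 * (2 * F * C * J) <= e / 2 by near: k.
apply: le_trans (cvl_poisson_error cf sf F0 hF (ltW e20) hr C0 d0 (fun z => hC _ z d0)) _.
have d2 : k.+1%:R^-1 ^+ 2 <= k.+1%:R^-1 :> R by rewrite expr2 ler_piMl// ltW.
have := ler_wpM2r A0 d2.
by move=> h; rewrite [leRHS](splitr e) lerD2l; exact: le_trans h Tk.
Unshelve. all: by end_near.
Qed.

(** A majorant independent of d, for dominated convergence in L^2: the sup bound on a cube one unit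
    larger than the support, and the tail of the kernel outside it. *)
Lemma cvl_poisson_dom f : continuous f -> csupp f ->
  exists F D B : R, [/\ 0 <= B, Itg (ibox B : 'rV[R]_n -> R) & forall d x, 0 < d <= 1 ->
  `|f x| + `|cvl (poisson d) f x| <= F * ibox B x + D * rw 1 cx x].
Proof.
move=> cf [B fB].
have Bf y : ~ box `|B| y -> f y = 0.
  by move=> by0; apply: fB; apply: contra_not by0 => b j; exact: le_trans (b j) (ler_norm _).
have sf : csupp f by exists B.
have [F F0 hF] : exists2 F : R, 0 <= F & forall y, `|f y| <= F.
  have [C C0 hC] := box_bounded cf (normr_ge0 B).
  exists C => // y; have [by0|/Bf->] := pselect (box `|B| y); first exact: hC.
  by rewrite normr0.
have [C C0 hC] := poisson_tail ltr01.
have [E E0 hE] := @rw_shift R n 1 cx `|B| ltr01 (ltW (@cexp_lt0 R n)) (normr_ge0 B).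
have [Ib _] := @Int_ibox R n _ (normr_ge0 B).
have B1 : 0 <= `|B| + 1 by rewrite addr_ge0.
have [Ib1 _] := @Int_ibox R n _ B1.
exists (2 * F), (C * E * F * Int (ibox `|B| : 'rV[R]_n -> R)), (`|B| + 1); split => //.
move=> d x /andP[d0 d1]; have W := ltW (rw_gt0 cx x (ltr01 : 0 < (1 : R))).
have V0 : 0 <= Int (ibox `|B| : 'rV[R]_n -> R).
  by apply: Int_ge0 => y; rewrite iboxP; case: asboolP.
rewrite iboxP; case: asboolP => bx.
  have h1 := hF x; have h2 := cvl_poisson_le x d0 cf sf hF.
  have h3 := mulr_ge0 (mulr_ge0 (mulr_ge0 (mulr_ge0 C0 E0) F0) V0) W.
  by rewrite mulr1; move: h1 h2 h3; move: `|_| `|cvl _ _ _| (_ * _ * _) => p q r; lra.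
rewrite mulr0 add0r Bf ?normr0 ?add0r; last first.
  by apply: contra_not bx => b j; apply: le_trans (b j) _; rewrite lerDl.
rewrite mulrAC -(IntZ _ Ib); apply: (Int_norm_le (cvl_Itg x (cont_poisson d0) cf sf) (ItgZ _ Ib)).
move=> y; rewrite normrM (ger0_norm (poisson_ge0 _ d0)) iboxP; case: asboolP => by0; last first.
  by rewrite (Bf _ by0) normr0 !mulr0.
have nb : ~ box 1 (x - y).
  apply: contra_not bx => b1 j.
  have -> : x 0 j = y 0 j + (x - y) 0 j by rewrite !mxE; ring.
  by apply: le_trans (ler_normD _ _) (lerD (by0 j) (b1 j)).
have h1 := hC _ _ d0 nb; have h2 := hE x y by0; have P0 := poisson_ge0 (x - y) d0.
have d2 : d ^+ 2 <= 1 by rewrite expr_le1// ltW.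
have h3 : C * d ^+ 2 * rw 1 cx (x - y) <= C * (E * rw 1 cx x).
  rewrite -mulrA; apply: ler_wpM2l => //; apply: le_trans h2.
  by apply: ler_piMl => //; exact: ltW (rw_gt0 _ _ ltr01).
rewrite (_ : _ * 1 = (C * (E * rw 1 cx x)) * F); last by move: (rw 1 cx x) => w; ring.
apply: ler_pM => //.
exact: le_trans h1 h3.
Qed.

(** The potential of f for the smoothed kernel has residual f minus its mollification, which is
    small in L^2. Smoothing the kernel avoids its singularity, and an L^2 residual is all that the
    iteration below asks for. *)
Lemma approx_poisson_eq f (e : R) : continuous f -> csupp f -> (forall x, 0 <= f x) -> 0 < e ->
  exists psi, [/\ decaying psi, forall x, 0 <= psi x,
    Itg (fun x => (lap psi x + f x) ^+ 2) & Int (fun x => (lap psi x + f x) ^+ 2) <= e].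
Proof.
move=> cf sf f0 e0.
have [F [D [B [B0 Ib FD]]]] := cvl_poisson_dom cf sf.
pose g x := 2 * F ^+ 2 * ibox B x + 2 * D ^+ 2 * rw 1 cx x.
have [I1 _] := @Int_rw_cexp R n 1 ltr01; rewrite expr1n in I1.
have Ig : Itg g by apply: ItgD; exact: ItgZ.
pose dk k : R := k.+1%:R^-1.
have ck k : continuous (fun x => (f x - cvl (poisson (dk k)) f x) ^+ 2).
  have c1 := cvl_continuous (cont_poisson (harm_gt0 k)) cf sf.
  exact: Ck_continuous (CkX 2 (CkB (Ck0I cf) (Ck0I c1))).
have gk k x : `|(f x - cvl (poisson (dk k)) f x) ^+ 2| <= g x.
  rewrite ger0_norm ?sqr_ge0//.
  have dk01 : 0 < dk k <= 1 by rewrite harm_gt0 harm_le1.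
  have := FD _ x dk01; rewrite /g => h.
  have h1 : `|f x - cvl (poisson (dk k)) f x| <= F * ibox B x + D * rw 1 cx x.
    exact: le_trans (ler_normB _ _) h.
  apply: le_trans (ler_sqr_norm h1) _.
  have i2 : ibox B x ^+ 2 = ibox B x by rewrite iboxP; case: asboolP; rewrite ?expr1n ?expr0n.
  have w2 : rw 1 cx x ^+ 2 <= rw 1 cx x.
    rewrite expr2; apply: ler_piMl; first exact: ltW (rw_gt0 _ _ ltr01).
    by have := @rw_le R n 1 cx 0 x (lexx _) (ltW (@cexp_lt0 R n)); rewrite rw0.
  have := ler_wpM2l (sqr_ge0 D) w2; have := sqr_ge0 (F * ibox B x - D * rw 1 cx x).
  rewrite -{3}i2; move: (ibox B x) (rw 1 cx x) => p q; nra.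
have [_ L] : Itg (fun _ : 'rV[R]_n => 0 : R) /\ Int (fun x => (f x - cvl (poisson (dk k)) f x) ^+ 2) @[k --> \oo] --> Int (fun _ : 'rV[R]_n => 0 : R).
  apply: (@Int_dct R n (fun k x => (f x - cvl (poisson (dk k)) f x) ^+ 2) (fun=> 0) g).
  - by move=> k; exact: continuous_Mf.
  - by apply: continuous_Mf; exact: cont_cst.
  - exact: Ig.
  - exact: gk.
  move=> x.
  have h : (f x - cvl (poisson (dk k)) f x) @[k --> \oo] --> f x - f x.
    by apply: cvgB; [exact: cvg_cst|exact: cvl_poisson_cvg].
  have h2 : (f x - cvl (poisson (dk k)) f x) * (f x - cvl (poisson (dk k)) f x) @[k --> \oo] -->
    (f x - f x) * (f x - f x) by apply: cvgM.
  by rewrite subrr mulr0 in h2; exact: h2.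
rewrite Int0 in L.
have [N _ hN] := (@cvgrPdist_le _ _ _ _ _ _ _).1 L e e0.
have := hN N (leqnn N); rewrite /= sub0r normrN ger0_norm; last by apply: Int_ge0 => x; exact: sqr_ge0.
move=> Ne; set d := dk N in Ne; have d0 : 0 < d by exact: harm_gt0.
have d20 : 0 < d ^+ 2 by rewrite exprn_gt0.
have n0 : 0 < n%:R * (n%:R - 2) * d ^+ 2 :> R.
  have n5' : 5 <= n%:R :> R by rewrite ler_nat.
  by apply: mulr_gt0 => //; apply: mulr_gt0; lra.
pose k := (I d * (n%:R * (n%:R - 2) * d ^+ 2))^-1.
have k0 : 0 < k by rewrite invr_gt0; apply: mulr_gt0 => //; exact: I_gt0.
have [B' fB'] := sf.
have Bf y : ~ box `|B'| y -> f y = 0.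
  by move=> by0; apply: fB'; apply: contra_not by0 => b j; exact: le_trans (b j) (ler_norm _).
have CG : CK 2 (fun z : 'rV[R]_n => k * rw (d ^+ 2) gx z) by apply: CkZ; exact: Ck_rw.
have E x : lap (cvl (fun z => k * rw (d ^+ 2) gx z) f) x + f x = f x - cvl (poisson d) f x.
  rewrite laplacian_cvl// addrC; congr (_ + _).
  have Ip := cvl_Itg x (cont_poisson d0) cf sf.
  rewrite /cvl -(IntN Ip); congr Int; apply/funext => y.
  rewrite laplacianZ; last exact: Ck_rw.
  rewrite laplacian_G// /k.
  suff -> : poisson d (x - y) = (I d)^-1 * rw (d ^+ 2) cx (x - y).
    have := lt0r_neq0 (I_gt0 d0); have := lt0r_neq0 n0.
    move: (I d) (_ * _ * d ^+ 2) (rw _ _ _) (f y) => p q w z h1 h2; field; exact/andP.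
  by [].
exists (cvl (fun z => k * rw (d ^+ 2) gx z) f); split.
- exact: (decaying_cvl_G k d20 cf (normr_ge0 B') Bf).
- move=> x; apply: Int_ge0 => y; apply: mulr_ge0 (f0 y).
  exact: mulr_ge0 (ltW k0) (ltW (rw_gt0 _ _ d20)).
- by rewrite (funext (fun x => congr1 (fun z => z ^+ 2) (E x))); apply: Itg_dom Ig (gk N); exact: continuous_Mf.
- by rewrite (funext (fun x => congr1 (fun z => z ^+ 2) (E x))).
Qed.

End newton.

(** * The interpolated stability inequality *)

Section Picone.
Context {R : realType} {n : nat}.
Implicit Types (phi psi : 'rV[R]_n -> R) (x : 'rV[R]_n).

(** With w = 1 + psi, the difference |grad phi|^2 - grad(phi^2/w) . grad w is the square |grad phi -
    (phi/w) grad w|^2. Adding 1 keeps w away from 0. *)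
Lemma Picone phi psi : CK 1 phi -> csupp phi -> CK 2 psi -> (forall x, 0 <= psi x) ->
  Itg (fun x => phi x ^+ 2 / (1 + psi x) * lap psi x) /\
  - Int (fun x => phi x ^+ 2 / (1 + psi x) * lap psi x) <= Int (gdot phi phi).
Proof.
move=> cp sp cs s0; have cs1 := CkW cs.
have w0 x : 0 < 1 + psi x by have := s0 x; lra.
have cw : CK 1 (fun x => 1 + psi x) by apply: CkD => //; exact: Ck_cst.
have cg : CK 1 (fun x => phi x ^+ 2 / (1 + psi x)) by apply: CkM; [exact: CkX|exact: Ck_inv].
have sg : csupp (fun x => phi x ^+ 2 / (1 + psi x)).
  by apply: csuppM; apply: (csupp_comp (h := fun z => z ^+ 2)) => //; rewrite expr0n.
split.
  apply: Itg_csupp; last exact: csuppM.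
  by apply: cont_mul; [exact: Ck_continuous cg|exact: continuous_laplacian].
rewrite -(Int_gdot cs cg sg); apply: Int_le.
- by apply: Itg_csupp; [exact: continuous_gdot|exact: csupp_gdot].
- by apply: Itg_csupp; [exact: continuous_gdot|exact: csupp_gdot].
move=> x; apply: ler_sum => i _.
have Dw : is_derive x (delta_mx 0 i) (fun y => 1 + psi y) (0 + pd i psi x).
  exact: isdD (isd_cst _ _ _) (Ck_isd i x cs1).
have Dg := isdM (isd_comp (isd_exprn 2 _) (Ck_isd i x cp)) (isd_comp (f := fun y => 1 + psi y) (isd_inv (lt0r_neq0 (w0 x))) Dw).
rewrite (partial_eq Dg) add0r /=; have := w0 x.
move: (pd i phi x) (pd i psi x) (phi x) (1 + psi x) => a b p w W.
rewrite -subr_ge0.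
have -> : a * a - (2 * p ^+ 1 * a / w + p ^+ 2 * (- w ^- 2 * b)) * b = (a - p * b / w) ^+ 2.
  by field; rewrite gt_eqF.
exact: sqr_ge0.
Qed.

End Picone.

Section interpolation.
Context {R : realType} {n : nat}.
Hypothesis n5 : (5 <= n)%N.
Implicit Types (phi psi f : 'rV[R]_n -> R) (x : 'rV[R]_n).
Variables (s : 'rV[R]_n -> R) (eta : R).
Hypotheses (cs : continuous s) (ss : csupp s) (s0 : forall x, 0 <= s x) (eta0 : 0 < eta).
Hypothesis sL : forall psi, decaying psi ->
  Int (fun x => (s x * psi x) ^+ 2) <= (1 + eta) * Int (fun x => lap psi x ^+ 2).

Let th : R := (1 + eta)^-1.
Let eta1 : 0 < 1 + eta. Proof. exact: addr_gt0. Qed.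
Let th0 : 0 < th. Proof. by rewrite invr_gt0. Qed.
Let thE : th * (1 + eta) = 1. Proof. by rewrite mulVf// gt_eqF. Qed.
(** The ratio of squared errors in one Picard step: th^2 (1 + eta) = th from the stability of s,
    times 1 + eta/2 from Young's inequality. The complementary weight 1 + 2/eta appears in [K],
    where 4 accounts for (a - b)^2 <= 2 (a^2 + b^2) and two residuals of size d. *)
Let r : R := th * (1 + eta / 2).
Let K : R := th * (1 + 2 / eta) * 4.
Let r1 : r < 1. Proof. by rewrite /r -[ltRHS]thE ltr_pM2l// ltrD2l ltr_pdivrMr// ltr_pMr// ltr1n. Qed.
Let r0 : 0 < r. Proof. by rewrite mulr_gt0// addr_gt0// divr_gt0. Qed.
Let K0 : 0 < K. Proof. by rewrite mulr_gt0// mulr_gt0// addr_gt0// divr_gt0. Qed.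

(** The right side of the equation -lap psi = th s (1 + psi), that is -lap w = th s w for the
    positive function w = 1 + psi. *)
Let g psi x : R := th * s x * (1 + psi x).

Let cont_g psi : decaying psi -> continuous (g psi).
Proof.
move=> [cp _]; apply: cont_mul; first by apply: cont_mul => //; exact: cont_cst.
by apply: cont_add; [exact: cont_cst|exact: Ck_continuous (cp 0%N)].
Qed.

Let csupp_g psi : csupp (g psi).
Proof. by apply: csuppM; exact: csuppMr. Qed.

Let Itg_sqr f : continuous f -> csupp f -> Itg (fun x => f x ^+ 2).
Proof.
move=> cf sf; apply: Itg_csupp; first by under eq_fun do rewrite expr2; exact: cont_mul.
by apply: (csupp_comp (h := fun z => z ^+ 2)) => //; rewrite expr0n.
Qed.

Let cont_sub f1 f2 : continuous f1 -> continuous f2 -> continuous (fun x => f1 x - f2 x).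
Proof. by move=> c1 c2; exact: Ck_continuous (CkB (Ck0I c1) (Ck0I c2)). Qed.

Let csupp_sub f1 f2 : csupp f1 -> csupp f2 -> csupp (fun x => f1 x - f2 x).
Proof. by move=> c1 c2; apply: csuppD => //; apply: (csupp_comp (h := fun z => - z)) => //; rewrite oppr0. Qed.

Definition approx d E f psi := [/\ continuous f, csupp f, forall x, 0 <= f x & decaying psi] /\
  [/\ forall x, 0 <= psi x, Itg (fun x => (lap psi x + f x) ^+ 2),
      Int (fun x => (lap psi x + f x) ^+ 2) <= d & Int (fun x => (g psi x - f x) ^+ 2) <= E].

(** A Picard step: the new datum is [g psi], and psi' solves its Poisson equation up to d. The new
    error th s (psi' - psi) is bounded by applying stability to psi' - psi, whose Laplacian is the
    old error up to the two residuals. *)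
Let approx_step d E f psi : 0 < d -> approx d E f psi ->
  exists f' psi', approx d (r * E + K * d) f' psi'.
Proof.
move=> d0 [[cf sf f0 dp] [p0 Ip Lp Ep]].
have cg := cont_g dp; have sg := csupp_g psi.
have g0 x : 0 <= g psi x.
  by apply: mulr_ge0; [exact: mulr_ge0 (ltW th0) (s0 x)|have := p0 x; lra].
have [psi' [dp' p0' Ip' Lp']] := approx_poisson_eq n5 cg sg g0 d0.
exists (g psi), psi'; split; split => //.
have dd := decayingB dp' dp; have [cp' _] := dp'; have [cp _] := dp.
have -> : (fun x => (g psi' x - g psi x) ^+ 2) = (fun x => th ^+ 2 * (s x * (psi' x - psi x)) ^+ 2).
  by apply/funext => x; rewrite /g; move: (psi x) (psi' x) (s x) => a b c; ring.
have Isd : Itg (fun x => (s x * (psi' x - psi x)) ^+ 2).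
  apply: Itg_sqr; last exact: csuppM.
  by apply: cont_mul => //; apply: cont_sub; [exact: Ck_continuous (cp' 0%N)|exact: Ck_continuous (cp 0%N)].
rewrite (IntZ _ Isd).
apply: le_trans (ler_wpM2l (sqr_ge0 _) (sL dd)) _.
rewrite mulrA (_ : th ^+ 2 * (1 + eta) = th); last by rewrite expr2 -mulrA thE mulr1.
have [_ _ Il] := Itg_decaying dd.
have Ig : Itg (fun x => (g psi x - f x) ^+ 2) by apply: Itg_sqr; [exact: cont_sub|exact: csupp_sub].
have IR : Itg (fun x => (1 + eta / 2) * (g psi x - f x) ^+ 2 +
   (2 * (1 + 2 / eta)) * ((lap psi' x + g psi x) ^+ 2 + (lap psi x + f x) ^+ 2)).
  by apply: ItgD; apply: ItgZ => //; exact: ItgD.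
have H : Int (fun x => lap (fun y => psi' y - psi y) x ^+ 2) <=
   (1 + eta / 2) * E + (2 * (1 + 2 / eta)) * (d + d).
  apply: (@le_trans _ _ _ _ _ (Int_le Il IR _)).
    move=> x; rewrite laplacianB; [|exact: cp' 2%N|exact: cp 2%N].
    have -> : lap psi' x - lap psi x = (lap psi' x + g psi x) - (lap psi x + f x) - (g psi x - f x).
      by move: (lap _ _) (lap _ _) (g _ _) (f x) => *; ring.
    move: (lap psi' x + g psi x) (lap psi x + f x) (g psi x - f x) => a b c.
    apply: (@le_trans _ _ ((1 + eta / 2) * c ^+ 2 + (1 + 2 / eta) * (a - b) ^+ 2)).
      rewrite -subr_ge0.
      have -> : (1 + eta / 2) * c ^+ 2 + (1 + 2 / eta) * (a - b) ^+ 2 - (a - b - c) ^+ 2 =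
        2 / eta * (eta / 2 * c + (a - b)) ^+ 2 by field; rewrite gt_eqF.
      by rewrite mulr_ge0 ?sqr_ge0// divr_ge0// ltW.
    apply: lerD => //; have -> : 2 * (1 + 2 / eta) * (a ^+ 2 + b ^+ 2) = (1 + 2 / eta) * (2 * (a ^+ 2 + b ^+ 2)) by ring.
    apply: ler_wpM2l.
      by rewrite addr_ge0// divr_ge0// ltW.
    by have := sqr_ge0 (a + b); nra.
  rewrite IntD ?IntZ ?IntD//; [|exact: ItgD|exact: ItgZ|by apply: ItgZ; exact: ItgD].
  apply: lerD; first by rewrite ler_wpM2l// addr_ge0// divr_ge0// ltW.
  by rewrite ler_wpM2l ?lerD// mulr_ge0// addr_ge0// divr_ge0// ltW.
apply: le_trans (ler_wpM2l (ltW th0) H) _.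
by rewrite le_eqVlt; apply/orP; left; apply/eqP; rewrite /r /K; move: th (eta / 2) (2 / eta) => *; ring.
Qed.

Let E0 : R := Int (fun x => (th * s x) ^+ 2).

Let decaying0 : decaying (fun _ : 'rV[R]_n => 0 : R).
Proof.
split; first by move=> k; exact: Ck_cst.
exists 1 => x; rewrite laplacian_cst expr0n mul0r add0r addr0 mul1r.
have -> : gdot (fun _ : 'rV[R]_n => 0 : R) (fun=> 0) x = 0.
  by rewrite /gdot big1// => i _; rewrite (partial_eq (isd_cst _ _ _)) mul0r.
by rewrite mul0r ltW// rw_gt0.
Qed.

Let approx_iter d k : 0 < d -> exists f psi, approx d (r ^+ k * E0 + K * d / (1 - r)) f psi.
Proof.
move=> d0; have r1' : 0 < 1 - r by rewrite subr_gt0.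
elim: k => [|k [f [psi /(approx_step d0)[f' [psi' h]]]]].
  exists (fun=> 0), (fun=> 0); split; split => //.
  - exact: cont_cst.
  - by exists 0.
  - by under eq_fun do rewrite laplacian_cst addr0 expr0n; exact: Itg0.
  - by under eq_fun do rewrite laplacian_cst addr0 expr0n; rewrite Int0 ltW.
  - rewrite expr0 mul1r /g; under eq_fun do rewrite addr0 mulr1 subr0.
    rewrite lerDl; apply: divr_ge0 (ltW r1'); exact: mulr_ge0 (ltW K0) (ltW d0).
exists f', psi'; suff <- : r * (r ^+ k * E0 + K * d / (1 - r)) + K * d = r ^+ k.+1 * E0 + K * d / (1 - r) by [].
by rewrite exprS; move: r K r1' => q p q1; field; rewrite gt_eqF.
Qed.

Let approx_exists e : 0 < e -> exists psi, [/\ decaying psi, forall x, 0 <= psi x,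
  Itg (fun x => (lap psi x + g psi x) ^+ 2) & Int (fun x => (lap psi x + g psi x) ^+ 2) <= e].
Proof.
move=> e0; have r1' : 0 < 1 - r by rewrite subr_gt0.
(* The final residual is at most twice d plus twice the error in [approx]; d <= e/4 gives e/2 for
   the former, and the two terms e/8 of the latter give the other e/2. *)
pose d := Num.min (e / 4) (e / 8 * (1 - r) / K).
have d0 : 0 < d by rewrite lt_min !divr_gt0// mulr_gt0// divr_gt0.
have d1 : d <= e / 4 by rewrite ge_min lexx.
have d2 : K * d / (1 - r) <= e / 8.
  by rewrite ler_pdivrMr// mulrC -ler_pdivlMr// ge_min lexx orbT.
have E00 : 0 <= E0 by apply: Int_ge0 => x; exact: sqr_ge0.
have [k hk] : exists k, r ^+ k * E0 <= e / 8.
  have L : r ^+ k * E0 @[k --> \oo] --> 0 * E0.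
    by apply: cvgM; [apply: cvg_expr; rewrite ger0_norm ?ltW|exact: cvg_cst].
  rewrite mul0r in L; have e8 : 0 < e / 8 by rewrite divr_gt0.
  have [N _ hN] := (@cvgrPdist_le _ _ _ _ _ _ _).1 L _ e8.
  exists N; have := hN N (leqnn N); rewrite /= sub0r normrN => /(le_trans _); apply.
  exact: ler_norm.
have [f [psi [[cf sf f0 dp] [p0 Ip Lp Ep]]]] := approx_iter k d0.
have Ig : Itg (fun x => (g psi x - f x) ^+ 2).
  by apply: Itg_sqr; [exact: cont_sub (cont_g dp) _|exact: csupp_sub (csupp_g _) _].
have ID := ItgD (ItgZ 2 Ip) (ItgZ 2 Ig).
have [cp _] := dp.
have cl : continuous (fun x => (lap psi x + g psi x) ^+ 2).
  by apply: (Ck_continuous (CkX 2 (CkD (Ck0I (continuous_laplacian (cp 2%N))) (Ck0I (cont_g dp))))).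
have pw x : (lap psi x + g psi x) ^+ 2 <= 2 * (lap psi x + f x) ^+ 2 + 2 * (g psi x - f x) ^+ 2.
  move: (lap psi x) (g psi x) (f x) => a b c; have := sqr_ge0 (a + f x - (b - f x)); have := sqr_ge0 (a + c - (b - c)); nra.
have I1 : Itg (fun x => (lap psi x + g psi x) ^+ 2).
  by apply: Itg_dom ID _; [exact: continuous_Mf|move=> x; rewrite ger0_norm ?sqr_ge0].
exists psi; split=> //; apply: le_trans (Int_le I1 ID pw) _.
rewrite (IntD (ItgZ 2 Ip) (ItgZ 2 Ig)) (IntZ _ Ip) (IntZ _ Ig).
have := le_trans Ep (lerD hk d2); move: Lp; move: (Int _) (Int _) => A B; lra.
Qed.

(** This takes the square root of the operator inequality [sL]. Dividing the equation of
    [approx_exists] by 1 + psi turns th s phi^2 into the quantity in [Picone], up to an error phi^2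
    times the residual. *)
Lemma interpolation phi : CK 1 phi -> csupp phi ->
  Int (fun x => s x * phi x ^+ 2) <= (1 + eta) * Int (gdot phi phi).
Proof.
move=> cp sp; have cp0 := Ck_continuous cp.
have Isp : Itg (fun x => s x * phi x ^+ 2).
  by apply: Itg_csupp; [apply: cont_mul => //; exact: Ck_continuous (CkX 2 cp)|exact: csuppM].
suff H : th * Int (fun x => s x * phi x ^+ 2) <= Int (gdot phi phi).
  by rewrite -ler_pdivrMl.
apply/ler_addgt0Pr => tau tau0.
have Ip4 : Itg (fun x => phi x ^+ 4).
  apply: Itg_csupp; first exact: Ck_continuous (CkX 4 cp).
  by apply: (csupp_comp (h := fun z => z ^+ 4)) => //; rewrite expr0n.
pose P := Int (fun x => phi x ^+ 4).
have P0 : 0 <= P by apply: Int_ge0 => x; rewrite -[4%N]/(2 * 2)%N exprM sqr_ge0.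
have P1 : 0 < P + 1 by rewrite ltr_wpDl.
(* Young's inequality splits phi^2 |e| into l e^2/2 and phi^4/(2 l). With a residual of squared norm
   at most tau/l, and l tau > P, each half is at most tau/2. *)
pose l := (P + 1) / tau.
have l0 : 0 < l by rewrite divr_gt0.
have [psi [dp p0 I1 L1]] := approx_exists (divr_gt0 tau0 l0).
have [cpsi _] := dp.
have [I2 L2] := Picone cp sp (cpsi 2%N) p0.
have pw x : th * (s x * phi x ^+ 2) <= - (phi x ^+ 2 / (1 + psi x) * lap psi x) +
    (l / 2 * (lap psi x + g psi x) ^+ 2 + (2 * l)^-1 * phi x ^+ 4).
  have w0 : 0 < 1 + psi x by have := p0 x; lra.
  have w1 : 1 <= 1 + psi x by have := p0 x; lra.
  set e := lap psi x + g psi x.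
  have -> : th * (s x * phi x ^+ 2) = - (phi x ^+ 2 / (1 + psi x) * lap psi x) + phi x ^+ 2 / (1 + psi x) * e.
    rewrite /e /g; move: (lap psi x) (1 + psi x) w0 (s x) (phi x) => a b b0 c f.
    by field; rewrite gt_eqF.
  rewrite lerD2l; apply: (@le_trans _ _ (phi x ^+ 2 * `|e|)).
    rewrite -mulrA ler_wpM2l ?sqr_ge0// mulrC; apply: le_trans (ler_norm _) _.
    rewrite normrM (gtr0_norm (_ : 0 < (1 + psi x)^-1)) ?invr_gt0//.
    by rewrite ler_piMr// invf_le1.
  have -> : e ^+ 2 = `|e| ^+ 2 by rewrite real_normK ?num_real.
  rewrite -subr_ge0; move: `|e| (phi x) => a b.
  have -> : l / 2 * a ^+ 2 + (2 * l)^-1 * b ^+ 4 - b ^+ 2 * a = (2 * l)^-1 * (l * a - b ^+ 2) ^+ 2.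
    by field; rewrite gt_eqF.
  by rewrite mulr_ge0 ?sqr_ge0// invr_ge0 mulr_ge0// ltW.
have J1 := ItgD (ItgZ (l / 2) I1) (ItgZ (2 * l)^-1 Ip4).
rewrite -(IntZ _ Isp); apply: le_trans (Int_le (ItgZ _ Isp) (ItgD (ItgN I2) J1) pw) _.
rewrite (IntD (ItgN I2) J1) (IntN I2) (IntD (ItgZ (l / 2) I1) (ItgZ (2 * l)^-1 Ip4)) (IntZ _ I1) (IntZ _ Ip4).
apply: lerD => //.
have -> : tau = l / 2 * (tau / l) + tau / 2 by field; rewrite gt_eqF.
apply: lerD; first by rewrite ler_wpM2l// divr_ge0// ltW.
rewrite -/P mulrC ler_pdivrMr; last exact: mulr_gt0.
by rewrite (_ : tau / 2 * (2 * l) = P + 1) ?lerDl// /l; field; rewrite ?gt_eqF.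
Qed.

End interpolation.

Section interpolated_stability.
Context {R : realType} {n : nat}.
Hypothesis n5 : (5 <= n)%N.
Implicit Types (phi psi f : 'rV[R]_n -> R) (x : 'rV[R]_n).
Variable u : 'rV[R]_n -> R.
Hypothesis cu : continuous u.
Hypothesis su : stable_outside_compact u.

Definition te x : R := expR (u x / 2).

Lemma te_gt0 x : 0 < te x. Proof. exact: expR_gt0. Qed.

Lemma te2 x : te x ^+ 2 = expR (u x). Proof. exact: expR_half2. Qed.

Lemma cont_te : continuous te.
Proof.
apply: (cont_comp (h := @expR R)); last by move=> x; exact: continuous_expR.
by apply: cont_mul => //; exact: cont_cst.
Qed.

Lemma stability_interpolated (L : R) : 1 < L -> exists B C : R, [/\ 0 <= B, 0 <= C &
  forall phi, CK 1 phi -> csupp phi ->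
  Int (fun x => te x * phi x ^+ 2) <=
    L * Int (gdot phi phi) + C * Int (fun x => ibox B x * phi x ^+ 2)].
Proof.
(* This ensures (1 + eta)^2 <= 1 + 3 eta <= L: one factor is lost in [interpolation], the other in
   removing the inner cutoff, which is at least 1/(1 + eta) off a box. *)
move=> L1; pose eta := Num.min 1 ((L - 1) / 3).
have eta0 : 0 < eta by rewrite lt_min ltr01 divr_gt0//; lra.
have eta1 : eta <= 1 by rewrite ge_min lexx.
have etaL : eta <= (L - 1) / 3 by rewrite ge_min lexx orbT.
have e1 : (1 + eta) ^+ 2 <= L.
  have : eta ^+ 2 <= eta by rewrite expr2 ler_piMl// ltW.
  by move: etaL; nra.
clearbody eta.
have ee0 : 0 < 1 + eta by lra.
have [t [c [t0 st]]] := stability_decaying n5 cu su eta0.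
have [B0 B00 hB] := @cut_lim R n t c ((1 + eta)^-1) t0 ltac:(by rewrite invf_lt1//; lra).
pose B := B0 + 1; have B1 : 0 <= B by rewrite /B; lra.
have [C C0 hC] := box_bounded cont_te B1.
exists B, C; split => // phi cp sp.
have cp2 : continuous (fun x => phi x ^+ 2) by exact: Ck_continuous (CkX 2 cp).
have sp2 : csupp (fun x => phi x ^+ 2) by apply: (csupp_comp (h := fun z => z ^+ 2)) => //; rewrite expr0n.
have cc tau s : continuous (lcut tau s : 'rV[R]_n -> R) by exact: Ck_continuous (Ck_cut 0 _ _).
pose s k x := te x * lcut t c x * lcut (- k.+1%:R^-1) k.+1%:R x.
have cs k : continuous (s k) by apply: cont_mul => //; apply: cont_mul => //; exact: cont_te.
have s0 k x : 0 <= s k x by apply: mulr_ge0 (cut_ge0 _ _ _); apply: mulr_ge0 (cut_ge0 _ _ _); exact: ltW (te_gt0 x).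
have ss k : csupp (s k) by apply: csuppMr; apply: csupp_cut; exact: harm_gt0.
have sL k psi : decaying psi -> Int (fun x => (s k x * psi x) ^+ 2) <= (1 + eta) * Int (fun x => lap psi x ^+ 2).
  move=> dp; have [I1 L0] := st _ dp; have [cpsi _] := dp; apply: le_trans L0; apply: Int_le => //.
    apply: Itg_csupp; last by apply: (csupp_comp (h := fun z => z ^+ 2)); [rewrite expr0n|exact: csuppM].
    by apply: (cont_comp (h := fun z => z ^+ 2)); [apply: cont_mul => //; exact: Ck_continuous (cpsi 0%N)|move=> x; exact: exprn_continuous].
  move=> x; rewrite -te2 /s.
  have -> : (te x * lcut t c x * lcut (- k.+1%:R^-1) k.+1%:R x * psi x) ^+ 2 =
    te x ^+ 2 * (lcut t c x * psi x) ^+ 2 * lcut (- k.+1%:R^-1) k.+1%:R x ^+ 2.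
    by move: (te x) (lcut _ _ x) (lcut _ _ x) (psi x) => p q r w; ring.
  apply: ler_piMr; first by rewrite -exprMn sqr_ge0.
  by apply: exprn_ile1; [exact: cut_ge0|exact: cut_le1].
have bd k : Int (fun x => s k x * phi x ^+ 2) <= (1 + eta) * Int (gdot phi phi).
  exact: (interpolation n5 (cs k) (ss k) (s0 k) eta0 (sL k) cp sp).
have [I1 L1'] : Itg (fun x => te x * lcut t c x * phi x ^+ 2) /\
    Int (fun x => te x * lcut t c x * phi x ^+ 2) <= (1 + eta) * Int (gdot phi phi).
  apply: (@Int_fatou R n (fun k x => s k x * phi x ^+ 2)) bd.
  - by move=> k; apply: Itg_csupp; [exact: cont_mul|exact: csuppMr].
  - by move=> k x; apply: mulr_ge0 (sqr_ge0 _); exact: s0.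
  - move=> x; apply: cvgM; last exact: cvg_cst.
    rewrite -[X in _ --> X]mulr1; apply: cvgM; [exact: cvg_cst|exact: cvg_cut_out].
have [Ib _] := @Int_ibox R n _ B1.
have Mb : Mf (ibox B : 'rV[R]_n -> R) by exact: Itg_Mf Ib.
have I2 : Itg (fun x => te x * phi x ^+ 2).
  by apply: Itg_csupp; [apply: cont_mul => //; exact: cont_te|exact: csuppMr].
have Ip2 : Itg (fun x => phi x ^+ 2) by exact: Itg_csupp.
have I3 : Itg (fun x => ibox B x * phi x ^+ 2).
  apply: (Itg_dom _ Ip2).
    by apply: measurable_funM => //; exact: Itg_Mf Ip2.
  move=> x; rewrite iboxP; case: asboolP => _; rewrite ?mul1r ?mul0r ?normr0 ?sqr_ge0//.
  by rewrite ger0_norm// sqr_ge0.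
have ID := ItgD (ItgZ (1 + eta) I1) (ItgZ C I3).
have pw x : te x * phi x ^+ 2 <= (1 + eta) * (te x * lcut t c x * phi x ^+ 2) + C * (ibox B x * phi x ^+ 2).
  have p0 := sqr_ge0 (phi x); have T0 := te_gt0 x; have c0 := cut_ge0 t c x.
  rewrite iboxP; case: asboolP => bx.
    have := hC _ bx; rewrite gtr0_norm// => h.
    have h1 := ler_wpM2r p0 h.
    have h2 : 0 <= (1 + eta) * (te x * lcut t c x * phi x ^+ 2).
      by apply: mulr_ge0 (ltW ee0) _; apply: mulr_ge0 p0; exact: mulr_ge0 (ltW T0) c0.
    by rewrite mul1r; move: h1 h2; move: (_ * _) (_ * _) (_ * _) => X Y Z; lra.
  rewrite mul0r mulr0 addr0.
  have nx : B0 <= nsq x.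
    by have := not_box_nsq B1 bx; rewrite /B; move: (nsq x) => q; nra.
  have h := hB _ nx.
  have h1 : 1 <= (1 + eta) * lcut t c x by rewrite -ler_pdivrMl// mulr1.
  have := ler_wpM2l (mulr_ge0 (ltW T0) p0) h1.
  by move: (te x) (lcut t c x) (phi x ^+ 2) => a b d; lra.
apply: le_trans (Int_le I2 ID pw) _.
rewrite (IntD (ItgZ (1 + eta) I1) (ItgZ C I3)) (IntZ _ I1) (IntZ _ I3) lerD2r.
apply: le_trans (ler_wpM2l (ltW ee0) L1') _; rewrite mulrA -expr2.
apply: ler_wpM2r e1; apply: Int_ge0 => x; exact: gdot_ge0.
Qed.

End interpolated_stability.

(** * The Nash inequality *)

Section autocorrelation.
Context {R : realType} {n : nat}.
Local Notation RT := (measurableTypeR R).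
Implicit Types (phi : 'rV[R]_n -> R) (x a : 'rV[R]_n).

(** By Tonelli, the autocorrelation of phi integrated over all shifts a is (Int phi)^2. The cube of
    shifts alone contributes at least m times its volume. *)
Lemma Int_autocorr phi (m r : R) : continuous phi -> csupp phi -> (forall x, 0 <= phi x) ->
  0 <= r -> 0 <= m -> (forall a, box r a -> m <= Int (fun x => phi x * phi (x + a))) ->
  m * (2 * r) ^+ n <= Int phi ^+ 2.
Proof.
move=> cp sp p0 r0 m0 h.
have [Ib Vb] := @Int_ibox R n _ r0.
have Ip := Itg_csupp cp sp.
have Is a : Itg (fun x => phi x * phi (x + a)).
  have [J _] := Int_shift a Ip.
  have [B fB] := sp; have [C C0 hC] := box_bounded cp (normr_ge0 B).
  have bd x : `|phi x| <= C.
    have [by0|by0] := pselect (box `|B| x); first exact: hC.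
    by rewrite fB ?normr0//; apply: contra_not by0 => b j; exact: le_trans (b j) (ler_norm _).
  apply: (Itg_dom _ (ItgZ C J)); first by apply: measurable_funM; [exact: Itg_Mf Ip|exact: Itg_Mf J].
  by move=> x; rewrite normrM (ger0_norm (p0 (x + a))) ler_wpM2r.
pose F (z : n.-tuple RT * n.-tuple RT) : \bar R :=
  (phi (row_of_tuple z.2) * phi (row_of_tuple z.2 + row_of_tuple z.1))%:E.
have F0 z : (0 <= F z)%E by rewrite lee_fin mulr_ge0.
have mF : measurable_fun setT F.
  apply/measurable_EFinP; apply: measurable_funM.
    apply: (measurableT_comp (continuous_Mf cp)); exact: measurable_snd.
  rewrite (_ : (fun z : _ * _ => _) = (phi \o row_of_tuple) \o
    (fun z : n.-tuple RT * n.-tuple RT => [tuple (tnth z.2 i + tnth z.1 i : RT) | i < n])); last first.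
    apply/funext => z /=; congr phi; apply/rowP => i; rewrite !mxE; by rewrite tnth_mktuple.
  apply: (measurableT_comp (continuous_Mf cp)).
  apply/measurable_fun_tnthP => i.
  rewrite (_ : _ \o _ = (fun z : n.-tuple RT * n.-tuple RT => (tnth z.2 i : R) + tnth z.1 i)); last first.
    by apply/funext => t; rewrite /= tnth_mktuple.
  apply: measurable_funD.
    apply: (@measurableT_comp _ _ _ _ _ _ (fun t : n.-tuple RT => tnth t i)); [exact: measurable_tnth|exact: measurable_snd].
  apply: (@measurableT_comp _ _ _ _ _ _ (fun t : n.-tuple RT => tnth t i)); [exact: measurable_tnth|exact: measurable_fst].
have FT := @fubini_tonelli _ _ _ _ _ (@lebesgue_tuple R n) (@lebesgue_tuple R n) F mF F0.
have mI := @measurable_fun_fubini_tonelli_F _ _ _ _ _ (@lebesgue_tuple R n) F mF F0.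
have E1 (t : n.-tuple RT) : (\int[@lebesgue_tuple R n]_y F (t, y) =
    (Int (fun x => (phi x * phi (x + row_of_tuple t))%R))%:E)%E by rewrite (IntE (Is _)).
have E2 (t : n.-tuple RT) : (\int[@lebesgue_tuple R n]_y F (y, t) =
    (phi (row_of_tuple t) * Int phi)%:E)%E.
  have [J V] := Int_shift (row_of_tuple t) Ip.
  rewrite -V -(IntZ _ J) (IntE (ItgZ _ J)) /integral_Rn; apply: eq_integral => y _.
  by rewrite /F /= addrC.
rewrite -lee_fin -Vb -(IntZ _ Ib) expr2 -(IntZ _ Ip) (IntE (ItgZ _ Ib)) (IntE (ItgZ _ Ip)).
have -> : integral_Rn (fun x => Int phi * phi x) = (\int[@lebesgue_tuple R n]_t \int[@lebesgue_tuple R n]_y F (y, t))%E.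
  by rewrite /integral_Rn; apply: eq_integral => t _; rewrite E2 mulrC.
rewrite -FT /integral_Rn; apply: ge0_le_integral.
- exact: measurableT.
- move=> t _; rewrite lee_fin; apply: mulr_ge0 => //; rewrite iboxP; by case: asboolP.
- by apply/measurable_EFinP; exact: Itg_Mf (ItgZ m Ib).
- exact: mI.
- move=> t _; rewrite E1 lee_fin iboxP; case: asboolP => bt; rewrite ?mulr1 ?mulr0; first exact: h.
  by apply: Int_ge0 => x; exact: mulr_ge0.
Qed.

End autocorrelation.

Section Gronwall.
Context {R : realType}.

Lemma Gronwall (h h' : R -> R) (r A s : R) : 0 < r -> 0 <= A ->
  (forall t : R, is_derive t (1 : R) h (h' t)) -> h 0 = 0 ->
  (forall t, h' t <= h t / r + r * A) -> 0 <= s <= r -> h s <= expR 1 * r ^+ 2 * A.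
Proof.
move=> r0 A0 dh h0 hh /andP[s0 sr].
have E0 : 0 <= expR 1 * r ^+ 2 * A by exact: mulr_ge0 (mulr_ge0 (expR_ge0 1) (sqr_ge0 r)) A0.
have [->|s1] := eqVneq s 0; first by rewrite h0.
have s2 : 0 < s by rewrite lt_neqAle eq_sym s1.
pose g t := expR (- r^-1 * t) * (h t + r ^+ 2 * A).
have dg (t : R) : is_derive t (1 : R) g ((expR (- r^-1 * t) * (- r^-1 * 1)) * (h t + r ^+ 2 * A) + expR (- r^-1 * t) * (h' t + 0)).
  have D1 := isd_comp (f := fun t : R => - r^-1 * t) (isd_expR _) (isdZ (- r^-1) (is_derive_id t (1 : R))).
  exact: isdM D1 (isdD (dh t) (isd_cst _ _ _)).
have cg : {within `[0, s], continuous g} by apply: continuous_subspaceT => x; exact: is_derive_cont (dg x).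
have [c _ gc] := @MVT R g (fun t => (expR (- r^-1 * t) * (- r^-1 * 1)) * (h t + r ^+ 2 * A) + expR (- r^-1 * t) * (h' t + 0)) 0 s s2 (fun x _ => dg x) cg.
have : g s - g 0 <= 0.
  rewrite gc subr0; apply: mulr_le0_ge0 => //.
  have -> : expR (- r^-1 * c) * (- r^-1 * 1) * (h c + r ^+ 2 * A) + expR (- r^-1 * c) * (h' c + 0) =
    expR (- r^-1 * c) * (h' c - (h c / r + r * A)) by field; rewrite gt_eqF.
  by apply: mulr_ge0_le0; [exact: expR_ge0|rewrite subr_le0].
rewrite /g mulr0 expR0 h0 add0r mul1r subr_le0 mulNr expRN => H.
have e1 : expR (r^-1 * s) <= expR 1 by rewrite ler_expR mulrC ler_pdivrMr// mul1r.
have H1 : h s + r ^+ 2 * A <= expR (r^-1 * s) * (r ^+ 2 * A) by rewrite -ler_pdivrMl ?expR_gt0.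
have P0 : 0 <= r ^+ 2 * A by rewrite mulr_ge0// sqr_ge0.
have := ler_wpM2r P0 e1; move: H1 P0; rewrite -mulrA; move: (r ^+ 2 * A) (_ * _) (_ * _) => p q q'; lra.
Qed.

End Gronwall.

Section Nash.
Context {R : realType} {n : nat}.
Implicit Types (phi : 'rV[R]_n -> R) (x a : 'rV[R]_n).

Definition osc phi a : R := Int (fun x => (phi (x + a) - phi x) ^+ 2).

Section fixed.
Variable phi : 'rV[R]_n -> R.
Hypotheses (cp : CK 1 phi) (sp : csupp phi).

Lemma csupp_shift (f : 'rV[R]_n -> R) a : csupp f -> csupp (fun x => f (x + a)).
Proof.
move=> [B fB]; exists (B + `|a|) => x nx; apply: fB; apply: contra_not nx => bx.
have -> : x = (x + a) - a by rewrite addrK.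
exact: boxB bx (box_norm a).
Qed.

Lemma cont_shift (f : 'rV[R]_n -> R) a : continuous f -> continuous (fun x => f (x + a)).
Proof.
move=> cf y; apply: seq_continuous => w wy.
exact: cvg_comp (cvgD wy (cvg_cst a)) (cf _).
Qed.

Lemma Itg_osc a : Itg (fun x => (phi (x + a) - phi x) ^+ 2).
Proof.
have c0 := Ck_continuous cp; have c1 := cont_shift (a := a) c0.
apply: Itg_csupp; first exact: Ck_continuous (CkX 2 (CkB (Ck0I c1) (Ck0I c0))).
apply: (csupp_comp (h := fun z => z ^+ 2)); first by rewrite expr0n.
apply: csuppD; first exact: csupp_shift.
by apply: (csupp_comp (h := fun z => - z)) => //; rewrite oppr0.
Qed.

Lemma oscN a : osc phi (- a) = osc phi a.
Proof.
have [_ V] := Int_shift (- a) (Itg_osc a).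
rewrite /osc -V; congr Int; apply/funext => x; rewrite subrK.
by rewrite -sqrrN opprB.
Qed.

Lemma oscD a b : osc phi (a + b) <= 2 * osc phi a + 2 * osc phi b.
Proof.
have [I1 V1] := Int_shift a (Itg_osc b).
rewrite /osc -V1 -(IntZ _ I1) -(IntZ _ (Itg_osc a)) -(IntD (ItgZ 2 (Itg_osc a)) (ItgZ 2 I1)).
apply: (Int_le (Itg_osc _) (ItgD (ItgZ 2 (Itg_osc a)) (ItgZ 2 I1))) => x.
rewrite addrA; move: (phi (x + a + b)) (phi (x + a)) (phi x) => p q s.
have := sqr_ge0 ((p - q) - (q - s)); nra.
Qed.

Lemma Itg_pd2 i : Itg (fun x => pd i phi x ^+ 2).
Proof.
apply: Itg_csupp; first exact: Ck_continuous (CkX 2 (Ck_partial i cp)).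
by apply: (csupp_comp (h := fun z => z ^+ 2)); [rewrite expr0n|exact: csupp_partial].
Qed.

(** Along the axis, the derivative of the squared L^2 oscillation is at most osc/r + r Int |d_i
    phi|^2, by Young's inequality and translation invariance. [Gronwall] over a length r then costs
    only a factor e. *)
Lemma osc_coord i (s r : R) : 0 < r -> 0 <= s <= r ->
  osc phi (s *: delta_mx 0 i) <= expR 1 * r ^+ 2 * Int (gdot phi phi).
Proof.
move=> r0 sr.
have c0 := Ck_continuous cp; have cpi := Ck_continuous (Ck_partial i cp).
have spi := csupp_partial i sp.
pose g t x := 2 * (phi (x + t *: delta_mx 0 i) - phi x) * pd i phi (x + t *: delta_mx 0 i).
have Ig : Itg (gdot phi phi) by apply: Itg_csupp; [exact: continuous_gdot|exact: csupp_gdot].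
have A0 : 0 <= Int (gdot phi phi) by apply: Int_ge0 => x; exact: gdot_ge0.
have [B fB] := sp.
have [C C0 hC] : exists2 C : R, 0 <= C & forall x, `|phi x| <= C /\ `|pd i phi x| <= C.
  have [C1 C10 h1] := box_bounded c0 (normr_ge0 B).
  have [C2 C20 h2] := box_bounded cpi (normr_ge0 B).
  have nb y : ~ box `|B| y -> ~ box B y.
    by move=> by0; apply: contra_not by0 => b j; exact: le_trans (b j) (ler_norm _).
  exists (C1 + C2) => [|x]; first exact: addr_ge0.
  have [bx|bx] := pselect (box `|B| x).
    by have := h1 _ bx; have := h2 _ bx; split; lra.
  rewrite fB; last exact: nb.
  rewrite (@box_partial _ _ phi i `|B| x _ bx); last by move=> y /nb; exact: fB.
  by rewrite normr0; split; exact: addr_ge0.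
apply: (@Gronwall R (fun t => osc phi (t *: delta_mx 0 i)) (fun t => Int (g t)) r _ s) => //.
- move=> t.
  have t1 : 0 < `|t| + 1 by rewrite ltr_wpDl.
  have [Ib _] := @Int_ibox R n (`|B| + (`|t| + 1)) (addr_ge0 (normr_ge0 _) (ltW t1)).
  apply: (@isd_Int R n (fun t x => (phi (x + t *: delta_mx 0 i) - phi x) ^+ 2) g
    (fun x => 4 * C ^+ 2 * ibox (`|B| + (`|t| + 1)) x) t 1) => //.
  + by move=> q _; exact: Itg_osc.
  + move=> q x _.
    have D : is_derive q (1 : R) (fun q : R => phi (x + q *: delta_mx 0 i) - phi x) (pd i phi (x + q *: delta_mx 0 i) - 0).
      by apply: isdB (isd_cst _ _ _); apply: isd_line; exact: (Ck_isd i _ cp).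
    have := isd_comp (isd_exprn 2 _) D.
    by rewrite subr0 expr1.
  + exact: ItgZ.
  + move=> q x /andP[q1 q2]; rewrite iboxP; case: asboolP => bx; last first.
      rewrite mulr0 /g.
      have nb : ~ box `|B| (x + q *: delta_mx 0 i).
        apply: contra_not bx => bx.
        have -> : x = (x + q *: delta_mx 0 i) - q *: delta_mx 0 i by rewrite addrK.
        apply: boxB bx _ => j; rewrite !mxE normrM.
        have q3 : `|q| <= `|t| + 1.
          have -> : q = t + (q - t) by ring.
          apply: le_trans (ler_normD _ _) _; rewrite lerD2l ler_norml; apply/andP; split; lra.
        by case: (_ && _); rewrite ?normr1 ?mulr1 ?normr0 ?mulr0// ltW.
      rewrite (@box_partial _ _ phi i `|B| _ _ nb) ?mulr0 ?normr0//.
      move=> y by0; apply: fB; apply: contra_not by0 => b j; exact: le_trans (b j) (ler_norm _).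
    rewrite mulr1 /g; have [h1 h2] := hC (x + q *: delta_mx 0 i); have [h3 _] := hC x.
    rewrite !normrM (@ger0_norm _ 2)//.
    have h4 : `|phi (x + q *: delta_mx 0 i) - phi x| <= 2 * C.
      by apply: le_trans (ler_normB _ _) _; lra.
    have h5 := ler_pM (normr_ge0 _) (normr_ge0 _) h4 h2.
    by rewrite -mulrA; move: h5; move: (_ * _) => z; lra.
- rewrite scale0r /osc; under eq_fun do rewrite addr0 subrr expr0n.
  exact: Int0.
- move=> t.
  have [I1 V1] := Int_shift (t *: delta_mx 0 i) (Itg_pd2 i).
  have Io := Itg_osc (t *: delta_mx 0 i).
  have L : Int (fun x => pd i phi x ^+ 2) <= Int (gdot phi phi).
    apply: (Int_le (Itg_pd2 i) Ig) => x; rewrite /gdot (bigD1 i)//= -expr2 lerDl.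
    by apply: sumr_ge0 => j _; rewrite -expr2 sqr_ge0.
  apply: (@le_trans _ _ (osc phi (t *: delta_mx 0 i) / r + r * Int (fun x => pd i phi x ^+ 2))); last first.
    by rewrite lerD2l ler_pM2l.
  rewrite mulrC -V1 -(IntZ _ I1) /osc -(IntZ _ Io) -(IntD (ItgZ _ Io) (ItgZ _ I1)).
  have cs := cont_shift (a := t *: delta_mx 0 i) c0.
  have csi := cont_shift (a := t *: delta_mx 0 i) cpi.
  apply: (Int_le _ (ItgD (ItgZ _ Io) (ItgZ _ I1))).
    apply: Itg_csupp; last by apply: csuppMr; exact: csupp_shift.
    apply: cont_mul => //; apply: cont_mul; first exact: cont_cst.
    exact: Ck_continuous (CkB (Ck0I cs) (Ck0I c0)).
  move=> x; rewrite /g; move: (phi _ - phi _) (pd _ _ _) => p q.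
  rewrite -subr_ge0.
  have -> : r^-1 * p ^+ 2 + r * q ^+ 2 - 2 * p * q = r^-1 * (p - r * q) ^+ 2 by field; rewrite gt_eqF.
  by rewrite mulr_ge0 ?sqr_ge0// invr_ge0 ltW.
Qed.

Definition prefix (a : 'rV[R]_n) (k : nat) : 'rV[R]_n := \row_i (if (i < k)%N then a 0 i else 0).

(** The shift is performed one coordinate at a time along [prefix]. Each step at most doubles the
    oscillation and adds 2 T, which gives (2^(k + 1) - 2) T after k steps. *)
Lemma osc_box (a : 'rV[R]_n) (r : R) : 0 < r -> box r a ->
  osc phi a <= 2 ^+ n.+1 * (expR 1 * r ^+ 2 * Int (gdot phi phi)).
Proof.
move=> r0 ba; set T := expR 1 * _ * _.
have T0 : 0 <= T.
  apply: mulr_ge0 (mulr_ge0 (expR_ge0 1) (sqr_ge0 r)) _; apply: Int_ge0 => x; exact: gdot_ge0.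
have step i : osc phi (a 0 i *: delta_mx 0 i) <= T.
  have := ba i; have [a0|a0] := ler0P (a 0 i) => ai.
    by rewrite -oscN -scaleNr; apply: osc_coord => //; rewrite oppr_ge0 a0.
  by apply: osc_coord => //; rewrite (ltW a0).
have P k : (k <= n)%N -> osc phi (prefix a k) <= (2 ^+ k.+1 - 2) * T.
  elim: k => [_|k IH kn].
    have -> : prefix a 0 = 0 by apply/rowP => i; rewrite !mxE.
    rewrite expr1 subrr mul0r /osc; under eq_fun do rewrite addr0 subrr expr0n.
    by rewrite Int0.
  have -> : prefix a k.+1 = prefix a k + a 0 (Ordinal kn) *: delta_mx 0 (Ordinal kn).
    apply/rowP => i; rewrite !mxE eqxx/= ltnS leq_eqVlt.
    case: (ltngtP i k) => ik /=.
    - by rewrite (_ : i == _ = false) ?mulr0 ?addr0//; apply/eqP => E; rewrite E /= ltnn in ik.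
    - by rewrite (_ : i == _ = false) ?mulr0 ?addr0//; apply/eqP => E; rewrite E /= ltnn in ik.
    - have -> : i = Ordinal kn by exact: val_inj.
      by rewrite eqxx mulr1 add0r.
  apply: le_trans (oscD _ _) _.
  have := IH (ltnW kn); have := step (Ordinal kn); rewrite [2 ^+ k.+2]exprS.
  move: (osc _ _) (osc _ _) (2 ^+ k.+1) => p q w; lra.
have := P n (leqnn n).
have -> : prefix a n = a by apply/rowP => i; rewrite !mxE ltn_ord.
move=> /le_trans; apply; rewrite ler_wpM2r//; lra.
Qed.

(** For shifts in the cube the autocorrelation equals Int phi^2 minus half the oscillation, hence is
    at least Int phi^2 minus the gradient term; [Int_autocorr] does the rest. The radius r stays
    free, so this additive form can be used at any scale. *)
Lemma Nash (r : R) : (forall x, 0 <= phi x) -> 0 < r ->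
  Int (fun x => phi x ^+ 2) <= 2 ^+ n * expR 1 * r ^+ 2 * Int (gdot phi phi) + (2 * r) ^- n * Int phi ^+ 2.
Proof.
move=> p0 r0; have c0 := Ck_continuous cp.
have I2 : Itg (fun x => phi x ^+ 2).
  apply: Itg_csupp; first exact: Ck_continuous (CkX 2 cp).
  by apply: (csupp_comp (h := fun z => z ^+ 2)) => //; rewrite expr0n.
set S := Int (fun x => phi x ^+ 2); set T := _ * Int (gdot phi phi).
rewrite -lerBlDl; have [m0|m0] := ltP (S - T) 0.
  by apply: le_trans (ltW m0) _; rewrite mulr_ge0 ?sqr_ge0// invr_ge0 exprn_ge0// mulr_ge0// ltW.
have rn : 0 < (2 * r) ^+ n by rewrite exprn_gt0// mulr_gt0.
rewrite mulrC ler_pdivlMr//; apply: Int_autocorr => //; first exact: ltW.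
move=> a ba; have H := osc_box r0 ba.
have [I2a V2] := Int_shift a I2.
have Io := Itg_osc a.
have E : (fun x => phi x * phi (x + a)) = (fun x => 2^-1 * (phi x ^+ 2 + phi (x + a) ^+ 2 - (phi (x + a) - phi x) ^+ 2)).
  by apply/funext => x; field.
rewrite E (IntZ _ (ItgB (ItgD I2 I2a) Io)) (IntB (ItgD I2 I2a) Io) (IntD I2 I2a) V2 -/S -/(osc phi a).
move: H; rewrite /T exprS -!mulrA; move: (2 ^+ n * _) (osc _ _) => p q; lra.
Qed.

End fixed.
End Nash.

(** * Energy identities *)

Section gdot_square.
Context {R : realType} {n : nat}.
Implicit Types (f g h : 'rV[R]_n -> R) (x : 'rV[R]_n).

(** The companion of [Int_gdot] with the support on the function that is differentiated twice: in
    [energy] it is Z^2, not j(w), that has compact support. *)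
Lemma Int_gdot_csupp f g : CK 2 f -> CK 1 g -> csupp f ->
  Int (gdot g f) = - Int (fun x => g x * lap f x).
Proof.
move=> cf cg sf.
have cfi i := Ck_partial i cf.
have I1 i : Itg (fun x => pd i g x * pd i f x).
  apply: Itg_csupp; last by apply: csuppMr; exact: csupp_partial.
  by apply: (@Ck_continuous _ _ 0); apply: CkM; [exact: Ck_partial|exact: CkW].
have I2 i : Itg (fun x => g x * pd i (pd i f) x).
  apply: Itg_csupp; last by apply: csuppMr; do 2 apply: csupp_partial.
  by apply: (@Ck_continuous _ _ 0); apply: CkM; [exact: CkW|exact: Ck_partial].
rewrite /gdot Int_sum//.
under [in RHS]eq_fun do rewrite !lapE mulr_sumr.
rewrite Int_sum// -sumrN; apply: eq_bigr => i _.
apply/eqP; rewrite -addr_eq0 -IntD//; apply/eqP.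
rewrite -[RHS](@Int_div_csupp _ _ (fun x => g x * pd i f x) i).
- by congr Int; apply/funext => x; rewrite partialM.
- by apply: CkM.
- by apply: csuppMr; exact: csupp_partial.
Qed.

Lemma gdot_sqrl f g x : CK 1 f -> gdot (fun y => f y ^+ 2) g x = 2 * f x * gdot f g x.
Proof.
move=> cf; have D := isd_exprn 2 (f x); rewrite expr1 in D.
exact: (gdot_compl (p := fun z => z ^+ 2) (p' := fun z => 2 * z) g cf D).
Qed.

End gdot_square.

Section energy.
Context {R : realType} {n : nat}.
Variables (w : 'rV[R]_n -> R) (g g1 k j : R -> R).
Hypothesis cw : CK 2 w.
Hypothesis dg : forall x, is_derive (w x) (1 : R) g (g1 (w x)).
Hypothesis dk : forall x, is_derive (w x) (1 : R) k (g1 (w x) ^+ 2).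
Hypothesis dj : forall x, is_derive (w x) (1 : R) j (g (w x) * g1 (w x) - k (w x)).
Hypothesis Cg : CK 1 (fun x => g (w x)).
Hypothesis Ckk : CK 1 (fun x => k (w x)).
Hypothesis Cj : CK 1 (fun x => j (w x)).

(** Since k' = g'^2, testing the equation of w with k(w) Z^2 produces the term g'^2 Z^2 |grad w|^2.
    What remains of the cross term has coefficient g g' - k = j', so it is grad j(w) . grad Z^2 and
    can be integrated by parts. *)
Lemma energy (Z : 'rV[R]_n -> R) : CK 2 Z -> csupp Z ->
  Int (gdot (fun x => g (w x) * Z x) (fun x => g (w x) * Z x)) =
  Int (fun x => k (w x) * - lap w x * Z x ^+ 2) - Int (fun x => j (w x) * lap (fun y => Z y ^+ 2) x) +
  Int (fun x => g (w x) ^+ 2 * gdot Z Z x).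
Proof.
move=> cZ sZ; have cZ1 := CkW cZ; have cw1 := CkW cw.
have cZ2 := CkX 2 cZ; have cZ21 := CkW cZ2.
have sZ2 : csupp (fun x => Z x ^+ 2) by apply: (csupp_comp (h := fun z => z ^+ 2)) => //; rewrite expr0n.
have ckZ : CK 1 (fun x => k (w x) * Z x ^+ 2) by exact: CkM.
have skZ : csupp (fun x => k (w x) * Z x ^+ 2) by exact: csuppMr.
have E1 := Int_gdot cw ckZ skZ.
have E2 := Int_gdot_csupp cZ2 Cj sZ2.
have I1 : Itg (gdot (fun x => k (w x) * Z x ^+ 2) w).
  by apply: Itg_csupp; [exact: continuous_gdot|exact: csupp_gdot].
have I2 : Itg (gdot (fun x => j (w x)) (fun x => Z x ^+ 2)).
  have -> : gdot (fun x => j (w x)) (fun x => Z x ^+ 2) = gdot (fun x => Z x ^+ 2) (fun x => j (w x)).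
    by apply/funext => x; exact: gdotC.
  by apply: Itg_csupp; [exact: continuous_gdot|exact: csupp_gdot].
have I3 : Itg (fun x => g (w x) ^+ 2 * gdot Z Z x).
  apply: Itg_csupp; last by apply: csuppMr; exact: csupp_gdot.
  by apply: cont_mul; [exact: Ck_continuous (CkX 2 Cg)|exact: continuous_gdot].
have -> : Int (fun x => k (w x) * - lap w x * Z x ^+ 2) = Int (gdot (fun x => k (w x) * Z x ^+ 2) w).
  have I4 : Itg (fun x => k (w x) * Z x ^+ 2 * lap w x).
    apply: Itg_csupp; last exact: csuppM.
    by apply: cont_mul; [exact: Ck_continuous ckZ|exact: continuous_laplacian].
  by rewrite E1 -(IntN I4); congr Int; apply/funext => x; move: (lap w x) (k _) => a b; ring.
rewrite -E2 -(IntD I1 I2) -(IntD (ItgD I1 I2) I3); congr Int; apply/funext => x.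
have G1 (h h1 : R -> R) f : is_derive (w x) (1 : R) h (h1 (w x)) ->
    gdot (fun y => h (w y)) f x = h1 (w x) * gdot w f x.
  by move=> dh; exact: gdot_compl.
rewrite gdotMl// [gdot Z (fun _ => _) x]gdotC [gdot (fun y => g (w y)) (fun _ => _) x]gdotC !gdotMl//.
rewrite [gdot Z (fun y => g (w y)) x]gdotC !(G1 g g1)//.
rewrite [gdot w (fun y => g (w y)) x]gdotC (G1 g g1)//.
rewrite (G1 k (fun z => g1 z ^+ 2))// (G1 j (fun z => g z * g1 z - k z))//.
rewrite [gdot w (fun y => Z y ^+ 2) x]gdotC !gdot_sqrl// [gdot Z w x]gdotC.
move: (g _) (g1 _) (k _) (gdot w w x) (gdot w Z x) (gdot Z Z x) (Z x) => a b c d e f z.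
ring.
Qed.

End energy.

Section cutoff_limit.
Context {R : realType} {n : nat}.
Implicit Types (x : 'rV[R]_n).

(** The derivatives of the cutoff are O(T), so for T small against Cz they only double the bounds
    relative to Z. The constants thus survive when the cutoff is sent to 1. *)
Lemma lcut_sqr_bounds (Z : 'rV[R]_n -> R) (Cz T c : R) : CK 2 Z -> (forall x, 0 <= Z x) ->
  0 < Cz <= 1 ->
  (forall x, `|lap (fun y => Z y ^+ 2) x| <= Cz * Z x ^+ 2) ->
  (forall x, gdot Z Z x <= Cz * Z x ^+ 2) ->
  0 <= T -> T <= 1 -> (2 * @cutC R n ^+ 2 + 10 * @cutC R n) * T <= Cz ->
  (forall x, `|lap (fun y => (lcut (- T) c y * Z y) ^+ 2) x| <= 2 * Cz * Z x ^+ 2) /\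
  (forall x, gdot (fun y => lcut (- T) c y * Z y) (fun y => lcut (- T) c y * Z y) x <= 2 * Cz * Z x ^+ 2).
Proof.
move=> cZ Z0 /andP[Cz0 Cz1] hl hg T0 T1 hT.
have cZ1 := CkW cZ; have cc k : CK k (lcut (- T) c : 'rV[R]_n -> R) by exact: Ck_cut.
have C0 := @cutC_gt0 R n; set C := @cutC R n in hT C0 *.
have nT : `|- T| <= 1 by rewrite normrN ger0_norm.
have W a x : a <= 0 -> 0 < rw (1 : R) a x <= 1.
  move=> a0; rewrite rw_gt0//=; have := @rw_le R n 1 a 0 x (lexx _) a0; by rewrite rw0.
have gc x : gdot (lcut (- T) c) (lcut (- T) c) x <= (C * T) ^+ 2.
  have := gdot_cut (- T) c x; rewrite mulrN sqrrN => /le_trans; apply.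
  by rewrite ler_piMr ?sqr_ge0//; have /andP[] := @W (-1) x ltac:(lra).
have lc x : `|lap (lcut (- T) c) x| <= C * T.
  have CT0 : 0 <= C * T by apply: mulr_ge0 => //; exact: ltW.
  rewrite -(ler_pXn2r (isT : (0 < 2)%N)) ?nnegrE// real_normK ?num_real//.
  have := lap_cut_le c x nT; rewrite mulrN sqrrN => /le_trans; apply.
  by rewrite ler_piMr ?sqr_ge0//; have /andP[] := @W (-2) x ltac:(lra).
have gcZ x : `|gdot (lcut (- T) c) Z x| <= C * T * Z x.
  have CT0 : 0 <= C * T by apply: mulr_ge0 => //; exact: ltW.
  have CTZ : 0 <= C * T * Z x by exact: mulr_ge0.
  rewrite -(ler_pXn2r (isT : (0 < 2)%N)) ?nnegrE// real_normK ?num_real//.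
  apply: le_trans (gdot_CS _ _ _) _; rewrite exprMn.
  apply: ler_pM => //; [exact: gdot_ge0|exact: gdot_ge0|].
  by apply: le_trans (hg x) _; rewrite ler_piMl// sqr_ge0.
have TT : T ^+ 2 <= T by rewrite expr2 ler_piMl.
have C2 : 0 <= C ^+ 2 by exact: sqr_ge0.
split.
- move=> x; have -> : (fun y => (lcut (- T) c y * Z y) ^+ 2) = (fun y => lcut (- T) c y ^+ 2 * Z y ^+ 2).
    by apply/funext => y; rewrite exprMn.
  rewrite laplacianM; [|exact: CkX|exact: CkX].
  rewrite laplacian_sqr// gdot_sqrl// gdotC gdot_sqrl// gdotC.
  have := gc x; have := lc x; have := gcZ x; have := hl x; have := Z0 x.
  have := cut_ge0 (- T) c x; have := cut_le1 (- T) c x; have := gdot_ge0 (lcut (- T) c) x.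
  move: (lap (fun y => Z y ^+ 2) x) (lap (lcut _ _) x) (gdot (lcut _ _) Z x) (gdot (lcut _ _) (lcut _ _) x) (lcut _ _ x) (Z x).
  move=> L lx gx g2 ch z g20 ch1 ch0 z0 HL Hg Hl H2.
  have z2 := sqr_ge0 z.
  apply: le_trans (ler_normD _ _) _; apply: le_trans (lerD (ler_normD _ _) (lexx _)) _.
  have n1 : `|(2 * g2 + 2 * ch * lx) * z ^+ 2| <= (2 * (C * T) ^+ 2 + 2 * (C * T)) * z ^+ 2.
    rewrite normrM (ger0_norm z2); apply: ler_wpM2r => //.
    apply: le_trans (ler_normD _ _) _; apply: lerD.
      by rewrite ger0_norm; lra.
    rewrite -mulrA normrM (@ger0_norm _ 2)// ler_pM2l// normrM (ger0_norm ch0).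
    by apply: le_trans (_ : 1 * `|lx| <= _); [exact: ler_wpM2r|rewrite mul1r].
  have n2 : `|2 * (2 * ch * (2 * z * gx))| <= 8 * (C * T) * z ^+ 2.
    have -> : 2 * (2 * ch * (2 * z * gx)) = (8 * z) * (ch * gx) by ring.
    rewrite normrM (@ger0_norm _ (8 * z)); last by rewrite mulr_ge0.
    have -> : 8 * (C * T) * z ^+ 2 = 8 * z * (C * T * z) by ring.
    rewrite ler_wpM2l ?mulr_ge0// normrM (ger0_norm ch0).
    by apply: le_trans (_ : 1 * `|gx| <= _); [exact: ler_wpM2r|rewrite mul1r].
  have n3 : `|ch ^+ 2 * L| <= Cz * z ^+ 2.
    rewrite normrM (ger0_norm (sqr_ge0 _)); apply: le_trans (_ : 1 * `|L| <= _); last by rewrite mul1r.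
    by apply: ler_wpM2r => //; rewrite expr_le1.
  apply: le_trans (lerD (lerD n1 n2) n3) _.
  have : (2 * (C * T) ^+ 2 + 2 * (C * T) + 8 * (C * T)) <= Cz.
    apply: le_trans hT; rewrite exprMn; have := ler_wpM2l C2 TT; lra.
  by move=> /(ler_wpM2r z2); lra.
- move=> x; rewrite gdotMl// [gdot Z _ x]gdotC [gdot (lcut _ _) (fun _ => _) x]gdotC !gdotMl// [gdot Z (lcut _ _) x]gdotC.
  have := gc x; have := gcZ x; have := hg x; have := Z0 x; have := gdot_ge0 Z x.
  have := cut_ge0 (- T) c x; have := cut_le1 (- T) c x.
  move: (gdot Z Z x) (gdot (lcut _ _) Z x) (gdot (lcut _ _) (lcut _ _) x) (lcut _ _ x) (Z x).
  move=> gz gx g2 ch z ch1 ch0 gz0 z0 Hg Hgx H2.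
  have z2 := sqr_ge0 z.
  have -> : ch * (ch * gz + z * gx) + z * (ch * gx + z * g2) = ch ^+ 2 * gz + 2 * (z * (ch * gx)) + z ^+ 2 * g2 by ring.
  have n1 : ch ^+ 2 * gz <= Cz * z ^+ 2.
    apply: le_trans Hg; rewrite ler_piMl// expr_le1//.
  have n2 : z * (ch * gx) <= C * T * z ^+ 2.
    have -> : C * T * z ^+ 2 = z * (C * T * z) by ring.
    apply: ler_wpM2l => //; apply: le_trans (ler_norm _) _; rewrite normrM (ger0_norm ch0).
    by apply: le_trans (_ : 1 * `|gx| <= _); [exact: ler_wpM2r|rewrite mul1r].
  have n3 : z ^+ 2 * g2 <= (C * T) ^+ 2 * z ^+ 2 by rewrite mulrC ler_wpM2r.
  have : 2 * (C * T) + (C * T) ^+ 2 <= Cz.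
    apply: le_trans hT; rewrite exprMn; have := ler_wpM2l C2 TT; have := mulr_ge0 C2 T0; have := mulr_ge0 (ltW C0) T0; lra.
  by move=> /(ler_wpM2r z2); lra.
Qed.

End cutoff_limit.

Section energy_limit.
Context {R : realType} {n : nat}.

Lemma Itg_ibox (B : R) (f : 'rV[R]_n -> R) : 0 <= B -> Itg f -> Itg (fun x => ibox B x * f x).
Proof.
move=> B0 If; have [Ib _] := @Int_ibox R n _ B0.
have IN : Itg (fun x => `|f x|) by exact: (integrable_norm If).
apply: (Itg_dom _ IN); first by apply: measurable_funM; [exact: Itg_Mf Ib|exact: Itg_Mf If].
by move=> x; rewrite iboxP; case: asboolP => _; rewrite ?mul1r ?mul0r ?normr0.
Qed.

Lemma ibox_ge0 (B : R) (x : 'rV[R]_n) : 0 <= ibox B x.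
Proof. by rewrite iboxP; case: asboolP. Qed.

Variables (w : 'rV[R]_n -> R) (g g1 k j : R -> R).
Hypothesis cw : CK 2 w.
Hypothesis dg : forall x, is_derive (w x) (1 : R) g (g1 (w x)).
Hypothesis dk : forall x, is_derive (w x) (1 : R) k (g1 (w x) ^+ 2).
Hypothesis dj : forall x, is_derive (w x) (1 : R) j (g (w x) * g1 (w x) - k (w x)).
Hypothesis Cg : CK 1 (fun x => g (w x)).
Hypothesis Ckk : CK 1 (fun x => k (w x)).
Hypothesis Cj : CK 1 (fun x => j (w x)).
Hypothesis g0 : forall x, 0 <= g (w x).
Hypothesis kF0 : forall x, 0 <= k (w x) * - lap w x.
Variables (om : 'rV[R]_n -> R) (A D E B : R).
Hypotheses (com : continuous om) (om0 : forall x, 0 <= om x).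
Hypotheses (A0 : 0 <= A) (D0 : 0 <= D) (E0 : 0 <= E) (B0 : 0 <= B).
Hypothesis H : forall phi, CK 1 phi -> csupp phi -> (forall x, 0 <= phi x) ->
  Int (fun x => om x * phi x ^+ 2) <=
  A * Int (gdot phi phi) + D * Int phi ^+ 2 + E * Int (fun x => ibox B x * phi x ^+ 2).
Variables (Z : 'rV[R]_n -> R) (Cz : R).
Hypotheses (cZ : CK 2 Z) (Z0 : forall x, 0 <= Z x) (Cz01 : 0 < Cz <= 1).
Hypothesis hl : forall x, `|lap (fun y => Z y ^+ 2) x| <= Cz * Z x ^+ 2.
Hypothesis hg : forall x, gdot Z Z x <= Cz * Z x ^+ 2.
Hypothesis I1 : Itg (fun x => k (w x) * - lap w x * Z x ^+ 2).
Hypothesis I2 : Itg (fun x => `|j (w x)| * Z x ^+ 2).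
Hypothesis I3 : Itg (fun x => g (w x) ^+ 2 * Z x ^+ 2).
Hypothesis I4 : Itg (fun x => g (w x) * Z x).

(** The functional inequality [H] is kept abstract so that the passage from compactly supported to
    decaying Z is done once: D = 0 for interpolated stability, E = 0 and om = 1 for Nash's
    inequality. *)
Lemma energy_limit :
  Itg (fun x => om x * (g (w x) ^+ 2 * Z x ^+ 2)) /\
  Int (fun x => om x * (g (w x) ^+ 2 * Z x ^+ 2)) <=
  A * (Int (fun x => k (w x) * - lap w x * Z x ^+ 2) + 2 * Cz *
     (Int (fun x => `|j (w x)| * Z x ^+ 2) + Int (fun x => g (w x) ^+ 2 * Z x ^+ 2)))
  + D * Int (fun x => g (w x) * Z x) ^+ 2 + E * Int (fun x => ibox B x * (g (w x) ^+ 2 * Z x ^+ 2)).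
Proof.
have CC0 : 0 < 2 * @cutC R n ^+ 2 + 10 * @cutC R n.
  by have := @cutC_gt0 R n; have := sqr_ge0 (@cutC R n); lra.
have [Cz0 Cz1] := andP Cz01.
have [N hN] : exists N, forall m, (N <= m)%N -> (2 * @cutC R n ^+ 2 + 10 * @cutC R n) * m.+1%:R^-1 <= Cz.
  have [N _ hN] := (@cvgrPdist_le _ _ _ _ _ _ _).1 (@cvg_harmonic R) _ (divr_gt0 Cz0 CC0).
  exists N => m /hN; rewrite /= sub0r normrN ger0_norm ?(ltW (harm_gt0 m))//.
  by rewrite ler_pdivlMr// mulrC.
pose ch m : 'rV[R]_n -> R := lcut (- (m + N).+1%:R^-1) (m + N).+1%:R.
pose Y m x := ch m x * Z x.
have cch m q : CK q (ch m) by exact: Ck_cut.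
have sch m : csupp (ch m) by apply: csupp_cut; exact: harm_gt0.
have ch01 m x : 0 <= ch m x <= 1 by rewrite cut_ge0 cut_le1.
have cY m : CK 2 (Y m) by exact: CkM.
have sY m : csupp (Y m) by exact: csuppM.
have Yle m x : 0 <= Y m x <= Z x.
  have /andP[c0 c1] := ch01 m x; rewrite mulr_ge0//=.
  by rewrite ler_piMl.
have Y2 m x : Y m x ^+ 2 <= Z x ^+ 2.
  by have /andP[y0 yz] := Yle m x; rewrite lerXn2r// nnegrE// (le_trans y0).
have [bl bg] : (forall m x, `|lap (fun y => Y m y ^+ 2) x| <= 2 * Cz * Z x ^+ 2) /\
    (forall m x, gdot (Y m) (Y m) x <= 2 * Cz * Z x ^+ 2).
  by split => m; have [] := lcut_sqr_bounds (m + N).+1%:R cZ Z0 Cz01 hl hg (ltW (harm_gt0 (m + N))) (harm_le1 (m + N)) (hN _ (leq_addl m N)).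
pose phi m x := g (w x) * Y m x.
have cphi m : CK 1 (phi m) by apply: CkM => //; exact: CkW.
have sphi m : csupp (phi m) by exact: csuppMr.
have phi0 m x : 0 <= phi m x by apply: mulr_ge0 => //; have /andP[] := Yle m x.
have IM := ItgD I2 I3.
set RHS := (X in _ /\ _ <= X).
have bd m : Int (fun x => om x * phi m x ^+ 2) <= RHS.
  apply: le_trans (H (cphi m) (sphi m) (phi0 m)) _.
  have EN := energy cw dg dk dj Cg Ckk Cj (cY m) (sY m).
  have T1 : Int (gdot (phi m) (phi m)) <= Int (fun x => k (w x) * - lap w x * Z x ^+ 2) + 2 * Cz *
     (Int (fun x => `|j (w x)| * Z x ^+ 2) + Int (fun x => g (w x) ^+ 2 * Z x ^+ 2)).
    rewrite EN mulrDr addrA; apply: lerD; first apply: lerD.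
    - apply: (Int_le _ I1).
        apply: Itg_csupp; last by apply: csuppMr; apply: (csupp_comp (h := fun z => z ^+ 2)) => //; rewrite expr0n.
        apply: cont_mul; last exact: Ck_continuous (CkX 2 (cY m)).
        exact: Ck_continuous (CkM (CkW Ckk) (CkN (@Ck_laplacian _ _ 0 _ cw))).
      by move=> x; exact: ler_wpM2l.
    - rewrite -(IntZ _ I2); have Ij : Itg (fun x => j (w x) * lap (fun y => Y m y ^+ 2) x).
        apply: Itg_csupp; last first.
          by apply: csuppMr; apply: csupp_laplacian; apply: (csupp_comp (h := fun z => z ^+ 2)) => //; rewrite expr0n.
        by apply: cont_mul; [exact: Ck_continuous Cj|exact: continuous_laplacian (CkX 2 (cY m))].
      rewrite -(IntN Ij); apply: (Int_le (ItgN Ij) (ItgZ _ I2)) => x.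
      apply: le_trans (ler_norm _) _; rewrite normrN normrM.
      rewrite mulrCA; apply: ler_wpM2l => //; exact: bl.
    - rewrite -(IntZ _ I3); apply: (Int_le _ (ItgZ _ I3)).
        apply: Itg_csupp; last by apply: csuppMr; exact: csupp_gdot.
        by apply: cont_mul; [exact: Ck_continuous (CkX 2 Cg)|apply: continuous_gdot; exact: CkW (cY m)].
      by move=> x; rewrite (mulrCA (2 * Cz)); apply: ler_wpM2l (bg m x); exact: sqr_ge0.
  have T2 : Int (phi m) <= Int (fun x => g (w x) * Z x).
    apply: (Int_le _ I4); first exact: Itg_csupp (Ck_continuous (cphi m)) (sphi m).
    by move=> x; apply: ler_wpM2l => //; have /andP[] := Yle m x.
  have T20 : 0 <= Int (phi m) by exact: Int_ge0.
  have T3 : Int (fun x => ibox B x * phi m x ^+ 2) <= Int (fun x => ibox B x * (g (w x) ^+ 2 * Z x ^+ 2)).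
    apply: (Int_le _ (Itg_ibox B0 I3)).
      apply: Itg_ibox => //; apply: Itg_csupp; first exact: Ck_continuous (CkX 2 (cphi m)).
      by apply: (csupp_comp (h := fun z => z ^+ 2)) => //; rewrite expr0n.
    move=> x; apply: ler_wpM2l; first exact: ibox_ge0.
    by rewrite exprMn; apply: ler_wpM2l; first exact: sqr_ge0.
  rewrite /RHS; apply: lerD; last exact: ler_wpM2l.
  apply: lerD; apply: ler_wpM2l => //.
  by rewrite lerXn2r// nnegrE// (le_trans T20).
apply: (@Int_fatou R n (fun m x => om x * phi m x ^+ 2)) bd.
- move=> m; apply: Itg_csupp; first by apply: cont_mul => //; exact: Ck_continuous (CkX 2 (cphi m)).
  by apply: csuppMr; apply: (csupp_comp (h := fun z => z ^+ 2)) => //; rewrite expr0n.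
- by move=> m x; apply: mulr_ge0 (sqr_ge0 _).
- move=> x; apply: cvgM; first exact: cvg_cst.
  rewrite -exprMn.
  have L : phi m x @[m --> \oo] --> g (w x) * Z x.
    apply: cvgM; first exact: cvg_cst.
    rewrite -[X in _ --> X]mul1r; apply: cvgM; last exact: cvg_cst.
    have := @cvg_cut_out R n x; rewrite -(cvg_shiftn N); exact.
  have L2 : phi m x * phi m x @[m --> \oo] --> (g (w x) * Z x) * (g (w x) * Z x) by apply: cvgM.
  exact: L2.
Qed.

End energy_limit.

(** * Power inequalities and dyadic weights *)

Section power_split.
Context {R : realType}.

(** Compare t with mu/eta: above this threshold the first term on the right dominates, below it the
    second does. *)
Lemma power_split (p t eta mu : R) : 0 < p -> 0 <= t -> 0 < eta -> 0 < mu ->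
  mu * t `^ p <= eta * t `^ (p + 1) + eta `^ (- p) * mu `^ (p + 1).
Proof.
move=> p0 t0 e0 m0.
have [h|h] := leP (mu / eta) t.
  have tp : 0 < t by apply: lt_le_trans h; rewrite divr_gt0.
  have h1 : mu <= eta * t by rewrite mulrC -ler_pdivrMr.
  have -> : t `^ (p + 1) = t * t `^ p by rewrite powRD ?(gt_eqF tp) ?implybT// powRr1// mulrC.
  rewrite mulrA; apply: le_trans (ler_wpM2r (powR_ge0 _ _) h1) _.
  by rewrite lerDl mulr_ge0 ?powR_ge0.
have h1 : t `^ p <= (mu / eta) `^ p.
  have m1 : 0 <= mu / eta by rewrite divr_ge0 ?ltW.
  by apply: (ge0_ler_powR (ltW p0)) (ltW h); rewrite nnegrE.
have -> : mu `^ (p + 1) = mu * mu `^ p by rewrite powRD ?(gt_eqF m0) ?implybT// powRr1 ?(ltW m0)// mulrC.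
apply: le_trans (ler_wpM2l (ltW m0) h1) _.
rewrite powRM ?invr_ge0 ?(ltW m0) ?(ltW e0)// -powR_inv1 ?(ltW e0)// -powRrM mulN1r.
rewrite (_ : mu * (_ * _) = eta `^ (- p) * (mu * mu `^ p)); last by ring.
by rewrite lerDr; apply: mulr_ge0; [exact: ltW|exact: powR_ge0].
Qed.

(** The difference of the two sides is t (t^p - w^p) (t - w), a product of quantities of the same
    sign. *)
Lemma power_exchange (p t w : R) : 0 <= p -> 0 < t -> 0 < w ->
  t `^ (p + 1) * w + t ^+ 2 * w `^ p <= t `^ (p + 2) + t * w `^ (p + 1).
Proof.
move=> p0 t0 w0.
have E (s q : R) : 0 < s -> s `^ (q + 1) = s `^ q * s.
  by move=> s0; rewrite powRD ?(gt_eqF s0) ?implybT// powRr1// ltW.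
have -> : p + 2 = p + 1 + 1 by ring.
rewrite !E// -subr_ge0.
have -> : t `^ p * t * t + t * (w `^ p * w) - (t `^ p * t * w + t ^+ 2 * w `^ p) =
  t * ((t `^ p - w `^ p) * (t - w)) by ring.
apply: mulr_ge0; first exact: ltW.
have [tw|tw] := leP t w.
  apply: mulr_le0; last by rewrite subr_le0.
  by rewrite subr_le0; apply: ge0_ler_powR; rewrite ?nnegrE// ltW.
apply: mulr_ge0; last by rewrite subr_ge0 ltW.
by rewrite subr_ge0; apply: ge0_ler_powR; rewrite ?nnegrE// ltW.
Qed.

End power_split.

Section Int_CS.
Context {R : realType} {n : nat}.
Implicit Types (f g h : 'rV[R]_n -> R).

(** The integrated form of 2 h <= l f + g/l is optimised at l = Int h / Int f; a vanishing Int f is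
    excluded by a large l instead. *)
Lemma Int_CS f g h : Itg f -> Itg g -> Itg h -> (forall x, 0 <= h x) -> (forall x, 0 <= f x) ->
  (forall x, 0 <= g x) -> (forall x, h x ^+ 2 <= f x * g x) -> Int h ^+ 2 <= Int f * Int g.
Proof.
move=> If Ig Ih h0 f0 g0 hfg.
have F0 : 0 <= Int f by exact: Int_ge0.
have G0 : 0 <= Int g by exact: Int_ge0.
have H0 : 0 <= Int h by exact: Int_ge0.
have K (l : R) : 0 < l -> 2 * Int h <= l * Int f + l^-1 * Int g.
  move=> l0; rewrite -(IntZ _ Ih) -(IntZ _ If) -(IntZ _ Ig) -(IntD (ItgZ _ If) (ItgZ _ Ig)).
  apply: (Int_le (ItgZ _ Ih) (ItgD (ItgZ _ If) (ItgZ _ Ig))) => x.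
  have P0 : 0 <= l * f x + l^-1 * g x by rewrite addr_ge0// mulr_ge0// ltW// invr_gt0.
  rewrite -(ler_pXn2r (isT : (0 < 2)%N)) ?nnegrE ?mulr_ge0//.
  have := hfg x; have := sqr_ge0 (l * f x - l^-1 * g x).
  have -> : (l * f x - l^-1 * g x) ^+ 2 = (l * f x + l^-1 * g x) ^+ 2 - 4 * (f x * g x).
    by field; rewrite gt_eqF.
  by rewrite exprMn; move: (_ ^+ 2) (h x ^+ 2) (f x * g x) => a b c; lra.
have [h1|h1] := eqVneq (Int h) 0; first by rewrite h1 expr0n mulr_ge0.
have hp : 0 < Int h by rewrite lt_neqAle eq_sym h1.
have [f1|f1] := eqVneq (Int f) 0.
  have := K ((Int g + 1) / Int h) ltac:(by rewrite divr_gt0//; lra).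
  rewrite f1 mulr0 add0r invf_div => k.
  have : Int h / (Int g + 1) * Int g <= Int h.
    by rewrite mulrAC ler_pdivrMr; [rewrite ler_pM2l//; lra|lra].
  lra.
have fp : 0 < Int f by rewrite lt_neqAle eq_sym f1.
have := K (Int h / Int f) (divr_gt0 hp fp).
rewrite divfK// invf_div => k.
have : Int h <= Int f / Int h * Int g by lra.
by rewrite mulrAC ler_pdivlMr// expr2.
Qed.

End Int_CS.

Section weight.
Context {R : realType} {n : nat}.
Hypothesis n5 : (5 <= n)%N.
Implicit Types (x : 'rV[R]_n) (M : R).

Definition wX M x : R := M ^+ 2 / rho (M ^+ 2) x.

Lemma wX_gt0 M x : 0 < M -> 0 < wX M x.
Proof. by move=> M0; rewrite divr_gt0 ?exprn_gt0// rho_gt0// exprn_gt0. Qed.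

Lemma wX_le1 M x : 0 < M -> wX M x <= 1.
Proof.
move=> M0; have M2 : 0 < M ^+ 2 by rewrite exprn_gt0.
by rewrite ler_pdivrMr ?rho_gt0// mul1r /rho lerDl nsq_ge0.
Qed.

Lemma wX_rw M m x : 0 < M -> wX M x ^+ m = (M ^+ 2) ^+ m * rw (M ^+ 2) (- m%:R) x.
Proof.
move=> M0; rewrite /wX exprMn; congr (_ * _).
have r0 : 0 <= rho (M ^+ 2) x by rewrite ltW// rho_gt0// exprn_gt0.
by rewrite /rw powRN powR_mulrn// exprVn.
Qed.

Lemma Ck_wX k M m : 0 < M -> CK k (fun x : 'rV[R]_n => wX M x ^+ m).
Proof.
move=> M0; rewrite (funext (fun x => wX_rw m x M0)).
by apply: CkZ; apply: Ck_rw; rewrite exprn_gt0.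
Qed.

Lemma powRexp (s : R) m : 0 < s -> s `^ m%:R = s ^+ m.
Proof. by move=> s0; rewrite powR_mulrn// ltW. Qed.

Lemma wX_cexp M m x : 0 < M -> (n <= m)%N -> wX M x ^+ m <= M ^+ n.+2 * rw (M ^+ 2) (@cexp R n) x.
Proof.
move=> M0 nm; have X0 := wX_gt0 x M0; have X1 := wX_le1 x M0.
have M2 : 0 < M ^+ 2 by rewrite exprn_gt0.
have -> : M ^+ n.+2 * rw (M ^+ 2) (@cexp R n) x = wX M x `^ (- @cexp R n).
  rewrite /wX powRM ?invr_ge0 ?(ltW M2) ?(ltW (rho_gt0 _ M2))//; congr (_ * _).
    by rewrite powRN powR_cexp// invrK addn2.
  rewrite -powR_inv1 ?(ltW (rho_gt0 _ M2))// -powRrM; congr (_ `^ _); ring.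
rewrite -powRexp// -[wX M x]invrK -powR_inv1 ?invr_ge0 ?(ltW X0)// -!powRrM.
apply: ler_powR; first by rewrite invf_ge1.
rewrite !mulN1r lerN2 /cexp.
have : n%:R <= m%:R :> R by rewrite ler_nat.
have : 5 <= n%:R :> R by rewrite ler_nat.
lra.
Qed.

Lemma Int_wX M m : 0 < M -> (n <= m)%N ->
  Itg (fun x : 'rV[R]_n => wX M x ^+ m) /\ Int (fun x : 'rV[R]_n => wX M x ^+ m) <= 3 * 4 ^+ n * M ^+ n.
Proof.
move=> M0 nm; have [I1 L1] := @Int_rw_cexp R n M M0.
have I2 : Itg (fun x : 'rV[R]_n => wX M x ^+ m).
  apply: (Itg_dom _ (ItgZ (M ^+ n.+2) I1)); first exact: continuous_Mf (Ck_continuous (Ck_wX 0 m M0)).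
  by move=> x; rewrite ger0_norm ?exprn_ge0 ?(ltW (wX_gt0 _ M0))// wX_cexp.
split=> //; apply: le_trans (Int_le I2 (ItgZ (M ^+ n.+2) I1) (fun x => wX_cexp x M0 nm)) _.
rewrite (IntZ _ I1); apply: le_trans (ler_wpM2l (exprn_ge0 _ (ltW M0)) L1) _.
rewrite le_eqVlt; apply/orP; left; apply/eqP; rewrite -addn2 exprD.
by move: (M ^+ n) (4 ^+ n) => a b; field; rewrite gt_eqF.
Qed.

Definition wC (q : nat) : R := 4 * q%:R * n%:R + 8 * q%:R * (2 * q%:R + 1).

Lemma wC_ge0 q : 0 <= wC q.
Proof. by rewrite /wC !(addr_ge0, mulr_ge0). Qed.

(** Since M^2 + |x|^2 >= M^2 everywhere, two derivatives of a power of this function cost a factor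
    M^-2 relative to the power itself. A compactly supported cutoff would not give such relative
    bounds. *)
Lemma wX_bounds M q : 0 < M ->
  (forall x, `|lap (fun y : 'rV[R]_n => (wX M y ^+ q) ^+ 2) x| <= wC q * M ^- 2 * (wX M x ^+ q) ^+ 2) /\
  (forall x, gdot (fun y : 'rV[R]_n => wX M y ^+ q) (fun y => wX M y ^+ q) x <= wC q * M ^- 2 * (wX M x ^+ q) ^+ 2).
Proof.
move=> M0; have M2 : 0 < M ^+ 2 by rewrite exprn_gt0.
have r1 x : rw (M ^+ 2) (-1) x <= M ^- 2.
  by rewrite rwN rw1// lef_pV2 ?posrE ?rho_gt0// lerDl nsq_ge0.
split=> x.
- have -> : (fun y : 'rV[R]_n => (wX M y ^+ q) ^+ 2) = (fun y => (M ^+ 2) ^+ (q * 2) * rw (M ^+ 2) (- (q * 2)%:R) y).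
    by apply/funext => y; rewrite -exprM wX_rw.
  rewrite laplacianZ; last exact: Ck_rw.
  rewrite laplacian_rw// -(exprM (wX M x)) wX_rw//.
  have h1 := nsq_rw (- (q * 2)%:R - 1) x M2.
  have -> : - (q * 2)%:R - 2 = - (q * 2)%:R - 1 - 1 :> R by ring.
  have h2 : 0 <= nsq x * rw (M ^+ 2) (- (q * 2)%:R - 1 - 1) x.
    by rewrite mulr_ge0 ?nsq_ge0// ltW// rw_gt0.
  have h3 := rw_gt0 (- (q * 2)%:R - 1) x M2.
  have h4 : rw (M ^+ 2) (- (q * 2)%:R - 1) x <= M ^- 2 * rw (M ^+ 2) (- (q * 2)%:R) x.
    rewrite rwD// mulrC; apply: ler_wpM2r => //; exact: ltW (rw_gt0 _ _ M2).
  have A0 : 0 <= (M ^+ 2) ^+ (q * 2) by rewrite exprn_ge0// ltW.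
  rewrite normrM (ger0_norm A0) mulrCA; apply: ler_wpM2l => //.
  rewrite -[4 * _ * _ * _ * _]mulrA.
  apply: le_trans (_ : wC q * rw (M ^+ 2) (- (q * 2)%:R - 1) x <= _); last first.
    by rewrite -[X in _ <= X]mulrA; apply: ler_wpM2l h4; exact: wC_ge0.
  move: h1 h2 h3; rewrite /wC natrM; move: (rw _ _ _) (nsq x * _) => a b h1 h2 /ltW h3.
  have Q0 : 0 <= q%:R :> R by [].
  have QN : 0 <= q%:R * n%:R :> R by [].
  have QQ : 0 <= q%:R * (2 * q%:R + 1) :> R by rewrite mulr_ge0// addr_ge0// mulr_ge0.
  have ab : 0 <= a - b by rewrite subr_ge0.
  move: q%:R n%:R Q0 QN QQ => Q m Q0 QN QQ.
  have := mulr_ge0 QN h3; have := mulr_ge0 QQ h3; have := mulr_ge0 QQ h2; have := mulr_ge0 QQ ab.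
  by move=> c1 c2 c3 c4; rewrite ler_norml; apply/andP; split; lra.
- have -> : (fun y : 'rV[R]_n => wX M y ^+ q) = (fun y => (M ^+ 2) ^+ q * rw (M ^+ 2) (- q%:R) y).
    by apply/funext => y; rewrite wX_rw.
  rewrite gdotZl; last exact: Ck_rw.
  rewrite gdotC gdotZl; last exact: Ck_rw.
  rewrite gdot_rw// rw_mul// wX_rw// [(_ * rw _ _ x) ^+ 2]exprMn [rw _ (- q%:R) x ^+ 2]expr2 rw_mul//.
  have h1 := nsq_rw (- q%:R - 1 + (- q%:R - 1) + 1) x M2; rewrite addrK in h1.
  have h4 : rw (M ^+ 2) (- q%:R - 1 + (- q%:R - 1) + 1) x <= M ^- 2 * rw (M ^+ 2) (- q%:R + - q%:R) x.
    have -> : - q%:R - 1 + (- q%:R - 1) + 1 = - q%:R + - q%:R + -1 :> R by ring.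
    rewrite [rw _ (_ + -1) _]rwD// mulrC; apply: ler_wpM2r => //; exact: ltW (rw_gt0 _ _ M2).
  have A0 : 0 <= ((M ^+ 2) ^+ q) ^+ 2 by exact: sqr_ge0.
  have -> : (M ^+ 2) ^+ q * ((M ^+ 2) ^+ q * (4 * - q%:R * - q%:R * nsq x * rw (M ^+ 2) (- q%:R - 1 + (- q%:R - 1)) x)) =
    ((M ^+ 2) ^+ q) ^+ 2 * (4 * q%:R ^+ 2 * (nsq x * rw (M ^+ 2) (- q%:R - 1 + (- q%:R - 1)) x)) by ring.
  rewrite [X in _ <= X]mulrCA; apply: ler_wpM2l => //.
  apply: le_trans (ler_wpM2l _ (le_trans h1 h4)) _; first by rewrite mulr_ge0// sqr_ge0.
  rewrite -[X in _ <= X]mulrA; apply: ler_wpM2r.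
    by apply: mulr_ge0; [rewrite invr_ge0 ltW|exact: ltW (rw_gt0 _ _ M2)].
  have Q0 : 0 <= q%:R :> R by [].
  by have : 0 <= q%:R * n%:R :> R by []; rewrite /wC; move: (q%:R) (n%:R) Q0 => Q m; nra.
Qed.

Lemma cvg_wX q x : (wX k.+1%:R x ^+ q) @[k --> \oo] --> (1 : R).
Proof.
have H : wX k.+1%:R x @[k --> \oo] --> (1 : R).
  have E k : wX k.+1%:R x = 1 - nsq x / rho (k.+1%:R ^+ 2) x.
    have r0 : rho (k.+1%:R ^+ 2) x != 0 :> R by rewrite gt_eqF// rho_gt0// exprn_gt0.
    apply: (mulIf r0); rewrite mulrBl !divfK// mul1r /rho; ring.
  apply/cvgrPdist_le => e e0.
  have D : 0 < e / (1 + nsq x) by rewrite divr_gt0//; have := nsq_ge0 x; lra.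
  have [N _ hN] := (@cvgrPdist_le _ _ _ _ _ _ _).1 (@cvg_harmonic R) _ D.
  exists N => // k /hN; rewrite /= sub0r normrN ger0_norm ?(ltW (harm_gt0 k))// => hk.
  have k1 : 1 <= k.+1%:R :> R by rewrite ler1n.
  have r0 : 0 < rho (k.+1%:R ^+ 2) x :> R by rewrite rho_gt0// exprn_gt0.
  rewrite E opprB addrC subrK ger0_norm; last by rewrite divr_ge0 ?nsq_ge0// ltW.
  have h1 : (rho (k.+1%:R ^+ 2) x)^-1 <= k.+1%:R^-1 :> R.
    rewrite lef_pV2 ?posrE ?ltr0n//; apply: le_trans (_ : k.+1%:R ^+ 2 <= _); last by rewrite lerDl nsq_ge0.
    by rewrite expr2 ler_pMr// ltr0n.
  apply: le_trans (ler_wpM2l (nsq_ge0 x) h1) _.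
  apply: le_trans (ler_wpM2l (nsq_ge0 x) hk) _.
  rewrite mulrA ler_pdivrMr; last by have := nsq_ge0 x; lra.
  by rewrite mulrC ler_pM2l//; lra.
have : (wX k.+1%:R x ^+ q) @[k --> \oo] --> (1 : R) ^+ q.
  exact: (cvg_comp (fun k => wX k.+1%:R x) (fun z => z ^+ q) H (@exprn_continuous R q 1)).
by rewrite expr1n.
Qed.

End weight.

(** * Uniform bounds in the subcritical range *)

Section main_estimate.
Context {R : realType} {n : nat}.
Hypothesis n5 : (5 <= n)%N.
Hypothesis n12 : (n <= 12)%N.
Implicit Types (x : 'rV[R]_n) (M : R).
Variables (u v : 'rV[R]_n -> R).
Hypotheses (cu : CK 2 u) (cv : CK 2 v).
Hypothesis lu : forall x, lap u x = - v x.
Hypothesis lv : forall x, lap v x = - expR (u x).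
Hypothesis v0 : forall x, 0 < v x.
Hypothesis vi : vanishes_at_infinity v.
Hypothesis su : stable_outside_compact u.

Let N5 : 5 <= n%:R :> R. Proof. by rewrite ler_nat. Qed.
Let N12 : n%:R <= 12 :> R. Proof. by rewrite ler_nat. Qed.
Let n0 : (0 < n)%N. Proof. exact: leq_trans n5. Qed.
(** The exponent for which 2 al + 1 = n/2: then (M^-2)^(2 al + 1) = M^-n compensates the mass M^n of
    the weight. *)
Let al : R := (n%:R - 2) / 4.
Let al_ge : 3 / 4 <= al. Proof. by have := N5; rewrite /al; lra. Qed.
Let al_le : al <= 5 / 2. Proof. by have := N12; rewrite /al; lra. Qed.
Let al2E : 2 * al + 1 = n%:R / 2. Proof. by rewrite /al; field. Qed.

Let cv0 : continuous v := Ck_continuous cv.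
Let t0 x : 0 < te u x := te_gt0 u x.
Let ct : continuous (te u) := cont_te (Ck_continuous cu).

Lemma te_le_v x : te u x <= v x.
Proof.
have h := comparison cu cv lu lv v0 x.
rewrite -(ler_pXn2r (isT : (0 < 2)%N)) ?nnegrE ?(ltW (v0 x)) ?(ltW (t0 x))// te2.
by apply: le_trans h; have := expR_ge0 (u x); lra.
Qed.

Lemma v_bounded : exists2 V : R, 0 < V & forall x, v x <= V.
Proof.
have [V V0 hV] := vanishes_bounded cv0 vi; exists V => // x.
exact: le_trans (ler_norm _) (hV x).
Qed.

Lemma v_wX_le : exists2 C : R, 0 <= C & forall M, 1 <= M ->
  Itg (fun x => v x * wX M x ^+ n) /\ Int (fun x => v x * wX M x ^+ n) <= C * (M ^+ n * M ^- 2).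
Proof.
have [C C0 hC] := G_expu_le n5 cu su; exists C => // M M1.
have M0 : 0 < M by lra.
have M2 : 0 < M ^+ 2 by rewrite exprn_gt0.
have [I1 L1] := hC M M1; have [I2 L2] := kernel_v_le n5 cv lv v0 vi M2 I1.
have I2' := ItgZ (M ^+ n.+2) I2.
have pw x : v x * wX M x ^+ n <= M ^+ n.+2 * (rw (M ^+ 2) (@cexp R n) x * v x).
  by rewrite mulrA mulrC ler_pM2r// wX_cexp.
have I3 : Itg (fun x => v x * wX M x ^+ n).
  apply: (Itg_dom _ I2'); first by apply: continuous_Mf; apply: cont_mul => //; exact: Ck_continuous (Ck_wX 0 n M0).
  by move=> x; rewrite ger0_norm// mulr_ge0 ?(ltW (v0 x))// exprn_ge0// ltW// wX_gt0.
split=> //; apply: le_trans (Int_le I3 I2' pw) _; rewrite (IntZ _ I2).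
have J0 : 0 <= Int (fun x => rw (M ^+ 2) (@cexp R n) x * v x).
  by apply: Int_ge0 => x; apply: mulr_ge0; [exact: ltW (rw_gt0 _ _ M2)|exact: ltW].
have h : M ^+ 2 * Int (fun x => rw (M ^+ 2) (@cexp R n) x * v x) <= C * M ^- 2.
  apply: le_trans (le_trans L2 L1); rewrite -[X in _ <= X]mulrA; apply: ler_peMl.
    by apply: mulr_ge0 => //; exact: ltW.
  by have := N5; move: (n%:R) => m; nra.
rewrite -addn2 exprD -mulrA [C * _]mulrCA ler_pM2l ?exprn_gt0//.
Qed.

Lemma Itg_bd (f : 'rV[R]_n -> R) (C M : R) (m : nat) : continuous f -> (forall x, `|f x| <= C) ->
  0 < M -> (n <= m)%N -> Itg (fun x => f x * wX M x ^+ m).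
Proof.
move=> cf fC M0 nm; have [I1 _] := Int_wX n5 M0 nm.
apply: (Itg_dom _ (ItgZ C I1)).
  by apply: continuous_Mf; apply: cont_mul => //; exact: Ck_continuous (Ck_wX 0 m M0).
move=> x; have X0 : 0 <= wX M x ^+ m by rewrite exprn_ge0// ltW// wX_gt0.
by rewrite normrM (ger0_norm X0); exact: ler_wpM2r.
Qed.

Lemma cont_powR (f : 'rV[R]_n -> R) (a : R) : continuous f -> (forall x, 0 < f x) ->
  continuous (fun x => f x `^ a).
Proof. by move=> cf f0; exact: Ck_continuous (Ck_powR a (Ck0I cf) f0). Qed.

Lemma powR_bd (f : 'rV[R]_n -> R) (a C : R) x : 0 <= a -> 0 < f x -> f x <= C -> `|f x `^ a| <= C `^ a.
Proof.
move=> a0 f0 fC; rewrite ger0_norm ?powR_ge0//.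
by apply: ge0_ler_powR; rewrite ?nnegrE// ltW// (lt_le_trans f0).
Qed.

(** The high power leaves room in [int_v_al]: Z^2 = wX^(10 n) is split as n + 9 n by the
    Cauchy-Schwarz inequality, and Young's inequality then spends up to 5 n, because 2 al <= 5. *)
Let Z M x : R := wX M x ^+ (5 * n).
Let Z2E M x : Z M x ^+ 2 = wX M x ^+ (10 * n). Proof. by rewrite /Z -exprM mulnAC. Qed.
Let n10 : (n <= 10 * n)%N. Proof. exact: leq_pmull. Qed.
Let Zge0 M x : 0 < M -> 0 <= Z M x. Proof. by move=> M0; rewrite exprn_ge0// ltW// wX_gt0. Qed.

Let C5 : R := @wC R n (5 * n) + 1.
Let C5_gt0 : 0 < C5. Proof. by have := @wC_ge0 R n (5 * n); rewrite /C5; lra. Qed.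

Let Zb M : C5 <= M -> [/\ 1 <= M, 0 < C5 * M ^- 2 <= 1,
  forall x, `|lap (fun y => Z M y ^+ 2) x| <= C5 * M ^- 2 * Z M x ^+ 2 &
  forall x, gdot (Z M) (Z M) x <= C5 * M ^- 2 * Z M x ^+ 2].
Proof.
have W0 := @wC_ge0 R n (5 * n).
move=> CM; have M1 : 1 <= M by apply: le_trans CM; rewrite /C5; lra.
have M0 : 0 < M by lra.
have M2 : 0 < M ^+ 2 by rewrite exprn_gt0.
have [b1 b2] := @wX_bounds R n M (5 * n) M0.
have le : @wC R n (5 * n) * M ^- 2 <= C5 * M ^- 2 by rewrite ler_pM2r ?invr_gt0// /C5; lra.
split => //.
- rewrite mulr_gt0 ?invr_gt0//= ler_pdivrMr// mul1r; apply: le_trans CM _.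
  by rewrite expr2 ler_peMr// ltW.
- by move=> x; apply: le_trans (b1 x) _; apply: ler_wpM2r => //; exact: sqr_ge0.
- by move=> x; apply: le_trans (b2 x) _; apply: ler_wpM2r => //; exact: sqr_ge0.
Qed.

(** [Xi] and [Y] are what interpolated stability bounds for the test functions e^(al u/2) Z and v^al
    Z; [P] and [Q] come out of their energies; [S] is the cutoff error of the second. *)
Let Xi M := Int (fun x => te u x `^ (2 * al + 1) * Z M x ^+ 2).
Let P M := Int (fun x => te u x `^ (2 * al) * v x * Z M x ^+ 2).
Let Y M := Int (fun x => te u x * v x `^ (2 * al) * Z M x ^+ 2).
Let Q M := Int (fun x => te u x ^+ 2 * v x `^ (2 * al - 1) * Z M x ^+ 2).
Let S M := Int (fun x => v x `^ (2 * al) * Z M x ^+ 2).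

Let powM M : 0 < M -> (M ^- 2) `^ (2 * al + 1) = M ^- n.
Proof.
move=> M0; have V0 : 0 <= M^-1 by rewrite invr_ge0 ltW.
rewrite al2E -exprVn -[X in X `^ _]powR_mulrn// -powRrM.
rewrite (_ : 2 * (n%:R / 2) = n%:R :> R); last by field.
by rewrite powR_mulrn ?invr_ge0 ?(ltW M0)// exprVn.
Qed.

Let te_powE (a : R) x : te u x `^ a = expR (a / 2 * u x).
Proof. by rewrite /te -expRM; congr expR; ring. Qed.

Let Itg_Z (f : 'rV[R]_n -> R) (C : R) M : continuous f -> (forall x, `|f x| <= C) -> 0 < M ->
  Itg (fun x => f x * Z M x ^+ 2).
Proof.
move=> cf fC M0; have := Itg_bd cf fC M0 n10.
by rewrite (funext (fun x => congr1 (fun z => f x * z) (Z2E M x))).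
Qed.

Let ibox_term (f : 'rV[R]_n -> R) (C B M : R) : continuous f -> (forall x, 0 <= f x <= C) -> 0 <= B -> 0 < M ->
  Int (fun x => ibox B x * (f x * Z M x ^+ 2)) <= C * (2 * B) ^+ n.
Proof.
move=> cf fC B0 M0; have [Ib Vb] := @Int_ibox R n _ B0.
rewrite -Vb -(IntZ _ Ib); apply: (Int_le _ (ItgZ _ Ib)).
  apply: Itg_ibox => //; apply: (@Itg_Z f C) => // x.
  by have /andP[f0 f1] := fC x; rewrite ger0_norm.
move=> x; rewrite mulrC; apply: ler_wpM2r; first exact: ibox_ge0.
have /andP[f0 f1] := fC x; apply: le_trans f1; apply: ler_piMr => //.
by rewrite exprn_ile1 ?Zge0// exprn_ile1 ?wX_le1// ltW// wX_gt0.
Qed.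

(** By [power_split] with mu = M^-2, the cutoff error M^-2 f^p is traded for a small multiple of
    f^(p + 1) and a constant times M^-n, which the mass of the weight turns into a constant. *)
Let int_split M (f : 'rV[R]_n -> R) (V p K eta : R) : 0 < M -> continuous f -> (forall x, 0 < f x <= V) ->
  0 < p -> 0 < K -> 0 < eta -> (M ^- 2) `^ (p + 1) <= M ^- n ->
  K * M ^- 2 * Int (fun x => f x `^ p * Z M x ^+ 2) <=
  eta * Int (fun x => f x `^ (p + 1) * Z M x ^+ 2) + K * (eta / K) `^ (- p) * (3 * 4 ^+ n).
Proof.
move=> M0 cf fV p0 K0 e0 pM.
have f0 x : 0 < f x by have /andP[] := fV x.
have fV' x : f x <= V by have /andP[] := fV x.
have M2 : 0 < M ^- 2 by rewrite invr_gt0 exprn_gt0.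
have eK : 0 < eta / K by rewrite divr_gt0.
have p1 : 0 <= p + 1 by lra.
have I1 : Itg (fun x => f x `^ p * Z M x ^+ 2).
  by apply: (@Itg_Z (fun x => f x `^ p) (V `^ p)) => //; [exact: cont_powR|move=> x; exact: powR_bd (ltW p0) (f0 x) (fV' x)].
have I2 : Itg (fun x => f x `^ (p + 1) * Z M x ^+ 2).
  by apply: (@Itg_Z (fun x => f x `^ (p + 1)) (V `^ (p + 1))) => //; [exact: cont_powR|move=> x; exact: powR_bd p1 (f0 x) (fV' x)].
have [I3 L3] := Int_wX n5 M0 n10.
rewrite -(funext (Z2E M)) in I3 L3.
pose c := K * (eta / K) `^ (- p) * M ^- n.
have c0 : 0 <= c.
  by apply: mulr_ge0; [apply: mulr_ge0; [exact: ltW|exact: powR_ge0]|rewrite invr_ge0 exprn_ge0// ltW].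
have H : K * M ^- 2 * Int (fun x => f x `^ p * Z M x ^+ 2) <=
   eta * Int (fun x => f x `^ (p + 1) * Z M x ^+ 2) + c * Int (fun x => Z M x ^+ 2).
  rewrite -(IntZ _ I1) -(IntZ _ I2) -(IntZ _ I3) -(IntD (ItgZ _ I2) (ItgZ _ I3)).
  apply: (Int_le (ItgZ _ I1) (ItgD (ItgZ _ I2) (ItgZ _ I3))) => x.
  have z0 := sqr_ge0 (Z M x).
  rewrite [leLHS]mulrA (mulrA eta) -mulrDl; apply: ler_wpM2r => //.
  have h := power_split p0 (ltW (f0 x)) eK M2.
  rewrite -mulrA; apply: le_trans (ler_wpM2l (ltW K0) h) _.
  rewrite mulrDr; apply: lerD; first by rewrite mulrA mulrCA divff ?gt_eqF// mulr1.
  rewrite /c -[X in _ <= X]mulrA; apply: ler_wpM2l; first exact: ltW.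
  by apply: ler_wpM2l => //; exact: powR_ge0.
apply: le_trans H _; rewrite lerD2l.
apply: le_trans (ler_wpM2l c0 L3) _.
have Mn : M ^+ n != 0 by rewrite expf_neq0// gt_eqF.
rewrite le_eqVlt; apply/orP; left; apply/eqP; rewrite /c.
by move: (M ^+ n) Mn (4 ^+ n) (_ `^ _) => a a0 b d; field.
Qed.

(** In [energy] with g(z) = e^(al z/2), integrating g'^2 gives k(z) = (al/4) e^(al z), the source of
    al/4 in front of [P]. The cutoff error is one power of te short of [Xi] and goes into it through
    [int_split]. *)
Lemma estimate_te (L eta : R) : 1 < L -> 0 < eta -> exists2 C : R, 0 <= C &
  forall M, C5 <= M -> Xi M <= L * (al / 4) * P M + eta * Xi M + C.
Proof.
move=> L1 e0; have [V V0 hV] := v_bounded.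
have [B [C0 [B0 C00 hB]]] := stability_interpolated n5 (Ck_continuous cu) su L1.
have L0 : 0 < L by lra.
have K0 : 0 < L * (2 * C5 * (4^-1 + 1)).
  by apply: mulr_gt0 => //; apply: mulr_gt0; [exact: mulr_gt0|rewrite addr_gt0// invr_gt0].
exists (L * (2 * C5 * (4^-1 + 1)) * (eta / (L * (2 * C5 * (4^-1 + 1)))) `^ (- (2 * al)) * (3 * 4 ^+ n) +
  C0 * (V `^ (2 * al) * (2 * B) ^+ n)).
  apply: addr_ge0; last by apply: mulr_ge0 => //; apply: mulr_ge0; [exact: powR_ge0|rewrite exprn_ge0// mulr_ge0].
  by apply: mulr_ge0; [apply: mulr_ge0; [exact: ltW|exact: powR_ge0]|rewrite mulr_ge0// exprn_ge0].
move=> M CM; have [M1 Cz hl hg] := Zb CM; have M0 : 0 < M by lra.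
have al0 : 0 < 2 * al by have := al_ge; lra.
have tV x : 0 < te u x <= V by rewrite t0/=; apply: le_trans (te_le_v x) (hV x).
have tV' x : te u x <= V by have /andP[] := tV x.
have G2 x : expR (al / 2 * u x) ^+ 2 = te u x `^ (2 * al).
  by rewrite te_powE -expRM_natl; congr expR; ring.
have GE x : expR (al * u x) = te u x `^ (2 * al) by rewrite te_powE; congr expR; field.
have ctp a : continuous (fun x => te u x `^ a) by exact: cont_powR.
have bt (a : R) x : 0 <= a -> `|te u x `^ a| <= V `^ a by move=> a0; exact: powR_bd.
have DE (a : R) (z : R) : is_derive z (1 : R) (fun z => expR (a * z)) (a * expR (a * z)).
  have := isd_comp (f := fun z : R => a * z) (isd_expR _) (isdZ a (is_derive_id z (1 : R))).
  by rewrite mulr1 mulrC.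
have CE (a : R) : CK 1 (fun x => expR (a * u x)) by apply: Ck_expR; apply: CkZ; exact: CkW.
have sq (z : R) : expR (al * z) = expR (al / 2 * z) ^+ 2 by rewrite -expRM_natl; congr expR; field.
have E1 : (fun x => al / 4 * expR (al * u x) * - lap u x * Z M x ^+ 2) =
   (fun x => al / 4 * (te u x `^ (2 * al) * v x * Z M x ^+ 2)).
  by apply/funext => x; rewrite lu opprK GE; ring.
have E2 : (fun x => `|4^-1 * expR (al * u x)| * Z M x ^+ 2) = (fun x => 4^-1 * (te u x `^ (2 * al) * Z M x ^+ 2)).
  apply/funext => x; rewrite GE ger0_norm; first exact: esym (mulrA _ _ _).
  by apply: mulr_ge0 => //; exact: powR_ge0.
have E3 : (fun x => expR (al / 2 * u x) ^+ 2 * Z M x ^+ 2) = (fun x => te u x `^ (2 * al) * Z M x ^+ 2).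
  by apply/funext => x; rewrite G2.
have E4 : (fun x => te u x * (expR (al / 2 * u x) ^+ 2 * Z M x ^+ 2)) = (fun x => te u x `^ (2 * al + 1) * Z M x ^+ 2).
  apply/funext => x; rewrite G2 powRD ?(gt_eqF (t0 x)) ?implybT// powRr1 ?(ltW (t0 x))//.
  by rewrite mulrA [te u x * _]mulrC.
have E5 : (fun x => ibox B x * (expR (al / 2 * u x) ^+ 2 * Z M x ^+ 2)) = (fun x => ibox B x * (te u x `^ (2 * al) * Z M x ^+ 2)).
  by apply/funext => x; rewrite G2.
have J3 : Itg (fun x => te u x `^ (2 * al) * Z M x ^+ 2).
  by apply: (@Itg_Z (fun x => te u x `^ (2 * al)) (V `^ (2 * al))) => // x; exact: bt (ltW al0).
have J1 : Itg (fun x => te u x `^ (2 * al) * v x * Z M x ^+ 2).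
  apply: (@Itg_Z (fun x => te u x `^ (2 * al) * v x) (V `^ (2 * al) * V)) => //; first exact: cont_mul.
  by move=> x; rewrite normrM (gtr0_norm (v0 x)); apply: ler_pM => //; [exact: ltW|exact: bt (ltW al0)].
have J4 : Itg (fun x => expR (al / 2 * u x) * Z M x).
  have -> : (fun x => expR (al / 2 * u x) * Z M x) = (fun x => te u x `^ al * wX M x ^+ (5 * n)).
    by apply/funext => x; rewrite te_powE.
  apply: (@Itg_bd (fun x => te u x `^ al) (V `^ al)) => //; last exact: leq_pmull.
  by move=> x; apply: bt; lra.
have H phi : CK 1 phi -> csupp phi -> (forall x, 0 <= phi x) -> Int (fun x => te u x * phi x ^+ 2) <=
    L * Int (gdot phi phi) + 0 * Int phi ^+ 2 + C0 * Int (fun x => ibox B x * phi x ^+ 2).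
  by move=> cp sp _; rewrite mul0r addr0; exact: hB.
have dg x : is_derive (u x) (1 : R) (fun z => expR (al / 2 * z)) (al / 2 * expR (al / 2 * u x)) by exact: DE.
have dk x : is_derive (u x) (1 : R) (fun z => al / 4 * expR (al * z)) ((al / 2 * expR (al / 2 * u x)) ^+ 2).
  suff <- : al / 4 * (al * expR (al * u x)) = (al / 2 * expR (al / 2 * u x)) ^+ 2 by exact: isdZ (DE al (u x)).
  by rewrite sq; field.
have dj x : is_derive (u x) (1 : R) (fun z => 4^-1 * expR (al * z))
   (expR (al / 2 * u x) * (al / 2 * expR (al / 2 * u x)) - al / 4 * expR (al * u x)).
  suff <- : 4^-1 * (al * expR (al * u x)) = expR (al / 2 * u x) * (al / 2 * expR (al / 2 * u x)) - al / 4 * expR (al * u x).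
    exact: isdZ (DE al (u x)).
  by rewrite sq; field.
have kF0 x : 0 <= al / 4 * expR (al * u x) * - lap u x.
  by rewrite lu opprK; apply: mulr_ge0 (ltW (v0 x)); apply: mulr_ge0 (expR_ge0 _); lra.
have J2 := ItgZ 4^-1 J3; rewrite -E2 in J2; have J1' := ItgZ (al / 4) J1; rewrite -E1 in J1'.
have J3' := J3; rewrite -E3 in J3'.
have [_] := energy_limit (g1 := fun z => al / 2 * expR (al / 2 * z)) cu dg dk dj (CE (al / 2)) (CkZ (al / 4) (CE al)) (CkZ 4^-1 (CE al))
  (fun x => expR_ge0 _) kF0 ct (fun x => ltW (t0 x)) (ltW L0) (lexx 0) C00 B0 H
  (Ck_wX 2 (5 * n) M0) (fun x => Zge0 x M0) Cz hl hg J1' J2 J3' J4.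
rewrite E1 E2 E3 E4 E5.
rewrite (IntZ _ J1) (IntZ _ J3) mul0r addr0 -/(Xi M) -/(P M).
have SP := int_split M0 ct tV al0 K0 e0 ltac:(by rewrite powM).
have IB := @ibox_term (fun x => te u x `^ (2 * al)) (V `^ (2 * al)) B M (ctp _) _ B0 M0.
have {}IB := IB (fun x => ltac:(apply/andP; split; [exact: powR_ge0|exact: le_trans (ler_norm _) (bt _ x (ltW al0))])).
have := ler_wpM2l C00 IB; move: SP; rewrite -/(Xi M).
move=> h1 h2 h3; apply: le_trans h3 _.
set I := Int (fun x => te u x `^ (2 * al) * Z M x ^+ 2) in h1 *.
have -> : L * (al / 4 * P M + 2 * (C5 / M ^+ 2) * (4^-1 * I + I)) =
  L * (al / 4) * P M + L * (2 * C5 * (4^-1 + 1)) / M ^+ 2 * I.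
  have E (a b c : R) : L * (al / 4 * b + 2 * (C5 * a) * (4^-1 * c + c)) =
    L * (al / 4) * b + L * (2 * C5 * (4^-1 + 1)) * a * c by ring.
  exact: E.
apply: le_trans (lerD (lerD (lexx _) h1) h2) _.
by rewrite !addrA.
Qed.

(** [bk] and [cj] are the coefficients of k and j in [energy] for g(z) = z^al. [cj] is negative when
    al < 1, hence the absolute values below. *)
Let bk : R := al ^+ 2 / (2 * al - 1).
Let cj : R := (al - 1) / (2 * (2 * al - 1)).
Let al1 : 0 < 2 * al - 1. Proof. by have := al_ge; lra. Qed.
Let bk0 : 0 < bk. Proof. by rewrite /bk divr_gt0// exprn_gt0//; have := al_ge; lra. Qed.

Let vpow2 (a : R) x : (v x `^ a) ^+ 2 = v x `^ (2 * a).
Proof. by rewrite expr2 -powRD ?(gt_eqF (v0 x)) ?implybT//; congr powR; ring. Qed.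

(** Used twice: with om = 1 and Nash's inequality for [S], and with om = te u and interpolated
    stability for [Y]. *)
Lemma estimate_energy_v (om : 'rV[R]_n -> R) (A D E B : R) : continuous om -> (forall x, 0 <= om x) ->
  0 <= A -> 0 <= D -> 0 <= E -> 0 <= B ->
  (forall phi, CK 1 phi -> csupp phi -> (forall x, 0 <= phi x) ->
    Int (fun x => om x * phi x ^+ 2) <=
    A * Int (gdot phi phi) + D * Int phi ^+ 2 + E * Int (fun x => ibox B x * phi x ^+ 2)) ->
  forall M, C5 <= M ->
  Int (fun x => om x * (v x `^ (2 * al) * Z M x ^+ 2)) <=
  A * (bk * Q M + 2 * (C5 * M ^- 2) * ((`|cj| + 1) * S M)) +
  D * Int (fun x => v x `^ al * Z M x) ^+ 2 + E * Int (fun x => ibox B x * (v x `^ (2 * al) * Z M x ^+ 2)).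
Proof.
move=> com om0 A0 D0 E0 B0 H M CM; have [V V0 hV] := v_bounded.
have [M1 Cz hl hg] := Zb CM; have M0 : 0 < M by lra.
have al0 : 0 < 2 * al by have := al_ge; lra.
have cvp a : continuous (fun x => v x `^ a) by exact: cont_powR.
have bv (a : R) x : 0 <= a -> `|v x `^ a| <= V `^ a by move=> a0; exact: powR_bd.
have al1' := al1; have al_ge' := al_ge.
have E1 : (fun x => bk * v x `^ (2 * al - 1) * - lap v x * Z M x ^+ 2) =
   (fun x => bk * (te u x ^+ 2 * v x `^ (2 * al - 1) * Z M x ^+ 2)).
  by apply/funext => x; rewrite lv opprK -te2; ring.
have E2 : (fun x => `|cj * v x `^ (2 * al)| * Z M x ^+ 2) = (fun x => `|cj| * (v x `^ (2 * al) * Z M x ^+ 2)).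
  by apply/funext => x; rewrite normrM (ger0_norm (powR_ge0 _ _)); exact: esym (mulrA _ _ _).
have E3 : (fun x => (v x `^ al) ^+ 2 * Z M x ^+ 2) = (fun x => v x `^ (2 * al) * Z M x ^+ 2).
  by apply/funext => x; rewrite vpow2.
have E4 : (fun x => om x * ((v x `^ al) ^+ 2 * Z M x ^+ 2)) = (fun x => om x * (v x `^ (2 * al) * Z M x ^+ 2)).
  by apply/funext => x; rewrite vpow2.
have E5 : (fun x => ibox B x * ((v x `^ al) ^+ 2 * Z M x ^+ 2)) = (fun x => ibox B x * (v x `^ (2 * al) * Z M x ^+ 2)).
  by apply/funext => x; rewrite vpow2.
have J3 : Itg (fun x => v x `^ (2 * al) * Z M x ^+ 2).
  by apply: (@Itg_Z (fun x => v x `^ (2 * al)) (V `^ (2 * al))) => // x; exact: bv (ltW al0).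
have J1 : Itg (fun x => te u x ^+ 2 * v x `^ (2 * al - 1) * Z M x ^+ 2).
  apply: (@Itg_Z (fun x => te u x ^+ 2 * v x `^ (2 * al - 1)) (V ^+ 2 * V `^ (2 * al - 1))) => //.
    by apply: cont_mul => //; exact: Ck_continuous (CkX 2 (Ck0I ct)).
  move=> x; rewrite normrM; apply: ler_pM => //; last exact: bv (ltW al1').
  rewrite ger0_norm ?sqr_ge0// lerXn2r// ?nnegrE ?(ltW V0) ?(ltW (t0 x))//.
  exact: le_trans (te_le_v x) (hV x).
have J4 : Itg (fun x => v x `^ al * Z M x).
  apply: (@Itg_bd (fun x => v x `^ al) (V `^ al)) => //; last exact: leq_pmull.
  by move=> x; apply: bv; lra.
have dg x : is_derive (v x) (1 : R) (fun z => z `^ al) (al * v x `^ (al - 1)) by exact: isd_powR.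
have p1 x : v x `^ (2 * al - 1) = v x `^ al * v x `^ (al - 1).
  by rewrite -powRD ?(gt_eqF (v0 x)) ?implybT//; congr powR; ring.
have dk x : is_derive (v x) (1 : R) (fun z => bk * z `^ (2 * al - 1)) ((al * v x `^ (al - 1)) ^+ 2).
  suff <- : bk * ((2 * al - 1) * v x `^ (2 * al - 1 - 1)) = (al * v x `^ (al - 1)) ^+ 2.
    exact: isdZ (isd_powR _ (v0 x)).
  rewrite exprMn vpow2 (_ : 2 * (al - 1) = 2 * al - 1 - 1); last by ring.
  by rewrite /bk; move: (_ `^ _) => q; field; rewrite gt_eqF.
have dj x : is_derive (v x) (1 : R) (fun z => cj * z `^ (2 * al))
   (v x `^ al * (al * v x `^ (al - 1)) - bk * v x `^ (2 * al - 1)).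
  suff <- : cj * (2 * al * v x `^ (2 * al - 1)) = v x `^ al * (al * v x `^ (al - 1)) - bk * v x `^ (2 * al - 1).
    exact: isdZ (isd_powR _ (v0 x)).
  rewrite p1 /bk /cj; move: (_ `^ _) (_ `^ _) => p q; field; exact: lt0r_neq0.
have kF0 x : 0 <= bk * v x `^ (2 * al - 1) * - lap v x.
  rewrite lv opprK; apply: mulr_ge0 (expR_ge0 _); apply: mulr_ge0; [exact: ltW|exact: powR_ge0].
have CP (a : R) : CK 1 (fun x => v x `^ a) by apply: Ck_powR => //; exact: CkW.
have J2 := ItgZ `|cj| J3; rewrite -E2 in J2; have J1' := ItgZ bk J1; rewrite -E1 in J1'.
have J3' := J3; rewrite -E3 in J3'.
have [_] := energy_limit (g1 := fun z => al * z `^ (al - 1)) cv dg dk dj (CP al) (CkZ bk (CP (2 * al - 1))) (CkZ cj (CP (2 * al)))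
  (fun x => powR_ge0 _ _) kF0 com om0 A0 D0 E0 B0 H
  (Ck_wX 2 (5 * n) M0) (fun x => Zge0 x M0) Cz hl hg J1' J2 J3' J4.
rewrite E1 E2 E3 E4 E5 (IntZ _ J1) (IntZ _ J3) -/(Q M) -/(S M).
by rewrite [(`|cj| + 1) * S M]mulrDl mul1r.
Qed.

Let cj1 : 0 < `|cj| + 1. Proof. by rewrite ltr_wpDl. Qed.

Let S_ge0 M : 0 <= S M.
Proof. by apply: Int_ge0 => x; apply: mulr_ge0 (sqr_ge0 _); exact: powR_ge0. Qed.

Let Q_ge0 M : 0 <= Q M.
Proof. by apply: Int_ge0 => x; apply: mulr_ge0 (sqr_ge0 _); apply: mulr_ge0 (powR_ge0 _ _); exact: sqr_ge0. Qed.

(* Cauchy-Schwarz against the weighted mass of v, then Young. *)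
Let int_v_al (K : R) : 0 < K -> exists2 C : R, 0 <= C & forall M, C5 <= M ->
  K * M ^- n * M ^- 2 * Int (fun x => v x `^ al * Z M x) ^+ 2 <= 4^-1 * (M ^- 2 * S M) + C.
Proof.
move=> K0; have [V V0 hV] := v_bounded; have [Cv Cv0 hv] := v_wX_le.
have al1' := al1; have al_ge' := al_ge; have al_le' := al_le.
pose K' := K * (Cv + 1); have K'0 : 0 < K' by rewrite mulr_gt0//; lra.
pose eta := (4 * K')^-1; have eta0 : 0 < eta by rewrite invr_gt0 mulr_gt0.
exists (K' * eta `^ (- (2 * al - 1)) * (3 * 4 ^+ n)).
  by apply: mulr_ge0; [apply: mulr_ge0; [exact: ltW|exact: powR_ge0]|rewrite mulr_ge0// exprn_ge0].
move=> M CM; have [M1 _ _ _] := Zb CM; have M0 : 0 < M by lra.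
have M2 : 0 < M ^- 2 by rewrite invr_gt0 exprn_gt0.
have Mn : 0 < M ^+ n by rewrite exprn_gt0.
have cvp a : continuous (fun x => v x `^ a) by exact: cont_powR.
have bv (a : R) x : 0 <= a -> `|v x `^ a| <= V `^ a by move=> a0; exact: powR_bd.
have [J1 L1] := hv M M1.
have n9 : (n <= 9 * n)%N by exact: leq_pmull.
have nn5 : (n <= 5 * n)%N by exact: leq_pmull.
have J2 : Itg (fun x => v x `^ (2 * al - 1) * wX M x ^+ (9 * n)).
  by apply: (@Itg_bd (fun x => v x `^ (2 * al - 1)) (V `^ (2 * al - 1))) => // x; exact: bv (ltW al1').
have J3 : Itg (fun x => v x `^ al * Z M x).
  apply: (@Itg_bd (fun x => v x `^ al) (V `^ al)) => //; by move=> x; apply: bv; lra.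
have J4 : Itg (fun x => v x `^ (2 * al) * Z M x ^+ 2).
  by apply: (@Itg_Z (fun x => v x `^ (2 * al)) (V `^ (2 * al))) => // x; apply: bv; lra.
have [J5 L5] := Int_wX n5 M0 nn5.
have CS := Int_CS J1 J2 J3.
have {}CS : Int (fun x => v x `^ al * Z M x) ^+ 2 <=
    Int (fun x => v x * wX M x ^+ n) * Int (fun x => v x `^ (2 * al - 1) * wX M x ^+ (9 * n)).
  have X0 m x : 0 <= wX M x ^+ m by rewrite exprn_ge0// ltW// wX_gt0.
  apply: CS => x.
  - exact: mulr_ge0 (powR_ge0 _ _) (X0 _ _).
  - exact: mulr_ge0 (ltW (v0 x)) (X0 _ _).
  - exact: mulr_ge0 (powR_ge0 _ _) (X0 _ _).
  - rewrite exprMn vpow2 Z2E mulrACA -exprD.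
    have -> : (n + 9 * n = 10 * n)%N by rewrite -mulSn.
    apply: ler_wpM2r => //.
    rewrite -[v x in X in _ <= X * _]powRr1 ?(ltW (v0 x))// -powRD ?(gt_eqF (v0 x)) ?implybT//.
    by rewrite (_ : 1 + (2 * al - 1) = 2 * al)//; ring.
set T := Int (fun x => v x `^ (2 * al - 1) * wX M x ^+ (9 * n)) in CS.
have T0 : 0 <= T by apply: Int_ge0 => x; apply: mulr_ge0 (powR_ge0 _ _) _; rewrite exprn_ge0// ltW// wX_gt0.
have h1 : K * M ^- n * M ^- 2 * Int (fun x => v x `^ al * Z M x) ^+ 2 <= K' * (M ^- 2 * M ^- 2 * T).
  have c0 : 0 <= K * M ^- n * M ^- 2 by rewrite !mulr_ge0 ?(ltW K0) ?(ltW M2)// invr_ge0 ltW.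
  apply: le_trans (ler_wpM2l c0 (le_trans CS (ler_wpM2r T0 L1))) _.
  have -> : K * M ^- n * M ^- 2 * (Cv * (M ^+ n / M ^+ 2) * T) = K * Cv * (M ^- 2 * M ^- 2 * T).
    have E (a b c : R) : a != 0 -> K * a^-1 * b * (Cv * (a * b) * c) = K * Cv * (b * b * c) by move=> a0; field.
    exact: E (lt0r_neq0 Mn).
  apply: ler_wpM2r; first by rewrite !mulr_ge0 ?(ltW M2).
  by rewrite /K' ler_pM2l// lerDl.
apply: le_trans h1 _.
have h2 : M ^- 2 * M ^- 2 * T <= eta * (M ^- 2 * S M) + eta `^ (- (2 * al - 1)) * M ^- n * Int (fun x => wX M x ^+ (5 * n)).
  rewrite mulrA -(IntZ _ J2) -(IntZ _ J4) -(IntZ _ J5) -(IntD (ItgZ _ J4) (ItgZ _ J5)).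
  apply: (Int_le (ItgZ _ J2) (ItgD (ItgZ _ J4) (ItgZ _ J5))) => x.
  have X0 := wX_gt0 x M0; have X1 := wX_le1 x M0.
  (* Dividing M^-2 by xi in [power_split] restores the full weight xi^10 in the v^(2 al) term. The
     other term keeps xi^(10 - 2 al), at most xi^5, which is still integrable with mass O(M^n). *)
  set xi := wX M x ^+ n; have xi0 : 0 < xi by rewrite exprn_gt0.
  have mu0 : 0 < M ^- 2 / xi by rewrite divr_gt0.
  have h := power_split al1' (ltW (v0 x)) eta0 mu0.
  rewrite subrK in h.
  have c0 : 0 <= M ^- 2 * Z M x ^+ 2 by rewrite mulr_ge0 ?(ltW M2)// sqr_ge0.
  have ZE : Z M x ^+ 2 = xi ^+ 10 by rewrite Z2E /xi -exprM mulnC.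
  have E1 : M ^- 2 * M ^- 2 * (v x `^ (2 * al - 1) * wX M x ^+ (9 * n)) =
     M ^- 2 * Z M x ^+ 2 * (M ^- 2 / xi * v x `^ (2 * al - 1)).
    rewrite ZE mulnC exprM -/xi; move: (M ^- 2) (_ `^ _) => a b; field; exact: lt0r_neq0.
  rewrite E1; apply: le_trans (ler_wpM2l c0 h) _.
  rewrite mulrDr; apply: lerD.
    by rewrite le_eqVlt; apply/orP; left; apply/eqP; move: (Z M x) (_ `^ _) (M ^- 2) => a b c; ring.
  have -> : M ^- 2 * Z M x ^+ 2 * (eta `^ (- (2 * al - 1)) * (M ^- 2 / xi) `^ (2 * al)) =
     eta `^ (- (2 * al - 1)) * (M ^- 2 * (M ^- 2 / xi) `^ (2 * al) * Z M x ^+ 2).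
    have E (a b c d : R) : a * b * (c * d) = c * (a * d * b) by ring.
    exact: E.
  rewrite -[X in _ <= X]mulrA; apply: ler_wpM2l; first exact: powR_ge0.
  have -> : M ^- 2 * (M ^- 2 / xi) `^ (2 * al) = M ^- n * xi^-1 `^ (2 * al).
    rewrite powRM ?(ltW M2) ?invr_ge0 ?(ltW xi0)// mulrA -powM// powRD ?(gt_eqF M2) ?implybT//.
    by rewrite powRr1 ?(ltW M2)// [_ * M ^- 2]mulrC.
  rewrite -mulrA; apply: ler_wpM2l; first by rewrite invr_ge0 ltW.
  have xi1 : 1 <= xi^-1 by rewrite invf_ge1// /xi exprn_ile1// ltW.
  have h3 : xi^-1 `^ (2 * al) <= xi^-1 ^+ 5.
    rewrite -powR_mulrn ?invr_ge0 ?(ltW xi0)//; apply: ler_powR => //; lra.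
  apply: le_trans (ler_wpM2r (sqr_ge0 _) h3) _.
  rewrite ZE mulnC exprM -/xi exprVn le_eqVlt; apply/orP; left; apply/eqP; field; exact: lt0r_neq0.
apply: le_trans (ler_wpM2l (ltW K'0) h2) _; rewrite mulrDr; apply: lerD.
  by rewrite le_eqVlt; apply/orP; left; apply/eqP; rewrite /eta; move: (M ^- 2 * S M) => a; field; rewrite gt_eqF.
have c1 : 0 <= K' * (eta `^ (- (2 * al - 1)) / M ^+ n).
  by apply: mulr_ge0; [exact: ltW|apply: mulr_ge0; [exact: powR_ge0|rewrite invr_ge0 ltW]].
rewrite [leLHS]mulrA; apply: le_trans (ler_wpM2l c1 L5) _.
rewrite le_eqVlt; apply/orP; left; apply/eqP.
by have := lt0r_neq0 Mn; move: (M ^+ n) (4 ^+ n) (_ `^ _) => a b d a0; field.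
Qed.

(** Stability cannot absorb M^-2 [S], as its left side is te v^(2 al) with te possibly much smaller
    than v. Nash's inequality at radius tau M instead bounds M^-2 [S] by tau^2 times the energy plus
    an L^1 term, which [int_v_al] handles. *)
Lemma estimate_S (eta : R) : 0 < eta -> exists2 C : R, 0 <= C & forall M, C5 <= M ->
  M ^- 2 * S M <= eta * Q M + C.
Proof.
move=> eta0.
pose An : R := 2 ^+ n * expR 1.
have An0 : 0 < An by rewrite mulr_gt0 ?exprn_gt0// expR_gt0.
pose k1 := An * (2 * C5 * (`|cj| + 1)); have k10 : 0 < k1 by rewrite !mulr_gt0.
pose k2 := An * bk; have k20 : 0 < k2 by rewrite mulr_gt0.
(* A quarter of M^-2 [S] comes back from the energy and another quarter from the L^1 term, so half
   of it remains on the left; accordingly [Q] may carry only eta/2. *)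
pose tau := Num.min 1 (Num.min (4 * k1)^-1 (eta / (2 * k2))).
have tau0 : 0 < tau by rewrite !lt_min ltr01/= invr_gt0 mulr_gt0//= divr_gt0// mulr_gt0.
have tau1 : tau <= 1 by rewrite ge_min lexx.
have tau2 : tau * k1 <= 4^-1.
  have : tau <= (4 * k1)^-1 by rewrite !ge_min lexx orbT.
  by move=> /(ler_wpM2r (ltW k10)) /le_trans; apply; rewrite invfM mulfVK// gt_eqF.
have tau3 : tau * k2 <= eta / 2.
  have : tau <= eta / (2 * k2) by rewrite !ge_min lexx !orbT.
  move=> /(ler_wpM2r (ltW k20)) /le_trans; apply.
  by rewrite le_eqVlt; apply/orP; left; apply/eqP; field; rewrite gt_eqF.
clearbody tau.
have K0 : 0 < (2 * tau) ^- n by rewrite invr_gt0 exprn_gt0// mulr_gt0.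
have [C C0 hC] := int_v_al K0; exists (2 * C); first by rewrite mulr_ge0.
move=> M CM; have [M1 _ _ _] := Zb CM; have M0 : 0 < M by lra.
have M2 : 0 < M ^- 2 by rewrite invr_gt0 exprn_gt0.
have r0 : 0 < tau * M by rewrite mulr_gt0.
have H (phi : 'rV[R]_n -> R) : CK 1 phi -> csupp phi -> (forall x, 0 <= phi x) ->
    Int (fun x => 1 * phi x ^+ 2) <= An * (tau * M) ^+ 2 * Int (gdot phi phi) +
      (2 * (tau * M)) ^- n * Int phi ^+ 2 + 0 * Int (fun x => ibox 0 x * phi x ^+ 2).
  move=> cp sp p0; rewrite mul0r addr0; have := Nash cp sp p0 r0.
  by rewrite (_ : (fun x => 1 * phi x ^+ 2) = (fun x => phi x ^+ 2))//; apply/funext => x; rewrite mul1r.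
have A0 : 0 <= An * (tau * M) ^+ 2 by rewrite mulr_ge0 ?sqr_ge0// ltW.
have D0 : 0 <= (2 * (tau * M)) ^- n by rewrite invr_ge0 exprn_ge0// mulr_ge0// ltW.
have c1 : continuous (fun _ : 'rV[R]_n => 1 : R) by exact: cont_cst.
have := estimate_energy_v c1 (fun=> ler01) A0 D0 (lexx 0) (lexx 0) H CM.
rewrite mul0r addr0.
have -> : (fun x => 1 * (v x `^ (2 * al) * Z M x ^+ 2)) = (fun x => v x `^ (2 * al) * Z M x ^+ 2).
  by apply/funext => x; rewrite mul1r.
rewrite -/(S M) => /(ler_wpM2l (ltW M2)).
rewrite mulrDr.
have -> : M ^- 2 * (An * (tau * M) ^+ 2 * (bk * Q M + 2 * (C5 * M ^- 2) * ((`|cj| + 1) * S M))) =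
   tau ^+ 2 * k2 * Q M + tau ^+ 2 * k1 * (M ^- 2 * S M).
  have E (a b c d e f m : R) : m != 0 ->
    m ^- 2 * (a * (tau * m) ^+ 2 * (b * e + 2 * (c * m ^- 2) * ((d + 1) * f))) =
    tau ^+ 2 * (a * b) * e + tau ^+ 2 * (a * (2 * c * (d + 1))) * (m ^- 2 * f) by move=> m0; field.
  exact: E (lt0r_neq0 M0).
have -> : M ^- 2 * ((2 * (tau * M)) ^- n * Int (fun x => v x `^ al * Z M x) ^+ 2) =
   (2 * tau) ^- n * M ^- n * M ^- 2 * Int (fun x => v x `^ al * Z M x) ^+ 2.
  by rewrite [2 * (tau * M)]mulrA exprMn [((2 * tau) ^+ n * _)^-1]invfM mulrA (mulrC (M ^- 2)).
have h := hC M CM.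
have t2 : tau ^+ 2 <= tau by rewrite expr2 ler_piMl// ltW.
have S0 : 0 <= M ^- 2 * S M by rewrite mulr_ge0// ltW.
have e1 : tau ^+ 2 * k2 * Q M <= eta / 2 * Q M.
  apply: ler_wpM2r; first exact: Q_ge0.
  by apply: le_trans tau3; rewrite ler_pM2r.
have e2 : tau ^+ 2 * k1 * (M ^- 2 * S M) <= 4^-1 * (M ^- 2 * S M).
  by apply: ler_wpM2r => //; apply: le_trans tau2; rewrite ler_pM2r.
move: h e1 e2; move: (M ^- 2 * S M) (_ * Int _ ^+ 2) (_ * k2 * _) (_ * k1 * _) => a b c d; lra.
Qed.

Lemma estimate_v (L eta : R) : 1 < L -> 0 < eta -> exists2 C : R, 0 <= C &
  forall M, C5 <= M -> Y M <= (L * bk + eta) * Q M + C.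
Proof.
move=> L1 eta0; have [V V0 hV] := v_bounded.
have [B [C0 [B0 C00 hB]]] := stability_interpolated n5 (Ck_continuous cu) su L1.
have L0 : 0 < L by lra.
have al_ge' := al_ge.
pose k1 := L * (2 * C5 * (`|cj| + 1)); have k10 : 0 < k1 by rewrite !mulr_gt0.
have [C Cp hC] := estimate_S (divr_gt0 eta0 k10).
have W0 : 0 <= C0 * (V `^ (2 * al) * (2 * B) ^+ n).
  by apply: mulr_ge0 => //; apply: mulr_ge0; [exact: powR_ge0|rewrite exprn_ge0// mulr_ge0].
exists (k1 * C + C0 * (V `^ (2 * al) * (2 * B) ^+ n)).
  by apply: addr_ge0 => //; apply: mulr_ge0 => //; exact: ltW.
move=> M CM; have [M1 _ _ _] := Zb CM; have M0 : 0 < M by lra.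
have H phi : CK 1 phi -> csupp phi -> (forall x, 0 <= phi x) -> Int (fun x => te u x * phi x ^+ 2) <=
    L * Int (gdot phi phi) + 0 * Int phi ^+ 2 + C0 * Int (fun x => ibox B x * phi x ^+ 2).
  by move=> cp sp _; rewrite mul0r addr0; exact: hB.
have := estimate_energy_v ct (fun x => ltW (t0 x)) (ltW L0) (lexx 0) C00 B0 H CM.
rewrite mul0r addr0.
have -> : (fun x => te u x * (v x `^ (2 * al) * Z M x ^+ 2)) = (fun x => te u x * v x `^ (2 * al) * Z M x ^+ 2).
  by apply/funext => x; rewrite mulrA.
rewrite -/(Y M) => h.
have IB : Int (fun x => ibox B x * (v x `^ (2 * al) * Z M x ^+ 2)) <= V `^ (2 * al) * (2 * B) ^+ n.
  apply: (@ibox_term (fun x => v x `^ (2 * al))) => //; first exact: cont_powR.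
  move=> x; rewrite powR_ge0/=; apply: le_trans (ler_norm _) _.
  by apply: powR_bd => //; lra.
have {}IB := ler_wpM2l C00 IB.
have {}hC := ler_wpM2l (ltW k10) (hC M CM).
apply: le_trans h _.
have -> : L * (bk * Q M + 2 * (C5 / M ^+ 2) * ((`|cj| + 1) * S M)) = L * bk * Q M + k1 * (M ^- 2 * S M).
  by rewrite /k1; move: (M ^+ 2)^-1 `|cj| (S M) (Q M) => a b c d; ring.
apply: le_trans (lerD (lerD (lexx _) hC) IB) _.
rewrite le_eqVlt; apply/orP; left; apply/eqP; move: (_ * (_ * _ ^+ n)) (Q M) => a b; field.
exact: lt0r_neq0.
Qed.

Let IXi M : 0 < M -> Itg (fun x => te u x `^ (2 * al + 1) * Z M x ^+ 2).
Proof.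
have [V V0 hV] := v_bounded; have al_ge' := al_ge; move=> M0.
apply: (@Itg_Z (fun x => te u x `^ (2 * al + 1)) (V `^ (2 * al + 1))) => //; first exact: cont_powR.
by move=> x; apply: powR_bd => //; [lra|exact: le_trans (te_le_v x) (hV x)].
Qed.

Let IP M : 0 < M -> Itg (fun x => te u x `^ (2 * al) * v x * Z M x ^+ 2).
Proof.
have [V V0 hV] := v_bounded; have al_ge' := al_ge; move=> M0.
apply: (@Itg_Z (fun x => te u x `^ (2 * al) * v x) (V `^ (2 * al) * V)) => //.
  by apply: cont_mul => //; exact: cont_powR.
move=> x; rewrite normrM (gtr0_norm (v0 x)); apply: ler_pM => //; first exact: ltW.
by apply: powR_bd => //; [lra|exact: le_trans (te_le_v x) (hV x)].
Qed.

Let IY M : 0 < M -> Itg (fun x => te u x * v x `^ (2 * al) * Z M x ^+ 2).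
Proof.
have [V V0 hV] := v_bounded; have al_ge' := al_ge; move=> M0.
apply: (@Itg_Z (fun x => te u x * v x `^ (2 * al)) (V * V `^ (2 * al))) => //.
  by apply: cont_mul => //; exact: cont_powR.
move=> x; rewrite normrM (gtr0_norm (t0 x)); apply: ler_pM => //; first exact: ltW.
  exact: le_trans (te_le_v x) (hV x).
by apply: powR_bd => //; lra.
Qed.

Let IQ M : 0 < M -> Itg (fun x => te u x ^+ 2 * v x `^ (2 * al - 1) * Z M x ^+ 2).
Proof.
have [V V0 hV] := v_bounded; have al_ge' := al_ge; move=> M0.
apply: (@Itg_Z (fun x => te u x ^+ 2 * v x `^ (2 * al - 1)) (V ^+ 2 * V `^ (2 * al - 1))) => //.
  by apply: cont_mul; [exact: Ck_continuous (CkX 2 (Ck0I ct))|exact: cont_powR].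
move=> x; rewrite normrM; apply: ler_pM => //; last by apply: powR_bd => //; lra.
rewrite ger0_norm ?sqr_ge0// lerXn2r// ?nnegrE ?(ltW V0) ?(ltW (t0 x))//.
exact: le_trans (te_le_v x) (hV x).
Qed.

(** This is [power_exchange] for te and v/k with p = 2 al - 1, integrated. The free scale k balances
    the constants al/4 and [bk] of the two energy estimates. *)
Let exchange M (k : R) : 0 < M -> 0 < k ->
  k^-1 * P M + k^-1 `^ (2 * al - 1) * Q M <= Xi M + k^-1 `^ (2 * al) * Y M.
Proof.
move=> M0 k0; have k1 : 0 < k^-1 by rewrite invr_gt0.
have J1 := IXi M0; have J2 := IP M0; have J3 := IY M0; have J4 := IQ M0.
rewrite -(IntZ _ J2) -(IntZ _ J3) -(IntZ _ J4) -(IntD J1 (ItgZ _ J3)) -(IntD (ItgZ _ J2) (ItgZ _ J4)).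
apply: (Int_le (ItgD (ItgZ _ J2) (ItgZ _ J4)) (ItgD J1 (ItgZ _ J3))) => x.
have w0 : 0 < k^-1 * v x by rewrite mulr_gt0.
have := power_exchange (ltW al1) (t0 x) w0.
rewrite subrK (_ : 2 * al - 1 + 2 = 2 * al + 1); last by ring.
rewrite !powRM ?(ltW k1) ?(ltW (v0 x))// => /(ler_wpM2r (sqr_ge0 (Z M x))).
move: (te u x `^ _) (te u x `^ _) (v x `^ _) (v x `^ _) (k^-1 `^ _) (k^-1 `^ _) (Z M x) => a b c d e f g h.
by apply: le_trans (le_trans h _); rewrite le_eqVlt; apply/orP; left; apply/eqP; ring.
Qed.

(* al bk / 4 = (n - 2)^3 / (128 (n - 4)): this is where n <= 12 is needed. *)
Let subcritical : al * bk / 4 <= 98 / 100.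
Proof.
have h1 := al_ge; have h2 := al_le; have h3 := al1; rewrite /bk.
have -> : al * (al ^+ 2 / (2 * al - 1)) / 4 = al ^+ 3 / 4 / (2 * al - 1).
  by field; rewrite gt_eqF.
rewrite ler_pdivrMr//.
(* This says that al^3 lies below its chord on [3/4, 5/2]; the third root -13/4 makes the al^2 term
   vanish. It reduces the claim to a linear inequality in al. *)
have : 0 <= (al - 3 / 4) * (5 / 2 - al) * (al + 13 / 4).
  by apply: mulr_ge0; [apply: mulr_ge0|]; lra.
have -> : (al - 3 / 4) * (5 / 2 - al) * (al + 13 / 4) = 139 / 16 * al - 195 / 32 - al ^+ 3 by field.
move: (al ^+ 3) => q; lra.
Qed.

Let Xi_bounded : exists2 C : R, 0 <= C & forall M, C5 <= M -> Xi M <= C.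
Proof.
(* The margin of two per cent in [subcritical] is shared between the stability loss L, the
   absorption loss e and the contraction factor q < 1; [key] checks that it suffices. *)
pose L : R := 201 / 200; pose e : R := 1 / 1000; pose q : R := 999 / 1000.
have L1 : 1 < L by rewrite /L; lra.
have e0 : 0 < e by rewrite /e; lra.
have [C1 C10 h1] := estimate_te L1 e0; have [C2 C20 h2] := estimate_v L1 e0.
have hb := bk0; have hs := subcritical; have ha := al_ge; have ha' := al_le.
have [q0 q1 e1] : [/\ 0 < q, 0 < 1 - q & 0 < 1 - e] by rewrite /q /e; split; lra.
have key : L * L * (al * bk / 4) + L * e * (al / 4) <= q * q * (1 - e).
  by rewrite /L /e /q; move: (al * bk) hs => z; lra.
clearbody L e q.
pose b' := L * bk + e; have b'0 : 0 < b' by rewrite addr_gt0// mulr_gt0//; lra.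
(* With this k, the term b' [Q] in the bound for K [Y] is exactly q times the [Q] term of
   [exchange], and [key] gives the same for the [P] term. Hence [Xi] + K [Y] is at most q times
   itself plus a constant. *)
pose k := b' / q; have k0 : 0 < k by rewrite divr_gt0.
pose K := k^-1 `^ (2 * al); have K0 : 0 <= K by exact: powR_ge0.
have KE : K = k^-1 `^ (2 * al - 1) * k^-1.
  rewrite /K -{3}(@powRr1 _ k^-1) ?invr_ge0 ?(ltW k0)//.
  by rewrite -powRD ?subrK// invr_eq0 (gt_eqF k0) implybT.
pose C3 := C1 / (1 - e) + K * C2.
have C30 : 0 <= C3 by rewrite /C3 addr_ge0 ?mulr_ge0// invr_ge0 ltW.
exists ((1 - q)^-1 * C3); first by rewrite mulr_ge0// invr_ge0 ltW.
move=> M CM; have [M1 _ _ _] := Zb CM; have M0 : 0 < M by lra.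
have X0 : 0 <= Xi M by apply: Int_ge0 => x; exact: mulr_ge0 (powR_ge0 _ _) (sqr_ge0 _).
have Y0 : 0 <= Y M.
  by apply: Int_ge0 => x; apply: mulr_ge0 (sqr_ge0 _); exact: mulr_ge0 (ltW (t0 x)) (powR_ge0 _ _).
have P0 : 0 <= P M.
  by apply: Int_ge0 => x; apply: mulr_ge0 (sqr_ge0 _); exact: mulr_ge0 (powR_ge0 _ _) (ltW (v0 x)).
have hx := exchange M0 k0; rewrite -/K in hx.
have hX : Xi M <= L * (al / 4) / (1 - e) * P M + C1 / (1 - e).
  have := h1 M CM.
  rewrite [_ / (1 - e) * P M]mulrAC -mulrDl ler_pdivlMr// mulrBr mulr1 (mulrC _ e); move: (L * _ * _) => z; lra.
have hY : K * Y M <= q * (k^-1 `^ (2 * al - 1) * Q M) + K * C2.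
  apply: le_trans (ler_wpM2l K0 (h2 M CM)) _; rewrite mulrDr lerD2r -/b' KE.
  rewrite le_eqVlt; apply/orP; left; apply/eqP.
  by rewrite /k; move: (Q M) (_ `^ _) => a c; field; rewrite !lt0r_neq0.
have hP : L * (al / 4) / (1 - e) * P M <= q * (k^-1 * P M).
  rewrite [leRHS]mulrA; apply: ler_wpM2r => //; rewrite /k invf_div [leRHS]mulrA ler_pdivlMr//.
  rewrite /b'; have -> : L * (al / 4) / (1 - e) * (L * bk + e) =
     (L * L * (al * bk / 4) + L * e * (al / 4)) / (1 - e) by field; exact: lt0r_neq0.
  by rewrite ler_pdivrMr.
have h3 : Xi M + K * Y M <= q * (Xi M + K * Y M) + C3.
  apply: le_trans (lerD hX hY) _.
  have := ler_wpM2l (ltW q0) hx; rewrite /C3 mulrDr.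
  move: hP; move: (_ / _ * P M) (q * (k^-1 * P M)) (q * (_ * Q M)) (q * (_ + _)) (C1 / _) (K * C2).
  by move=> z1 z2 z3 z4 z5 z6; lra.
have KY : 0 <= K * Y M by exact: mulr_ge0.
rewrite mulrC ler_pdivlMr//; move: h3 KY; move: (K * Y M) => z h3 z0.
by have := mulr_ge0 (ltW q1) z0; lra.
Qed.

Lemma integrable_expR : Itg (fun x => expR (n%:R / 4 * u x)).
Proof.
have [C C0 hC] := Xi_bounded.
have E x : expR (n%:R / 4 * u x) = te u x `^ (2 * al + 1).
  by rewrite te_powE al2E; congr expR; field.
rewrite (funext E).
have [m hm] : exists m : nat, forall k, C5 <= (k + m).+1%:R.
  exists (Num.bound C5) => k; have h := archi_boundP (ltW C5_gt0).
  by apply: le_trans (ltW h) _; rewrite ler_nat -addnS (leq_trans (leqnSn _))// leq_addl.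
have bd k : (Int (fun x => te u x `^ (2 * al + 1) * Z (k + m).+1%:R x ^+ 2)) <= C by exact: hC.
have [] // := @Int_fatou R n (fun k x => te u x `^ (2 * al + 1) * Z (k + m).+1%:R x ^+ 2)
  (fun x => te u x `^ (2 * al + 1)) C _ _ _ bd.
- by move=> k; exact: IXi.
- by move=> k x; exact: mulr_ge0 (powR_ge0 _ _) (sqr_ge0 _).
- move=> x; rewrite -[X in _ --> X]mulr1; apply: cvgMr.
  rewrite (funext (fun k => Z2E (k + m).+1%:R x)).
  by rewrite (cvg_shiftn m (fun k => wX k.+1%:R x ^+ (10 * n))); exact: cvg_wX.
Qed.

End main_estimate.

(** * Weighted means of an integrable solution *)

Section spherical_mean.
Context {R : realType} {n : nat}.
Hypothesis n5 : (5 <= n)%N.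
Implicit Types (x : 'rV[R]_n) (M : R).
Variables (u v : 'rV[R]_n -> R).
Hypotheses (cu : CK 2 u) (cv : CK 2 v).
Hypothesis lu : forall x, lap u x = - v x.
Hypothesis lv : forall x, lap v x = - expR (u x).
Hypothesis v0 : forall x, 0 < v x.
Hypothesis vi : vanishes_at_infinity v.
Hypothesis Iu : Itg (fun x => expR (n%:R / 4 * u x)).

Let N5 : 5 <= n%:R :> R. Proof. by rewrite ler_nat. Qed.
Let n0 : (0 < n)%N. Proof. exact: leq_trans n5. Qed.

Lemma Itg_iboxC (f : 'rV[R]_n -> R) (B : R) : 0 <= B -> Itg f -> Itg (fun x => (1 - ibox B x) * f x).
Proof.
move=> B0 If; have H := ItgB If (Itg_ibox B0 If).
by rewrite (_ : (fun x => _) = (fun x => f x - ibox B x * f x))//; apply/funext => x; ring.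
Qed.

Lemma tail_small (f : 'rV[R]_n -> R) (e : R) : Itg f -> (forall x, 0 <= f x) -> 0 < e ->
  exists2 B : R, 0 <= B & Int (fun x => (1 - ibox B x) * f x) <= e.
Proof.
move=> If f0 e0.
have I1 (k : nat) : Itg (fun x => (1 - ibox (k%:R : R) x) * f x) by exact: Itg_iboxC.
have [||k x|x|_] := @Int_dct R n (fun k x => (1 - ibox k%:R x) * f x) (fun=> 0) f _ _ If.
- by move=> k; exact: Itg_Mf.
- exact: Itg_Mf Itg0.
- rewrite normrM (ger0_norm (f0 x)); apply: ler_piMl => //.
  by rewrite iboxP; case: ifP => _; rewrite ?subrr ?subr0 ?normr0 ?normr1.
- have [N hN] : exists N : nat, enorm x <= N%:R.
    exists (Num.bound (enorm x)); apply/ltW; apply: archi_boundP.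
    by rewrite enormE sqrtr_ge0.
  apply: (@cvg_eventually _ _ _ N) => k Nk; rewrite iboxP asboolT ?subrr ?mul0r// => i.
  by apply: le_trans (coord_enorm x i) _; apply: le_trans hN _; rewrite ler_nat.
- rewrite Int0 => /cvgrPdist_le /(_ e e0) [N _ hN]; exists N%:R => //.
  have := hN N (leqnn N); rewrite /= sub0r normrN; exact: le_trans (ler_norm _).
Qed.

(** Off the box, where e^u <= th rho^-2, the product with the kernel is at most th [rw (M^2) cexp].
    Where e^u is larger, e^u = (e^u)^(1 - n/4) e^(n u/4) with a negative first exponent, and the
    powers of rho combine to rho^-1 <= M^-2. In the box gexp <= -3/2 gives M^-3. *)
Let expu_split M (th B C : R) x : 1 <= M -> 0 < th -> 0 <= B -> 0 <= C ->
  (forall y, box B y -> expR (u y) <= C) ->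
  rw (M ^+ 2) (@gexp R n) x * expR (u x) <=
  C * M ^- 3 * ibox B x + th * rw (M ^+ 2) (@cexp R n) x +
  th `^ (1 - n%:R / 4) * M ^- 2 * ((1 - ibox B x) * expR (n%:R / 4 * u x)).
Proof.
move=> M1 th0 B0 C0 hC; have N5' := N5; have M0 : 0 < M by lra.
have M2 : 0 < M ^+ 2 by rewrite exprn_gt0.
have [r0 r1] : 0 < rho (M ^+ 2) x /\ M ^+ 2 <= rho (M ^+ 2) x.
  by rewrite rho_gt0// /rho lerDl nsq_ge0.
have a1 : 0 <= th * rw (M ^+ 2) (@cexp R n) x by rewrite mulr_ge0// ltW// rw_gt0.
rewrite iboxP; case: ifPn => [/asboolP bx|_].
  rewrite subrr mul0r mulr0 addr0 mulr1; apply: le_trans (_ : C * M ^- 3 <= _); last by rewrite lerDl.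
  rewrite mulrC; apply: ler_pM; [exact: expR_ge0|exact: ltW (rw_gt0 _ _ M2)|exact: hC|].
  rewrite /rw; apply: le_trans (powR_anti _ M2 r1) _; first by rewrite /gexp; lra.
  rewrite -[M ^+ 2]powR_mulrn ?(ltW M0)// -powRrM -[M ^+ 3]powR_mulrn ?(ltW M0)// -powRN.
  by apply: ler_powR => //; rewrite /gexp; lra.
rewrite mulr0 add0r subr0 mul1r.
have e0 : 0 < expR (u x) by exact: expR_gt0.
have rN a : 0 <= rw (M ^+ 2) a x by rewrite ltW// rw_gt0.
have p1 : 1 - n%:R / 4 <= 0 :> R by lra.
have m0 : 0 < th * rw (M ^+ 2) (-2) x by rewrite mulr_gt0// rw_gt0.
have b0 : 0 <= th `^ (1 - n%:R / 4) * M ^- 2 * expR (n%:R / 4 * u x).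
  by rewrite mulr_ge0 ?expR_ge0// mulr_ge0 ?powR_ge0// invr_ge0 ltW.
have [h|h] := leP (expR (u x)) (th * rw (M ^+ 2) (-2) x).
  apply: le_trans (ler_wpM2l (rN _) h) _; rewrite mulrCA -rwD// -cexpE.
  by rewrite lerDl.
apply: le_trans (_ : _ <= th `^ (1 - n%:R / 4) * M ^- 2 * expR (n%:R / 4 * u x)) _; last by rewrite lerDr.
have -> : expR (u x) = expR (u x) `^ (1 - n%:R / 4) * expR (n%:R / 4 * u x).
  rewrite [n%:R / 4 * _]mulrC expRM -powRD ?(gt_eqF e0) ?implybT//.
  by rewrite subrK powRr1// ltW.
rewrite mulrA; apply: ler_wpM2r; first exact: expR_ge0.
apply: le_trans (ler_wpM2l (rN _) (powR_anti p1 m0 (ltW h))) _.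
rewrite powRM ?(ltW th0)// rw_powR mulrCA; apply: ler_wpM2l; first exact: powR_ge0.
rewrite -rwD// (_ : gexp + -2 * (1 - n%:R / 4) = -1 :> R); last by rewrite /gexp; field.
by rewrite rwN rw1// lef_pV2 ?posrE.
Qed.

(** Integrability of e^(n u/4) improves O(M^-2) to o(M^-2). The order of choices is th, then a box
    outside which the integral of e^(n u/4) is tiny, then M large enough to make the box term
    small. *)
Lemma G_expu_small (e : R) : 0 < e -> exists2 M0 : R, 1 <= M0 & forall M, M0 <= M ->
  Itg (fun x => rw (M ^+ 2) (@gexp R n) x * expR (u x)) /\
  M ^+ 2 * Int (fun x => rw (M ^+ 2) (@gexp R n) x * expR (u x)) <= e.
Proof.
move=> e0; pose A : R := 3 * 4 ^+ n; have A0 : 0 < A by rewrite mulr_gt0// exprn_gt0.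
pose th := e / 3 / A; have th0 : 0 < th by rewrite !divr_gt0.
pose D : R := th `^ (1 - n%:R / 4); have D0 : 0 < D by exact: powR_gt0.
have [B B0 hB] := tail_small Iu (fun x => expR_ge0 _) (divr_gt0 (divr_gt0 e0 (ltr0n _ 3)) D0).
have [C C0 hC] := box_bounded (Ck_continuous (Ck_expR cu)) B0.
have hC' y : box B y -> expR (u y) <= C by move=> /hC; apply: le_trans; exact: ler_norm.
pose Q := C * (2 * B) ^+ n; have Q0 : 0 <= Q by rewrite mulr_ge0// exprn_ge0// mulr_ge0.
exists (Num.max 1 (Q / (e / 3))); first by rewrite le_max lexx.
move=> M; rewrite ge_max => /andP[M1 MQ].
have M0 : 0 < M by lra.
have M2 : 0 < M ^+ 2 by rewrite exprn_gt0.
have [Ib Vb] := @Int_ibox R n _ B0.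
have [Ic Lc] := @Int_rw_cexp R n M M0.
have It := Itg_iboxC B0 Iu.
have I1 := ItgZ (C * M ^- 3) Ib; have I2 := ItgZ th Ic; have I3 := ItgZ (D * M ^- 2) It.
have pw x := expu_split x M1 th0 B0 C0 hC'.
have I4 : Itg (fun x => rw (M ^+ 2) (@gexp R n) x * expR (u x)).
  apply: (Itg_dom _ (ItgD (ItgD I1 I2) I3)).
    apply: continuous_Mf; apply: cont_mul; first exact: Ck_continuous (Ck_rw 0 _ M2).
    exact: Ck_continuous (Ck_expR cu).
  by move=> x; rewrite ger0_norm// mulr_ge0 ?expR_ge0// ltW// rw_gt0.
split => //; apply: le_trans (ler_wpM2l (ltW M2) (Int_le I4 (ItgD (ItgD I1 I2) I3) pw)) _.
rewrite (IntD (ItgD I1 I2) I3) (IntD I1 I2) (IntZ _ Ib) (IntZ _ Ic) (IntZ _ It) Vb.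
move: Lc hB; set ic := Int (rw _ _); set it := Int _ => Lc hB.
have -> : M ^+ 2 * (C / M ^+ 3 * (2 * B) ^+ n + th * ic + D / M ^+ 2 * it) = Q / M + th * (M ^+ 2 * ic) + D * it.
  by rewrite /Q; field; exact: lt0r_neq0.
have h1 : Q / M <= e / 3.
  by move: MQ; rewrite ler_pdivrMr ?divr_gt0// => h; rewrite ler_pdivrMr// mulrC.
have h2 : th * (M ^+ 2 * ic) <= e / 3.
  have : M ^+ 2 * ic <= A.
    by apply: le_trans (ler_wpM2l (ltW M2) Lc) _; rewrite mulrCA divff ?mulr1// lt0r_neq0.
  by move=> /(ler_wpM2l (ltW th0)); rewrite /th divfK// lt0r_neq0.
have h3 : D * it <= e / 3 by move: hB; rewrite ler_pdivlMr// mulrC.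
lra.
Qed.

Lemma v_small (e : R) : 0 < e -> exists2 M0 : R, 1 <= M0 & forall M, M0 <= M ->
  Itg (fun x => rw (M ^+ 2) (@cexp R n) x * v x) /\
  M ^+ 4 * Int (fun x => rw (M ^+ 2) (@cexp R n) x * v x) <= e.
Proof.
move=> e0; have [M0 M01 h] := G_expu_small e0; exists M0 => // M MM.
have M1 : 0 < M by lra.
have M2 : 0 < M ^+ 2 by rewrite exprn_gt0.
have [I1 L1] := h M MM; have [I2 L2] := kernel_v_le n5 cv lv v0 vi M2 I1.
split => //; apply: le_trans L1.
rewrite (_ : (4 = 2 + 2)%N)// exprD -mulrA ler_pM2l//; apply: le_trans L2.
have J0 : 0 <= Int (fun x => rw (M ^+ 2) (@cexp R n) x * v x).
  by apply: Int_ge0 => x; apply: mulr_ge0; [exact: ltW (rw_gt0 _ _ M2)|exact: ltW].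
rewrite -[X in _ <= X]mulrA; apply: ler_peMl; first exact: mulr_ge0 (ltW M2) J0.
by have := N5; move: (n%:R) => m; nra.
Qed.

Let arg M x : R := 1 - M ^- 2 * nsq x.

Let Ck_arg k M : CK k (arg M).
Proof. by apply: CkB; [exact: Ck_cst|apply: CkZ; exact: Ck_nsq]. Qed.

Let arg_box k M x : 0 < M -> ~ box M x -> flat k (arg M x) = 0.
Proof.
move=> M0 bx; apply: flat_le0; rewrite /arg subr_le0.
by rewrite ler_pdivlMl ?exprn_gt0// mulr1 ltW// not_box_nsq// ltW.
Qed.

Let csupp_flat k M : 0 < M -> csupp (fun x => flat k (arg M x)).
Proof. by move=> M0; exists M => x; exact: arg_box. Qed.

(** The profile [flat 2] is the derivative of [flat 0]; because of this the derivative of W in M is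
    M^(1 - n)/2 times the Laplacian of flat 0 (arg M), and Green's formula turns the derivative of
    [U] into an integral of v. *)
Let W M x : R := M ^- n * flat 2 (arg M x).

Let U M : R := Int (fun x => W M x * u x).

Let cf k M : continuous (fun x => flat k (arg M x)).
Proof. by apply: (@Ck_continuous _ _ 0); exact: Ck_flat. Qed.

Let Itg_flat k M (f : 'rV[R]_n -> R) : continuous f -> 0 < M -> Itg (fun x => flat k (arg M x) * f x).
Proof.
move=> cf' M0; apply: Itg_csupp; first exact: cont_mul.
by apply: csuppM; exact: csupp_flat.
Qed.

Let ItgU M : 0 < M -> Itg (fun x => W M x * u x).
Proof.
move=> M0; have := ItgZ (M ^- n) (Itg_flat 2 (Ck_continuous cu) M0).
by rewrite (_ : (fun x => _) = (fun x => W M x * u x))//; apply/funext => x; rewrite /W mulrA.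
Qed.

Let W_mass : exists2 c : R, 0 < c & forall M, 0 < M -> Itg (W M) /\ c <= Int (W M).
Proof.
(* On the cube of half-side M/(2 n), of volume (M/n)^n, the argument lies between 1/2 and 1, so
   [flat 2] is at least e^-2. *)
exists (expR (-2) / n%:R ^+ n); first by rewrite divr_gt0 ?expR_gt0// exprn_gt0// ltr0n.
move=> M M0; have Mn : 0 < M ^+ n by rewrite exprn_gt0.
have I1 : Itg (W M).
  have := ItgZ (M ^- n) (Itg_flat 2 (@cont_cst _ _ 1) M0).
  by rewrite (_ : (fun x => _) = W M)//; apply/funext => x; rewrite /W mulr1.
have B0 : 0 <= M / (2 * n%:R) by rewrite divr_ge0 ?mulr_ge0 ?ler0n// ltW.
have [Ib Vb] := @Int_ibox R n _ B0.
split => //; have -> : expR (-2) / n%:R ^+ n = M ^- n * expR (-2) * Int (@ibox R n (M / (2 * n%:R))).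
  rewrite Vb (_ : 2 * (M / (2 * n%:R)) = M / n%:R); last by field; rewrite pnatr_eq0 -lt0n.
  by rewrite expr_div_n; field; rewrite !expf_neq0 ?lt0r_neq0// ltr0n.
rewrite -(IntZ _ Ib); apply: (Int_le (ItgZ _ Ib) I1) => x.
rewrite /W -mulrA; apply: ler_wpM2l; first by rewrite invr_ge0 ltW.
rewrite iboxP; case: ifPn => [/asboolP bx|_]; last by rewrite mulr0 flat_ge0.
have h1 : arg M x <= 1 by rewrite /arg gerBl mulr_ge0 ?nsq_ge0// invr_ge0 ltW// exprn_gt0.
have h2 : 2^-1 <= arg M x.
  have := nsq_box bx; have m2 : 0 < M ^- 2 by rewrite invr_gt0 exprn_gt0.
  move=> /(ler_wpM2l (ltW m2)).
  have -> : M ^- 2 * (n%:R * (M / (2 * n%:R)) ^+ 2) = (4 * n%:R)^-1.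
    by field; rewrite pnatr_eq0 -lt0n n0 lt0r_neq0.
  have : (4 * n%:R)^-1 <= (20 : R)^-1 by rewrite lef_pV2 ?posrE ?mulr_gt0 ?ltr0n//; have := N5; lra.
  by rewrite /arg; lra.
have h0 : 0 < arg M x by lra.
rewrite mulr1 /flat h0 -[leLHS]mul1r; apply: ler_pM; [exact: ler01|exact: expR_ge0| |].
  by rewrite invf_ge1 ?exprn_gt0// exprn_ile1// ltW.
by rewrite ler_expR lerN2 invf_ple ?posrE.
Qed.

(* Tangent-line form of Jensen's inequality for exp. *)
Let U_le : exists C c : R, 0 < c /\ forall M, 1 <= M -> U M <= C - 4 * c * ln M.
Proof.
have [c c0 hc] := W_mass; exists (4 / n%:R * (4 * Int (fun x => expR (n%:R / 4 * u x)))), c; split => // M M1.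
have N5' := N5; have M0 : 0 < M by lra.
have l0 : 0 <= ln M by exact: ln_ge0.
have [I1 L1] := hc M M0; have I2 := ItgU M0.
(* The tangent to the exponential is taken at u = -4 ln M, so that the factor M^n it produces
   cancels the M^-n of W; the price is the constant -4 ln M. The factor 4 on the integral bounds
   [flat 2]. *)
pose k : R := - (4 / n%:R * (1 + n%:R * ln M)).
have W0 x : 0 <= W M x by rewrite /W mulr_ge0 ?flat_ge0// invr_ge0 exprn_ge0// ltW.
apply: le_trans (_ : _ <= 4 / n%:R * 4 * Int (fun x => expR (n%:R / 4 * u x)) + k * Int (W M)) _.
  rewrite -(IntZ _ Iu) -(IntZ _ I1) -(IntD (ItgZ _ Iu) (ItgZ _ I1)).
  apply: (Int_le I2 (ItgD (ItgZ _ Iu) (ItgZ _ I1))) => x.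
  have h : u x <= 4 / n%:R * (M ^+ n * expR (n%:R / 4 * u x)) + k.
    have := expR_ge1Dx (n%:R * ln M + n%:R / 4 * u x).
    rewrite expRD expRM_natl lnK ?posrE// => /(ler_wpM2l (_ : 0 <= 4 / n%:R :> R)) H.
    have {}H := H ltac:(by rewrite divr_ge0).
    apply: le_trans (_ : u x <= u x) _ => //; rewrite -lerBlDr; apply: le_trans H.
    by rewrite /k le_eqVlt; apply/orP; left; apply/eqP; field; rewrite pnatr_eq0 -lt0n.
  apply: le_trans (ler_wpM2l (W0 x) h) _; rewrite mulrDr [k * _]mulrC lerD2r.
  rewrite mulrCA -[leRHS]mulrA; apply: ler_wpM2l; first by rewrite divr_ge0.
  have -> : W M x * (M ^+ n * expR (n%:R / 4 * u x)) = flat 2 (arg M x) * expR (n%:R / 4 * u x).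
    have E (a b d : R) : a != 0 -> a^-1 * b * (a * d) = b * d by move=> a0; field.
    by apply: E; rewrite expf_neq0// lt0r_neq0.
  by apply: ler_wpM2r; [exact: expR_ge0|rewrite (le_trans (flat_le _ _))// expr2; lra].
rewrite mulrA lerD2l.
have k0 : k <= - (4 * ln M).
  rewrite /k lerN2 mulrDr mulr1.
  have -> : 4 / n%:R * (n%:R * ln M) = 4 * ln M by field; rewrite pnatr_eq0 -lt0n.
  by rewrite lerDr divr_ge0.
have I0 : 0 <= Int (W M) by exact: Int_ge0.
have p1 : 0 <= 4 * ln M by rewrite mulr_ge0.
have := ler_wpM2l p1 L1; have := ler_wpM2r I0 k0.
by move: (Int _) (ln M) p1 => a b p1; lra.
Qed.

Let lap_flat M x : 0 < M -> lap (fun y => flat 0 (arg M y)) x =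
  (flat 4 (arg M x) - 2 * flat 3 (arg M x)) * (4 * (M ^- 2) ^+ 2 * nsq x) - flat 2 (arg M x) * (2 * n%:R * M ^- 2).
Proof.
move=> M0; have dp y : is_derive (arg M y) (1 : R) (flat 0) (flat 2 (arg M y)).
  by have := isd_flat 0 (arg M y); rewrite mul0r subr0.
rewrite (laplacian_comp (p'' := fun t => flat 4 t - 2 * flat 3 t) (Ck_arg 2 M) dp (isd_flat 2 (arg M x))).
have p i : pd i (arg M) x = - (M ^- 2 * (2 * x 0 i)).
  have D := isdB (isd_cst 1 x (delta_mx 0 i)) (isdZ (M ^- 2) (Ck_isd i x (Ck_nsq 1))).
  by rewrite sub0r partial_nsq in D; exact: partial_eq D.
have -> : lap (arg M) x = - (2 * n%:R * M ^- 2).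
  rewrite laplacianB; [|exact: Ck_cst|by apply: CkZ; exact: Ck_nsq].
  by rewrite laplacian_cst laplacianZ ?laplacian_nsq; [ring|exact: Ck_nsq].
have -> : gdot (arg M) (arg M) x = 4 * (M ^- 2) ^+ 2 * nsq x.
  by rewrite /gdot /nsq mulr_sumr; apply: eq_bigr => i _; rewrite p; ring.
by rewrite mulrN.
Qed.

Let dU M x : R := 2^-1 * (M * M ^- n) * (lap (fun y => flat 0 (arg M y)) x * u x).

Let isd_WU M x : 0 < M -> is_derive M (1 : R) (fun s => W s x * u x) (dU M x).
Proof.
move=> M0; have Mn : M != 0 by exact: lt0r_neq0.
have d1 : is_derive M (1 : R) (fun s : R => s ^- n) (- ((M ^+ n) ^- 2) * (n%:R * M ^+ n.-1)).
  by apply: (isd_comp (f := fun s : R => s ^+ n) (isd_inv _) (isd_exprn n M)); rewrite expf_neq0.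
have d2 : is_derive M (1 : R) (fun s : R => s ^- 2) (- ((M ^+ 2) ^- 2) * (2%:R * M ^+ 1)).
  by apply: (isd_comp (f := fun s : R => s ^+ 2) (isd_inv _) (isd_exprn 2 M)); rewrite expf_neq0.
have d3 : is_derive M (1 : R) (fun s : R => arg s x) (0 - nsq x * (- ((M ^+ 2) ^- 2) * (2%:R * M ^+ 1))).
  have := isdB (isd_cst 1 M (1 : R)) (isdZ (nsq x) d2).
  by rewrite (_ : (fun s : R => arg s x) = (fun s : R => 1 - nsq x * s ^- 2))//; apply/funext => s; rewrite /arg mulrC.
have d4 := isd_comp (f := fun s : R => arg s x) (isd_flat 2 (arg M x)) d3.
have d5 := isdZ (u x) (isdM d1 d4).
rewrite (_ : (fun s => W s x * u x) = (fun s : R => u x * (s ^- n * flat 2 (arg s x)))); last first.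
  by apply/funext => s; rewrite mulrC.
apply: is_derive_eq d5 _.
rewrite /dU lap_flat// (_ : M ^+ n = M ^+ n.-1 * M); last by rewrite -exprSr prednK.
move: (flat _ _) (flat _ _) (flat _ _) (nsq x) (u x) (M ^+ n.-1) (expf_neq0 n.-1 Mn) => a b c d e f f0.
by field; rewrite Mn.
Qed.

Let U_deriv M : 0 < M ->
  is_derive M (1 : R) U (- (2^-1 * (M * M ^- n) * Int (fun x => flat 0 (arg M x) * v x))).
Proof.
move=> M0.
have -> : - (2^-1 * (M * M ^- n) * Int (fun x => flat 0 (arg M x) * v x)) = Int (dU M).
  have J : Itg (fun x => lap (fun y => flat 0 (arg M y)) x * u x).
    apply: Itg_csupp; last by apply: csuppM; exact: csupp_laplacian (csupp_flat 0 M0).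
    by apply: cont_mul; [exact: continuous_laplacian (Ck_flat 0 (Ck_arg 2 M))|exact: Ck_continuous cu].
  rewrite (IntZ _ J) -(Green cu (Ck_flat 0 (Ck_arg 2 M)) (csupp_flat 0 M0)) -mulrN; congr (_ * _).
  rewrite -(IntN (Itg_flat 0 (Ck_continuous cv) M0)); congr Int; apply/funext => x.
  by rewrite lu mulrN.
have M2 : 0 < M / 2 by rewrite divr_gt0.
pose m := (M / 2) ^- 2; have m0 : 0 < m by rewrite invr_gt0 exprn_gt0.
(* Bounds the factor of u in [dU] uniformly for s between M/2 and 2 M on the cube of half-side 2 M,
   each [flat k] being at most k^k; outside that cube the integrand vanishes. *)
pose K := 2^-1 * ((2 * M) * (M / 2) ^- n) *
  ((4%:R ^+ 4 + 2 * 3%:R ^+ 3) * (4 * m ^+ 2 * (n%:R * (2 * M) ^+ 2)) + 2%:R ^+ 2 * (2 * n%:R * m)).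
have B0 : 0 <= 2 * M by lra.
have [C C0 hC] := box_bounded (Ck_continuous cu) B0.
have [Ib _] := @Int_ibox R n _ B0.
have lt2 s : M - M / 2 < s < M + M / 2 -> [/\ 0 < s, M / 2 < s & s < 2 * M].
  by move=> /andP[h1 h2]; split; lra.
apply: (isd_Int (f := fun s x => W s x * u x) (G := fun x => K * C * ibox (2 * M) x) M2).
- by move=> s /lt2[s0 _ _]; exact: ItgU.
- by move=> s x /lt2[s0 _ _]; exact: isd_WU.
- exact: ItgZ.
move=> s x /lt2[s0 s1 s2].
have S0 : 0 < s ^+ n by rewrite exprn_gt0.
rewrite iboxP; case: ifPn => [/asboolP bx|/asboolP bx]; last first.
  have bs : ~ box s x by move=> h; apply: bx => i; apply: le_trans (h i) (ltW s2).
  by rewrite /dU lap_flat// !arg_box// !(mul0r, mulr0, subr0) normr0.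
rewrite mulr1 /dU mulrA normrM; apply: ler_pM => //; last exact: hC.
rewrite normrM; apply: ler_pM => //.
  rewrite ger0_norm ?mulr_ge0 ?invr_ge0 ?(ltW s0) ?(ltW S0)// ler_pM2l//.
  apply: ler_pM; rewrite ?invr_ge0 ?(ltW s0) ?(ltW s2) ?(ltW S0)// lef_pV2 ?posrE ?exprn_gt0//.
  by rewrite lerXn2r ?nnegrE ?(ltW s0) ?(ltW M2) ?(ltW s1).
have m1 : 0 <= s ^- 2 <= m.
  rewrite invr_ge0 exprn_ge0 ?(ltW s0)//= lef_pV2 ?posrE ?exprn_gt0//.
  by rewrite lerXn2r ?nnegrE ?(ltW s0) ?(ltW M2) ?(ltW s1).
have q1 := nsq_box bx; have q0 := nsq_ge0 x.
have F k : `|flat k (arg s x)| <= k%:R ^+ k by rewrite ger0_norm ?flat_ge0// flat_le.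
have mm : 0 <= (s ^- 2) ^+ 2 <= m ^+ 2.
  by have /andP[a b] := m1; rewrite sqr_ge0 lerXn2r// nnegrE// ltW.
have /andP[m1a m1b] := m1; have /andP[mma mmb] := mm.
rewrite lap_flat//; apply: le_trans (ler_normB _ _) _; apply: lerD; rewrite normrM; apply: ler_pM => //.
- apply: le_trans (ler_normB _ _) _; apply: lerD => //; rewrite normrM ger0_norm//.
  by apply: ler_pM.
- rewrite ger0_norm; last by apply: mulr_ge0 q0; apply: mulr_ge0.
  by apply: ler_pM => //; [exact: mulr_ge0|apply: ler_pM].
- by rewrite ger0_norm ?ler_pM// !mulr_ge0.
Qed.

(** On the ball of radius M the weight [wX M] is at least 1/2, so flat 0 (arg M) <= 2^n wX^n, which
    is bounded by a multiple of the kernel in [v_small]. The target e/2^n there pays for the 2^n. *)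
Let U_slope (e : R) : 0 < e -> exists2 M0 : R, 1 <= M0 & forall M, M0 <= M ->
  2^-1 * (M * M ^- n) * Int (fun x => flat 0 (arg M x) * v x) <= e * M^-1.
Proof.
move=> e0; have d0 : 0 < e / 2 ^+ n by rewrite divr_gt0// exprn_gt0.
have [M0 M01 h] := v_small d0; exists M0 => // M MM.
have M1 : 0 < M by lra.
have M2 : 0 < M ^+ 2 by rewrite exprn_gt0.
have [I1 L1] := h M MM; have I2 := Itg_flat 0 (Ck_continuous cv) M1.
have pw x : flat 0 (arg M x) * v x <= 2 ^+ n * M ^+ n.+2 * (rw (M ^+ 2) (@cexp R n) x * v x).
  rewrite [leRHS]mulrA; apply: ler_wpM2r; first exact: ltW.
  rewrite -mulrA; apply: le_trans (_ : 2 ^+ n * wX M x ^+ n <= _); last first.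
    by rewrite ler_pM2l ?exprn_gt0//; exact: wX_cexp.
  have [h0|h0] := leP (arg M x) 0.
    by rewrite flat_le0// mulr_ge0 ?exprn_ge0// ltW// wX_gt0.
  apply: le_trans (flat_le1 _) _; rewrite -exprMn; apply: exprn_ege1.
  rewrite /wX mulrA ler_pdivlMr ?rho_gt0// mul1r /rho.
  move: h0; rewrite /arg subr_gt0 ltr_pdivrMl ?mulr1//; move: (M ^+ 2) => z; lra.
have := Int_le I2 (ItgZ _ I1) pw; rewrite (IntZ _ I1).
have c0 : 0 <= 2^-1 * (M * M ^- n) by rewrite !mulr_ge0 ?invr_ge0 ?exprn_ge0 ?(ltW M1).
move=> /(ler_wpM2l c0) /le_trans; apply.
have J0 : 0 <= M ^+ 4 * Int (fun x => rw (M ^+ 2) (@cexp R n) x * v x).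
  apply: mulr_ge0; first by rewrite exprn_ge0// ltW.
  by apply: Int_ge0 => x; apply: mulr_ge0; [exact: ltW (rw_gt0 _ _ M2)|exact: ltW].
move: L1 J0; move: (Int _) => J L1 J0.
have -> : 2^-1 * (M / M ^+ n) * (2 ^+ n * M ^+ n.+2 * J) = 2^-1 * 2 ^+ n * (M ^+ 4 * J) * M^-1.
  have Mn : M ^+ n != 0 by rewrite expf_neq0// lt0r_neq0.
  rewrite -(addn2 n) exprD; move: (M ^+ n) Mn (2 ^+ n) => a a0 b; field.
  by rewrite a0 lt0r_neq0.
apply: ler_wpM2r; first by rewrite invr_ge0 ltW.
apply: le_trans (_ : 2 ^+ n * (M ^+ 4 * J) <= _).
  rewrite -mulrA; apply: ler_piMl; last by lra.
  by rewrite mulr_ge0// exprn_ge0.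
by move: L1; rewrite ler_pdivlMr ?exprn_gt0// mulrC.
Qed.

(** [U_slope] with e = c makes U + c ln nondecreasing, so U decreases at most like -c ln M, while
    [U_le] forces it below C - 4 c ln M. *)
Lemma integrable_expR_false : False.
Proof.
have [C [c [c0 hU]]] := U_le.
have [A A1 hA] := U_slope c0.
have A0 : 0 < A by lra.
pose F s := U s + c * ln s.
have dF (s : R) : 0 < s -> is_derive s (1 : R) F
    (- (2^-1 * (s * s ^- n) * Int (fun x => flat 0 (arg s x) * v x)) + c * s^-1).
  by move=> s0; apply: isdD; [exact: U_deriv|exact: isdZ (isd_ln s0)].
have mono M : A < M -> F A <= F M.
  move=> AM.
  have cF : {within `[A, M], continuous F}.
    apply: derivable_within_continuous => s; rewrite in_itv/= => /andP[As _].
    by have [] := dF s (lt_le_trans A0 As).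
  have [|t] := @MVT R F (fun s => - (2^-1 * (s * s ^- n) * Int (fun x => flat 0 (arg s x) * v x)) + c * s^-1) A M AM _ cF.
    by move=> s; rewrite in_itv/= => /andP[As _]; apply: dF; lra.
  rewrite in_itv/= => /andP[At tM] E; rewrite -subr_ge0 E; apply: mulr_ge0; last by lra.
  by rewrite addrC subr_ge0 hA// ltW.
(* At M = e^t the two bounds on U contradict each other as soon as 3 c t > C - F A. *)
pose t := Num.max (ln A + 1) ((C - F A) / (3 * c) + 1).
have AM : A < expR t.
  rewrite -[A]lnK ?posrE// ltr_expR; apply: lt_le_trans (_ : ln A + 1 <= t); first by rewrite ltrDl.
  by rewrite le_max lexx.
have h1 := mono _ AM; have h2 := hU (expR t) ltac:(lra).
move: h1; rewrite {2}/F expRK; move: h2; rewrite expRK => h2 h1.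
have h3 : (C - F A) / (3 * c) + 1 <= t by rewrite le_max lexx orbT.
have : (C - F A) / (3 * c) < t by lra.
rewrite ltr_pdivrMr ?mulr_gt0//; move: (F A) (U _) h1 h2 => a b; lra.
Qed.

End spherical_mean.

Theorem theorem5p1 (R : realType) (n : nat) (hn : (5 <= n <= 12)%N) :
  ~ exists u : 'rV[R]_n -> R,
      [/\ Ck 4 u,
          forall x, bilaplacian u x = expR (u x),
          stable_outside_compact u &
          vanishes_at_infinity (laplacian u)].
Proof.
move: hn => /andP[n5 n12] [u [cu eu su vu]].
(* The hypotheses are transferred to the locked operators, in terms of which everything above is
   stated. *)
rewrite /bilaplacian -laplacianE in eu vu; rewrite -CKE in cu.
have clu : CK 2 (lap u) by exact: Ck_laplacian.
pose v x := - lap u x; have cv : CK 2 v by exact: CkN.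
have lu x : lap u x = - v x by rewrite opprK.
have lv x : lap v x = - expR (u x) by rewrite laplacianN// eu.
have vi : vanishes_at_infinity v.
  by move=> e e0; have [M hM] := vu e e0; exists M => x /hM; rewrite normrN.
have v0 : forall x, 0 < v x.
  by apply: superharmonic_gt0 => // x; rewrite lv oppr_lt0 expR_gt0.
have cu2 : CK 2 u by exact: Ck_le cu.
have Iu := integrable_expR n5 n12 cu2 cv lu lv v0 vi su.
exact: (integrable_expR_false n5 cu2 cv lu lv v0 vi Iu).
Qed.
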